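(* Fix a positive integer $d$. There exist a number $s=s(d)$ and a polynomial time algorithm which, given linearly independent vectors $u_1,\ldots,u_d\in\mathbb{Z}^d$, computes the generating function $f(S;\mathbf{x})=\sum_{m\in S}\mathbf{x}^m$ of the (minimal) Hilbert basis $S$ of the semigroup of integer points in the cone spanned by $u_1,\ldots,u_d$ in the form $$f(S;\mathbf{x})=\sum_{i\in I}\alpha_i\frac{\mathbf{x}^{p_i}}{(1-\mathbf{x}^{b_{i1}})\cdots(1-\mathbf{x}^{b_{is}})},$$ where $I$ is a finite index set, $\alpha_i\in\mathbb{Q}$, $p_i,b_{ij}\in\mathbb{Z}^d$ and $b_{ij}\neq0$ for all $i,j$.
   Context: Let $\Pi=\{\sum_{i=1}^d\alpha_iu_i: 0\le\alpha_i\le1\}$ be the parallelepiped spanned by $u_1,\ldots,u_d$. A point $v\in\Pi\cap\mathbb{Z}^d$ is indecomposable if it cannot be written as $v=v_1+v_2$ with $v_1,v_2$ non-zero integer points of $\Pi$. The minimal Hilbert basis $S$ is the set of non-zero indecomposable points of $\Pi\cap\mathbb{Z}^d$. $\mathbf{x}^m=x_1^{\mu_1}\cdots x_d^{\mu_d}$. Polynomial time means running time polynomial in the number of bits needed to write $u_1,\ldots,u_d$. *)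

(* Defs.v *)
From HB Require Import structures.
From mathcomp Require Import all_boot all_order all_algebra.
From mathcomp Require Import boolp classical_sets cardinality fsbigop reals.
From mathcomp Require Import mpoly.

Set Implicit Arguments.
Unset Strict Implicit.
Unset Printing Implicit Defensive.

Import Order.TTheory GRing.Theory Num.Theory.
Local Open Scope ring_scope.
Local Open Scope classical_set_scope.

(* Deterministic multi-tape Turing machines.  The tape alphabet is fixed: the
   letters used to write integers, plus the blank [None]. *)

Inductive letter := Bit of bool | Minus | Sep.
Definition word := seq letter.
Definition cell := option letter.

Inductive direction := MoveLeft | MoveRight | Stay.

(* A machine with [ntapes] = k has k + 1 tapes; [delta q r = None] means that
   the machine halts in state q when reading the symbols r. *)
Record machine := Machine {
  ntapes : nat;
  state : finType;
  start : state;
  delta : state -> ntapes.+1.-tuple cell ->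
          option (state * ntapes.+1.-tuple (cell * direction))
}.

(* A two-way infinite tape: the cells on the left of the head (nearest first),
   the scanned cell and the cells on the right (nearest first); all the cells
   that are not listed are blank. *)
Record tape := Tape { lcells : seq cell; scanned : cell; rcells : seq cell }.

Definition move (dir : direction) (t : tape) : tape :=
  match dir with
  | MoveLeft => Tape (behead (lcells t)) (head None (lcells t))
                     (scanned t :: rcells t)
  | MoveRight => Tape (scanned t :: lcells t) (head None (rcells t))
                      (behead (rcells t))
  | Stay => t
  end.

Definition act (a : cell * direction) (t : tape) : tape :=
  move a.2 (Tape (lcells t) a.1 (rcells t)).

Definition config (M : machine) : Type :=
  (state M * (ntapes M).+1.-tuple tape)%type.

Definition step (M : machine) (c : config M) : option (config M) :=
  match delta c.1 (map_tuple scanned c.2) with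
  | Some (q, a) => Some (q, [tuple act (tnth a i) (tnth c.2 i) | i < _])
  | None => None
  end.

(* The halting configuration reached from c, if it is reached in at most n
   steps. *)
Fixpoint run (M : machine) (n : nat) (c : config M) : option (config M) :=
  match step c with
  | None => Some c
  | Some c' => if n is n'.+1 then run n' c' else None
  end.

Definition blank_tape : tape := Tape [::] None [::].

Definition tape_of_word (w : word) : tape :=
  let s := map some w in Tape [::] (head None s) (behead s).

Fixpoint letters_before_blank (s : seq cell) : word :=
  if s is Some a :: s' then a :: letters_before_blank s' else [::].

Definition word_of_tape (t : tape) : word :=
  letters_before_blank (scanned t :: rcells t).

(* Input and output are on tape 0, starting at the head. *)
Definition init (M : machine) (w : word) : config M :=
  (start M, [tuple if i == ord0 then tape_of_word w else blank_tape
            | i < (ntapes M).+1]).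

Definition outputs_within (M : machine) (n : nat) (w w' : word) : Prop :=
  omap (fun c : config M => word_of_tape (tnth c.2 ord0)) (run n (init M w))
  = Some w'.

(* There is a polynomial time algorithm which, given any x satisfying [pre x],
   computes some y such that [post x y]. *)
Definition poly_time_computable (X Y : Type) (encX : X -> word)
    (encY : Y -> word) (pre : X -> Prop) (post : X -> Y -> Prop) : Prop :=
  exists (M : machine) (P : {poly nat}), forall x : X, pre x ->
    exists2 y : Y, post x y
      & outputs_within M P.[size (encX x)] (encX x) (encY y).

(* Binary digits, least significant first; 0 is the empty word. *)
Definition bits (n : nat) : seq bool :=
  mkseq (fun i => odd (n %/ 2 ^ i)%N) (up_log 2 n.+1).

Definition encode_int (z : int) : word :=
  (if z < 0 then [:: Minus] else [::]) ++ map Bit (bits `|z|%N).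

Definition encode_ints (s : seq int) : word :=
  flatten [seq rcons (encode_int z) Sep | z <- s].

Definition entries (m n : nat) (A : 'M[int]_(m, n)) : seq int :=
  [seq A i j | i <- enum 'I_m, j <- enum 'I_n].

Definition encode_mx (m n : nat) (A : 'M[int]_(m, n)) : word :=
  encode_ints (entries A).

Definition ratfun (d : nat) : fieldType := {fraction {mpoly rat[d]}}.

(* The Laurent monomial x^m. *)
Definition xpow (d : nat) (m : 'rV[int]_d) : ratfun d :=
  \prod_(i < d) (tofrac ('X_i : {mpoly rat[d]}) : ratfun d) ^ (m 0 i).

(* The data (alpha, p, b_1, ..., b_s) of one fraction; the b_j are the rows of
   the matrix. *)
Definition term (d s : nat) : Type :=
  (rat * 'rV[int]_d * 'M[int]_(s, d))%type.

Definition t_coef (d s : nat) (t : term d s) : rat := t.1.1.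
Definition t_num (d s : nat) (t : term d s) : 'rV[int]_d := t.1.2.
Definition t_den (d s : nat) (t : term d s) : 'M[int]_(s, d) := t.2.

Definition term_ratfun (d s : nat) (t : term d s) : ratfun d :=
  tofrac (t_coef t)%:MP_[d] *
  (xpow (t_num t) / \prod_(j < s) (1 - xpow (row j (t_den t)))).

(* Since d and s are fixed, the flat list of integers determines the terms. *)
Definition encode_terms (d s : nat) (F : seq (term d s)) : word :=
  encode_ints (flatten
    [seq [:: numq (t_coef t); denq (t_coef t)]
         ++ entries (t_num t) ++ entries (t_den t) | t <- F]).

Section HilbertBasis.
Variables (R : realType) (d : nat).

Definition real_mx (m n : nat) (A : 'M[int]_(m, n)) : 'M[R]_(m, n) :=
  map_mx intr A.

(* The vectors u_1, ..., u_d are the rows of u. *)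
Definition parallelepiped (u : 'M[int]_d) : set 'rV[R]_d :=
  [set x | exists2 a : 'I_d -> R, forall i, 0 <= a i <= 1
         & x = \sum_(i < d) a i *: row i (real_mx u)].

Definition integer_points (A : set 'rV[R]_d) : set 'rV[int]_d :=
  [set v | A (real_mx v)].

Definition indecomposable (u : 'M[int]_d) (v : 'rV[int]_d) : Prop :=
  ~ exists v1 v2 : 'rV[int]_d,
      [/\ integer_points (parallelepiped u) v1, v1 != 0,
          integer_points (parallelepiped u) v2, v2 != 0 & v = v1 + v2].

Definition hilbert_basis (u : 'M[int]_d) : set 'rV[int]_d :=
  [set v | [/\ integer_points (parallelepiped u) v, v != 0
             & indecomposable u v]].

(* Hence the sum over [hilbert_basis u] below is the genuine finite sum. *)
Lemma hilbert_basis_finite (u : 'M[int]_d) : finite_set (hilbert_basis u).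
Proof.
pose N : nat := (\sum_i \sum_j `|u i j|)%N.
pose f (g : {ffun 'I_d -> 'I_N.*2.+1}) : 'rV[int]_d :=
  \row_j ((g j : nat)%:Z - N%:Z).
apply: (@sub_finite_set _ _ (f @` setT)); last first.
  exact/finite_image/finite_finset.
move=> v [[a a01 va] _ _] /=.
have vN j : (`|v ord0 j| <= N)%N.
  have -> : (`|v ord0 j| <= N)%N = (`|(v 0 j)%:~R : R| <= N%:R).
    by rewrite -intr_norm -[N%:R]/((N%:Z)%:~R) ler_int -lez_nat abszE.
  have -> : (v 0 j)%:~R = \sum_i a i * (u i j)%:~R :> R.
    have /(congr1 (fun A : 'rV[R]_d => A 0 j)) := va.
    rewrite mxE summxE => ->; apply: eq_bigr => i _.
    by rewrite !mxE.
  rewrite (le_trans (ler_norm_sum _ _ _))// natr_sum ler_sum// => i _.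
  rewrite normrM (@le_trans _ _ (`|u i j|%N%:R))//.
    rewrite -intr_norm -[`|u i j|%N%:R]/((`|u i j|%N%:Z)%:~R) abszE.
    have /andP[a0 a1] := a01 i.
    by rewrite ger0_norm// ler_piMl// ler0z.
  by rewrite ler_nat (bigD1 j)//= leq_addr.
exists [ffun j => inord `|(v ord0 j + N%:Z)%R|%N] => //.
apply/rowP => j; rewrite !mxE ffunE.
have := vN j => vNj.
have v0 : 0 <= v 0 j + N%:Z.
  rewrite -lerBlDr sub0r; have : `|v 0 j| <= N%:Z by rewrite -abszE lez_nat.
  by rewrite ler_norml => /andP[].
have vu : (`|(v ord0 j + N%:Z)%R| <= N.*2)%N.
  rewrite -lez_nat abszE ger0_norm// -addnn PoszD lerD2r.
  by rewrite (le_trans (ler_norm _))// -abszE lez_nat.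
by rewrite inordK// abszE ger0_norm// addrK.
Qed.

Definition hilbert_genfun (u : 'M[int]_d) : ratfun d :=
  \sum_(m \in hilbert_basis u) xpow m.

End HilbertBasis.

(* Main.v *)
Require Import Defs.
From HB Require Import structures.
From mathcomp Require Import all_boot all_order all_algebra.
From mathcomp Require Import boolp classical_sets cardinality fsbigop reals.
From mathcomp Require Import fingroup perm mpoly.
From mathcomp Require Import zify ring lra.

Set Implicit Arguments.
Unset Strict Implicit.
Unset Printing Implicit Defensive.

Import Order.TTheory GRing.Theory Num.Theory.
Local Open Scope nat_scope.

(** A point [v] of the parallelepiped is decomposable iff some integer [y] satisfies
    a system of linear inequalities parametrised by [v], so the Hilbert basis is the
    complement of a projection of integer points.  The projection is eliminated one
    variable at a time.  For fixed [v] the feasible polytope is compared, up to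
    constants, with an ellipsoid built from dyadic roundings of the slacks at the
    average of its vertices; there are polynomially many such roundings, and each of
    them defines a polyhedral cell of parameters.  In a reduced basis of the
    ellipsoid either all the basis vectors are short, and the polytope contains an
    integer point, or the last coordinate of [y] takes boundedly many values around
    that of a vertex, whose integer part becomes a new parameter determined by [v].
    Thus the Hilbert basis is a disjoint union of bijective projections of polyhedra
    of fixed dimension.  The generating functions of these polyhedra are found by
    Barvinok's signed decomposition into simplicial cones of bounded index, and
    the extra parameters are specialised to [1] by reading off a coefficient of a
    Laurent expansion along a generic curve.  Running times are tracked through a
    class of functions on binary trees computed by stack programs. *)

(** * Stack programs compiled to Turing machines *)

(** The generating function of a projection counts a point once per preimage, so the quantifier over
    [y] cannot simply be projected away. It is traded for parameters that are functions of [v]: each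
    is the floor of an affine form divided by an integer independent of [v]. That no [y] exists is a
    conjunction over slices, which only accumulates such parameters. Their number, and that of the
    constraints of a cell, depends on [d] alone; hence Barvinok's algorithm applies to every cell in
    fixed dimension, and one [s] serves all inputs.

    Points are perturbed along the moment curve, so that signed decompositions of cones hold exactly
    at every integer point, with no correction on common faces. These identities pass to rational
    functions by clearing denominators with difference operators, so convergence is never discussed.

    A class of functions closed under composition must bound running times on all inputs, not only
    on sensible ones. Loops therefore run on clocks computed from their input, and guards keep the
    data small; on legitimate data the guards always succeed. *)

Record prog := Prog {
  pst : finType;
  pini : pst;
  pdel : pst -> 5.-tuple cell -> option (pst * 5.-tuple (cell * direction)) }.

Definition mach (p : prog) : machine := @Machine 4 (pst p) (pini p) (@pdel p).

Fixpoint reach (p : prog) (n : nat) (c c' : config (mach p)) : Prop :=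
  if n is n'.+1 then exists2 c1, step c = Some c1 & reach n' c1 c' else c = c'.

Definition stk := 'I_5 -> word.

(** The tape is a stack with its top under the head. The numbers of blanks on both sides are left
    free: a pop leaves a blank on the left, a push may reuse one. *)
Definition rep_tape (t : tape) (w : word) : Prop :=
  exists i j, lcells t = nseq i None /\
              scanned t :: rcells t = map Some w ++ nseq j None.

Definition rep (c : 5.-tuple tape) (s : stk) := forall i, rep_tape (tnth c i) (s i).

(** Total correctness with a time bound. Quantifying over all tapes that represent [s] makes these
    triples composable, whatever blanks earlier programs have left. *)
Definition ex (p : prog) (s : stk) (n : nat) (s' : stk) : Prop :=
  forall c, rep c s -> exists q c' m,
    [/\ m <= n, @reach p m (pini p, c) (q, c'),
        @step (mach p) (q, c') = None & rep c' s'].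

Definition nop (r : 5.-tuple cell) : 5.-tuple (cell * direction) :=
  [tuple (tnth r k, Stay) | k < 5].

Lemma nopE (c : 5.-tuple tape) :
  [tuple act (tnth (nop (map_tuple scanned c)) k) (tnth c k) | k < 5] = c.
Proof.
apply: eq_from_tnth => k; rewrite !tnth_mktuple tnth_map /act /=.
by case: (tnth c k).
Qed.

Lemma reach_cat p m n c c1 c2 :
  @reach p m c c1 -> @reach p n c1 c2 -> @reach p (m + n) c c2.
Proof.
elim: m c => [|m IH] c /=; first by move=> ->.
by case=> c0 h /IH hr /hr; exists c0.
Qed.

Lemma scanned_rep t w : rep_tape t w -> scanned t = ohead w.
Proof.
case=> i [j [_ h]]; case: w h => [|a w] /= h; last by case: h.
by case: j h => [|j] //= [].
Qed.

Definition actat (i : 'I_5) (x : cell) (dir : direction) (r : 5.-tuple cell) :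
    5.-tuple (cell * direction) :=
  [tuple if k == i then (x, dir) else (tnth r k, Stay) | k < 5].

Lemma actatE i x dir (c : 5.-tuple tape) k :
  tnth [tuple act (tnth (actat i x dir (map_tuple scanned c)) k) (tnth c k)
       | k < 5] k
  = if k == i then act (x, dir) (tnth c k) else tnth c k.
Proof.
rewrite !tnth_mktuple; case: eqP => // _.
by rewrite tnth_map /act /=; case: (tnth c k).
Qed.

Definition upd (s : stk) i w : stk := fun k => if k == i then w else s k.

Definition ppop (i : 'I_5) : prog :=
  @Prog bool false (fun q r =>
    if q then None else Some (true, actat i None MoveRight r)).

Definition ppush (i : 'I_5) (a : letter) : prog :=
  @Prog (option bool) None (fun q r =>
    match q with
    | None => Some (Some false, actat i (tnth r i) MoveLeft r)
    | Some false => Some (Some true, actat i (Some a) Stay r)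
    | Some true => None
    end).

Lemma ex_ext p s n s1 s2 : ex p s n s1 -> s1 =1 s2 -> ex p s n s2.
Proof.
move=> h e c /h [q [c' [m [? ? ? r]]]].
by exists q, c', m; split=> // k; rewrite -e; apply: r.
Qed.

Lemma ex_le p s n m s1 : ex p s n s1 -> n <= m -> ex p s m s1.
Proof.
move=> h e c /h [q [c' [k [? ? ? r]]]].
by exists q, c', k; split=> //; apply: leq_trans e.
Qed.

Lemma ex_pop i s : ex (ppop i) s 1 (upd s i (behead (s i))).
Proof.
move=> c hc; eexists true, _, 1; split=> //=.
  by eexists; [rewrite /step /=; reflexivity|reflexivity].
move=> k; rewrite actatE /upd; case: eqP => [->|_]; last exact: hc.
have [l [j [hl hr]]] := hc i; rewrite /act /move /=.
case: (tnth c i) hl hr => L S0 R0 /= -> hr.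
exists l.+1; case: (s i) hr => [|a w] /=.
  case: j => [|[|j]] //= [_ ->]; first by exists 1.
  by exists j.+1.
case=> _ ->; case: w => [|b w] /=; last by exists j.
by case: j => [|j]; [exists 1|exists j.+1].
Qed.
Arguments ex_pop : clear implicits.

Lemma ex_push i a s : ex (ppush i a) s 2 (upd s i (a :: s i)).
Proof.
move=> c hc; eexists (Some true), _, 2; split=> //=.
  eexists; first by rewrite /step /=; reflexivity.
  by eexists; [rewrite /step /=; reflexivity|reflexivity].
move=> k; rewrite actatE /upd tnth_mktuple [tnth (actat _ _ _ _) k]tnth_mktuple.
case: eqP => [->|_]; last first.
  rewrite tnth_map; have := hc k.
  by case: (tnth c k).
have [l [j [hl hr]]] := hc i; rewrite /act /move /= tnth_map.
case: (tnth c i) hl hr => L S0 R0 /= -> hr.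
by exists l.-1, j; split; [case: l|rewrite /= hr].
Qed.
Arguments ex_push : clear implicits.

(** Halting of the first program becomes one idle transition into the second, which accounts for the
    successor in the bound of [ex_seq]. *)
Definition pseq (p1 p2 : prog) : prog :=
  @Prog (pst p1 + pst p2)%type (inl (pini p1)) (fun q r =>
    match q with
    | inl q => match pdel q r with
               | Some (q', a) => Some (inl q', a)
               | None => Some (inr (pini p2), nop r) end
    | inr q => match pdel q r with
               | Some (q', a) => Some (inr q', a)
               | None => None end
    end).

Definition pif (i : 'I_5) (f : cell -> bool) (p1 p2 : prog) : prog :=
  @Prog (option (pst p1 + pst p2)) None (fun q r =>
    match q with
    | None => Some (Some (if f (tnth r i) then inl (pini p1)
                          else inr (pini p2)), nop r)
    | Some (inl q) => match pdel q r with
               | Some (q', a) => Some (Some (inl q'), a)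
               | None => None end
    | Some (inr q) => match pdel q r with
               | Some (q', a) => Some (Some (inr q'), a)
               | None => None end
    end).

Definition pwhile (i : 'I_5) (f : cell -> bool) (p : prog) : prog :=
  @Prog (option (pst p)) None (fun q r =>
    match q with
    | None => if f (tnth r i) then Some (Some (pini p), nop r) else None
    | Some q => match pdel q r with
               | Some (q', a) => Some (Some q', a)
               | None => Some (None, nop r) end
    end).

(* The states of a program embed in those of a compound program by [f]. *)
Lemma reach_embed (p p' : prog) (f : pst p -> pst p') :
  (forall q r q' a, pdel q r = Some (q', a) -> pdel (f q) r = Some (f q', a)) ->
  forall n q c q' c', @reach p n (q, c) (q', c') ->
                      @reach p' n (f q, c) (f q', c').
Proof.
move=> h; elim=> [|n IH] q c q' c' /=; first by case=> -> ->.
case=> -[q1 c1]; rewrite {1}/step /=.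
case e: (pdel _ _) => [[q2 a]|] // [<- <-] /IH r.
by eexists; [rewrite /step /= (h _ _ _ _ e); reflexivity|].
Qed.

Lemma step_None (p : prog) (q : pst p) c :
  (@step (mach p) (q, c) = None) <-> (pdel q (map_tuple scanned c) = None).
Proof. by rewrite /step /=; case: (pdel _ _) => [[]|]. Qed.

Lemma ex_seq p1 p2 s s1 s2 n1 n2 :
  ex p1 s n1 s1 -> ex p2 s1 n2 s2 -> ex (pseq p1 p2) s (n1 + n2).+1 s2.
Proof.
move=> h1 h2 c /h1 [q1 [c1 [m1 [le1 r1 /step_None e1 /h2]]]].
case=> q2 [c2 [m2 [le2 r2 /step_None e2 hc2]]].
exists (inr q2), c2, (m1 + m2.+1); split=> //.
- by rewrite addnS ltnS leq_add.
- apply: (@reach_cat (pseq p1 p2) _ _ _ (inl q1, c1)).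
    by apply: (@reach_embed p1 (pseq p1 p2) inl _ _ _ _ _ _ r1) => q r q' a /= ->.
  exists (inr (pini p2), c1); first by rewrite /step /= e1 nopE.
  by apply: (@reach_embed p2 (pseq p1 p2) inr _ _ _ _ _ _ r2) => q r q' a /= ->.
- by apply/step_None; rewrite /= e2.
Qed.

Lemma ex_if i (f : cell -> bool) p1 p2 s s1 n :
  ex (if f (ohead (s i)) then p1 else p2) s n s1 -> ex (pif i f p1 p2) s n.+1 s1.
Proof.
move=> h c hc; have top := scanned_rep (hc i).
case b: (f _) h => h; have [q1 [c1 [m1 [le1 r1 /step_None e1 h1]]]] := h _ hc.
- exists (Some (inl q1)), c1, m1.+1; split=> //; last by apply/step_None; rewrite /= e1.
  exists (Some (inl (pini p1)), c); first by rewrite /step /= tnth_map top b nopE.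
  by apply: (@reach_embed p1 (pif i f p1 p2) (Some \o inl) _ _ _ _ _ _ r1) => q r q' a /= ->.
- exists (Some (inr q1)), c1, m1.+1; split=> //; last by apply/step_None; rewrite /= e1.
  exists (Some (inr (pini p2)), c); first by rewrite /step /= tnth_map top b nopE.
  by apply: (@reach_embed p2 (pif i f p1 p2) (Some \o inr) _ _ _ _ _ _ r1) => q r q' a /= ->.
Qed.

Lemma ex_while_end i (f : cell -> bool) p s : ~~ f (ohead (s i)) -> ex (pwhile i f p) s 0 s.
Proof.
move=> h c hc; exists None, c, 0; split=> //; apply/step_None.
by rewrite /= tnth_map (scanned_rep (hc i)) (negPf h).
Qed.

Lemma ex_while_step i (f : cell -> bool) p s s1 s2 n m : f (ohead (s i)) -> ex p s n s1 ->
  ex (pwhile i f p) s1 m s2 -> ex (pwhile i f p) s (n + m).+2 s2.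
Proof.
move=> b h1 h2 c hc; have top := scanned_rep (hc i).
have [q1 [c1 [m1 [le1 r1 /step_None e1 hc1]]]] := h1 _ hc.
have [q2 [c2 [m2 [le2 r2 e2 hc2]]]] := h2 _ hc1.
exists q2, c2, (m1 + m2.+1).+1; split=> //; first by rewrite addnS !ltnS leq_add.
exists (Some (pini p), c); first by rewrite /step /= tnth_map top b nopE.
apply: (@reach_cat (pwhile i f p) _ _ _ (Some q1, c1)).
  by apply: (@reach_embed p (pwhile i f p) Some _ _ _ _ _ _ r1) => q r q' a /= ->.
by exists (None, c1) => //; rewrite /step /= e1 nopE.
Qed.

Lemma reach_run p n m c c' : @reach p n c c' -> step c' = None -> n <= m ->
  run m c = Some c'.
Proof.
elim: n m c => [|n IH] m c /=; first by move=> -> h _; case: m => [|m] /=; rewrite h.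
case=> c1 e r h; case: m => // m; rewrite ltnS => le /=.
by rewrite e; apply: IH.
Qed.

Lemma rep_init p w :
  rep (@init (mach p) w).2 (fun k => if k == ord0 then w else [::]).
Proof.
move=> k; rewrite /init /= tnth_mktuple; case: ifP => _; last by exists 0, 1.
by exists 0; case: w => [|a w] /=; [exists 1|exists 0; rewrite cats0].
Qed.

Lemma rep_word t w : rep_tape t w -> word_of_tape t = w.
Proof.
case=> i [j [_ h]]; rewrite /word_of_tape h.
by elim: w {h} => [|a w IH] /=; [case: j|rewrite IH].
Qed.

Lemma ex_outputs p w n s' : ex p (fun k => if k == ord0 then w else [::]) n s' ->
  outputs_within (mach p) n w (s' ord0).
Proof.
move=> /(_ _ (rep_init p w)) [q [c' [m [le r e hc]]]].
by rewrite /outputs_within (reach_run r e le) /= (rep_word (hc ord0)).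
Qed.

(** * Polynomial-time functions on binary trees *)

Inductive tree := Leaf | Node of tree & tree.

(** Polish notation is prefix-free, so a tree on top of a stack needs no end marker. *)
Fixpoint code (t : tree) : word :=
  if t is Node a b then Bit true :: code a ++ code b else [:: Bit false].

Definition tsize t := size (code t).

Lemma tsizeN a b : tsize (Node a b) = (tsize a + tsize b).+1.
Proof. by rewrite /tsize /= size_cat. Qed.

Lemma tsize_gt0 t : 0 < tsize t.
Proof. by case: t. Qed.

(** Input and output, data, two scratch stacks, and a stack of unary counters. *)
Definition sIO : 'I_5 := @Ordinal 5 0 isT.
Definition sD : 'I_5 := @Ordinal 5 1 isT.
Definition sX : 'I_5 := @Ordinal 5 2 isT.
Definition sY : 'I_5 := @Ordinal 5 3 isT.
Definition sN : 'I_5 := @Ordinal 5 4 isT.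

Definition isbit (c : cell) := if c is Some (Bit _) then true else false.
Definition istrue (c : cell) := if c is Some (Bit true) then true else false.

Definition st (a d x y n : word) : stk := fun k => nth [::] [:: a; d; x; y; n] k.

Lemma st_ext (s1 s2 : stk) : s1 sIO = s2 sIO -> s1 sD = s2 sD ->
  s1 sX = s2 sX -> s1 sY = s2 sY -> s1 sN = s2 sN -> s1 =1 s2.
Proof.
move=> h0 h1 h2 h3 h4 [[|[|[|[|[|//]]]]] h].
- by rewrite (_ : Ordinal h = sIO) //; apply: val_inj.
- by rewrite (_ : Ordinal h = sD) //; apply: val_inj.
- by rewrite (_ : Ordinal h = sX) //; apply: val_inj.
- by rewrite (_ : Ordinal h = sY) //; apply: val_inj.
- by rewrite (_ : Ordinal h = sN) //; apply: val_inj.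
Qed.

Lemma ex_push_st i a a0 d x y n :
  ex (ppush i a) (st a0 d x y n) 2
     (st (if i == sIO then a :: a0 else a0) (if i == sD then a :: d else d)
         (if i == sX then a :: x else x) (if i == sY then a :: y else y)
         (if i == sN then a :: n else n)).
Proof.
apply: ex_ext (ex_push _ _ _) _.
by apply: st_ext; rewrite /upd; case: eqVneq => [<-|ne]; rewrite /= ?eqxx // eq_sym (negPf ne).
Qed.
Arguments ex_push_st : clear implicits.

Lemma ex_pop_st i a0 d x y n :
  ex (ppop i) (st a0 d x y n) 1
     (st (if i == sIO then behead a0 else a0) (if i == sD then behead d else d)
         (if i == sX then behead x else x) (if i == sY then behead y else y)
         (if i == sN then behead n else n)).
Proof.
apply: ex_ext (ex_pop _ _) _.
by apply: st_ext; rewrite /upd; case: eqVneq => [<-|ne]; rewrite /= ?eqxx // eq_sym (negPf ne).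
Qed.
Arguments ex_pop_st : clear implicits.

(* [b] selects the auxiliary stack that receives the tree. *)
Definition aux (b : bool) := if b then sX else sY.

(** The bits on top of [sN] count the subtrees still to be read: a node letter turns one pending
    subtree into two, a leaf letter completes one. *)
Definition mvbody b : prog :=
  pif sD istrue
    (pseq (ppop sD) (pseq (ppush (aux b) (Bit true)) (ppush sN (Bit true))))
    (pseq (ppop sD) (pseq (ppush (aux b) (Bit false)) (ppop sN))).

Definition stx b a d x y n := if b then st a d x y n else st a d y x n.

Lemma ex_mvloop b t a r x y n m s2 v :
  ex (pwhile sN isbit (mvbody b)) (stx b a r (rev (code t) ++ x) y n) m s2 ->
  ex (pwhile sN isbit (mvbody b))
     (stx b a (code t ++ r) x y (Bit v :: n)) (m + 12 * tsize t) s2.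
Proof.
elim: t r x n m v => [|t1 IH1 t2 IH2] r x n m v h.
  apply: (@ex_le _ _ (8 + m).+2); last by rewrite /tsize /=; lia.
  apply: ex_while_step h; first by case: b.
  apply: (@ex_le _ _ (1 + (2 + 1).+1).+2); last by [].
  apply: ex_if; case: b => /=.
    apply: ex_seq (ex_pop_st _ _ _ _ _ _) _.
    exact: ex_seq (ex_push_st _ _ _ _ _ _ _) (ex_pop_st _ _ _ _ _ _).
  apply: ex_seq (ex_pop_st _ _ _ _ _ _) _.
  exact: ex_seq (ex_push_st _ _ _ _ _ _ _) (ex_pop_st _ _ _ _ _ _).
apply: (@ex_le _ _ (9 + ((m + 12 * tsize t2) + 12 * tsize t1)).+2); last first.
  by rewrite tsizeN; lia.
apply: (@ex_while_step _ _ _ _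
  (stx b a (code t1 ++ code t2 ++ r) (Bit true :: x) y (Bit true :: Bit v :: n))).
- by case: (b).
- apply: (@ex_le _ _ (1 + (2 + 2).+1).+2); last by [].
  apply: ex_if.
  case: (b) => /=; rewrite -catA.
    apply: ex_seq (ex_pop_st _ _ _ _ _ _) _.
    exact: ex_seq (ex_push_st _ _ _ _ _ _ _) (ex_push_st _ _ _ _ _ _ _).
  apply: ex_seq (ex_pop_st _ _ _ _ _ _) _.
  exact: ex_seq (ex_push_st _ _ _ _ _ _ _) (ex_push_st _ _ _ _ _ _ _).
- apply: IH1; apply: IH2.
  suff -> : rev (code t2) ++ rev (code t1) ++ Bit true :: x =
            rev (code (Node t1 t2)) ++ x by [].
  by rewrite /= rev_cons rev_cat -cats1 -!catA.
Qed.

Definition pmv b : prog :=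
  pseq (ppush (aux b) Sep) (pseq (ppush sN Sep) (pseq (ppush sN (Bit true))
    (pseq (pwhile sN isbit (mvbody b)) (ppop sN)))).

Lemma ex_mv b t a r x y n :
  ex (pmv b) (stx b a (code t ++ r) x y n) (11 + 12 * tsize t)
             (stx b a r (rev (code t) ++ Sep :: x) y n).
Proof.
have h := @ex_mvloop b t a r (Sep :: x) y (Sep :: n) 0 _ true
            (@ex_while_end _ _ _ _ _).
have -> : 11 + 12 * tsize t = (2 + (2 + (2 + (12 * tsize t + 1).+1).+1).+1).+1.
  by lia.
case: b h => /= h.
  apply: ex_seq (ex_push_st _ _ _ _ _ _ _) _.
  apply: ex_seq (ex_push_st _ _ _ _ _ _ _) _.
  apply: ex_seq (ex_push_st _ _ _ _ _ _ _) _.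
  by apply: ex_seq (h _) (ex_pop_st _ _ _ _ _ _).
apply: ex_seq (ex_push_st _ _ _ _ _ _ _) _.
apply: ex_seq (ex_push_st _ _ _ _ _ _ _) _.
apply: ex_seq (ex_push_st _ _ _ _ _ _ _) _.
by apply: ex_seq (h _) (ex_pop_st _ _ _ _ _ _).
Qed.

(* Pop the letters of a stack down to the separator, running [p v] for each
   letter [Bit v]. *)
Definition punload (i : 'I_5) (p : bool -> prog) : prog :=
  pseq (pwhile i isbit (pif i istrue (pseq (ppop i) (p true))
                                     (pseq (ppop i) (p false))))
       (ppop i).

Lemma ex_unload i p k (S : word -> word -> stk) (w x : word) z :
  (forall u z, S u z i = u) ->
  (forall v u z, ex (p v) (S u z) k (S u (Bit v :: z))) ->
  (forall v u z, upd (S (v :: u) z) i u =1 S u z) ->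
  all (isbit \o Some) w ->
  ex (punload i p) (S (rev w ++ Sep :: x) z) ((k + 5) * size w + 2)
     (S x (w ++ z)).
Proof.
move=> h1 h2 h3 hw.
have pop v u z' : ex (ppop i) (S (v :: u) z') 1 (S u z').
  apply: ex_ext (ex_pop _ _) _ => j; rewrite -(h3 v u z') /upd; case: eqP => // _.
  by rewrite h1.
rewrite addn2; apply: (@ex_le _ _ ((k + 5) * size w + 1).+1); last by lia.
apply: ex_seq (pop Sep _ _).
elim/last_ind: w z hw => [|w v IH] z /=.
  by rewrite muln0 => _; apply: ex_while_end; rewrite h1.
rewrite all_rcons => /andP[hv hw]; rewrite size_rcons rev_rcons cat_rcons.
apply: ex_le (ex_while_step _ _ (IH _ hw)) _; first by rewrite h1.
- apply: ex_if; rewrite h1 /=; case: v hv => [[]| |] //= _;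
  exact: ex_seq (pop _ _ _) (h2 _ _ _).
- by rewrite mulnS; lia.
Qed.

Lemma code_bits t : all (isbit \o Some) (code t).
Proof. by elim: t => //= a ha b hb; rewrite all_cat; apply/andP. Qed.

Definition pback b := punload (aux b) (fun v => ppush sD (Bit v)).

Lemma ex_back b t a r x y n :
  ex (pback b) (stx b a r (rev (code t) ++ Sep :: x) y n) (7 * tsize t + 2)
               (stx b a (code t ++ r) x y n).
Proof.
have -> : 7 = 2 + 5 by [].
apply: (@ex_unload _ _ 2 (fun u z => stx b a z u y n)); case: b => //.
- by move=> v u z /=; apply: ex_push_st.
- by move=> v u z /=; apply: ex_push_st.
- by move=> v u z; apply: st_ext.
- by move=> v u z; apply: st_ext.
- exact: code_bits.
- exact: code_bits.
Qed.

Definition pskip : prog := @Prog unit tt (fun _ _ => None).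

Lemma ex_skip s : ex pskip s 0 s.
Proof. by move=> c hc; exists tt, c, 0. Qed.

Definition pdrop := pseq (pmv true) (punload sX (fun _ => pskip)).

Lemma ex_drop t a r x y n :
  ex pdrop (st a (code t ++ r) x y n) (20 * tsize t + 20) (st a r x y n).
Proof.
apply: (@ex_le _ _ ((11 + 12 * tsize t) + ((0 + 5) * tsize t + 2)).+1).
  apply: ex_seq (@ex_mv true t a r x y n) _.
  apply: (@ex_unload _ _ 0 (fun u z => st a r u y n)) => //.
  - by move=> v u z; apply: ex_skip.
  - by move=> v u z; apply: st_ext.
  - exact: code_bits.
by lia.
Qed.
Arguments ex_drop : clear implicits.

Definition pswap := pseq (pmv true) (pseq (pmv false) (pseq (pback true) (pback false))).

Lemma ex_swap t u a r x y n :
  ex pswap (st a (code t ++ code u ++ r) x y n) (20 * (tsize t + tsize u) + 30)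
           (st a (code u ++ code t ++ r) x y n).
Proof.
apply: (@ex_le _ _ ((11 + 12 * tsize t) + ((11 + 12 * tsize u) +
          ((7 * tsize t + 2) + (7 * tsize u + 2)).+1).+1).+1).
  apply: ex_seq (@ex_mv true t a _ x y n) _.
  apply: ex_seq (@ex_mv false u a r y _ n) _.
  apply: ex_seq (@ex_back true t a r x _ n) _.
  exact: (@ex_back false u a _ y x n).
by lia.
Qed.
Arguments ex_swap : clear implicits.

Definition pdup := pseq (pmv true) (pseq (ppush sY Sep)
  (pseq (punload sX (fun v => pseq (ppush sD (Bit v)) (ppush sY (Bit v))))
  (pseq (ppush sX Sep)
  (pseq (punload sY (fun v => ppush sX (Bit v))) (pback true))))).

Lemma ex_dup t a r x y n :
  ex pdup (st a (code t ++ r) x y n) (40 * tsize t + 40)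
          (st a (code t ++ code t ++ r) x y n).
Proof.
apply: (@ex_le _ _ ((11 + 12 * tsize t) + (2 + (((2 + 2).+1 + 5) * tsize t + 2 +
          (2 + (((2 + 5) * tsize t + 2) + (7 * tsize t + 2)).+1).+1).+1).+1).+1).
  apply: ex_seq (@ex_mv true t a _ x y n) _.
  apply: ex_seq (ex_push_st _ _ _ _ _ _ _) _.
  have h := @ex_unload sX (fun v => pseq (ppush sD (Bit v)) (ppush sY (Bit v)))
    _ (fun u z => st a (z ++ r) u (z ++ Sep :: y) n) (code t) x [::].
  apply: ex_seq; first (apply: h => //).
  - move=> v u z.
    exact: ex_seq (ex_push_st _ _ _ _ _ _ _) (ex_push_st _ _ _ _ _ _ _).
  - by move=> v u z; apply: st_ext.
  - exact: code_bits.
  apply: ex_seq (ex_push_st _ _ _ _ _ _ _) _.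
  have h2 := @ex_unload sY (fun v => ppush sX (Bit v))
    _ (fun u z => st a (code t ++ r) (z ++ Sep :: x) u n) (rev (code t)) y [::].
  rewrite revK size_rev in h2; rewrite cats0.
  apply: ex_seq; first (apply: h2 => //).
  - by move=> v u z; apply: ex_push_st.
  - by move=> v u z; apply: st_ext.
  - by rewrite all_rev code_bits.
  by rewrite cats0; apply: (@ex_back true t a (code t ++ r) x y n).
by lia.
Qed.
Arguments ex_dup : clear implicits.

Structure encType := EncType { esort :> Type; encode : esort -> tree }.
Arguments encode {e} _.
Canonical tree_enc := @EncType tree id.

Definition sz (X : encType) (x : X) := tsize (encode x).

(** The program acts on the top of [sD] above an arbitrary [r] and restores the other stacks, so
    that programs nest. With base [sz t + 2], at least 2, a single exponent absorbs constants, sums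
    and products. *)
Definition PT (X Y : encType) (f : X -> Y) : Prop :=
  exists p k, forall t a r x y n,
  ex p (st a (code (encode t) ++ r) x y n) ((sz t + 2) ^ k)
       (st a (code (encode (f t)) ++ r) x y n).

Definition polyb (f : nat -> nat) := exists k, forall n, f n <= (n + 2) ^ k.

Lemma polyb_le f g : (forall n, f n <= g n) -> polyb g -> polyb f.
Proof. by move=> h [k hk]; exists k => n; apply: leq_trans (hk n). Qed.

Lemma polyb_id : polyb id.
Proof. by exists 1 => n; rewrite expn1 leq_addr. Qed.

Lemma polyb_cst c : polyb (fun => c).
Proof.
exists c => n; apply: leq_trans (_ : 2 ^ c <= _); first exact/ltnW/ltn_expl.
by case: c => // c; rewrite leq_exp2r // leq_addl.
Qed.

Lemma polyb_add f g : polyb f -> polyb g -> polyb (fun n => f n + g n).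
Proof.
move=> [k hk] [l hl]; exists (k + l).+1 => n.
apply: (@leq_trans ((n + 2) ^ (k + l) * 2)); last first.
  by rewrite expnS mulnC leq_mul2r leq_addl orbT.
rewrite muln2 -addnn leq_add //.
  by apply: leq_trans (hk n) _; rewrite leq_exp2l ?leq_addr // addn2.
by apply: leq_trans (hl n) _; rewrite leq_exp2l ?leq_addl // addn2.
Qed.

Lemma polyb_mul f g : polyb f -> polyb g -> polyb (fun n => f n * g n).
Proof. by move=> [k hk] [l hl]; exists (k + l) => n; rewrite expnD leq_mul. Qed.

Lemma polyb_exp f k : polyb f -> polyb (fun n => f n ^ k).
Proof.
move=> h; elim: k => [|k IH]; first exact: polyb_cst.
by apply: polyb_le (polyb_mul h IH) => n; rewrite expnS.
Qed.

Definition ppushw (w : word) := foldr (fun a p => pseq p (ppush sD a)) pskip w.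

Lemma ex_pushw w a r x y n :
  ex (ppushw w) (st a r x y n) (3 * size w) (st a (w ++ r) x y n).
Proof.
elim: w => [|v w IH] /=; first exact: ex_skip.
apply: (@ex_le _ _ (3 * size w + 2).+1); last by lia.
exact: ex_seq IH (ex_push_st _ _ _ _ _ _ _).
Qed.
Arguments ex_pushw : clear implicits.

Definition cells (t : tape) := count (@isSome letter) (lcells t ++ scanned t :: rcells t).

Lemma cells_rep t w : rep_tape t w -> cells t = size w.
Proof.
case=> i [j [hl hr]]; rewrite /cells hl hr !count_cat !count_nseq /= !mul0n addn0.
by rewrite count_map -[RHS](count_predT w).
Qed.

Lemma cells_act a t : cells (act a t) <= cells t + 1.
Proof.
have hb (s : seq cell) : count (@isSome letter) s =
    isSome (head None s) + count (@isSome letter) (behead s) by case: s.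
rewrite /cells; case: t => l c r; case: a => b [] /=; rewrite !count_cat /=.
- by rewrite [count _ l]hb; case: (b) => [?|] /=; lia.
- by rewrite [count _ r]hb; case: (b) => [?|] /=; lia.
- by case: (b) => [?|] /=; lia.
Qed.

(** Space is bounded by time: a step writes at most one new non-blank cell on each tape. This yields
    the size bounds needed to compose running times. *)
Lemma ex_size p s n s' i : ex p s n s' -> size (s' i) <= size (s i) + n.
Proof.
move=> h.
pose c := [tuple Tape [::] (ohead (s k)) (behead (map Some (s k))) | k < 5].
have hc : rep c s.
  move=> k; rewrite tnth_mktuple; exists 0.
  by case: (s k) => [|b w]; [exists 1|exists 0; rewrite cats0].
have [q [c' [m [le r _ hc']]]] := h _ hc.
rewrite -(cells_rep (hc i)) -(cells_rep (hc' i)).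
suff {le} : cells (tnth c' i) <= cells (tnth c i) + m.
  by move=> h1; apply: leq_trans h1 _; rewrite leq_add2l.
elim: m (pini p) c {hc} r => [|m IH] q0 c /=; first by case=> _ ->; rewrite addn0.
case=> -[q1 c1] e /IH h1; apply: leq_trans h1 _.
move: e; rewrite /step /=; case: (pdel _ _) => [[q2 b]|] // [_ <-].
rewrite tnth_mktuple; have := cells_act (tnth b i) (tnth c i); lia.
Qed.

Definition pcount := pseq (ppush sN Sep) (pseq (pmv true)
  (punload sX (fun v => pseq (ppush sD (Bit v)) (ppush sN (Bit true))))).

Lemma ex_count t a r x y n :
  ex pcount (st a (code t ++ r) x y n) (30 * tsize t + 30)
     (st a (code t ++ r) x y (nseq (tsize t) (Bit true) ++ Sep :: n)).
Proof.
apply: (@ex_le _ _ (2 + ((11 + 12 * tsize t) + (((2 + 2).+1 + 5) * tsize t + 2)).+1).+1);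
  last by lia.
apply: ex_seq (ex_push_st _ _ _ _ _ _ _) _.
apply: ex_seq (@ex_mv true t a r x y _) _.
have h := @ex_unload sX (fun v => pseq (ppush sD (Bit v)) (ppush sN (Bit true)))
    _ (fun u z => st a (z ++ r) u y (nseq (size z) (Bit true) ++ Sep :: n)) (code t) x [::].
rewrite cats0 in h; apply: h => //.
- move=> v u z.
  exact: ex_seq (ex_push_st _ _ _ _ _ _ _) (ex_push_st _ _ _ _ _ _ _).
- by move=> v u z; apply: st_ext.
- exact: code_bits.
Qed.
Arguments ex_count : clear implicits.

Section Closure.
Variables X Y Z W : encType.

Lemma PTI (f : X -> Y) p T : polyb T -> (forall t a r x y n,
  ex p (st a (code (encode t) ++ r) x y n) (T (sz t))
       (st a (code (encode (f t)) ++ r) x y n)) -> PT f.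
Proof.
by move=> [k hk] h; exists p, k => t a r x y n; apply: ex_le (h _ _ _ _ _ _) (hk _).
Qed.

Lemma PT_recast (f : X -> Y) (g : X -> Z) :
  (forall x, encode (f x) = encode (g x)) -> PT f -> PT g.
Proof. by move=> e [p [k h]]; exists p, k => *; rewrite -e. Qed.

Lemma PT_ext (f g : X -> Y) : f =1 g -> PT f -> PT g.
Proof. by move=> e [p [k h]]; exists p, k => *; rewrite -e. Qed.

Lemma PT_cst (c : Y) : PT (fun _ : X => c).
Proof.
apply: (@PTI _ (pseq pdrop (ppushw (code (encode c))))
  (fun n => (20 * n + 20 + 3 * tsize (encode c)).+1)).
  have h := polyb_add (polyb_mul (polyb_cst 20) polyb_id)
                      (polyb_cst (20 + 3 * tsize (encode c) + 1)).
  by apply: (polyb_le _ h) => n /=; lia.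
by move=> t a r x y n; apply: ex_seq (ex_drop _ _ _ _ _ _) (ex_pushw _ _ _ _ _ _).
Qed.

Lemma PT_size (f : X -> Y) : PT f -> exists k, forall t, sz (f t) <= (sz t + 2) ^ k.
Proof.
move=> [p [k h]].
have [l hl] : polyb (fun n => n + (n + 2) ^ k).
  exact/polyb_add/polyb_exp/polyb_add/polyb_cst/polyb_id/polyb_id.
exists l => t; apply: leq_trans (hl _).
by have := ex_size sD (h t [::] [::] [::] [::] [::]); rewrite /= !cats0.
Qed.

End Closure.

Section Closure2.
Variables X Y Z W : encType.

Lemma PT_id : PT (fun x : X => x).
Proof.
apply: (@PTI X X _ pskip (fun=> 0)); first exact: polyb_cst.
by move=> *; apply: ex_skip.
Qed.

Lemma PT_comp (f : X -> Y) (g : Y -> Z) : PT f -> PT g -> PT (fun x => g (f x)).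
Proof.
move=> hG hF; have [s hs] := PT_size hG.
case: hG => pG [k hk]; case: hF => pF [l hl].
apply: (@PTI _ _ _ (pseq pG pF) (fun n => ((n + 2) ^ k + ((n + 2) ^ s + 2) ^ l).+1)).
  have h2 := polyb_add polyb_id (polyb_cst 2).
  apply: polyb_le (polyb_add (polyb_cst 1) (polyb_add (polyb_exp k h2)
    (polyb_exp l (polyb_add (polyb_exp s h2) (polyb_cst 2))))) => n; lia.
move=> t a r x y n; apply: ex_seq (hk _ _ _ _ _ _) _.
apply: ex_le (hl _ _ _ _ _ _) _.
by case: (l) => // l'; rewrite leq_exp2r // leq_add2r.
Qed.

Lemma PT_node (f : X -> Y) (g : X -> Z) (h : X -> W) :
  (forall x, encode (h x) = Node (encode (f x)) (encode (g x))) ->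
  PT f -> PT g -> PT h.
Proof.
move=> e hF hG; have [s hs] := PT_size hF; have [s' hs'] := PT_size hG.
case: hG => pG [k hk]; case: hF => pF [l hl].
pose b n e := (n + 2) ^ e.
apply: (@PTI _ _ _ (pseq pdup (pseq pF (pseq pswap (pseq pG (pseq pswap
   (ppush sD (Bit true)))))))
  (fun n => 40 * n + 120 + b n l + 20 * b n s + 20 * n + b n k + 20 * b n s'
     + 20 * b n s)).
  have h2 i : polyb (b^~ i) := polyb_exp i (polyb_add polyb_id (polyb_cst 2)).
  by do ![apply: polyb_add|apply: polyb_mul|exact: polyb_cst|exact: polyb_id|exact: h2].
move=> t a r x y n; rewrite /b.
apply: (@ex_le _ _ ((40 * sz t + 40) + ((sz t + 2) ^ l + ((20 * (sz (f t) + sz t)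
  + 30) + ((sz t + 2) ^ k + ((20 * (sz (g t) + sz (f t)) + 30) + 2).+1).+1).+1).+1).+1);
  last by have := hs t; have := hs' t; lia.
apply: ex_seq (ex_dup _ _ _ _ _ _) _; apply: ex_seq (hl _ _ _ _ _ _) _.
apply: ex_seq (ex_swap _ _ _ _ _ _ _) _; apply: ex_seq (hk _ _ _ _ _ _) _.
apply: ex_seq (ex_swap _ _ _ _ _ _ _) _.
by apply: ex_ext (ex_push_st _ _ _ _ _ _ _) _; rewrite e /= -catA.
Qed.

Lemma PT_ifN (c : X -> Z) (f g : X -> Y) : PT c -> PT f -> PT g ->
  PT (fun x => if encode (c x) is Node _ _ then f x else g x).
Proof.
move=> hC; have [s hs] := PT_size hC; case: hC => pC [m hc].
move=> [pF [k hk]] [pG [l hl]].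
pose b n e := (n + 2) ^ e.
apply: (@PTI _ _ _ (pseq pdup (pseq pC (pif sD istrue (pseq pdrop pF) (pseq pdrop pG))))
  (fun n => 40 * n + 120 + b n m + 20 * b n s + b n k + b n l)).
  have h2 e : polyb (b^~ e) := polyb_exp e (polyb_add polyb_id (polyb_cst 2)).
  by do ![apply: polyb_add|apply: polyb_mul|exact: polyb_cst|exact: polyb_id|exact: h2].
move=> t a r x y n; rewrite /b.
apply: (@ex_le _ _ ((40 * sz t + 40) + ((sz t + 2) ^ m + ((20 * sz (c t) + 20)
  + ((sz t + 2) ^ k + (sz t + 2) ^ l)).+2).+1).+1); last by have := hs t; lia.
apply: ex_seq (ex_dup _ _ _ _ _ _) _; apply: ex_seq (hc _ _ _ _ _ _) _.
apply: ex_if; have hd := ex_drop (encode (c t)) a (code (encode t) ++ r) x y n.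
rewrite [sz (c t)]/sz; case: (encode (c t)) hd => [|u v] /= hd.
  by apply: ex_seq hd _; apply: ex_le (hl _ _ _ _ _ _) _; rewrite leq_addl.
by apply: ex_seq hd _; apply: ex_le (hk _ _ _ _ _ _) _; rewrite leq_addr.
Qed.

(** The counter is the size of the initial value, written in unary by [pcount]. A polynomial-time
    step may square the size at each turn, whence the uniform bound required of all iterates. *)
Lemma PT_iter (i : X -> Y) (f : Y -> Y) (k : nat) : PT i -> PT f ->
  (forall t n, n <= sz (i t) -> sz (iter n f (i t)) <= (sz t + 2) ^ k) ->
  PT (fun t => iter (sz (i t)) f (i t)).
Proof.
move=> [q [m hm]] [p [l hl]] hk; pose b n e := (n + 2) ^ e.
apply: (@PTI _ _ _
  (pseq q (pseq pcount (pseq (pwhile sN isbit (pseq (ppop sN) p)) (ppop sN))))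
  (fun n => b n m + (30 * b n k + 40 + b n k * (4 + (b n k + 2) ^ l)))).
  have h2 e : polyb (b^~ e) := polyb_exp e (polyb_add polyb_id (polyb_cst 2)).
  by do ![apply: polyb_add|apply: polyb_mul|apply: polyb_exp|exact: polyb_cst|exact: polyb_id|exact: h2].
move=> t a r x y n; rewrite /b; set B := (_ ^ l).
have h0 := hk t 0 isT; rewrite /= in h0.
apply: (@ex_le _ _ ((sz t + 2) ^ m + ((30 * sz (i t) + 30) + (sz (i t) * (4 + B) + 1).+1).+1).+1);
  last by have := leq_mul h0 (leqnn (4 + B)); lia.
apply: ex_seq (hm _ _ _ _ _ _) _.
apply: ex_seq (ex_count (encode (i t)) a r x y n) _.
have h : ex (ppop sN) (st a (code (encode (iter (sz (i t)) f (i t))) ++ r) x y (Sep :: n)) 1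
  (st a (code (encode (iter (sz (i t)) f (i t))) ++ r) x y n) by apply: ex_pop_st.
apply: ex_seq h.
suff h j t' : (forall i, i <= j -> sz (iter i f t') <= (sz t + 2) ^ k) ->
    ex (pwhile sN isbit (pseq (ppop sN) p))
      (st a (code (encode t') ++ r) x y (nseq j (Bit true) ++ Sep :: n)) (j * (4 + B))
      (st a (code (encode (iter j f t')) ++ r) x y (Sep :: n)).
  by apply: h => i'; apply: hk.
move: j t'; elim=> [|j IH] t' ht; first exact: ex_while_end.
apply: (@ex_le _ _ ((1 + B).+1 + j * (4 + B)).+2); last by rewrite mulSn; lia.
rewrite iterSr; apply: ex_while_step => //; last first.
  by apply: IH => i' le; rewrite -iterSr; apply: ht.
apply: ex_seq (ex_pop_st _ _ _ _ _ _) _.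
apply: ex_le (hl _ _ _ _ _ _) _; rewrite /B; have := ht 0 isT => /= {}h.
by case: (l) => // l'; rewrite leq_exp2r // leq_add2r.
Qed.

End Closure2.

Lemma PT_tfst : PT (fun t => if t is Node a _ then a else Leaf).
Proof.
apply: (@PTI _ _ _ (pif sD istrue (pseq (ppop sD) (pseq (pmv true) (pseq pdrop (pback true))))
                              pskip) (fun n => 40 * n + 60)).
  exact: polyb_add (polyb_mul (polyb_cst 40) polyb_id) (polyb_cst 60).
move=> [|u v] a r x y n; rewrite /=.
  by apply: (@ex_le _ _ 1); [apply: ex_if; apply: ex_skip|lia].
rewrite /sz tsizeN.
apply: (@ex_le _ _ (1 + ((11 + 12 * tsize u) + ((20 * tsize v + 20)
   + (7 * tsize u + 2)).+1).+1).+2); last by lia.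
apply: ex_if => /=; rewrite -catA.
apply: ex_seq (ex_pop_st _ _ _ _ _ _) _.
apply: ex_seq (@ex_mv true u a _ x y n) _.
exact: ex_seq (ex_drop _ _ _ _ _ _) (@ex_back true u a r x y n).
Qed.

Lemma PT_tsnd : PT (fun t => if t is Node _ b then b else Leaf).
Proof.
apply: (@PTI _ _ _ (pif sD istrue (pseq (ppop sD) pdrop) pskip) (fun n => 40 * n + 60)).
  exact: polyb_add (polyb_mul (polyb_cst 40) polyb_id) (polyb_cst 60).
move=> [|u v] a r x y n; rewrite /=.
  by apply: (@ex_le _ _ 1); [apply: ex_if; apply: ex_skip|lia].
rewrite /sz tsizeN.
apply: (@ex_le _ _ (1 + (20 * tsize u + 20)).+2); last by lia.
apply: ex_if => /=; rewrite -catA.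
apply: ex_seq (ex_pop_st _ _ _ _ _ _) _.
exact: (ex_drop u a (code v ++ r) x y n).
Qed.

Definition btree (b : bool) := if b then Node Leaf Leaf else Leaf.

Definition ltree (a : letter) :=
  match a with
  | Bit b => btree b
  | Minus => Node Leaf (btree true)
  | Sep => Node (btree true) Leaf
  end.

Fixpoint wtree (w : word) := if w is a :: w' then Node (ltree a) (wtree w') else Leaf.

Definition isnone (c : cell) := if c is None then true else false.
Definition isletter (a : letter) (c : cell) :=
  match a, c with
  | Bit true, Some (Bit true) | Bit false, Some (Bit false)
  | Minus, Some Minus | Sep, Some Sep => true
  | _, _ => false end.

Definition pcons a := pseq (ppop sIO) (ppushw (Bit true :: code (ltree a))).

Definition pread := pseq (ppush sD (Bit false))
  (pwhile sIO (negb \o isnone)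
    (pif sIO (isletter (Bit true)) (pcons (Bit true))
    (pif sIO (isletter (Bit false)) (pcons (Bit false))
    (pif sIO (isletter Minus) (pcons Minus) (pcons Sep))))).

Lemma ex_read w : ex pread (fun k => if k == ord0 then w else [::]) (30 * size w + 3)
  (st [::] (code (wtree (rev w))) [::] [::] [::]).
Proof.
have hp : ex (ppush sD (Bit false)) (fun k => if k == ord0 then w else [::]) 2
   (st w (code (wtree [::])) [::] [::] [::]).
  by apply: ex_ext (ex_push _ _ _) _; apply: st_ext.
apply: (@ex_le _ _ (2 + 30 * size w).+1); last by lia.
apply: ex_seq hp _.
suff h v : ex (pwhile sIO (negb \o isnone)
    (pif sIO (isletter (Bit true)) (pcons (Bit true))
    (pif sIO (isletter (Bit false)) (pcons (Bit false))
    (pif sIO (isletter Minus) (pcons Minus) (pcons Sep)))))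
    (st w (code (wtree v)) [::] [::] [::]) (30 * size w)
    (st [::] (code (wtree (catrev w v))) [::] [::] [::]) by exact: h.
elim: w v => [|c w IH] v; first exact: ex_while_end.
apply: (@ex_le _ _ (25 + 30 * size w).+2); last by rewrite /=; lia.
apply: (ex_while_step _ _ (IH (c :: v))) => //.
have hc (P := pcons c) : ex P (st (c :: w) (code (wtree v)) [::] [::] [::]) 20
    (st w (code (wtree (c :: v))) [::] [::] [::]).
  apply: (@ex_le _ _ (1 + 3 * size (Bit true :: code (ltree c))).+1).
    apply: ex_seq (ex_pop_st _ _ _ _ _ _) _.
    exact: (ex_pushw (Bit true :: code (ltree c))).
  by case: (c) => [[]| |].
have e n : 20 <= n -> ex (pcons c) (st (c :: w) (code (wtree v)) [::] [::] [::]) n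
    (st w (code (wtree (c :: v))) [::] [::] [::]) by exact: ex_le.
by case: (c) e => [[]| |] e; (do ![apply: ex_if => /=]); apply: e.
Qed.
Arguments ex_read : clear implicits.

(** The [n.+1] pops discard the rest of the code of the letter just recognised. *)
Definition pout n a := pseq (iter n (pseq (ppop sD)) (ppop sD)) (ppush sIO a).

(** A decision tree on the prefix codes 0, 100, 10100 and 11000 of the letters [Bit false],
    [Bit true], [Minus] and [Sep]. *)
Definition pwrite := pwhile sD istrue (pseq (ppop sD)
  (pif sD istrue (pseq (ppop sD)
     (pif sD istrue (pout 3 Sep) (pseq (ppop sD)
        (pif sD istrue (pout 2 Minus) (pout 0 (Bit true))))))
   (pout 0 (Bit false)))).

Lemma ex_write a v : ex pwrite (st a (code (wtree v)) [::] [::] [::]) (30 * size v)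
   (st (catrev v a) [:: Bit false] [::] [::] [::]).
Proof.
elim: v a => [|c v IH] a; first exact: ex_while_end.
apply: (@ex_le _ _ (25 + 30 * size v).+2); last by rewrite /=; lia.
apply: (ex_while_step _ _ (IH (c :: a))) => //.
have hp m w : ex (pout m c) (st a w [::] [::] [::]) (2 * m + 4)
    (st (c :: a) (drop m.+1 w) [::] [::] [::]).
  apply: (@ex_le _ _ ((2 * m + 1) + 2).+1); last by lia.
  apply: ex_seq (ex_push_st _ _ _ _ _ _ _).
  elim: m w => [|m IHm] w; first by rewrite drop1; apply: ex_pop_st.
  apply: (@ex_le _ _ (1 + (2 * m + 1)).+1); last by lia.
  apply: ex_seq (ex_pop_st _ _ _ _ _ _) _.
  by case: w => [|b w]; [have := IHm [::]|apply: IHm].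
case: c hp {IH} => [[]| |] hp.
- apply: (@ex_le _ _ (1 + ((1 + ((1 + ((2 * 0 + 4).+1)).+2)).+2)).+1); last by [].
  apply: ex_seq (ex_pop_st _ _ _ _ _ _) _; apply: ex_if => /=.
  apply: ex_seq (ex_pop_st _ _ _ _ _ _) _; apply: ex_if => /=.
  apply: ex_seq (ex_pop_st _ _ _ _ _ _) _; apply: ex_if => /=.
  by apply: ex_ext (hp _ _) _; apply: st_ext; rewrite //= drop0.
- apply: (@ex_le _ _ (1 + (2 * 0 + 4).+1).+1); last by [].
  apply: ex_seq (ex_pop_st _ _ _ _ _ _) _; apply: ex_if => /=.
  by apply: ex_ext (hp _ _) _; apply: st_ext; rewrite //= drop0.
- apply: (@ex_le _ _ (1 + ((1 + ((1 + ((2 * 2 + 4).+1)).+2)).+2)).+1); last by [].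
  apply: ex_seq (ex_pop_st _ _ _ _ _ _) _; apply: ex_if => /=.
  apply: ex_seq (ex_pop_st _ _ _ _ _ _) _; apply: ex_if => /=.
  apply: ex_seq (ex_pop_st _ _ _ _ _ _) _; apply: ex_if => /=.
  by apply: ex_ext (hp _ _) _; apply: st_ext; rewrite //= drop0.
- apply: (@ex_le _ _ (1 + ((1 + ((2 * 3 + 4).+1)).+2)).+1); last by [].
  apply: ex_seq (ex_pop_st _ _ _ _ _ _) _; apply: ex_if => /=.
  apply: ex_seq (ex_pop_st _ _ _ _ _ _) _; apply: ex_if => /=.
  by apply: ex_ext (hp _ _) _; apply: st_ext; rewrite //= drop0.
Qed.
Arguments ex_write : clear implicits.

Lemma tsize_wtree w : size w <= tsize (wtree w) <= 7 * size w + 1.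
Proof.
elim: w => //= c w; rewrite tsizeN => /andP[h1 h2].
by apply/andP; split; case: c => [[]| |]; rewrite /ltree /tsize /= -/(tsize _); lia.
Qed.

(** Reading and writing each transfer letters from one stack to another and so reverse the word;
    hence [rev] on both sides. *)
Lemma PT_machine (X Y : encType) (f : X -> Y) : PT f -> exists (M : machine) (P : {poly nat}),
  forall x w w', encode x = wtree (rev w) -> encode (f x) = wtree (rev w') ->
    outputs_within M P.[size w]%R w w'.
Proof.
move=> hF; have [s hs] := PT_size hF; case: hF => p [k hk].
have [l hl] : polyb (fun n => (30 * n + 3 + ((7 * n + 3) ^ k + 30 * (7 * n + 3) ^ s).+1).+1).
  apply: (@polyb_le _ (fun n => 30 * n + 5 + ((7 * n + 3) ^ k + 30 * (7 * n + 3) ^ s))).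
    by move=> n; lia.
  by do ![apply: polyb_add|apply: polyb_mul|apply: polyb_exp|exact: polyb_cst|exact: polyb_id].
rewrite /sz /= in hk hs.
exists (mach (pseq pread (pseq p pwrite))), (('X + 2%:P) ^+ l)%R => x w w' e1 e2.
have -> : w' = st (catrev (rev w') [::]) [:: Bit false] [::] [::] [::] ord0.
  by rewrite /= -/(rev _) revK.
have -> : ((('X + 2%:P) ^+ l).[size w])%R = (size w + 2) ^ l.
  rewrite horner_exp hornerD hornerX hornerC.
  by elim: (l) => // i IH; rewrite exprS IH expnS.
apply: ex_outputs; apply: ex_le (hl _).
have := tsize_wtree (rev w); rewrite size_rev => /andP[h1 h2].
have le2 : tsize (wtree (rev w)) + 2 <= 7 * size w + 3 by lia.
have le3 i : (tsize (wtree (rev w)) + 2) ^ i <= (7 * size w + 3) ^ i.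
  by case: i => // i; rewrite leq_exp2r.
apply: ex_seq (ex_read w) _; apply: ex_seq.
  apply: ex_le (le3 k); have := hk x [::] [::] [::] [::] [::].
  by rewrite !cats0 e1 e2; apply.
apply: ex_le (ex_write _ _) _; rewrite leq_mul2l /=.
apply: leq_trans (le3 s); have := hs x; rewrite e1 e2.
by have /andP[] := tsize_wtree (rev w'); lia.
Qed.

(** * Encodings and the basic polynomial-time operations *)

Canonical bool_enc := EncType btree.
Canonical unit_enc := EncType (fun _ : unit => Leaf).
Canonical letter_enc := EncType ltree.
Canonical prod_enc (X Y : encType) :=
  @EncType (X * Y)%type (fun p => Node (encode p.1) (encode p.2)).

Fixpoint enc_seq (X : encType) (s : seq X) : tree :=
  if s is x :: s' then Node (encode x) (enc_seq s') else Leaf.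
Canonical seq_enc (X : encType) := @EncType (seq X) (@enc_seq X).

Lemma sz_pair (X Y : encType) (x : X) (y : Y) : sz (x, y) = (sz x + sz y).+1.
Proof. by rewrite /sz /= tsizeN. Qed.

Lemma sz_cons (X : encType) (x : X) (s : seq X) : sz (x :: s) = (sz x + sz s).+1.
Proof. by rewrite /sz /= tsizeN. Qed.

Lemma sz_gt0 (X : encType) (x : X) : 0 < sz x.
Proof. exact: tsize_gt0. Qed.

Lemma sz_cat (X : encType) (s1 s2 : seq X) : (sz (s1 ++ s2)).+1 = sz s1 + sz s2.
Proof. by elim: s1 => [|x s IH] //; rewrite cat_cons !sz_cons; lia. Qed.

Lemma sz_rev (X : encType) (s : seq X) : sz (rev s) = sz s.
Proof.
elim: s => // x s IH; rewrite rev_cons -cats1 sz_cons.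
by have := sz_cat (rev s) [:: x]; rewrite sz_cons IH; have : sz ([::] : seq X) = 1 by []; lia.
Qed.

Lemma sz_size (X : encType) (s : seq X) : size s < sz s.
Proof. by elim: s => // x s IH; rewrite sz_cons /=; lia. Qed.

Lemma sz_mem (X : encType) (s1 s2 : seq X) x : sz x < sz (s1 ++ x :: s2).
Proof. by have := sz_cat s1 (x :: s2); rewrite sz_cons; have := sz_gt0 s1; lia. Qed.

Lemma sz_drop (X : encType) n (s : seq X) : sz (drop n s) <= sz s.
Proof.
by rewrite -{2}(cat_take_drop n s); have := sz_cat (take n s) (drop n s); have := sz_gt0 (take n s); lia.
Qed.

Lemma sz_take (X : encType) n (s : seq X) : sz (take n s) <= sz s.
Proof.
by rewrite -{2}(cat_take_drop n s); have := sz_cat (take n s) (drop n s); have := sz_gt0 (drop n s); lia.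
Qed.

Lemma sz_seq_le (X : encType) (s : seq X) B :
  (forall s1 x s2, s = s1 ++ x :: s2 -> sz x <= B) -> sz s <= size s * B.+1 + 1.
Proof.
elim: s => [|x s IH] h //; rewrite sz_cons /= mulSn.
have h1 := h [::] x s erefl.
have : sz s <= size s * B.+1 + 1 by apply: IH => s1 y s2 e; apply: (h (x :: s1) y s2); rewrite e.
by lia.
Qed.

Definition pbd (X : encType) (g : X -> nat) := exists k, forall x, g x <= (sz x + 2) ^ k.

Section Pbd.
Variable X : encType.
Implicit Types f g : X -> nat.

Lemma pbd_le f g : (forall x, f x <= g x) -> pbd g -> pbd f.
Proof. by move=> h [k hk]; exists k => x; apply: leq_trans (hk x). Qed.

Lemma pbd_cst c : pbd (fun _ : X => c).
Proof. by have [k h] := polyb_cst c; exists k. Qed.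

Lemma pbd_add f g : pbd f -> pbd g -> pbd (fun x => f x + g x).
Proof.
move=> [k hk] [l hl].
have [m hm] : polyb (fun n => (n + 2) ^ k + (n + 2) ^ l).
  by do ![apply: polyb_add|apply: polyb_exp|exact: polyb_cst|exact: polyb_id].
by exists m => x; apply: leq_trans (hm _); apply: leq_add.
Qed.

Lemma pbd_mul f g : pbd f -> pbd g -> pbd (fun x => f x * g x).
Proof. by move=> [k hk] [l hl]; exists (k + l) => n; rewrite expnD leq_mul. Qed.

Lemma pbd_exp f k : pbd f -> pbd (fun x => f x ^ k).
Proof.
move=> h; elim: k => [|k IH]; first exact: pbd_cst.
by apply: pbd_le (pbd_mul h IH) => n; rewrite expnS.
Qed.

Lemma pbd_sz (Y : encType) (h : X -> Y) : PT h -> pbd (fun x => sz (h x)).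
Proof. exact: PT_size. Qed.

End Pbd.

Ltac pbdt := do ![apply: pbd_add|apply: pbd_mul|apply: pbd_exp|exact: pbd_cst
                 |by apply: pbd_sz|by apply: pbd_sz; apply: PT_id|by assumption].

Lemma PT_tree (X Y : encType) (F : tree -> tree) (g : X -> Y) :
  PT F -> (forall x, F (encode x) = encode (g x)) -> PT g.
Proof. by move=> [p [k h]] e; exists p, k => t; rewrite -e; apply: (h (encode t)). Qed.

Lemma PT_pair (X Y Z : encType) (f : X -> Y) (g : X -> Z) : PT f -> PT g -> PT (fun x => (f x, g x)).
Proof. exact: PT_node. Qed.

Lemma PT_cons (X Y : encType) (f : X -> Y) (g : X -> seq Y) : PT f -> PT g -> PT (fun x => f x :: g x).
Proof. exact: PT_node. Qed.

Lemma PT_fst (X Y Z : encType) (f : X -> Y * Z) : PT f -> PT (fun x => (f x).1).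
Proof. by move=> h; apply: (PT_comp h); apply: PT_tree PT_tfst _. Qed.

Lemma PT_snd (X Y Z : encType) (f : X -> Y * Z) : PT f -> PT (fun x => (f x).2).
Proof. by move=> h; apply: (PT_comp h); apply: PT_tree PT_tsnd _. Qed.

Lemma PT_if (X Y : encType) (c : X -> bool) (f g : X -> Y) : PT c -> PT f -> PT g ->
  PT (fun x => if c x then f x else g x).
Proof.
by move=> hc hf hg; apply: PT_ext (PT_ifN hc hf hg) => x; case: (c x).
Qed.

Lemma PT_behead (X Y : encType) (f : X -> seq Y) : PT f -> PT (fun x => behead (f x)).
Proof. by move=> h; apply: (PT_comp h); apply: PT_tree PT_tsnd _; case. Qed.

Lemma PT_nilp (X Y : encType) (f : X -> seq Y) : PT f -> PT (fun x => nilp (f x)).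
Proof.
move=> h; apply: PT_ext (PT_ifN h (PT_cst _ false) (PT_cst _ true)) => x.
by case: (f x).
Qed.

Lemma PT_head (X Y : encType) y0 (f : X -> seq Y) : PT f -> PT (fun x => head y0 (f x)).
Proof.
move=> h; apply: (PT_comp h).
apply: (PT_tree (PT_ifN (PT_id _) PT_tfst (PT_cst _ (encode y0)))).
by case.
Qed.

Lemma PT_foldl (X Y A : encType) (op : X -> A -> Y -> A) (a : X -> A) (l : X -> seq Y) (B : X -> nat) :
  PT (fun p : X * (A * Y) => op p.1 p.2.1 p.2.2) -> PT a -> PT l -> pbd B ->
  (forall x n, sz (foldl (op x) (a x) (take n (l x))) <= B x) ->
  PT (fun x => foldl (op x) (a x) (l x)).
Proof.
move=> hop ha hl hB hb.
(* [head] needs a default; when [Y] is empty, so is every list over it. *)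
have [[y0 _]|nY] := EM (exists y : Y, True); last first.
  by apply: PT_ext ha => x; case: (l x) => // y s; case: nY; exists y.
pose S := (X * (A * seq Y))%type.
(* The step idles on an exhausted list, so it may be run [sz (i x)] times, which exceeds the length
   of the list. *)
pose f (s : S) : S := if nilp s.2.2 then s
  else (s.1, (op s.1 s.2.1 (head y0 s.2.2), behead s.2.2)).
pose i x : S := (x, (a x, l x)).
have hf : PT f.
  have h1 : PT (fun s : S => s.1) by exact/PT_fst/PT_id.
  have h2 : PT (fun s : S => s.2.1) by exact/PT_fst/PT_snd/PT_id.
  have h3 : PT (fun s : S => s.2.2) by exact/PT_snd/PT_snd/PT_id.
  apply: PT_if (PT_nilp h3) (PT_id _) _; apply: (PT_pair h1); apply: PT_pair; last exact: PT_behead.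
  exact: (PT_comp (PT_pair h1 (PT_pair h2 (PT_head y0 h3))) hop).
have hi : PT i by exact/PT_pair/PT_pair/hl/ha/PT_id.
have E n x : iter n f (i x) = (x, (foldl (op x) (a x) (take n (l x)), drop n (l x))).
  elim: n => [|n IH]; first by rewrite take0 drop0.
  rewrite iterS IH /f /=; case: (ltnP n (size (l x))) => hn; last first.
    by rewrite drop_oversize // take_oversize // ?[take n.+1 _]take_oversize ?drop_oversize //; apply: leqW.
  by rewrite (drop_nth y0 hn) /= (take_nth y0 hn) foldl_rcons.
have [k hk] : pbd (fun x => sz x + B x + sz (l x) + 2).
  by pbdt.
have h : PT (fun x => iter (sz (i x)) f (i x)).
  apply: (@PT_iter _ _ _ _ k) => // x n _; apply: leq_trans (hk x).
  by rewrite E !sz_pair; have := hb x n; have := sz_drop n (l x); lia.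
apply: PT_ext (PT_fst (PT_snd h)) => x; rewrite E /= take_oversize //.
by rewrite !sz_pair; have := sz_size (l x); lia.
Qed.

Lemma PT_rev (X Y : encType) (l : X -> seq Y) : PT l -> PT (fun x => rev (l x)).
Proof.
have e (s t : seq Y) : foldl (fun acc y => y :: acc) t s = catrev s t.
  by elim: s t => //= y s IH t; rewrite IH.
move=> hl; pose op (x : X) (acc : seq Y) (y : Y) := y :: acc.
have h : PT (fun x => foldl (op x) [::] (l x)).
  apply: (@PT_foldl _ _ _ op (fun=> [::]) l (fun x => sz (l x))) => //.
  - exact/PT_cons/PT_fst/PT_snd/PT_id/PT_snd/PT_snd/PT_id.
  - exact: PT_cst.
  - exact: pbd_sz.
  - by move=> x n; rewrite e -/(rev _) sz_rev sz_take.
by apply: PT_ext h => x; rewrite e.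
Qed.

Lemma PT_map (X Y Z : encType) (F : X -> Y -> Z) (l : X -> seq Y) :
  PT (fun p : X * Y => F p.1 p.2) -> PT l -> PT (fun x => [seq F x y | y <- l x]).
Proof.
move=> hF hl; pose op (x : X) (acc : seq Z) (y : Y) := F x y :: acc.
have e x s t : foldl (op x) t s = catrev (map (F x) s) t.
  by elim: s t => //= y s IH t; rewrite IH.
have [k hk] := PT_size hF.
have h : PT (fun x => foldl (op x) [::] (l x)).
  apply: (@PT_foldl _ _ _ op (fun=> [::]) l
           (fun x => sz (l x) * ((sz x + sz (l x) + 3) ^ k + 1) + 1)) => //.
  - apply: PT_cons; last exact/PT_fst/PT_snd/PT_id.
    apply: (@PT_comp _ _ _ (fun p : X * (seq Z * Y) => (p.1, p.2.2)) _ _ hF).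
    exact/PT_pair/PT_snd/PT_snd/PT_id/PT_fst/PT_id.
  - exact: PT_cst.
  - by pbdt.
  - move=> x n; rewrite e -/(rev _) sz_rev map_take.
    apply: leq_trans (sz_take _ _) _.
    apply: leq_trans (sz_seq_le (B := (sz x + sz (l x) + 3) ^ k) _) _; last first.
      by rewrite size_map !addn1 ltnS leq_mul2r; apply/orP; right; exact/ltnW/sz_size.
    move=> s1 z s2 /esym E.
    have /(congr1 (drop (size s1))) := E; rewrite drop_size_cat // -map_drop.
    case E2: (drop _ _) => [|y s] //= [-> _].
    apply: leq_trans (hk (x, y)) _; case: (k) => // k'; rewrite leq_exp2r // sz_pair.
    have : sz y < sz (l x).
      by rewrite -(cat_take_drop (size s1) (l x)) E2; apply: sz_mem.
    by lia.
by apply: PT_ext (PT_rev h) => x; rewrite e -/(rev _) revK.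
Qed.

Lemma PT_cat (X Y : encType) (f g : X -> seq Y) : PT f -> PT g ->
  PT (fun x => f x ++ g x).
Proof.
move=> hf hg; pose op (x : X) (acc : seq Y) (y : Y) := y :: acc.
have e (x : X) (s t : seq Y) : foldl (op x) t s = catrev s t.
  by elim: s t => //= y s IH t; rewrite IH.
have h : PT (fun x => foldl (op x) (g x) (rev (f x))).
  apply: (@PT_foldl _ _ _ op g (fun x => rev (f x)) (fun x => sz (f x) + sz (g x))) => //.
  - exact/PT_cons/PT_fst/PT_snd/PT_id/PT_snd/PT_snd/PT_id.
  - exact: PT_rev.
  - by pbdt.
  - move=> x n; rewrite e catrevE; have := sz_cat (rev (take n (rev (f x)))) (g x).
    by rewrite sz_rev; have := sz_take n (rev (f x)); rewrite sz_rev; lia.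
by apply: PT_ext h => x; rewrite e catrevE revK.
Qed.

Lemma sz_flatten (X : encType) (s : seq (seq X)) : sz (flatten s) <= sz s.
Proof.
elim: s => // x s IH; rewrite sz_cons /=; have := sz_cat x (flatten s); lia.
Qed.

Lemma PT_flatten (X Y : encType) (f : X -> seq (seq Y)) : PT f ->
  PT (fun x => flatten (f x)).
Proof.
move=> hf; pose op (x : X) (acc s : seq Y) := acc ++ s.
have e (x : X) (s : seq (seq Y)) t : foldl (op x) t s = t ++ flatten s.
  by elim: s t => [|y s IH] t /=; rewrite ?cats0 // IH catA.
have h : PT (fun x => foldl (op x) [::] (f x)).
  apply: (@PT_foldl _ _ _ op (fun=> [::]) f (fun x => sz (f x))) => //.
  - exact/PT_cat/PT_snd/PT_snd/PT_id/PT_fst/PT_snd/PT_id.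
  - exact: PT_cst.
  - by pbdt.
  - by move=> x n; rewrite e; apply: leq_trans (sz_flatten _) (sz_take _ _).
by apply: PT_ext h => x; rewrite e.
Qed.

(** A list known in advance is unrolled in the program, so no uniformity in [t] is required.
    Everything that depends only on the dimension enters this way. *)
Lemma PT_mapc (X Y : encType) (T : Type) (F : X -> T -> Y) (s : seq T) :
  (forall t, PT (F^~ t)) -> PT (fun x => [seq F x t | t <- s]).
Proof. by move=> h; elim: s => [|t s IH]; [exact: PT_cst|exact: PT_cons]. Qed.

Lemma PT_negb (X : encType) (f : X -> bool) : PT f -> PT (fun x => ~~ f x).
Proof.
by move=> h; apply: PT_ext (PT_if h (PT_cst _ false) (PT_cst _ true)) => x; case: (f x).
Qed.

Lemma PT_andb (X : encType) (f g : X -> bool) : PT f -> PT g -> PT (fun x => f x && g x).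
Proof. by move=> h h'; apply: PT_ext (PT_if h h' (PT_cst _ false)) => x; case: (f x). Qed.

Lemma PT_orb (X : encType) (f g : X -> bool) : PT f -> PT g -> PT (fun x => f x || g x).
Proof. by move=> h h'; apply: PT_ext (PT_if h (PT_cst _ true) h') => x; case: (f x). Qed.

Lemma PT_addb (X : encType) (f g : X -> bool) : PT f -> PT g -> PT (fun x => f x (+) g x).
Proof. by move=> h h'; apply: PT_ext (PT_if h (PT_negb h') h') => x; case: (f x). Qed.

Lemma PT_allc (X : encType) (T : Type) (P : X -> T -> bool) (s : seq T) :
  (forall t, PT (P^~ t)) -> PT (fun x => all (P x) s).
Proof. by move=> h; elim: s => [|t s IH]; [exact: PT_cst|exact: PT_andb]. Qed.

Lemma PT_forall (X : encType) (T : finType) (P : X -> T -> bool) :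
  (forall t, PT (P^~ t)) -> PT (fun x => [forall t, P x t]).
Proof.
move=> h; apply: PT_ext (PT_allc (enum T) h) => x.
by apply/allP/forallP => [H t|H t _]; apply: H; rewrite ?mem_enum.
Qed.

Lemma PT_exists (X : encType) (T : finType) (P : X -> T -> bool) :
  (forall t, PT (P^~ t)) -> PT (fun x => [exists t, P x t]).
Proof.
move=> h; have := PT_negb (PT_forall (fun t => PT_negb (h t))).
by apply: PT_ext => x; rewrite negb_forall; apply: eq_existsb => t; rewrite negbK.
Qed.

(** [T] carries no encoding: its value is found by testing all its elements, and control branches
    accordingly. *)
Lemma PT_fin (X Y : encType) (T : finType) (e : X -> T) (F : X -> T -> Y) :
  (forall t, PT (fun x => e x == t)) -> (forall t, PT (F^~ t)) -> PT (fun x => F x (e x)).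
Proof.
move=> he hF.
have [/eqP t0|[t0]] := set_0Vmem [set: T].
  have n (x : X) : False by have := finset.in_setT (e x); rewrite (eqP t0) inE.
  have [[y0 _]|nY] := EM (exists y : Y, True).
    by apply: PT_ext (PT_cst _ y0) => x; case: (n x).
  by exists pskip, 0 => x; case: (n x).
move=> _; suff h (s : seq T) : PT (fun x => if e x \in s then F x (e x) else F x t0).
  by apply: PT_ext (h (enum T)) => x; rewrite mem_enum.
elim: s => [|t s IH]; first exact: hF.
apply: PT_ext (PT_if (he t) (hF t) IH) => x; rewrite inE.
by case: eqP => [->|].
Qed.

Lemma PT_pick (X Y : encType) (T : finType) (P : X -> T -> bool) (F : X -> option T -> Y) :
  (forall t, PT (P^~ t)) -> (forall t, PT (F^~ t)) ->
  PT (fun x => F x [pick t | P x t]).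
Proof.
move=> hP hF; apply: (@PT_fin _ _ _ (fun x => [pick t | P x t])) => // o.
rewrite /pick /=.
have hs (s : seq T) : PT (fun x => ohead [seq t <- s | P x t] == o).
  elim: s => [|t s IH] /=; first exact: PT_cst.
  by apply: PT_ext (PT_if (hP t) (PT_cst _ (Some t == o)) IH) => x; case: ifP.
apply: PT_ext (hs (Finite.enum T)) => x; rewrite /enum_mem.
by congr (ohead _ == o); apply: eq_filter.
Qed.

Lemma PT_app2 (X A B C : encType) (F : A -> B -> C) (f : X -> A) (g : X -> B) :
  PT (fun p : A * B => F p.1 p.2) -> PT f -> PT g -> PT (fun x => F (f x) (g x)).
Proof. by move=> hF hf hg; apply: (PT_comp (PT_pair hf hg) hF). Qed.

Lemma PT_app3 (X A B C D : encType) (F : A -> B -> C -> D) f g (h : X -> C) :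
  PT (fun p : A * (B * C) => F p.1 p.2.1 p.2.2) -> PT f -> PT g -> PT h ->
  PT (fun x => F (f x) (g x) (h x)).
Proof. by move=> hF hf hg hh; apply: (PT_comp (PT_pair hf (PT_pair hg hh)) hF). Qed.

Lemma sz_nseq n : sz (nseq n tt) = 2 * n + 1.
Proof. by elim: n => // n IH; rewrite [nseq _ _]/= sz_cons IH; have : sz tt = 1 by []; lia. Qed.

Lemma PT_clock (X : encType) : PT (fun x : X => nseq (sz x + 2) tt).
Proof.
pose f (s : X * seq unit) := (s.1, tt :: s.2); pose i (x : X) := (x, ([::] : seq unit)).
have E n x : iter n f (i x) = (x, nseq n tt) by elim: n => //= n ->.
have si x : sz (i x) = sz x + 2 by rewrite sz_pair; have : sz ([::] : seq unit) = 1 by []; lia.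
have hf : PT f.
  by apply: PT_pair; [exact/PT_fst/PT_id|apply: PT_cons; [exact: PT_cst|exact/PT_snd/PT_id]].
have hi : PT i by apply: PT_pair; [exact: PT_id|exact: PT_cst].
have [k hk] : pbd (fun x : X => 3 * sz x + 10) by pbdt.
have h : PT (fun x => iter (sz (i x)) f (i x)).
  apply: (PT_iter (k := k)) => // x n; rewrite si => le; apply: leq_trans (hk x).
  by rewrite E sz_pair sz_nseq; lia.
by apply: PT_ext (PT_snd h) => x; rewrite E si.
Qed.

(** The list [c x] is a unary clock; only its length matters. *)
Lemma PT_loop (X S : encType) (c : X -> seq unit) (i : X -> S) (f : X -> S -> S) (B : X -> nat) :
  PT c -> PT i -> PT (fun p : X * S => f p.1 p.2) -> pbd B ->
  (forall x n, n <= size (c x) -> sz (iter n (f x) (i x)) <= B x) ->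
  PT (fun x => iter (size (c x)) (f x) (i x)).
Proof.
move=> hc hi hf hB hb; pose op (x : X) (s : S) (_ : unit) := f x s.
have E x s (l : seq unit) : foldl (op x) s l = iter (size l) (f x) s.
  by elim: l s => [|u l IH] s //=; rewrite IH -iterSr.
have h : PT (fun x => foldl (op x) (i x) (c x)).
  apply: (@PT_foldl _ _ _ op i c B) => //.
    apply: (@PT_comp _ _ _ (fun p : X * (S * unit) => (p.1, p.2.1)) _ _ hf).
    exact/PT_pair/PT_fst/PT_snd/PT_id/PT_fst/PT_id.
  by move=> x n; rewrite E; apply: hb; rewrite size_take_min geq_minr.
by apply: PT_ext h => x; rewrite E.
Qed.

Lemma PT_bigc (X Y : encType) (T : Type) (op : Y -> Y -> Y) (z : Y) (F : X -> T -> Y)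
    (P : X -> T -> bool) (s : seq T) :
  PT (fun p : Y * Y => op p.1 p.2) -> (forall t, PT (F^~ t)) -> (forall t, PT (P^~ t)) ->
  PT (fun x => \big[op/z]_(t <- s | P x t) F x t).
Proof.
move=> hop hF hP; elim: s => [|t s IH].
  by apply: PT_ext (PT_cst _ z) => x; rewrite big_nil.
have := PT_if (hP t) (PT_app2 hop (hF t) IH) IH.
by apply: PT_ext => x; rewrite big_cons.
Qed.

Lemma PT_nth (X Y : encType) y0 (f : X -> seq Y) i : PT f -> PT (fun x => nth y0 (f x) i).
Proof.
move=> h; have : PT (fun x => head y0 (iter i behead (f x))).
  by apply: PT_head; elim: i => //= i; apply: PT_behead.
apply: PT_ext => x; rewrite -nth0; suff -> : iter i behead (f x) = drop i (f x).
  by rewrite nth_drop addn0.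
by elim: i => [|i IH]; rewrite ?drop0 //= IH -drop1 drop_drop.
Qed.

(** * Arithmetic on binary numbers *)

Definition bval (s : seq bool) : nat := foldr (fun (b : bool) n => b + n.*2) 0 s.

Lemma bits0 : bits 0 = [::].
Proof. by []. Qed.

Lemma up_log_double (b : bool) n : 0 < b + n.*2 -> up_log 2 (b + n.*2).+1 = (up_log 2 n.+1).+1.
Proof.
move=> h; apply: up_log_eq => //.
have /andP[h1 h2] : 2 ^ (up_log 2 n.+1).-1 < n.+1 + (n == 0) <= 2 ^ (up_log 2 n.+1) + (n == 0).
  case: n h => [|n] h; first by rewrite up_log1.
  by rewrite !addn0; apply: up_log_bounds.
case: n h h1 h2 => [|n] h.
  by rewrite up_log1; case: b h.
rewrite !addn0 => h1 h2; rewrite expnS; case e: (up_log 2 n.+2) h1 h2 => [|m] /= h1 h2.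
  by move: h2; rewrite expn0.
by move: h1 h2; rewrite !expnS; case: b {h} => /=; lia.
Qed.

(** [bits] is given by divisions by powers of 2 and [up_log]; this recursion on the lowest digit is
    the form that is used from here on. *)
Lemma bitsE (b : bool) n : bits (b + n.*2) =
  if (b + n.*2 == 0) then [::] else b :: bits n.
Proof.
case: eqP => [->|/eqP]; first exact: bits0.
rewrite -lt0n => h; rewrite /bits up_log_double // /mkseq /= expn0 divn1 oddD odd_double addbF.
congr (_ :: _); first by case: b {h}.
rewrite -[iota 1 _]/(iota (1 + 0) _) iotaDl -map_comp; apply: eq_map => i /=.
by rewrite add1n expnS divnMA divn2 halfD odd_double andbF add0n doubleK; case: b {h}.
Qed.

Fixpoint norm (s : seq bool) : seq bool :=
  if s is b :: s' then let t := norm s' in if ~~ b && nilp t then [::] else b :: t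
  else [::].

Lemma bits_eq0 n : nilp (bits n) = (n == 0).
Proof.
case: n => [|n]; first by rewrite bits0.
by rewrite -(odd_double_half n.+1) bitsE; case: (_ == 0).
Qed.

Lemma normE s : norm s = bits (bval s).
Proof.
elim: s => [|b s IH] //=; rewrite bitsE IH bits_eq0.
by case: b => //=; rewrite add0n double_eq0; case: eqP.
Qed.

Lemma bitsK n : bval (bits n) = n.
Proof.
have [m] := ubnP n; elim: m n => // m IH n.
rewrite -(odd_double_half n) bitsE; case: eqP => [-> //|h] /= le.
by rewrite IH //; move: h le; case: (odd n) => /=; lia.
Qed.

Lemma size_bits n k : (size (bits n) <= k) = (n < 2 ^ k).
Proof.
rewrite size_mkseq; apply/idP/idP => h; last exact: up_log_min.
by have := @up_logP 2 n.+1 isT; move/leq_trans; apply; rewrite leq_exp2l.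
Qed.

Canonical nat_enc := EncType (fun n : nat => encode (bits n)).

Lemma sz_bits (s : seq bool) : 2 * size s + 1 <= sz s <= 4 * size s + 1.
Proof. by elim: s => // b s IH; rewrite sz_cons /=; case: b; [have : sz true = 3 by []|have : sz false = 1 by []]; lia. Qed.

Lemma ltn_sz (n : nat) : n < 2 ^ sz n.
Proof.
rewrite -size_bits; have := sz_bits (bits n).
by rewrite -[sz (bits n)]/(sz n); lia.
Qed.

Lemma sz_nat_le (n k : nat) : n < 2 ^ k -> sz n <= 4 * k + 1.
Proof.
rewrite -size_bits => h; have := sz_bits (bits n).
by rewrite -[sz (bits n)]/(sz n); lia.
Qed.

Lemma sz_nat_mono (m n : nat) : m <= n -> sz m <= 4 * sz n + 1.
Proof. by move=> h; apply: sz_nat_le; apply: leq_ltn_trans h (ltn_sz n). Qed.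

Lemma PT_norm (X : encType) (f : X -> seq bool) : PT f -> PT (fun x => norm (f x)).
Proof.
move=> h; pose op (x : X) (acc : seq bool) (b : bool) := if ~~ b && nilp acc then [::] else b :: acc.
have E x s t : foldl (op x) (norm t) (rev s) = norm (s ++ t).
  by elim: s t => //= b s IH t; rewrite rev_cons -cats1 foldl_cat IH.
have hl s : sz (norm s) <= sz s.
  by elim: s => //= b s IH; case: ifP => _; [exact: (sz_gt0 (b :: s))|rewrite !sz_cons; lia].
have hf : PT (fun x => foldl (op x) [::] (rev (f x))).
  apply: (@PT_foldl _ _ _ op (fun=> [::]) (fun x => rev (f x)) (fun x => sz (f x))).
  - have h1 : PT (fun p : X * (seq bool * bool) => p.2.1) by exact/PT_fst/PT_snd/PT_id.
    have h2 : PT (fun p : X * (seq bool * bool) => p.2.2) by exact/PT_snd/PT_snd/PT_id.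
    exact: PT_if (PT_andb (PT_negb h2) (PT_nilp h1)) (PT_cst _ _) (PT_cons h2 h1).
  - exact: PT_cst.
  - exact: PT_rev.
  - by pbdt.
  - move=> x n; rewrite take_rev (E x _ [::]) cats0; apply: leq_trans (hl _) (sz_drop _ _).
by apply: PT_ext hf => x; rewrite (E x _ [::]) cats0.
Qed.

Lemma PT_nat (X : encType) (f : X -> seq bool) (g : X -> nat) :
  PT f -> (forall x, bval (f x) = g x) -> PT g.
Proof.
by move=> h e; apply: PT_recast (PT_norm h) => x /=; rewrite normE e.
Qed.

Lemma PT_bits (X : encType) (g : X -> nat) : PT g -> PT (fun x => bits (g x)).
Proof. by apply: PT_recast. Qed.

Section Ripple.
Variable neg : bool.
(** One digit of an adder, or of a subtracter if [neg]: the carry is the majority of the three bits,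
    the borrow is the same with [b1] complemented. *)
Definition rip (s : seq bool * (bool * seq bool)) (b1 : bool) : seq bool * (bool * seq bool) :=
  let b2 := head false s.1 in let c := s.2.1 in let a := b1 (+) neg in
  (behead s.1, ((a && b2) || (a && c) || (b2 && c), (b1 (+) b2 (+) c) :: s.2.2)).

Definition sg : int := (if neg then -1 else 1)%R.

Lemma ripE s1 s2 c out : (size s2 <= size s1)%N ->
  let r := foldl rip (s2, (c, out)) s1 in
  size r.2.2 = (size out + size s1)%N /\
  ((bval (rev r.2.2))%:Z + (2 ^ size r.2.2)%:Z * sg * (nat_of_bool r.2.1)%:Z =
  (bval (rev out))%:Z + (2 ^ size out)%:Z * ((bval s1)%:Z + sg * ((bval s2)%:Z + (nat_of_bool c)%:Z)))%R.
Proof.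
have bvr t (b : bool) : bval (rev (b :: t)) = (bval (rev t) + b * 2 ^ size t)%N.
  rewrite rev_cons -(size_rev t); elim: (rev t) => [|b' u IH] /=; first by case: b.
  by rewrite IH expnS; lia.
elim: s1 s2 c out => [|b1 s1 IH] s2 c out /=.
  by case: s2 => // _; split; rewrite ?addn0 //= add0r mulrA; lia.
move=> hs; pose b2 := head false s2; have e2 : bval s2 = (b2 + (bval (behead s2)).*2)%N.
  by rewrite /b2; case: (s2).
have hs' : (size (behead s2) <= size s1)%N by rewrite size_behead; lia.
have [-> ->] := IH (behead s2) ((b1 (+) neg) && b2 || (b1 (+) neg) && c || b2 && c) ((b1 (+) b2 (+) c) :: out) hs'.
split; first by rewrite /= addSnnS.
rewrite bvr e2 /sg /= expnS -!muln2 !PoszD !PoszM.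
set P := (2 ^ size out)%:Z%R; set A := bval s1; set B := bval (behead s2).
by case: neg; case: b1; case: b2 {e2}; case: c => /=; ring.
Qed.
End Ripple.

(** The zeros appended to [s1] make it outlast [s2], with one more digit for the final carry. *)
Definition ripple neg s1 s2 :=
  foldl (rip neg) (s2, (false, [::])) (s1 ++ nseq (size s2).+1 false).

Lemma rippleE neg s1 s2 (r := ripple neg s1 s2) :
  ((bval (rev r.2.2))%:Z + (2 ^ (size s1 + size s2).+1)%:Z * sg neg * (nat_of_bool r.2.1)%:Z
   = (bval s1)%:Z + sg neg * (bval s2)%:Z)%R.
Proof.
have [] := @ripE neg (s1 ++ nseq (size s2).+1 false) s2 false [::].
  by rewrite size_cat size_nseq; lia.
rewrite -/(ripple neg s1 s2) -/r => -> /=.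
rewrite size_cat /= size_nseq addnS add0n expn0 !mul1r addr0 add0r => ->.
have -> : bval (s1 ++ nseq (size s2).+1 false) = bval s1.
  elim: s1 {r} => [|b s IH] /=; last by rewrite IH.
  by rewrite (_ : bval (nseq _ _) = 0) //; elim: (size s2) => //= n ->.
by [].
Qed.

Lemma bval_lt s : bval s < 2 ^ size s.
Proof. by elim: s => //= b s IH; rewrite expnS; case: b => /=; lia. Qed.

Lemma PT_ripple (X : encType) neg (f g : X -> seq bool) : PT f -> PT g ->
  PT (fun x => ripple neg (f x) (g x)).
Proof.
move=> hf hg; pose op (x : X) := rip neg.
have hs (s : seq bool) r : size (foldl (rip neg) r s).1 <= size r.1 /\
    size (foldl (rip neg) r s).2.2 = size r.2.2 + size s.
  elim: s r => [|b s IH] r /=; first by rewrite addn0.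
  have [h1 h2] := IH (rip neg r b).
  split; first by apply: leq_trans h1 _; rewrite /= size_behead leq_pred.
  by rewrite h2 /= addSnnS.
have sb (s : seq bool) := sz_bits s.
apply: (@PT_foldl _ _ _ op (fun x => (g x, (false, [::])))
  (fun x => f x ++ nseq (size (g x)).+1 false)
  (fun x => 20 * (sz (f x) + sz (g x)) + 20)).
- set S := (X * (seq bool * (bool * seq bool) * bool))%type.
  have h1 : PT (fun p : S => p.2.1.1) by exact/PT_fst/PT_fst/PT_snd/PT_id.
  have h2 : PT (fun p : S => p.2.1.2.1) by exact/PT_fst/PT_snd/PT_fst/PT_snd/PT_id.
  have h3 : PT (fun p : S => p.2.1.2.2) by exact/PT_snd/PT_snd/PT_fst/PT_snd/PT_id.
  have h4 : PT (fun p : S => p.2.2) by exact/PT_snd/PT_snd/PT_id.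
  have h5 : PT (fun p : S => head false p.2.1.1) by exact/PT_head.
  have h6 : PT (fun p : S => p.2.2 (+) neg) by apply: PT_addb => //; exact: PT_cst.
  apply: PT_pair; first exact: PT_behead.
  apply: PT_pair; last by apply: PT_cons => //; apply: PT_addb => //; apply: PT_addb.
  by apply: PT_orb; [apply: PT_orb|]; apply: PT_andb.
- by apply: PT_pair => //; apply: PT_pair; exact: PT_cst.
- apply: PT_cat => //; have := PT_cons (PT_cst X false) (PT_map (F := fun _ _ => false) (PT_cst _ false) hg).
  by apply: PT_ext => x; rewrite /=; congr (_ :: _); elim: (g x) => //= ? ? ->.
- by pbdt.
- move=> x n; set s := take _ _; have /= [h1 h2] := hs s (g x, (false, [::])).
  rewrite /op; move: h1 h2; case: (foldl _ _ s) => t [c out] /= h1 h2; rewrite !sz_pair.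
  have h3 : size s <= size (f x) + (size (g x)).+1.
    by rewrite size_take_min geq_min size_cat size_nseq leqnn orbT.
  have h4 : sz c <= 3 by case: (c).
  have /andP[_ h5] := sb t; have /andP[_ h6] := sb out.
  have /andP[h7 _] := sb (f x); have /andP[h8 _] := sb (g x).
  by move: h1 h2 h3 h4 h5 h6 h7 h8; rewrite /=; lia.
Qed.

(** The digits written form a nonnegative number below the weight of the borrow, so the borrow
    records the sign of the difference. *)
Lemma ripple_neg s1 s2 : (ripple true s1 s2).2.1 = (bval s1 < bval s2).
Proof.
have := rippleE true s1 s2; rewrite /sg.
set r := ripple _ _ _; have h1 := bval_lt s1; have h2 := bval_lt s2.
have h : 2 ^ size s1 + 2 ^ size s2 <= 2 ^ (size s1 + size s2).+1.
  rewrite expnS mul2n -addnn; apply: leq_add; rewrite leq_exp2l //; lia.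
have h3 : bval (rev r.2.2) < 2 ^ (size s1 + size s2).+1.
  apply: leq_trans (bval_lt _) _; rewrite size_rev.
  have [] := @ripE true (s1 ++ nseq (size s2).+1 false) s2 false [::].
    by rewrite size_cat size_nseq; lia.
  by rewrite -/(ripple true s1 s2) -/r => -> _; rewrite /= size_cat /= size_nseq addnS.
by case: (r.2.1) => /= e; apply/esym; [apply/idP|apply/negbTE; rewrite -leqNgt]; lia.
Qed.

Section NatOps.
Variable X : encType.
Variables f g : X -> nat.
Hypotheses (hf : PT f) (hg : PT g).

Lemma PT_addn : PT (fun x => f x + g x).
Proof.
have h := PT_rev (PT_snd (PT_snd (PT_ripple false (PT_bits hf) (PT_bits hg)))).
apply: (PT_nat h) => x; have := rippleE false (bits (f x)) (bits (g x)).
rewrite !bitsK /sg; set r := ripple _ _ _.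
have h1 := bval_lt (bits (f x)); have h2 := bval_lt (bits (g x)); rewrite !bitsK in h1 h2.
set s1 := size _ in h1 *; set s2 := size _ in h2 *.
have : 2 ^ s1 + 2 ^ s2 <= 2 ^ (s1 + s2).+1.
  rewrite expnS mul2n -addnn; apply: leq_add; rewrite leq_exp2l //; lia.
by case: (r.2.1) => /=; lia.
Qed.

Lemma PT_ltn : PT (fun x => f x < g x).
Proof.
have := PT_fst (PT_snd (PT_ripple true (PT_bits hf) (PT_bits hg))).
by apply: PT_ext => x; rewrite ripple_neg !bitsK.
Qed.

Lemma PT_subn : PT (fun x => f x - g x).
Proof.
have h := PT_rev (PT_snd (PT_snd (PT_ripple true (PT_bits hf) (PT_bits hg)))).
apply: (PT_nat (PT_if PT_ltn (PT_cst _ [::]) h)) => x.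
have := ripple_neg (bits (f x)) (bits (g x)).
have := rippleE true (bits (f x)) (bits (g x)); rewrite !bitsK /sg; set r := ripple _ _ _.
by case: ltnP => hh; case: (r.2.1) => //=; lia.
Qed.

Lemma PT_bcons (b : X -> bool) : PT b -> PT (fun x => b x + (f x).*2).
Proof. by move=> hb; apply: (PT_nat (PT_cons hb (PT_bits hf))) => x /=; rewrite bitsK. Qed.

End NatOps.

Lemma PT_leq (X : encType) (f g : X -> nat) : PT f -> PT g -> PT (fun x => f x <= g x).
Proof.
by move=> hf hg; apply: PT_ext (PT_negb (PT_ltn hg hf)) => x; rewrite -leqNgt.
Qed.

Lemma PT_eqn (X : encType) (f g : X -> nat) : PT f -> PT g -> PT (fun x => f x == g x).
Proof.
move=> hf hg; apply: PT_ext (PT_andb (PT_leq hf hg) (PT_leq hg hf)) => x.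
by rewrite eqn_leq.
Qed.

Lemma bval_cat s t : bval (s ++ t) = bval s + 2 ^ size s * bval t.
Proof. by elim: s => [|b s IH] /=; rewrite ?mul1n // IH expnS; lia. Qed.

(* Horner evaluation: processing the digits of [n] from the most significant one
   visits exactly the values of its prefixes. *)
Lemma foldl_bits (S : Type) (op : S -> bool -> S) (i : S) (F : nat -> S) n :
  F 0 = i -> (forall m (b : bool), b + m.*2 <= n -> op (F m) b = F (b + m.*2)) ->
  forall k, exists2 m, m <= n & foldl op i (take k (rev (bits n))) = F m.
Proof.
move=> h0 hS k; rewrite take_rev; set s := drop _ _.
have le : bval s <= n.
  rewrite -[X in _ <= X](bitsK n) -(cat_take_drop (size (bits n) - k) (bits n)) bval_cat.
  by rewrite -/s; have := expn_gt0 2 (size (take (size (bits n) - k) (bits n))); nia.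
exists (bval s) => //; elim: s le => [|b s IH] //= le.
by rewrite rev_cons -cats1 foldl_cat /= IH ?hS //; move: le; lia.
Qed.

Lemma foldl_bits_all (S : Type) (op : S -> bool -> S) (i : S) (F : nat -> S) n :
  F 0 = i -> (forall m (b : bool), b + m.*2 <= n -> op (F m) b = F (b + m.*2)) ->
  foldl op i (rev (bits n)) = F n.
Proof.
move=> h0 hS; rewrite -{2}(bitsK n); set s := bits n.
have : bval s <= n by rewrite bitsK.
elim: s => [|b s IH] //= le.
by rewrite rev_cons -cats1 foldl_cat /= IH ?hS //; move: le; lia.
Qed.

(** Double-and-add. The intermediate values are multiples of [g x] by prefixes of [f x], hence never
    exceed the product. *)
Lemma PT_muln (X : encType) (f g : X -> nat) : PT f -> PT g -> PT (fun x => f x * g x).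
Proof.
move=> hf hg; pose op (x : X) (a : nat) (b : bool) := a + a + (if b then g x else 0).
have hop x m (b : bool) : b + m.*2 <= f x -> op x (m * g x) b = (b + m.*2) * g x.
  by move=> _; rewrite /op; case: b; lia.
have h : PT (fun x => foldl (op x) 0 (rev (bits (f x)))).
  apply: (@PT_foldl _ _ _ op (fun=> 0) (fun x => rev (bits (f x)))
           (fun x => 4 * (sz (f x) + sz (g x)) + 1)).
  - have h1 : PT (fun p : X * (nat * bool) => p.2.1) by exact/PT_fst/PT_snd/PT_id.
    have h2 : PT (fun p : X * (nat * bool) => p.2.2) by exact/PT_snd/PT_snd/PT_id.
    apply: PT_addn; first exact: PT_addn.
    by apply: PT_if => //; [exact: (PT_comp (PT_fst (PT_id _)) hg)|exact: PT_cst].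
  - exact: PT_cst.
  - exact/PT_rev/PT_bits.
  - by pbdt.
  - move=> x k; have [m le ->] := @foldl_bits _ (op x) 0 (fun m => m * g x) _ erefl (hop x) k.
    apply: sz_nat_le; rewrite expnD; have := ltn_sz (f x); have := ltn_sz (g x).
    by move=> ? ?; apply: leq_ltn_trans (_ : f x * g x < _); [rewrite leq_mul2r le orbT|apply: ltn_mul].
by apply: PT_ext h => x; apply: (@foldl_bits_all _ (op x) 0 (fun m => m * g x)) => //; apply: hop.
Qed.

(** Long division: the state is the quotient and the remainder of the prefix read so far. *)
Lemma PT_divn (X : encType) (f g : X -> nat) : PT f -> PT g -> PT (fun x => f x %/ g x).
Proof.
move=> hf hg; pose op (x : X) (a : nat * nat) (b : bool) :=
  let r := b + a.2.*2 in
  if g x <= r then (true + a.1.*2, r - g x) else (false + a.1.*2, r).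
have hop x m (b : bool) : 0 < g x -> b + m.*2 <= f x ->
    op x (m %/ g x, m %% g x) b = ((b + m.*2) %/ g x, (b + m.*2) %% g x).
  move=> h _; rewrite /op /=; have hm := ltn_pmod m h.
  have e : b + m.*2 = ((m %/ g x).*2 * g x + (b + (m %% g x).*2))%N.
    by rewrite {1}(divn_eq m (g x)); lia.
  case: ifP => h1; rewrite e.
    rewrite [X in (X %/ _, X %% _)](_ : _ = ((m %/ g x).*2.+1 * g x + (b + (m %% g x).*2 - g x))%N); last by lia.
    have h2 : b + (m %% g x).*2 - g x < g x by case: (b) h1; lia.
    by rewrite divnMDl // modnMDl (divn_small h2) (modn_small h2) addn0.
  have h2 : b + (m %% g x).*2 < g x by rewrite ltnNge h1.
  by rewrite divnMDl // modnMDl (divn_small h2) (modn_small h2) addn0.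
(* The invariant needs a positive divisor, so the fold is given nothing to do when [g x] is 0. *)
pose l x := if g x == 0 then [::] else rev (bits (f x)).
have h : PT (fun x => if g x == 0 then (0, 0) else foldl (op x) (0, 0) (l x)).
  have h0 : PT (fun x => g x == 0) by apply: PT_eqn => //; exact: PT_cst.
  apply: PT_if => //; first exact: PT_cst.
  apply: (@PT_foldl _ _ _ op (fun=> (0, 0)) l (fun x => 10 * sz (f x) + 10)).
  - set S := (X * (nat * nat * bool))%type.
    have h1 : PT (fun p : S => p.2.1.1) by exact/PT_fst/PT_fst/PT_snd/PT_id.
    have h2 : PT (fun p : S => p.2.1.2) by exact/PT_snd/PT_fst/PT_snd/PT_id.
    have h3 : PT (fun p : S => p.2.2) by exact/PT_snd/PT_snd/PT_id.
    have h4 : PT (fun p : S => g p.1) by exact: (PT_comp (PT_fst (PT_id _)) hg).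
    have h5 := PT_bcons h2 h3; apply: PT_if; first exact: PT_leq.
      by apply: PT_pair; [apply: (PT_bcons h1); exact: PT_cst|apply: PT_subn].
    by apply: PT_pair => //; apply: (PT_bcons h1); exact: PT_cst.
  - exact: PT_cst.
  - by apply: PT_if => //; [exact: PT_cst|exact/PT_rev/PT_bits].
  - by pbdt.
  - move=> x k; rewrite /l; have [e|g0] := posnP (g x); first by rewrite /= sz_pair; have : sz 0 = 1 by []; lia.
    rewrite /=.
    have [||m le ->] := @foldl_bits _ (op x) (0, 0) (fun m => (m %/ g x, m %% g x)) (f x) _ _ k.
    - by rewrite div0n mod0n.
    - by move=> m b; apply: hop.
    have h1 := sz_nat_mono (leq_trans (leq_div m (g x)) le).
    by have h2 := sz_nat_mono (leq_trans (leq_mod m (g x)) le); rewrite sz_pair; lia.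
apply: PT_ext (PT_fst h) => x; rewrite /l; case: eqP => [->|/eqP g0]; first by rewrite divn0.
rewrite (@foldl_bits_all _ (op x) (0, 0) (fun m => (m %/ g x, m %% g x))) //.
  by rewrite div0n mod0n.
by move=> m b; apply: hop; rewrite lt0n.
Qed.

(** * Integers and integer matrices *)

Canonical int_enc := EncType (fun z : int => encode ((z < 0)%R, absz z)).

Lemma sz_int (z : int) : sz z <= sz (absz z) + 4.
Proof. by rewrite /sz /= tsizeN -/(sz _); case: (z < 0)%R; [have : sz true = 3 by []|have : sz false = 1 by []]; lia. Qed.

Lemma sz_absz (z : int) : sz (absz z) <= sz z.
Proof.
have -> : sz z = (sz (z < 0)%R + sz (absz z)).+1 by rewrite /sz /= tsizeN.
by lia.
Qed.

Lemma PT_mkint (X : encType) (s : X -> bool) (n : X -> nat) : PT s -> PT n ->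
  PT (fun x => if s x then - (n x)%:Z else (n x)%:Z)%R.
Proof.
(* Zero has a single encoding, with sign [false], whatever [s x] is. *)
move=> hs hn; have h0 := PT_negb (PT_eqn hn (PT_cst _ 0)).
apply: PT_recast (PT_pair (PT_andb hs h0) hn) => x.
rewrite [LHS]/= [RHS]/= -!/(encode _); case: (s x) => /=.
  by rewrite oppr_lt0 abszN absz_nat ltz_nat lt0n.
by [].
Qed.

Section IntOps.
Variable X : encType.
Variables f g : X -> int.
Hypotheses (hf : PT f) (hg : PT g).
Local Open Scope ring_scope.

Lemma PT_absz : PT (fun x => absz (f x)).
Proof. by apply: (PT_snd (f := fun x => (f x < 0, absz (f x)))); apply: PT_recast hf. Qed.

Lemma PT_ltz0 : PT (fun x => f x < 0).
Proof. by apply: (PT_fst (f := fun x => (f x < 0, absz (f x)))); apply: PT_recast hf. Qed.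

Lemma PT_oppz : PT (fun x => - f x).
Proof.
apply: PT_ext (PT_mkint (PT_negb PT_ltz0) PT_absz) => x.
by case: (ltP (f x) 0) => /= h; lia.
Qed.
End IntOps.

Section IntOps2.
Variable X : encType.
Variables f g : X -> int.
Hypotheses (hf : PT f) (hg : PT g).
Local Open Scope ring_scope.

Lemma PT_addz : PT (fun x => f x + g x).
Proof.
have sf := PT_ltz0 hf; have sg0 := PT_ltz0 hg.
have af := PT_absz hf; have ag := PT_absz hg.
have h := PT_if (PT_addb sf sg0)
  (PT_if (PT_leq ag af) (PT_mkint sf (PT_subn af ag)) (PT_mkint sg0 (PT_subn ag af)))
  (PT_mkint sf (PT_addn af ag)).
by apply: PT_ext h => x; case: (ltP (f x) 0) => h1; case: (ltP (g x) 0) => h2 /=;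
   try (case: leqP => h3); lia.
Qed.

Lemma PT_mulz : PT (fun x => f x * g x).
Proof.
have h := PT_mkint (PT_addb (PT_ltz0 hf) (PT_ltz0 hg)) (PT_muln (PT_absz hf) (PT_absz hg)).
apply: PT_ext h => x; rewrite PoszM !abszE.
by case: (ltP (f x) 0) => h1; case: (ltP (g x) 0) => h2 /=;
   rewrite ?(ltr0_norm h1) ?(ger0_norm h1) ?(ltr0_norm h2) ?(ger0_norm h2); ring.
Qed.

Lemma PT_posz (n : X -> nat) : PT n -> PT (fun x => (n x)%:Z).
Proof. by move=> hn; apply: PT_ext (PT_mkint (PT_cst _ false) hn). Qed.

End IntOps2.

Lemma PT_subz (X : encType) (f g : X -> int) : PT f -> PT g -> PT (fun x => f x - g x)%R.
Proof. by move=> hf hg; apply: PT_addz => //; apply: PT_oppz. Qed.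

Lemma PT_ltz (X : encType) (f g : X -> int) : PT f -> PT g -> PT (fun x => f x < g x)%R.
Proof.
by move=> hf hg; apply: PT_ext (PT_ltz0 (PT_subz hf hg)) => x; rewrite subr_lt0.
Qed.

Lemma PT_lez (X : encType) (f g : X -> int) : PT f -> PT g -> PT (fun x => f x <= g x)%R.
Proof. by move=> hf hg; apply: PT_ext (PT_negb (PT_ltz hg hf)) => x; rewrite -leNgt. Qed.

Lemma PT_eqz (X : encType) (f g : X -> int) : PT f -> PT g -> PT (fun x => f x == g x)%R.
Proof.
by move=> hf hg; apply: PT_ext (PT_andb (PT_lez hf hg) (PT_lez hg hf)) => x; rewrite eq_le.
Qed.

Lemma PT_divz (X : encType) (f g : X -> int) : PT f -> PT g ->
  PT (fun x => if (0 < g x)%R then (f x %/ g x)%Z else 0%R).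
Proof.
move=> hf hg; have af := PT_absz hf; have ag := PT_absz hg.
(* Rounding goes towards minus infinity: for negative [f] the quotient is
   [- ((|f| - 1) %/ g + 1)]. *)
have h := PT_if (PT_ltz (PT_cst _ (0%R : int)) hg)
  (PT_if (PT_ltz0 hf)
     (PT_mkint (PT_cst _ true) (PT_addn (PT_divn (PT_subn af (PT_cst _ 1)) ag) (PT_cst _ 1)))
     (PT_mkint (PT_cst _ false) (PT_divn af ag))) (PT_cst _ (0%R : int)).
apply: PT_ext h => x; case: ifP => // g0; case: ifP => f0.
  case: (f x) f0 => // n _; rewrite -[g x]gez0_abs ?ltW // /absz subn1 /=.
  by rewrite divNz_nat ?addn1 // -ltz_nat gez0_abs ?ltW.
move/negbT: f0; rewrite -leNgt => f0; rewrite -divz_nat !gez0_abs // ltW //.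
Qed.

Canonical mx_enc m n := EncType (fun A : 'M[int]_(m, n) => encode (entries A)).

Lemma entriesE m n (A : 'M[int]_(m, n)) :
  entries A = [seq A ij.1 ij.2 | ij <- [seq (i, j) | i <- enum 'I_m, j <- enum 'I_n]].
Proof. by rewrite /entries map_allpairs. Qed.

Lemma PT_mxE (X : encType) m n (A : X -> 'M[int]_(m, n)) i j : PT A -> PT (fun x => A x i j).
Proof.
move=> h; have h' : PT (fun x => entries (A x)) by apply: PT_recast h.
pose s := [seq (i, j) | i <- enum 'I_m, j <- enum 'I_n].
have := PT_nth (0%R : int) (index (i, j) s) h'; apply: PT_ext => x.
rewrite entriesE; have hin : (i, j) \in s by apply/allpairsP; exists (i, j); rewrite !mem_enum.
by rewrite (nth_map (i, j)) ?index_mem // nth_index.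
Qed.

Lemma PT_mx (X : encType) m n (A : X -> 'M[int]_(m, n)) :
  (forall i j, PT (fun x => A x i j)) -> PT A.
Proof.
move=> h; pose s := [seq (i, j) | i <- enum 'I_m, j <- enum 'I_n].
have := @PT_mapc X _ _ (fun x ij => A x ij.1 ij.2) s (fun ij => h ij.1 ij.2).
by apply: PT_recast => x /=; rewrite entriesE.
Qed.

Lemma PT_sumz (X : encType) (T : Type) (F : X -> T -> int) (P : X -> T -> bool) (s : seq T) :
  (forall t, PT (F^~ t)) -> (forall t, PT (P^~ t)) ->
  PT (fun x => \sum_(t <- s | P x t) F x t)%R.
Proof. by move=> hF hP; apply: PT_bigc => //; apply: PT_addz; [exact/PT_fst/PT_id|exact/PT_snd/PT_id]. Qed.

Lemma PT_prodz (X : encType) (T : Type) (F : X -> T -> int) (P : X -> T -> bool) (s : seq T) :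
  (forall t, PT (F^~ t)) -> (forall t, PT (P^~ t)) ->
  PT (fun x => \prod_(t <- s | P x t) F x t)%R.
Proof. by move=> hF hP; apply: PT_bigc => //; apply: PT_mulz; [exact/PT_fst/PT_id|exact/PT_snd/PT_id]. Qed.

Lemma PT_expz (X : encType) (f : X -> int) k : PT f -> PT (fun x => f x ^+ k)%R.
Proof.
move=> h; elim: k => [|k IH]; first exact: PT_cst.
by apply: PT_ext (PT_mulz h IH) => x; rewrite exprS.
Qed.

Lemma PT_mulmx (X : encType) m n p (A : X -> 'M[int]_(m, n)) (B : X -> 'M[int]_(n, p)) :
  PT A -> PT B -> PT (fun x => A x *m B x)%R.
Proof.
move=> hA hB; apply: PT_mx => i j; have : PT (fun x => \sum_k A x i k * B x k j)%R.
  by apply: PT_sumz => [k|k]; [apply: PT_mulz; apply: PT_mxE|exact: PT_cst].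
by apply: PT_ext => x; rewrite mxE.
Qed.

Lemma PT_trmx (X : encType) m n (A : X -> 'M[int]_(m, n)) : PT A -> PT (fun x => (A x)^T)%R.
Proof.
by move=> hA; apply: PT_mx => i j; apply: PT_ext (PT_mxE j i hA) => x; rewrite mxE.
Qed.

(** The Leibniz sum has a fixed number of terms, since [n] is not part of the input. *)
Lemma PT_det (X : encType) n (A : X -> 'M[int]_n) : PT A -> PT (fun x => \det (A x))%R.
Proof.
move=> hA; apply: PT_sumz => s; last exact: PT_cst.
apply: PT_mulz; first exact: PT_cst.
by apply: PT_prodz => i; [apply: PT_mxE|exact: PT_cst].
Qed.

Lemma PT_adj (X : encType) n (A : X -> 'M[int]_n) : PT A -> PT (fun x => \adj (A x))%R.
Proof.
move=> hA; apply: PT_mx => i j; have : PT (fun x => cofactor (A x) j i).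
  apply: PT_mulz; first exact: PT_cst.
  apply: PT_det; apply: PT_mx => k l; have := PT_mxE (lift j k) (lift i l) hA.
  by apply: PT_ext => x; rewrite !mxE.
by apply: PT_ext => x; rewrite mxE.
Qed.

(** * Reduction of positive definite integral forms *)

Local Open Scope ring_scope.

Section QuadForms.
Implicit Types n : nat.

Definition bil n (S : 'M[rat]_n) (x y : 'rV[rat]_n) : rat := \sum_i \sum_j x 0 i * S i j * y 0 j.
Definition qf n (S : 'M[rat]_n) (x : 'rV[rat]_n) : rat := bil S x x.

Definition pd n (S : 'M[rat]_n) := S^T = S /\ forall x, x != 0 -> 0 < qf S x.

Lemma bilE n (S : 'M[rat]_n) x y : bil S x y = (x *m S *m y^T) 0 0.
Proof.
rewrite mxE /bil exchange_big; apply: eq_bigr => j _.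
by rewrite !mxE mulr_suml; apply: eq_bigr.
Qed.

Lemma qf_mul n m (S : 'M[rat]_n) (U : 'M[rat]_(m, n)) x :
  qf (U *m S *m U^T) x = qf S (x *m U).
Proof. by rewrite /qf !bilE trmx_mul !mulmxA. Qed.

Lemma qf_ge0 n (S : 'M[rat]_n) x : pd S -> 0 <= qf S x.
Proof.
move=> [_ h]; have [->|/h /ltW //] := eqVneq x 0.
by rewrite /qf /bil big1 // => i _; rewrite big1 // => j _; rewrite mxE !mul0r.
Qed.

Lemma pd_mul n (S U : 'M[rat]_n) : pd S -> U \in unitmx -> pd (U *m S *m U^T).
Proof.
move=> [h1 h2] hU; split; first by rewrite !trmx_mul trmxK h1 mulmxA.
move=> x x0; rewrite qf_mul; apply: h2; apply: contra x0 => /eqP h.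
by rewrite -(mulmxK hU x) h mul0mx.
Qed.

Lemma bilDl n (S : 'M[rat]_n) x y z : bil S (x + y) z = bil S x z + bil S y z.
Proof.
rewrite /bil -big_split; apply: eq_bigr => i _; rewrite -big_split.
by apply: eq_bigr => j _; rewrite !mxE /=; ring.
Qed.

Lemma bilDr n (S : 'M[rat]_n) x y z : bil S z (x + y) = bil S z x + bil S z y.
Proof.
rewrite /bil -big_split; apply: eq_bigr => i _; rewrite -big_split.
by apply: eq_bigr => j _; rewrite !mxE /=; ring.
Qed.

Lemma bilZl n (S : 'M[rat]_n) a x z : bil S (a *: x) z = a * bil S x z.
Proof.
rewrite /bil mulr_sumr; apply: eq_bigr => i _; rewrite mulr_sumr.
by apply: eq_bigr => j _; rewrite !mxE; ring.
Qed.

Lemma bilZr n (S : 'M[rat]_n) a x z : bil S z (a *: x) = a * bil S z x.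
Proof.
rewrite /bil mulr_sumr; apply: eq_bigr => i _; rewrite mulr_sumr.
by apply: eq_bigr => j _; rewrite !mxE; ring.
Qed.

Lemma qf_comb n (S : 'M[rat]_n) a u b w : qf S (a *: u + b *: w) =
  a * a * qf S u + a * b * (bil S u w + bil S w u) + b * b * qf S w.
Proof. by rewrite /qf !bilDl !bilDr !bilZl !bilZr; ring. Qed.

Lemma bil_delta n (S : 'M[rat]_n) i j : bil S (delta_mx 0 i) (delta_mx 0 j) = S i j.
Proof.
rewrite /bil (bigD1 i) //= (bigD1 j) //= !mxE !eqxx mul1r mulr1.
rewrite big1 ?addr0 => [|k ne]; last by rewrite !mxE eqxx /= (negPf ne) mulr0.
rewrite big1 ?addr0 // => k ne; rewrite big1 // => l _.
by rewrite mxE eqxx /= (negPf ne) !mul0r.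
Qed.

Lemma qf_delta n (S : 'M[rat]_n) i : qf S (delta_mx 0 i) = S i i.
Proof. exact: bil_delta. Qed.

Lemma delta_neq0 n (i : 'I_n) : delta_mx 0 i != 0 :> 'rV[rat]_n.
Proof. by apply/eqP => /rowP/(_ i); rewrite !mxE !eqxx => /eqP; rewrite oner_eq0. Qed.

Lemma pd_diag n (S : 'M[rat]_n) i : pd S -> 0 < S i i.
Proof. by move=> [_ h]; rewrite -qf_delta; apply/h/delta_neq0. Qed.

Lemma pd_sym n (S : 'M[rat]_n) i j : pd S -> S i j = S j i.
Proof. by move=> [h _]; rewrite -{1}h mxE. Qed.

(* The form obtained by projecting along the first basis vector. *)
Definition schur n (S : 'M[rat]_n.+1) : 'M[rat]_n :=
  let T : 'M[rat]_(1 + n) := S in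
  drsubmx T - (S 0 0)^-1 *: (dlsubmx T *m ursubmx T).

Lemma schurE n (S : 'M[rat]_n.+1) i j : schur S i j =
  S (lift ord0 i) (lift ord0 j) - S (lift ord0 i) 0 * S 0 (lift ord0 j) / S 0 0.
Proof.
rewrite !mxE big_ord1 !mxE !rshift1 (_ : lshift n 0 = 0); last exact: val_inj.
by rewrite [_^-1 * _]mulrC.
Qed.

Definition coef0 n (S : 'M[rat]_n.+1) (x' : 'rV[rat]_n) : rat :=
  (\sum_j x' 0 j * S 0 (lift ord0 j)) / S 0 0.

(** Completing the square in the first variable. *)
Lemma qf_recl n (S : 'M[rat]_n.+1) (x : 'rV[rat]_n.+1) (x' := \row_j x 0 (lift ord0 j)) : pd S ->
  qf S x = S 0 0 * (x 0 0 + coef0 S x') ^+ 2 + qf (schur S) x'.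
Proof.
move=> hS; have a0 := pd_diag ord0 hS; set a := S 0 0 in a0 *.
have an : a != 0 by rewrite gt_eqF.
pose A := \sum_j x' 0 j * S 0 (lift ord0 j).
have -> : qf (schur S) x' = \sum_i \sum_j x' 0 i * S (lift ord0 i) (lift ord0 j) * x' 0 j - A * A / a.
  rewrite /qf /bil mulr_suml mulr_suml -sumrB; apply: eq_bigr => i _.
  rewrite mulr_sumr mulr_suml -sumrB; apply: eq_bigr => j _.
  by rewrite schurE -/a (pd_sym _ 0 hS); field.
rewrite /qf /bil big_ord_recl big_ord_recl.
have -> : \sum_(i < n) x 0 0 * S 0 (lift ord0 i) * x 0 (lift ord0 i) = x 0 0 * A.
  by rewrite mulr_sumr; apply: eq_bigr => j _; rewrite mxE; ring.
have -> : \sum_(i < n) \sum_j x 0 (lift ord0 i) * S (lift ord0 i) j * x 0 j =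
  x 0 0 * A + \sum_i \sum_j x' 0 i * S (lift ord0 i) (lift ord0 j) * x' 0 j.
  rewrite mulr_sumr -big_split; apply: eq_bigr => i _; rewrite big_ord_recl !mxE.
  rewrite (pd_sym _ 0 hS); congr (_ + _); first by ring.
  by apply: eq_bigr => j _; rewrite mxE.
rewrite /coef0 -/A -/a; set Q := \sum_i _; field; exact: an.
Qed.

Definition cons_row n (a : rat) (x' : 'rV[rat]_n) : 'rV[rat]_n.+1 :=
  \row_i (if unlift ord0 i is Some j then x' 0 j else a).

Lemma cons_row0 n a (x' : 'rV[rat]_n) : cons_row a x' 0 0 = a.
Proof. by rewrite mxE unlift_none. Qed.

Lemma cons_rowS n a (x' : 'rV[rat]_n) : \row_j cons_row a x' 0 (lift ord0 j) = x'.
Proof. by apply/rowP => j; rewrite !mxE liftK. Qed.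

Lemma pd_schur n (S : 'M[rat]_n.+1) : pd S -> pd (schur S).
Proof.
move=> hS; split.
  apply/matrixP => i j; rewrite mxE !schurE (pd_sym (lift ord0 j) _ hS) (pd_sym (lift ord0 j) _ hS).
  by rewrite (pd_sym 0 (lift ord0 i) hS) [S _ 0 * _]mulrC.
move=> x' x0; pose x := cons_row (- coef0 S x') x'.
have := qf_recl x hS; rewrite cons_row0 cons_rowS addNr expr0n /= mulr0 add0r => <-.
apply: hS.2; apply: contra x0 => /eqP h; apply/eqP; rewrite -(cons_rowS (- coef0 S x') x') -/x h.
by apply/rowP => j; rewrite !mxE.
Qed.

Lemma det_schur n (S : 'M[rat]_n.+1) : S 0 0 != 0 -> \det S = S 0 0 * \det (schur S).
Proof.
move=> a0; set a := S 0 0 in a0 *; pose T : 'M[rat]_(1 + n) := S.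
have ul : ulsubmx T = a%:M.
  by apply/matrixP => i j; rewrite !mxE !ord1 /= (_ : lshift n 0 = 0) //; apply: val_inj.
have e : T = block_mx 1%:M 0 (a^-1 *: dlsubmx T) 1%:M *m block_mx (ulsubmx T) (ursubmx T) 0 (schur S).
  rewrite mulmx_block !mul1mx !mul0mx !addr0 ul -[LHS]submxK ul.
  congr block_mx.
    by rewrite mul_mx_scalar scalerA mulfV // scale1r.
  by rewrite /schur -/T -/a -scalemxAl addrC subrK.
have -> : \det S = \det T by [].
by rewrite e det_mulmx det_lblock det_ublock !det1 !mul1r ul det_scalar1.
Qed.

Lemma schur_scale n c (S : 'M[rat]_n.+1) : c != 0 -> schur (c *: S) = c *: schur S.
Proof.
move=> c0; apply/matrixP => i j; rewrite [RHS]mxE !schurE !mxE.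
have [->|h] := eqVneq (S 0 0) 0; first by rewrite mulr0 !invr0 !mulr0 !subr0.
by field; apply/andP.
Qed.

(** Change of basis fixing the first vector: [V] acts on the quotient, and [p] adds multiples of the
    first vector to the others. *)
Definition lowmx n (p : 'cV[rat]_n) (V : 'M[rat]_n) : 'M[rat]_n.+1 :=
  (block_mx 1%:M 0 p V : 'M[rat]_(1 + n)).

(** The projected form does not see the multiples of the first vector, so [p] disappears. Size
    reduction thus leaves an already reduced projection intact. *)
Lemma lowmx_act n (S : 'M[rat]_n.+1) p V (T := lowmx p V *m S *m (lowmx p V)^T) : S^T = S -> S 0 0 != 0 ->
  T 0 0 = S 0 0 /\ schur T = V *m schur S *m V^T.
Proof.
move=> hS a0; set a := S 0 0 in a0 *; pose S' : 'M[rat]_(1 + n) := S.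
have ul : ulsubmx S' = a%:M.
  by apply/matrixP => i j; rewrite !mxE !ord1 /= (_ : lshift n 0 = 0) //; apply: val_inj.
set s := ursubmx S'; set D := drsubmx S'.
have dl : dlsubmx S' = s^T by apply: trmx_inj; rewrite trmxK trmx_dlsub (_ : S'^T = S').
have eS : S' = block_mx a%:M s s^T D by rewrite -[LHS]submxK ul dl.
have eT : T = block_mx a%:M (a *: p^T + s *m V^T) (a *: p + V *m s^T)
   (a *: (p *m p^T) + V *m s^T *m p^T + (p *m s *m V^T + V *m D *m V^T)) :> 'M[rat]_(1 + n).
  pose P : 'M[rat]_(1 + n) := block_mx 1%:M 0 p V; have -> : T = P *m S' *m P^T by [].
  rewrite eS /P tr_block_mx !mulmx_block !trmx1 !trmx0 !mul1mx !mul0mx !addr0.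
  rewrite !mulmx1 !mulmx0 !addr0 !mul_scalar_mx mul_mx_scalar.
  by rewrite !mulmxDl -!scalemxAl.
have e00 : T 0 0 = a.
  have -> : T 0 0 = (T : 'M[rat]_(1 + n)) (lshift n 0) (lshift n 0).
    by rewrite (_ : lshift n 0 = 0) //; apply: val_inj.
  by rewrite eT block_mxEul mxE.
split=> //; rewrite /schur e00 -/a eT block_mxKdr block_mxKdl block_mxKur -/S' -/D dl -/s.
rewrite mulmxDl !mulmxDr -!scalemxAr -!scalemxAl !scalerDr !scalerA mulVf // !scale1r.
rewrite ?mulmxN ?mulNmx -?scalemxAr mulmxBl -?scalemxAl ?mulmxA.
move: (p *m p^T) (p *m s *m V^T) (V *m s^T *m p^T) (V *m s^T *m s *m V^T) (V *m D *m V^T).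
move=> A1 A2 A3 A4 A5; apply/matrixP => i j; rewrite !mxE; field.
by rewrite a0.
Qed.

(** The squared length of the last Gram-Schmidt vector; [gsum] below is the sum of all of them. *)
Fixpoint glast n : 'M[rat]_n.+1 -> rat :=
  if n is n'.+1 then fun S => glast (schur S) else fun S => S 0 0.

Fixpoint gsum n : 'M[rat]_n -> rat :=
  if n is n'.+1 then fun S => S 0 0 + gsum (schur S) else fun=> 0.

(** Reducedness in the sense of Lenstra, Lenstra and Lovasz: size reduction, and a Gram-Schmidt
    square at least half of the preceding one. The condition [val i = 0%N] makes the second clause
    empty in dimension one. *)
Fixpoint red n : 'M[rat]_n -> Prop :=
  if n is n'.+1 then fun S =>
    [/\ forall i : 'I_n', `|S 0 (lift ord0 i)| <= S 0 0 / 2,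
        forall i : 'I_n', val i = 0%N -> S 0 0 <= 2 * schur S i i
      & red (schur S)]
  else fun=> True.

Lemma red_scale n c (S : 'M[rat]_n) : 0 < c -> red S -> red (c *: S).
Proof.
elim: n S => // n IH S c0 [h1 h2 h3]; rewrite /= schur_scale ?gt_eqF //; split.
- by move=> i; rewrite !mxE normrM gtr0_norm // -mulrA ler_pM2l.
- by move=> i e; rewrite [X in _ <= 2 * X]mxE [X in X <= _]mxE [2 * _]mulrCA ler_pM2l // h2.
- exact: IH.
Qed.

Definition zrow n (z : 'rV[int]_n) : 'rV[rat]_n := map_mx intr z.

Lemma round_rat (x : rat) : exists z : int, `|x - z%:~R| <= 1 / 2.
Proof.
exists (Num.floor (x + 1 / 2)); have /andP[] := floor_itv (x + 1 / 2).
by rewrite intrD => h1 h2; rewrite ler_norml; apply/andP; split; lra.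
Qed.

Lemma qf_last n (S : 'M[rat]_n.+1) (x : 'rV[rat]_n.+1) : pd S ->
  glast S * (x 0 ord_max) ^+ 2 <= qf S x.
Proof.
elim: n S x => [|n IH] S x hS.
  rewrite /qf /bil big_ord1 big_ord1 /= (_ : ord_max = 0); last exact: val_inj.
  by rewrite le_eqVlt; apply/orP; left; apply/eqP; ring.
rewrite qf_recl //=; set y := \row_j _.
have -> : x 0 ord_max = y 0 ord_max.
  by rewrite mxE; congr (x 0 _); apply: val_inj.
apply: (le_trans (IH _ y (pd_schur hS))); rewrite lerDr mulr_ge0 ?sqr_ge0 //.
exact/ltW/pd_diag.
Qed.

Lemma glast_gt0 n (S : 'M[rat]_n.+1) : pd S -> 0 < glast S.
Proof. by elim: n S => [|n IH] S hS /=; [exact: pd_diag|exact/IH/pd_schur]. Qed.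

(** The Gram-Schmidt squares drop by a factor at most 2 at each step, so the last one controls them
    all. *)
Lemma red_glast n (S : 'M[rat]_n.+1) : pd S -> red S ->
  S 0 0 <= 2 ^+ n * glast S /\ gsum S <= 2 ^+ n.+1 * glast S.
Proof.
elim: n S => [|n IH] S hS; first by move=> _; rewrite /= expr0 expr1 addr0; have := pd_diag 0 hS; split; lra.
move=> [_ h2 /(IH _ (pd_schur hS))[h3 h4]].
have h1 : S 0 0 <= 2 ^+ n.+1 * glast (schur S).
  by apply: le_trans (h2 0 erefl) _; rewrite exprS -mulrA ler_pM2l.
split=> //; rewrite (_ : gsum S = S 0 0 + gsum (schur S)) // [glast S]/= [2 ^+ n.+2]exprS -mulrA.
by move: h1 h4; set u := 2 ^+ n.+1 * glast _; set v := gsum (schur S) => h1 h4; lra.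
Qed.

(** The determinant is the product of the Gram-Schmidt squares, each at least half of its
    predecessor; the exponent of 2 is generous. *)
Lemma red_det n (S : 'M[rat]_n.+1) : pd S -> red S ->
  S 0 0 ^+ n.+1 <= 2 ^+ (n.+1 * n.+1) * \det S.
Proof.
elim: n S => [|n IH] S hS.
  move=> _; rewrite expr1 muln1 expr1 (_ : \det S = S 0 0); last first.
    by rewrite [S]mx11_scalar det_scalar1 mxE eqxx.
  by have := pd_diag 0 hS; lra.
move=> [_ h2 hr]; have hs := pd_schur hS; have := IH _ hs hr.
have a0 := pd_diag 0 hS; have s0 := pd_diag 0 hs.
rewrite (det_schur (lt0r_neq0 a0)) => h.
rewrite exprS mulrCA ler_pM2l //.
apply: le_trans (_ : (2 * schur S 0 0) ^+ n.+1 <= _).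
  by rewrite ler_pXn2r ?nnegrE ?h2 //; [exact: ltW|rewrite mulr_ge0 // ltW].
rewrite exprMn (_ : (n.+2 * n.+2 = n.+1 + (n.+1 * n.+1 + n.+2))%N); last by lia.
rewrite exprD -mulrA ler_pM2l ?exprn_gt0 //; apply: le_trans h _.
rewrite exprD -mulrA ler_pM2l ?exprn_gt0 // ler_peMl ?exprn_ege1 //.
have := det_schur (lt0r_neq0 a0).
have : 0 < 2 ^+ (n.+1 * n.+1) * \det (schur S).
  by apply: lt_le_trans (IH _ hs hr); rewrite exprn_gt0.
by rewrite pmulr_rgt0 ?exprn_gt0 // => /ltW.
Qed.

Lemma red_diag n (S : 'M[rat]_n) i : pd S -> red S -> S i i <= gsum S.
Proof.
elim: n S i => [|n IH] S i hS; first by case: i.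
move=> [h1 _ hr]; have hs := pd_schur hS; have a0 := pd_diag 0 hS.
case: (unliftP ord0 i) => [j ->|->] /=; last first.
  rewrite lerDl; case: (n) S {IH h1 hS a0} hr hs => [|m] S hr hs //.
  have [_ h] := red_glast hs hr.
  have : 0 <= schur S 0 0 by exact/ltW/pd_diag.
  have hg : forall k (T : 'M[rat]_k), pd T -> 0 <= gsum T.
    by elim=> // k IHk T hT /=; rewrite addr_ge0 ?IHk //; [exact/ltW/pd_diag|exact: pd_schur].
  by move=> _; apply: hg.
have := IH _ j hs hr; rewrite schurE (pd_sym _ 0 hS) => h.
have hj : `|S 0 (lift ord0 j)| <= S 0 0 by have := h1 j; lra.
have h2 : S 0 (lift ord0 j) * S 0 (lift ord0 j) / S 0 0 <= S 0 0.
  by rewrite ler_pdivrMr // -!expr2 -[leLHS]real_normK ?num_real // ler_pXn2r ?nnegrE // ltW.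
by lra.
Qed.

(** Positivity at [y_i e_i - y_j e_j] bounds each pair of off-diagonal terms by the two diagonal
    ones. *)
Lemma qf_le_trace n (S : 'M[rat]_n) (y : 'rV[rat]_n) : pd S ->
  (forall i, `|y 0 i| <= 1 / 2) -> qf S y <= n%:R / 4 * \tr S.
Proof.
move=> hS hy.
have h i j : y 0 i * S i j * y 0 j + y 0 j * S j i * y 0 i <=
    y 0 i ^+ 2 * S i i + y 0 j ^+ 2 * S j j.
  have [->|ne] := eqVneq i j; first by rewrite le_eqVlt; apply/orP; left; apply/eqP; ring.
  have := qf_ge0 (y 0 i *: delta_mx 0 i + - y 0 j *: delta_mx 0 j) hS.
  by rewrite qf_comb !qf_delta !bil_delta; lra.
have := ler_sum (P := xpredT) (index_enum 'I_n) (fun i _ => ler_sum (P := xpredT) (index_enum 'I_n) (fun j _ => h i j)).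
under eq_bigr => i _ do rewrite big_split.
rewrite big_split /= [X in _ + X <= _]exchange_big /= -!/(bil S y y) -!/(qf S y).
under [X in _ <= X]eq_bigr => i _ do rewrite big_split sumr_const card_ord.
rewrite big_split /= sumr_const card_ord -sumrMnl.
set q := \sum_i y 0 i ^+ 2 * S i i; have -> : \sum_(i < n) y 0 i ^+ 2 * S i i *+ n = q *+ n by rewrite -sumrMnl.
have hq : q <= 1 / 4 * \tr S.
  rewrite /mxtrace mulr_sumr; apply: ler_sum => i _; rewrite ler_pM2r ?pd_diag //.
  rewrite (_ : 1 / 4 = (1 / 2) ^+ 2) // -[leLHS]real_normK ?num_real //.
  by rewrite ler_pXn2r ?nnegrE.
rewrite -[q *+ n]mulr_natr => h2; have : q * n%:R <= 1 / 4 * \tr S * n%:R by rewrite ler_wpM2r.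
by lra.
Qed.

Lemma bil_CS n (S : 'M[rat]_n) u w : pd S -> bil S u w ^+ 2 <= qf S u * qf S w.
Proof.
move=> hS; have [->|w0] := eqVneq w 0.
  rewrite /qf /bil; have z T : \sum_(i < n) \sum_j T i j * (0 : 'rV[rat]_n) 0 j = 0.
    by rewrite big1 // => i _; rewrite big1 // => j _; rewrite mxE mulr0.
  by rewrite !z mulr0 expr0n.
have qw := hS.2 _ w0.
have sym : bil S w u = bil S u w.
  rewrite /bil exchange_big; apply: eq_bigr => i _; apply: eq_bigr => j _.
  by rewrite (pd_sym _ _ hS); ring.
have := qf_ge0 (qf S w *: u + - bil S u w *: w) hS.
rewrite qf_comb sym (_ : _ + _ = qf S w * (qf S w * qf S u - bil S u w ^+ 2)); last by ring.
by rewrite pmulr_rge0 // subr_ge0 mulrC.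
Qed.

End QuadForms.

Definition qm m n (A : 'M[int]_(m, n)) : 'M[rat]_(m, n) := map_mx intr A.

Lemma qm_mul m n p (A : 'M[int]_(m, n)) (B : 'M[int]_(n, p)) : qm (A *m B) = qm A *m qm B.
Proof. exact: map_mxM. Qed.

Lemma qm_tr m n (A : 'M[int]_(m, n)) : qm A^T = (qm A)^T.
Proof. by rewrite /qm map_trmx. Qed.

Lemma qm_unit n (U : 'M[int]_n) : U \in unitmx -> qm U \in unitmx.
Proof. by rewrite !unitmxE det_map_mx => h; apply: rmorph_unit. Qed.

Lemma qmE m n (A : 'M[int]_(m, n)) i j : qm A i j = (A i j)%:~R.
Proof. by rewrite mxE. Qed.

(* [cob S U] is the form [S] in the basis given by the rows of [U]. *)
Definition cob n (S U : 'M[int]_n) := U *m S *m U^T.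

Lemma qm_cob n (S U : 'M[int]_n) : qm (cob S U) = qm U *m qm S *m (qm U)^T.
Proof. by rewrite !qm_mul qm_tr. Qed.

Lemma pd_cob n (S U : 'M[int]_n) : pd (qm S) -> U \in unitmx -> pd (qm (cob S U)).
Proof. by move=> hS hU; rewrite qm_cob; apply: pd_mul => //; apply: qm_unit. Qed.

Lemma cob_mul n (S U V : 'M[int]_n) : cob S (V *m U) = cob (cob S U) V.
Proof. by rewrite /cob trmx_mul !mulmxA. Qed.

Lemma mxtrace_qm n (S : 'M[int]_n) : \tr (qm S) = (\tr S)%:~R.
Proof. by rewrite /mxtrace rmorph_sum; apply: eq_bigr => i _; rewrite mxE. Qed.

Definition redC n := (n * n * 2 ^ n)%N.

(** Half of the last reduced vector has squared distance at least [glast / 4] from the lattice.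
    Rounding its coordinates in the original basis bounds this distance by the original trace, and
    [glast] controls the reduced one. This limits the growth of the forms during the recursion. *)
Lemma red_trace n (S U : 'M[int]_n) : pd (qm S) -> U \in unitmx ->
  red (qm (cob S U)) -> \tr (qm (cob S U)) <= (redC n)%:R * \tr (qm S).
Proof.
case: n S U => [|n] S U hS hU hr; first by rewrite /mxtrace !big_ord0 mulr0.
set T := qm (cob S U); have hT : pd T by exact: pd_cob.
have [_ h1] := red_glast hT hr.
have h2 : \tr T <= n.+1%:R * gsum T.
  rewrite /mxtrace; apply: (@le_trans _ _ (\sum_(i < n.+1) gsum T)).
    by apply: ler_sum => i _; apply: red_diag.
  by rewrite sumr_const card_ord mulr_natl.
have h3 : glast T <= n.+1%:R * \tr (qm S).
  pose e : 'rV[rat]_n.+1 := (1 / 2) *: delta_mx 0 ord_max.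
  pose p := e *m qm U; pose z : 'rV[int]_n.+1 := \row_i Num.floor (p 0 i + 1 / 2).
  have hz i : `|(p - zrow z) 0 i| <= 1 / 2.
    have -> : (p - zrow z) 0 i = p 0 i - (Num.floor (p 0 i + 1 / 2))%:~R.
      by move: (p) @z => q z; rewrite !mxE.
    have /andP[] := floor_itv (p 0 i + 1 / 2).
    by rewrite intrD => a b; rewrite ler_norml; apply/andP; split; lra.
  have := qf_le_trace hS hz.
  have -> : p - zrow z = (e - zrow (z *m invmx U)) *m qm U.
    by rewrite mulmxBl -/p; congr (_ - _); rewrite -[zrow _ *m _]qm_mul mulmxKV.
  rewrite -qf_mul -qm_cob -/T => h4.
  have := qf_last (e - zrow (z *m invmx U)) hT.
  set k := (z *m invmx U); rewrite [X in _ * X ^+ 2](_ : _ = 1 / 2 - (k 0 ord_max)%:~R); last first.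
    by rewrite !mxE !eqxx mulr1.
  have h5 : 1 / 4 <= (1 / 2 - (k 0 ord_max)%:~R) ^+ 2 :> rat.
    have [h|h] := lerP (k 0 ord_max) 0.
      have : (k 0 ord_max)%:~R <= 0 :> rat by rewrite lerz0.
      by nra.
    have : 1 <= (k 0 ord_max)%:~R :> rat by rewrite ler1z.
    by nra.
  have := glast_gt0 hT; set g := glast T; move=> g0 h6.
  have : g * (1 / 4) <= n.+1%:R / 4 * \tr (qm S).
    by apply: le_trans (le_trans h6 h4); rewrite ler_pM2l.
  by lra.
apply: le_trans h2 _; rewrite /redC !natrM natrX -!mulrA ler_pM2l //.
apply: le_trans h1 _; rewrite mulrCA ler_pM2l ?exprn_gt0 //.
Qed.

(** The projected form multiplied by [S 0 0], which clears its denominators; reducedness is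
    invariant under scaling. *)
Definition zschur n (S : 'M[int]_n.+1) : 'M[int]_n :=
  \matrix_(i, j) (S 0 0 * S (lift ord0 i) (lift ord0 j) - S (lift ord0 i) 0 * S 0 (lift ord0 j)).

Lemma zschurE n (S : 'M[int]_n.+1) : S 0 0 != 0 ->
  qm (zschur S) = (S 0 0)%:~R *: schur (qm S).
Proof.
move=> a0; apply/matrixP => i j; rewrite [RHS]mxE schurE !mxE intrB !intrM.
by field; rewrite intr_eq0.
Qed.

Definition zlow n (p : 'cV[int]_n) (V : 'M[int]_n) : 'M[int]_n.+1 :=
  (block_mx 1%:M 0 p V : 'M[int]_(1 + n)).

Lemma qm_zlow n (p : 'cV[int]_n) V : qm (zlow p V) = lowmx (qm p) (qm V).
Proof. by have := map_block_mx (intr : int -> rat) 1%:M 0 p V; rewrite map_mx1 map_mx0. Qed.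

Lemma zlow_unit n (p : 'cV[int]_n) V : V \in unitmx -> zlow p V \in unitmx.
Proof.
rewrite !unitmxE => h; rewrite (_ : \det (zlow p V) = \det V) //.
by rewrite /zlow -[LHS]/(\det (block_mx 1%:M 0 p V)) det_lblock det1 mul1r.
Qed.

Lemma zlow00 n (p : 'cV[int]_n) V : zlow p V 0 0 = 1.
Proof.
rewrite [LHS](_ : _ = (block_mx 1%:M 0 p V) (lshift n ord0) (lshift n ord0)).
  by rewrite block_mxEul mxE eqxx.
by congr (_ _ _); apply: val_inj.
Qed.

Lemma zlow0S n (p : 'cV[int]_n) V j : zlow p V 0 (lift ord0 j) = 0.
Proof.
rewrite [LHS](_ : _ = (block_mx 1%:M 0 p V) (lshift n ord0) (rshift 1 j)).
  by rewrite block_mxEur mxE.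
by rewrite rshift1; congr (_ _ _); apply: val_inj.
Qed.

Lemma zlowS0 n (p : 'cV[int]_n) V i : zlow p V (lift ord0 i) 0 = p i 0.
Proof.
rewrite [LHS](_ : _ = (block_mx 1%:M 0 p V) (rshift 1 i) (lshift n ord0)).
  by rewrite block_mxEdl.
by rewrite rshift1; congr (_ _ _); apply: val_inj.
Qed.

Lemma zlowSS n (p : 'cV[int]_n) V i j : zlow p V (lift ord0 i) (lift ord0 j) = V i j.
Proof.
rewrite [LHS](_ : _ = (block_mx 1%:M 0 p V) (rshift 1 i) (rshift 1 j)).
  by rewrite block_mxEdr.
by rewrite !rshift1.
Qed.

Definition rnd (a b : int) : int := if 0 < b * 2 then ((a * 2 + b) %/ (b * 2))%Z else 0.

Lemma rndP a b : 0 < b -> `|a%:~R - (rnd a b)%:~R * b%:~R| <= b%:~R / 2 :> rat.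
Proof.
move=> b0; rewrite /rnd ifT ?mulr_gt0 //.
have b2 : b * 2 != 0 by rewrite gt_eqF // mulr_gt0.
have := divz_eq (a * 2 + b) (b * 2); set q := (_ %/ _)%Z; set r := (_ %% _)%Z => e.
have r0 : 0 <= r by rewrite modz_ge0.
have r1 : r < b * 2 by apply: ltz_pmod; rewrite mulr_gt0.
have e' : a%:~R * 2 + b%:~R = q%:~R * (b%:~R * 2) + r%:~R :> rat.
  by have := congr1 (intr : int -> rat) e; rewrite !intrD !intrM.
have h1 : 0 <= r%:~R :> rat by rewrite ler0z.
have h2 : r%:~R <= b%:~R * 2 :> rat by rewrite -[2]/(2%:~R) -intrM ler_int ltW.
by rewrite ler_norml; apply/andP; split; lra.
Qed.

Definition swp n (i1 : 'I_n.+1) : 'M[int]_n.+1 := tperm_mx 0 i1.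

(** Reduce the projected lattice recursively, size-reduce against the first vector, then exchange
    the first two vectors if the Lovasz condition fails. The boolean of the state says that
    reduction is complete. *)
Definition rstep n (R : 'M[int]_n -> 'M[int]_n) (S : 'M[int]_n.+1)
    (st : bool * 'M[int]_n.+1) : bool * 'M[int]_n.+1 :=
  if st.1 then st else
  let U1 := zlow 0 (R (zschur (cob S st.2))) *m st.2 in
  let T1 := cob S U1 in
  let U2 := zlow (\col_i - rnd (T1 (lift ord0 i) 0) (T1 0 0)) 1%:M *m U1 in
  let T2 := cob S U2 in
  if 4 * T2 (inord 1) (inord 1) < 3 * T2 0 0 then (false, swp (inord 1) *m U2)
  else (true, U2).

Definition redspec n (R : 'M[int]_n -> 'M[int]_n) := forall S, pd (qm S) ->
  R S \in unitmx /\ red (qm (cob S (R S))).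

Definition rstepC n := (redC n + n.+2)%N.

Lemma int_pd_gt0 n (S : 'M[int]_n) i : pd (qm S) -> 0 < S i i.
Proof. by move=> /(pd_diag i); rewrite mxE ltr0z. Qed.

Lemma tr_ge0 n (S : 'M[rat]_n) : pd S -> 0 <= \tr S.
Proof. by move=> hS; apply: sumr_ge0 => i _; apply/ltW/pd_diag. Qed.

Lemma swp_unit n (i1 : 'I_n.+1) : swp i1 \in unitmx.
Proof. exact: unitmx_perm. Qed.

Lemma swp_cobE n (T : 'M[int]_n.+1) (i1 : 'I_n.+1) i j :
  cob T (swp i1) i j = T (tperm 0 i1 i) (tperm 0 i1 j).
Proof.
rewrite /cob /swp /tperm_mx -row_permE tr_perm_mx -col_permE !mxE.
by [].
Qed.

(** A step that does not finish lowers the first diagonal entry by a factor 3/4; meanwhile the trace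
    grows at most by a constant factor. *)
Lemma rstepP n (R : 'M[int]_n -> 'M[int]_n) S U (r := rstep R S (false, U)) :
  redspec R -> pd (qm S) -> U \in unitmx ->
  [/\ r.2 \in unitmx,
      \tr (qm (cob S r.2)) <= (rstepC n)%:R * \tr (qm (cob S U)),
      r.1 -> red (qm (cob S r.2))
    & ~~ r.1 -> 4 * cob S r.2 0 0 < 3 * cob S U 0 0].
Proof.
move=> hR hS hU; set T := cob S U; have hT : pd (qm T) by exact: pd_cob.
have a0 := int_pd_gt0 0 hT; have an : T 0 0 != 0 by rewrite gt_eqF.
have an' : qm T 0 0 != 0 by rewrite qmE intr_eq0.
set V := R (zschur T).
have hZ : pd (qm (zschur T)).
  rewrite zschurE //; have [h1 h2] := pd_schur hT; split; first by rewrite linearZ /= h1.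
  move=> x /h2 h; have -> : qf ((T 0 0)%:~R *: schur (qm T)) x = (T 0 0)%:~R * qf (schur (qm T)) x.
    rewrite /qf /bil mulr_sumr; apply: eq_bigr => i _; rewrite mulr_sumr.
    by apply: eq_bigr => j _; rewrite [X in _ * X * _ = _]mxE; ring.
  by rewrite mulr_gt0 // ltr0z.
have [hV hred] := hR _ hZ; rewrite -/V in hV hred.
pose U1 := zlow 0 V *m U; pose T1 := cob S U1.
pose p : 'cV_n := \col_i - rnd (T1 (lift ord0 i) 0) (T1 0 0).
pose U2 := zlow p 1%:M *m U1; pose T2 := cob S U2.
have u1 : U1 \in unitmx by rewrite unitmx_mul zlow_unit.
have u2 : U2 \in unitmx by rewrite unitmx_mul zlow_unit ?unitmx1.
have pT1 : pd (qm T1) by exact: pd_cob.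
have pT2 : pd (qm T2) by exact: pd_cob.
have [e1 s1] : qm T1 0 0 = qm T 0 0 /\ schur (qm T1) = qm V *m schur (qm T) *m (qm V)^T.
  by rewrite /T1 /U1 cob_mul qm_cob qm_zlow; apply: lowmx_act => //; case: hT.
have [e2 s2] : qm T2 0 0 = qm T1 0 0 /\ schur (qm T2) = schur (qm T1).
  rewrite /T2 /U2 cob_mul qm_cob qm_zlow.
  have [||-> ->] := @lowmx_act _ (qm T1) (qm p) (qm 1%:M); [by case: pT1|by rewrite e1|].
  by rewrite /qm map_mx1 trmx1 mul1mx mulmx1.
have e00 : T2 0 0 = T 0 0.
  by apply/eqP; rewrite -(eqr_int rat) -!qmE e2 e1.
have hsz i : `|qm T2 0 (lift ord0 i)| <= qm T2 0 0 / 2.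
  rewrite (pd_sym _ _ pT2) e2.
  have -> : qm T2 (lift ord0 i) 0 = qm T1 (lift ord0 i) 0 - (rnd (T1 (lift ord0 i) 0) (T1 0 0))%:~R * qm T1 0 0.
    rewrite /T2 /U2 cob_mul qmE; suff -> : cob T1 (zlow p 1%:M) (lift ord0 i) 0 =
      T1 (lift ord0 i) 0 + p i 0 * T1 0 0 by rewrite intrD intrM [p i 0]mxE rmorphN !qmE; ring.
    rewrite /cob.
    have rowl (M : 'M[int]_n.+1) k : (zlow p 1%:M *m M) (lift ord0 i) k = M (lift ord0 i) k + p i 0 * M 0 k.
      rewrite mxE big_ord_recl zlowS0 addrC; congr (_ + _).
      rewrite (bigD1 i) //= zlowSS mxE eqxx mul1r big1 ?addr0 // => j ne.
      by rewrite zlowSS mxE eq_sym (negPf ne) mul0r.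
    have col0 (M : 'M[int]_n.+1) k : (M *m (zlow p 1%:M)^T) k 0 = M k 0.
      rewrite mxE big_ord_recl mxE zlow00 mulr1 big1 ?addr0 // => j _.
      by rewrite mxE zlow0S mulr0.
    by rewrite col0 rowl.
  by rewrite !qmE; apply: rndP; apply: int_pd_gt0.
have hs : red (schur (qm T2)).
  rewrite s2 s1 (_ : schur (qm T) = (qm T 0 0)^-1 *: qm (zschur T)); last first.
    by rewrite zschurE // -qmE scalerA mulVf // scale1r.
  rewrite -scalemxAr -scalemxAl -qm_cob; apply: red_scale hred.
  by rewrite invr_gt0 pd_diag.
have htr : \tr (qm T2) <= (rstepC n)%:R * \tr (qm T).
  have A : \tr (schur (qm T2)) <= (redC n)%:R * \tr (schur (qm T)).
    rewrite s2 s1 (_ : schur (qm T) = (qm T 0 0)^-1 *: qm (zschur T)); last first.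
      by rewrite zschurE // -qmE scalerA mulVf // scale1r.
    rewrite -scalemxAr -scalemxAl -qm_cob !mxtraceZ mulrCA ler_pM2l ?invr_gt0 ?pd_diag //.
    exact: red_trace.
  have B (M : 'M[rat]_n.+1) : \tr M = M 0 0 + \sum_i M (lift ord0 i) (lift ord0 i).
    by rewrite /mxtrace big_ord_recl.
  have sqle (M : 'M[rat]_n.+1) i : pd M -> 0 <= M (lift ord0 i) 0 * M 0 (lift ord0 i) / M 0 0.
    by move=> hM; rewrite (pd_sym _ 0 hM) -expr2 divr_ge0 ?sqr_ge0 // ltW // pd_diag.
  have C : \tr (schur (qm T)) <= \tr (qm T).
    rewrite [leRHS]B; apply: (@le_trans _ _ (\sum_i qm T (lift ord0 i) (lift ord0 i))).
      by apply: ler_sum => i _; rewrite schurE gerBl sqle.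
    by rewrite lerDr ltW // pd_diag.
  have D : \tr (qm T2) <= qm T2 0 0 + (\tr (schur (qm T2)) + n%:R * qm T2 0 0).
    rewrite B lerD2l mulr_natl -[X in _ *+ X]card_ord -sumr_const /mxtrace -big_split /=.
    apply: ler_sum => i _; rewrite schurE (pd_sym _ 0 pT2).
    have b0 := pd_diag 0 pT2; have hi := hsz i.
    have : qm T2 0 (lift ord0 i) * qm T2 0 (lift ord0 i) / qm T2 0 0 <= qm T2 0 0.
      rewrite ler_pdivrMr // -!expr2 -[leLHS]real_normK ?num_real // ler_pXn2r ?nnegrE // ?ltW //.
      by apply: le_lt_trans hi _; lra.
    by lra.
  have E : qm T2 0 0 <= \tr (qm T).
    by rewrite e2 e1 B lerDl; apply: sumr_ge0 => i _; apply/ltW/pd_diag.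
  have F := tr_ge0 hT.
  have A' : (redC n)%:R * \tr (schur (qm T)) <= (redC n)%:R * \tr (qm T) by rewrite ler_wpM2l.
  have E' : n%:R * qm T2 0 0 <= n%:R * \tr (qm T) by rewrite ler_wpM2l.
  by rewrite /rstepC natrD -addn2 natrD !mulrDl; lra.
have er : r = if 4 * T2 (inord 1) (inord 1) < 3 * T2 0 0 then (false, swp (inord 1) *m U2) else (true, U2) by [].
rewrite {}er; case: ifP => hc; split=> //=.
- by rewrite unitmx_mul swp_unit.
- rewrite cob_mul -/T2; suff -> : \tr (qm (cob T2 (swp (inord 1)))) = \tr (qm T2) by [].
  rewrite !mxtrace_qm; congr (_%:~R); rewrite /mxtrace (reindex_inj (@perm_inj _ (tperm 0 (inord 1)))).
  by apply: eq_bigr => i _; rewrite swp_cobE !tpermK.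
- by move=> _; rewrite cob_mul -/T2 swp_cobE tpermL -e00.
- move=> _; split=> // i i0; have hi := hsz i.
  have e : lift ord0 i = inord 1 by apply: val_inj; rewrite /= /bump i0 inordK // ltnS (leq_ltn_trans _ (ltn_ord i)).
  move/negbT: hc; rewrite -leNgt -(ler_int rat) !intrM -!qmE -e schurE (pd_sym (lift ord0 i) 0 pT2) => hc.
  have b0 := pd_diag 0 pT2.
  have : qm T2 0 (lift ord0 i) * qm T2 0 (lift ord0 i) / qm T2 0 0 <= qm T2 0 0 / 4.
    rewrite ler_pdivrMr // -expr2 -[leLHS]real_normK ?num_real //.
    rewrite (_ : _ / 4 * _ = (qm T2 0 0 / 2) ^+ 2); last by field.
    by rewrite ler_pXn2r ?nnegrE // divr_ge0 // ltW.
  move: hc; rewrite -[3%:~R]/(3 : rat) -[4%:~R]/(4 : rat); lra.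
Qed.

Lemma det_pd n (S : 'M[rat]_n) : pd S -> 0 < \det S.
Proof.
elim: n S => [|n IH] S hS; first by rewrite det_mx00.
have a0 := pd_diag 0 hS; rewrite det_schur ?gt_eqF //.
by rewrite mulr_gt0 // IH //; apply: pd_schur.
Qed.

(** [U i j] is the pairing under [S] of the row [i] of [U] with [e_j S^-1]. Apply Cauchy-Schwarz,
    the determinant of [S] being a positive integer. *)
Lemma row_bound n (S U : 'M[int]_n) i j : pd (qm S) ->
  ((U i j) ^+ 2)%:~R <= qm (cob S U) i i * (\adj S j j)%:~R.
Proof.
move=> hS; have dS := det_pd hS.
have uS : qm S \in unitmx by rewrite unitmxE unitfE gt_eqF.
pose u := row i (qm U); pose w : 'rV[rat]_n := delta_mx 0 j *m invmx (qm S).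
have e1 : bil (qm S) u w = (U i j)%:~R.
  rewrite bilE trmx_mul trmx_inv hS.1 mulmxA mulmxK // trmx_delta.
  by rewrite -colE !mxE.
have e2 : qf (qm S) w = invmx (qm S) j j.
  rewrite /qf bilE /w trmx_mul mulmxKV // trmx_inv hS.1 mulmxA.
  by rewrite trmx_delta -colE -rowE !mxE.
have e3 : qf (qm S) u = qm (cob S U) i i.
  by rewrite qm_cob -qf_delta qf_mul /u rowE.
have := bil_CS u w hS; rewrite e1 e2 e3 rmorphXn.
move=> h; apply: le_trans h _; rewrite ler_wpM2l //.
  by rewrite -e3; apply: qf_ge0.
have hinv : invmx (qm S) j j = (\det S)%:~R^-1 * (\adj S j j)%:~R.
  by rewrite /invmx uS mxE /qm det_map_mx -map_mx_adj mxE.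
have w0 : 0 <= invmx (qm S) j j by rewrite -e2; apply: qf_ge0.
have d1 : 1 <= (\det S)%:~R :> rat.
  by move: dS; rewrite /qm det_map_mx ltr0z => h; rewrite ler1z -gtz0_ge1.
have d0 : 0 < (\det S)%:~R :> rat by apply: lt_le_trans d1.
rewrite [in leLHS]hinv ler_pdivrMl //; move: w0; rewrite hinv pmulr_rge0 ?invr_gt0 //.
by move=> a0; rewrite ler_peMl.
Qed.

Lemma absz_entry m n (A : 'M[int]_(m, n)) i j : (absz (A i j) < 2 ^ sz A)%N.
Proof.
have h : (i, j) \in [seq (i, j) | i <- enum 'I_m, j <- enum 'I_n].
  by apply/allpairsP; exists (i, j); rewrite !mem_enum.
have : (sz (A i j) < sz A)%N.
  have -> : sz A = sz (entries A) by [].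
  rewrite entriesE; case/splitPr: h => s1 s2; rewrite map_cat /=.
  exact: (@sz_mem int_enc).
move=> h2; apply: leq_trans (ltn_sz _) _; rewrite leq_exp2l //.
exact: leq_trans (sz_absz _) (ltnW h2).
Qed.

Lemma sz_int_le (z : int) k : (absz z < 2 ^ k)%N -> (sz z <= 4 * k + 5)%N.
Proof. by move=> h; have := sz_int z; have := sz_nat_le h; lia. Qed.

Lemma sz_mx_le m n (A : 'M[int]_(m, n)) k : (forall i j, (absz (A i j) < 2 ^ k)%N) ->
  (sz A <= m * n * (4 * k + 6) + 1)%N.
Proof.
move=> h; have -> : sz A = sz (entries A) by [].
have -> : (m * n = size (entries A))%N by rewrite size_allpairs !size_enum_ord.
apply: (leq_trans (@sz_seq_le int_enc _ (4 * k + 5) _)); last by rewrite -addnS.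
move=> s1 z s2 e; have : z \in entries A by rewrite e mem_cat inE eqxx orbT.
by case/allpairsP => [[i j] [_ _ ->]] /=; apply: sz_int_le.
Qed.

(** Three unfinished steps more than halve the first diagonal entry, since [27 / 64 < 1 / 2]; it
    starts below [2 ^ sz S] and stays a positive integer. *)
Definition rclk n (S : 'M[int]_n) := nseq (3 * (sz S + 2)) tt.

(** The bound of [row_bound], with the trace after all the allotted steps in place of a diagonal
    entry. *)
Definition rbnd n (S : 'M[int]_n.+1) : int :=
  (rstepC n ^ size (rclk S))%N%:Z * (absz (\tr S))%:Z * \sum_j (absz (\adj S j j))%:Z.

(* The bound test only fails on forms that are not positive definite; it makes
   the iteration polynomial on every input. *)
Definition gstep n (R : 'M[int]_n -> 'M[int]_n) (S : 'M[int]_n.+1) st :=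
  let r := rstep R S st in
  if [forall i, forall j, r.2 i j ^+ 2 <= rbnd S] then r else (true, 1%:M).

Fixpoint Red n : 'M[int]_n -> 'M[int]_n :=
  if n is n'.+1 then fun S => (iter (size (rclk S)) (gstep (@Red n') S) (false, 1%:M)).2
  else fun=> 1%:M.

Lemma Red_correct n : redspec (@Red n).
Proof.
elim: n => [|n IH] S hS; first by rewrite /= unitmx1.
set K := size (rclk S); pose st k := iter k (gstep (@Red n) S) (false, 1%:M).
have sK : K = (3 * (sz S + 2))%N by rewrite /K size_nseq.
have c1 : cob S 1%:M = S by rewrite /cob trmx1 mul1mx mulmx1.
have hk k : (k <= K)%N -> [/\ (st k).2 \in unitmx,
    \tr (qm (cob S (st k).2)) <= (rstepC n ^ k)%:R * \tr (qm S),
    (st k).1 -> red (qm (cob S (st k).2))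
  & ~~ (st k).1 -> 4 ^+ k * cob S (st k).2 0 0 <= 3 ^+ k * S 0 0].
  elim: k => [|k IHk] le; first by rewrite /st /= c1; split; rewrite ?unitmx1 ?expn0 ?expr0 ?mul1r.
  have [h1 h2 h3 h4] := IHk (ltnW le).
  rewrite /st iterS -/(st k).
  set U := (st k).2 in h1 h2 h3 h4.
  have tr0 := tr_ge0 hS.
  have ok (U' : 'M_n.+1) : \tr (qm (cob S U')) <= (rstepC n ^ k.+1)%:R * \tr (qm S) ->
     pd (qm (cob S U')) -> [forall i, forall j, U' i j ^+ 2 <= rbnd S].
    move=> ht hp; apply/forallP => i; apply/forallP => j.
    rewrite -(ler_int rat); apply: le_trans (row_bound U' i j hS) _.
    have hi : qm (cob S U') i i <= \tr (qm (cob S U')).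
      rewrite /mxtrace (bigD1 i) //= lerDl; apply: sumr_ge0 => l _; exact/ltW/pd_diag.
    have hi0 : 0 <= qm (cob S U') i i by exact/ltW/pd_diag.
    rewrite /rbnd intrM; apply: ler_pM => //.
    - have := row_bound 1%:M j j hS; rewrite mxE eqxx expr1n c1 => h.
      by have := lt_le_trans ltr01 h; rewrite pmulr_rgt0 ?pd_diag // => /ltW.
    - apply: le_trans hi (le_trans ht _); rewrite intrM mxtrace_qm; apply: ler_pM => //.
      + by rewrite -mxtrace_qm.
      + rewrite -[X in X <= _]/((Posz _)%:~R) ler_int lez_nat leq_pexp2l //.
        by rewrite /rstepC addnS.
      + by rewrite ler_int abszE ler_norm.
    - rewrite ler_int (bigD1 j) //= abszE; apply: le_trans (ler_norm _) _.
      by rewrite lerDl sumr_ge0.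
  have [d|nd] := boolP (st k).1.
    have -> : gstep (@Red n) S (st k) = st k.
      have e : rstep (@Red n) S (st k) = st k by rewrite /rstep d.
      rewrite /gstep e ok //; last exact: pd_cob.
      apply: le_trans h2 _; rewrite ler_wpM2r // ler_nat leq_pexp2l // /rstepC addnS //.
    split=> //; last by rewrite d.
    apply: le_trans h2 _; rewrite ler_wpM2r // ler_nat leq_pexp2l // /rstepC addnS //.
  have est : st k = (false, U) by rewrite /U; case: (st k) nd => [[]].
  have [g1 g2 g3 g4] := rstepP IH hS h1.
  have g2' : \tr (qm (cob S (rstep (@Red n) S (false, U)).2)) <= (rstepC n ^ k.+1)%:R * \tr (qm S).
    apply: le_trans g2 _; rewrite expnS natrM -mulrA ler_wpM2l //.
  rewrite est /gstep ok //; last exact: pd_cob.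
  split=> // nb; have := g4 nb; have := h4 nd.
  rewrite !exprS; set b := cob S U 0 0; set a := cob S _ 0 0; set x := 4 ^+ k; set y := 3 ^+ k * _.
  have x0 : 0 < x by rewrite exprn_gt0.
  move=> h5 h6; apply: (@le_trans _ _ (x * (3 * b))); first by rewrite mulrAC [x * _]mulrC ler_pM2r // ltW.
  by rewrite mulrCA -[3 * 3 ^+ k * _]mulrA ler_pM2l.
have [h1 h2 h3 h4] := hk K (leqnn K).
have e : Red S = (st K).2 by [].
rewrite e; split=> //; apply: h3; apply/negP => /negP nd; move: (h4 nd).
have a1 := int_pd_gt0 0 (pd_cob hS h1).
have b1 : S 0 0 < 2 ^+ sz S.
  apply: le_lt_trans (ler_norm _) _; rewrite -abszE.
  have -> : 2 ^+ sz S = (2 ^ sz S)%N%:Z :> int by rewrite -[RHS]natz natrX.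
  by rewrite ltz_nat absz_entry.
move: a1; move: (cob S (st K).2 0 0) => q a1; rewrite sK; set m := (sz S + 2)%N => h5.
(* Were the clock to run out, the first entry would still be at least 1; but [64 < 27 * 2] is
   false. *)
have : 4 ^+ (3 * m) < 3 ^+ (3 * m) * 2 ^+ m :> int.
  apply: le_lt_trans (_ : 3 ^+ (3 * m) * S 0 0 < _).
    by apply: le_trans h5; rewrite ler_peMr ?exprn_ge0 // -gtz0_ge1.
  rewrite ltr_pM2l ?exprn_gt0 //; apply: lt_le_trans b1 _.
  by rewrite ler_eXn2l // leq_addr.
rewrite !exprM -exprMn ltNge => /negP; apply.
by apply: lerXn2r; rewrite ?nnegrE.
Qed.

Lemma PT_expc (X : encType) (C : nat) (c : X -> seq unit) : PT c ->
  PT (fun x => C ^ size (c x))%N.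
Proof.
move=> hc; have e x : iter (size (c x)) (muln C) 1%N = (C ^ size (c x))%N.
  by elim: (size _) => //= k ->; rewrite expnS.
apply: PT_ext e _.
apply: (@PT_loop _ _ c (fun=> 1%N) (fun _ => muln C) (fun x => (4 * (C.+1 * size (c x) + 1) + 1)%N)) => //.
- exact: PT_cst.
- apply: PT_muln; [exact: PT_cst|exact/PT_snd/PT_id].
- apply: (@pbd_le _ _ (fun x => (4 * (C.+1 * sz (c x) + 1) + 1)%N)); last by pbdt.
  by move=> x; rewrite leq_add2r leq_mul2l leq_add2r leq_mul2l (ltnW (sz_size _)) !orbT.
- move=> x k le; apply: sz_nat_le.
  have -> : iter k (muln C) 1%N = (C ^ k)%N by elim: (k) => //= i ->; rewrite expnS.
  apply: (@leq_ltn_trans ((2 ^ C.+1) ^ k)%N).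
    by case: (k) => // k'; rewrite leq_exp2r //; apply: ltnW; apply: leq_trans (ltn_expl C (isT : 1 < 2)%N) _; rewrite leq_exp2l.
  rewrite -expnM ltn_exp2l // addn1 ltnS leq_mul2l le orbT //.
Qed.

Lemma PT_rclk n : PT (@rclk n).
Proof.
have h := PT_clock (mx_enc n n).
apply: PT_ext (PT_cat h (PT_cat h h)) => S; rewrite /rclk -!nseqD.
by congr nseq; lia.
Qed.

Lemma PT_mxtrace (X : encType) n (A : X -> 'M[int]_n) : PT A -> PT (fun x => \tr (A x)).
Proof. by move=> hA; apply: PT_sumz => i; [exact: PT_mxE|exact: PT_cst]. Qed.

Lemma PT_cob (X : encType) n (S U : X -> 'M[int]_n) : PT S -> PT U -> PT (fun x => cob (S x) (U x)).
Proof. by move=> hS hU; apply: PT_mulmx; [exact: PT_mulmx|exact: PT_trmx]. Qed.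

Lemma PT_zlow (X : encType) n (p : X -> 'cV[int]_n) V : PT p -> PT V ->
  PT (fun x => zlow (p x) (V x)).
Proof.
move=> hp hV; apply: PT_mx => i j.
case: (unliftP ord0 i) => [i' ->|->]; case: (unliftP ord0 j) => [j' ->|->].
- by apply: PT_ext (PT_mxE i' j' hV) => x; rewrite zlowSS.
- by apply: PT_ext (PT_mxE i' 0 hp) => x; rewrite zlowS0.
- by apply: PT_ext (PT_cst _ (0 : int)) => x; rewrite zlow0S.
- by apply: PT_ext (PT_cst _ (1 : int)) => x; rewrite zlow00.
Qed.

Lemma PT_rnd (X : encType) (a b : X -> int) : PT a -> PT b -> PT (fun x => rnd (a x) (b x)).
Proof.
move=> ha hb; have c2 := PT_cst X (2 : int).
exact: PT_divz (PT_addz (PT_mulz ha c2) hb) (PT_mulz hb c2).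
Qed.

Lemma PT_rstep n (R : 'M[int]_n -> 'M[int]_n) : PT R ->
  PT (fun p : 'M[int]_n.+1 * (bool * 'M[int]_n.+1) => rstep R p.1 p.2).
Proof.
move=> hR; set X := (_ * (_ * _))%type.
have hS : PT (fun p : X => p.1) by exact/PT_fst/PT_id.
have hU : PT (fun p : X => p.2.2) by exact/PT_snd/PT_snd/PT_id.
have hU1 : PT (fun p : X => zlow 0 (R (zschur (cob p.1 p.2.2))) *m p.2.2).
  apply: PT_mulmx => //; apply: PT_zlow; first exact: PT_cst.
  apply: (PT_comp (f := fun p : X => zschur (cob p.1 p.2.2)) _ hR).
  have hT := PT_cob hS hU; apply: PT_mx => i j.
  have := PT_subz (PT_mulz (PT_mxE 0 0 hT) (PT_mxE (lift ord0 i) (lift ord0 j) hT))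
    (PT_mulz (PT_mxE (lift ord0 i) 0 hT) (PT_mxE 0 (lift ord0 j) hT)).
  by apply: PT_ext => p; rewrite [RHS]mxE.
rewrite /rstep /=; set U1 := fun p : X => _ in hU1.
apply: PT_if; [exact/PT_fst/PT_snd/PT_id|exact/PT_snd/PT_id|].
have hT1 := PT_cob hS hU1.
set U2 := fun p : X => zlow (\col_i - rnd (cob p.1 (U1 p) (lift ord0 i) 0) (cob p.1 (U1 p) 0 0)) 1%:M *m U1 p.
have hU2 : PT U2.
  apply: PT_mulmx => //; apply: PT_zlow; last exact: PT_cst.
  apply: PT_mx => i j; have := PT_oppz (PT_rnd (PT_mxE (lift ord0 i) 0 hT1) (PT_mxE 0 0 hT1)).
  by apply: PT_ext => p; rewrite [RHS]mxE.
have hT2 := PT_cob hS hU2.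
apply: (PT_if (c := fun p : X => 4 * cob p.1 (U2 p) (inord 1) (inord 1) < 3 * cob p.1 (U2 p) 0 0)).
- by apply: PT_ltz; apply: PT_mulz; try exact: PT_cst; apply: PT_mxE.
- by apply: PT_pair; [exact: PT_cst|apply: PT_mulmx => //; exact: PT_cst].
- by apply: PT_pair => //; exact: PT_cst.
Qed.

Lemma PT_rbnd n : PT (@rbnd n).
Proof.
have hid := PT_id (mx_enc n.+1 n.+1).
apply: PT_mulz; first apply: PT_mulz.
- exact/PT_posz/PT_expc/PT_rclk.
- exact/PT_posz/PT_absz/PT_mxtrace.
- apply: PT_sumz => j; last exact: PT_cst.
  exact/PT_posz/PT_absz/PT_mxE/PT_adj.
Qed.

Lemma PT_Red n : PT (@Red n).
Proof.
elim: n => [|n IH]; first exact: PT_cst.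
apply: PT_snd; pose E := mx_enc n.+1 n.+1.
have hb := PT_rbnd n.
apply: (@PT_loop E _ (@rclk n.+1) (fun=> (false, 1%:M)) (gstep (@Red n))
  (fun S => 10 + (n.+1 * n.+1 * (4 * (sz (rbnd S) + 1) + 6) + 1))%N).
- exact: PT_rclk.
- exact: PT_cst.
- have hr := PT_rstep IH; apply: PT_if => //; last exact: PT_cst.
  apply: PT_forall => i; apply: PT_forall => j; apply: PT_lez.
    by apply/PT_expz/PT_mxE/PT_snd.
  exact: (PT_comp (PT_fst (PT_id _)) hb).
- by pbdt.
- move=> S k _; have bb (b : bool) : (sz b <= 3)%N by case: b.
  have h1 : (sz (1%:M : 'M[int]_n.+1) <= n.+1 * n.+1 * (4 * (sz (rbnd S) + 1) + 6) + 1)%N.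
    apply: sz_mx_le => i j; rewrite mxE; apply: (@leq_ltn_trans 1%N); first by case: (_ == _).
    by rewrite addn1 -[1%N]/(2 ^ 0)%N ltn_exp2l.
  have hbad : (sz (false, (1%:M : 'M[int]_n.+1)) <= 10 + (n.+1 * n.+1 * (4 * (sz (rbnd S) + 1) + 6) + 1))%N.
    by rewrite sz_pair; have := bb false; lia.
  elim: k => [|k _]; first exact: hbad.
  rewrite iterS /gstep; set r := rstep _ _ _; case: ifP => [/forallP h|_]; last first.
    by rewrite sz_pair; have := bb true; lia.
  have hm : (sz r.2 <= n.+1 * n.+1 * (4 * (sz (rbnd S) + 1) + 6) + 1)%N.
    apply: sz_mx_le => i j; have /forallP/(_ j) := h i; set z := r.2 i j => hz.
    apply: (@leq_ltn_trans (absz (rbnd S))).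
      by move: hz; case: (rbnd S) => b; case: (z) => c /=; rewrite ?expr2; nia.
    apply: leq_trans (ltn_sz _) _; rewrite leq_exp2l // (leq_trans (sz_absz _)) // leq_addr //.
  by case: r hm {h} => b M /= hm; rewrite sz_pair; have := bb b; lia.
Qed.

(** * Signed decompositions of perturbed simplicial cones *)

(* Sign of an expression [s_0 + s_1 e + s_2 e^2 + ...] for infinitesimal [e > 0]. *)
Fixpoint lexpos (s : seq int) : bool :=
  if s is a :: s' then (0 < a) || ((a == 0) && lexpos s') else false.

Fixpoint ev (e : rat) (s : seq int) : rat :=
  if s is a :: s' then a%:~R + e * ev e s' else 0.

Lemma ev_bound e s : 0 <= e <= 1 -> `|ev e s| <= (\sum_(a <- s) `|a|)%:~R.
Proof.
move=> /andP[e0 e1]; elim: s => [|a s IH] /=; first by rewrite big_nil normr0.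
rewrite big_cons intrD; apply: le_trans (ler_normD _ _) _; rewrite -intr_norm lerD //.
by rewrite normrM (ger0_norm e0); apply: le_trans (ler_piMl _ e1) IH.
Qed.

Lemma lexpos_ev s : has (predC1 0) s -> exists2 e0 : rat, 0 < e0 &
  forall e, 0 < e < e0 -> (ev e s != 0) && (lexpos s == (0 < ev e s)).
Proof.
elim: s => // a s IH /=; have [->|a0] /= := eqVneq a 0.
  move=> /IH[e0 h0 h]; exists e0 => // e he; have /andP[e1 _] := he.
  have := h _ he; rewrite add0r mulf_eq0 (gt_eqF e1) /= pmulr_rgt0 //.
move=> _; pose B := (\sum_(a <- s) `|a|)%:~R : rat.
have B0 : 0 <= B by rewrite ler0z sumr_ge0.
exists (1 / (B + 1)); first by rewrite divr_gt0 // ltr_wpDl.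
move=> e /andP[e1 e2]; have hB : 0 < B + 1 by rewrite ltr_wpDl.
have e3 : e * (B + 1) < 1 by rewrite -ltr_pdivlMr.
have e4 : e <= 1 by nra.
have h : `|ev e s| <= B by apply: ev_bound; rewrite (ltW e1).
have : `|e * ev e s| < 1.
  by rewrite normrM gtr0_norm //; apply: le_lt_trans (_ : e * B < 1); [rewrite ler_pM2l|lra].
rewrite ltr_norml => /andP[h1 h2].
have [ap|an|/eqP] := ltrgtP a 0; last by rewrite (negPf a0).
  have h3 : a%:~R <= -1 :> rat by rewrite -[-1]/((-1)%:~R) ler_int; lia.
  have hE : a%:~R + e * ev e s < 0 by lra.
  by rewrite (lt_eqF hE) (le_gtF (ltW hE)).
have h3 : 1 <= a%:~R :> rat by rewrite ler1z -gtz0_ge1.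
have hE : 0 < a%:~R + e * ev e s by lra.
by rewrite (gt_eqF hE) hE.
Qed.

Lemma lexpos_ev_seq (L : seq (seq int)) : all (has (predC1 0)) L ->
  exists2 e : rat, 0 < e &
    all (fun s => (ev e s != 0) && (lexpos s == (0 < ev e s))) L.
Proof.
move=> hL; suff [e0 h0 h] : exists2 e0 : rat, 0 < e0 & forall e, 0 < e < e0 ->
    all (fun s => (ev e s != 0) && (lexpos s == (0 < ev e s))) L.
  by exists (e0 / 2); [lra|apply: h; lra].
elim: L hL => [|s L IH] /=; first by exists 1.
move=> /andP[/lexpos_ev[e1 h1 H1] /IH[e2 h2 H2]].
exists (Num.min e1 e2); first by rewrite lt_min h1.
by move=> e; rewrite lt_min => /and3P[e0 le1 le2]; rewrite H1 ?H2 ?e0.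
Qed.

Section SignedStep.
Variables (n : nat) (al be : 'I_n -> rat).
Hypothesis alP : exists i, 0 < al i.
Hypothesis be0 : forall i, be i != 0.
Let t i := be i / al i.
Hypothesis gen : forall i j, i != j -> al i != 0 -> be j - al j * t i != 0.

Let cnd i := (0 < t i) && [forall j, (j != i) ==> (0 < be j - al j * t i)].

(** [be] and [al] are the coordinates of a point [p] and of a new vector [w]. The ray [p - t w],
    [t > 0], crosses facet [i] of the cone at time [t i] exactly if [cnd i] holds; it leaves the
    cone if [al i > 0] and enters it if [al i < 0]. It is eventually outside by [alP], so [p] is
    inside iff exits minus entries is 1. Genericity excludes crossings through smaller faces. *)
Lemma signed_step :
  ([forall j, 0 < be j] : nat)%:Z =
  \sum_(i | al i != 0) sgz (al i) * (cnd i : nat)%:Z.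
Proof.
have bt j : al j != 0 -> be j = al j * t j by move=> h; rewrite /t mulrC divfK.
have tne i j : i != j -> al i != 0 -> al j != 0 -> t i != t j.
  move=> ne hi hj; have := gen ne hi; rewrite {1}(bt j hj) -mulrBr mulf_eq0 negb_or hj /=.
  by rewrite subr_eq0 eq_sym.
(* Coordinates with [al j = 0] are constant along the ray; if one of them is not positive, the ray
   never meets the open cone. *)
have [zz|] := boolP [forall j, (al j == 0) ==> (0 < be j)]; last first.
  rewrite negb_forall => /existsP[j]; rewrite negb_imply => /andP[/eqP aj bj].
  rewrite (_ : [forall j, _] = false); last by apply/negbTE; rewrite negb_forall; apply/existsP; exists j.
  rewrite big1 // => i ai; rewrite (_ : cnd i = false) ?mulr0 //; apply/negbTE.
  rewrite negb_and negb_forall; apply/orP; right; apply/existsP; exists j.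
  rewrite aj mul0r subr0 negb_imply bj andbT; apply: contra ai => /eqP <-; exact/eqP.
have cndP i : 0 < al i -> cnd i = (0 < t i) &&
    ([forall j, (0 < al j) ==> (t i <= t j)] && [forall j, (al j < 0) ==> (t j < t i)]).
  move=> ai; rewrite /cnd; congr andb; apply/forallP/andP => [h|[/forallP h1 /forallP h2] j].
    split; apply/forallP => j; apply/implyP => aj.
      have [->//|ne] := eqVneq j i; have := h j; rewrite ne /= {1}(bt j) ?gt_eqF //.
      by rewrite -mulrBr pmulr_rgt0 // subr_gt0 => /ltW.
    have ne : j != i by apply: contraL ai => /eqP <-; rewrite -leNgt ltW.
    have := h j; rewrite ne /= {1}(bt j) ?lt_eqF // -mulrBr nmulr_rgt0 //.
    by rewrite subr_lt0.
  apply/implyP => ne; have [aj|aj|aj] := ltrgtP (al j) 0.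
  - rewrite {1}(bt j) ?lt_eqF // -mulrBr nmulr_rgt0 // subr_lt0.
    by have := h2 j; rewrite aj.
  - rewrite {1}(bt j) ?gt_eqF // -mulrBr pmulr_rgt0 // subr_gt0 lt_neqAle.
    by have := h1 j; rewrite aj /= => ->; rewrite andbT; apply: tne; [by rewrite eq_sym|by rewrite gt_eqF|by rewrite gt_eqF].
  - by rewrite aj mul0r subr0; have := forallP zz j; rewrite aj eqxx.
have cndN i : al i < 0 -> cnd i = (0 < t i) &&
    ([forall j, (0 < al j) ==> (t i < t j)] && [forall j, (al j < 0) ==> (t j <= t i)]).
  move=> ai; rewrite /cnd; congr andb; apply/forallP/andP => [h|[/forallP h1 /forallP h2] j].
    split; apply/forallP => j; apply/implyP => aj.
      have ne : j != i by apply: contraL ai => /eqP <-; rewrite -leNgt ltW.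
      have := h j; rewrite ne /= {1}(bt j) ?gt_eqF //.
      by rewrite -mulrBr pmulr_rgt0 // subr_gt0.
    have [->//|ne] := eqVneq j i.
    have := h j; rewrite ne /= {1}(bt j) ?lt_eqF // -mulrBr nmulr_rgt0 //.
    by rewrite subr_lt0 => /ltW.
  apply/implyP => ne; have [aj|aj|aj] := ltrgtP (al j) 0.
  - rewrite {1}(bt j) ?lt_eqF // -mulrBr nmulr_rgt0 // subr_lt0 lt_neqAle.
    by have := h2 j; rewrite aj /= => ->; rewrite andbT; apply: tne; [by []|by rewrite lt_eqF|by rewrite lt_eqF].
  - rewrite {1}(bt j) ?gt_eqF // -mulrBr pmulr_rgt0 // subr_gt0.
    by have := h1 j; rewrite aj.
  - by rewrite aj mul0r subr0; have := forallP zz j; rewrite aj eqxx.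
(* The only possible exit is at the earliest of the times with [al > 0]. *)
case: alP => i0 hi0; pose m := [arg min_(i < i0 | 0 < al i) t i]%O.
have [hm mmin] : 0 < al m /\ forall j, 0 < al j -> t m <= t j.
  by rewrite /m; case: arg_minP => // i hi h; split.
have tm0 : t m != 0 by rewrite mulf_neq0 // invr_eq0 gt_eqF.
rewrite (bigID (fun i => 0 < al i)) /=.
have -> : \sum_(i | (al i != 0) && (0 < al i)) sgz (al i) * (cnd i : nat)%:Z =
   (((0 < t m) && [forall j, (al j < 0) ==> (t j < t m)]) : nat)%:Z.
  rewrite (bigD1 m) /=; last by rewrite gt_eqF.
  rewrite gtr0_sgz // mul1r cndP // (_ : [forall j, (0 < al j) ==> _] = true); last first.
    by apply/forallP => j; apply/implyP; apply: mmin.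
  rewrite big1 ?addr0 // => i /andP[/andP[h1 h2] ne].
  rewrite cndP // (_ : [forall j, (0 < al j) ==> _] = false) ?andbF ?mulr0 //.
  apply/negbTE; rewrite negb_forall; apply/existsP; exists m; rewrite hm /= -ltNge.
  by rewrite lt_neqAle mmin // andbT; apply: tne; [by rewrite eq_sym|by rewrite gt_eqF|by rewrite gt_eqF].
have -> : [forall j, 0 < be j] = (0 < t m) && [forall j, (al j < 0) ==> (t j < 0)].
  apply/forallP/andP => [h|[h1 /forallP h2] j].
    split; first by rewrite divr_gt0.
    by apply/forallP => j; apply/implyP => aj; rewrite /t pmulr_rlt0 ?invr_lt0.
  have [aj|aj|aj] := ltrgtP (al j) 0.
  - by rewrite (bt j) ?lt_eqF // nmulr_rgt0 //; have := h2 j; rewrite aj.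
  - by rewrite (bt j) ?gt_eqF // pmulr_rgt0 //; apply: lt_le_trans h1 (mmin _ aj).
  - by have := forallP zz j; rewrite aj eqxx.
have [/existsP[k0 hk0]|] := boolP [exists k, al k < 0]; last first.
  rewrite negb_exists => /forallP nk.
  rewrite big1 ?addr0; last first.
    move=> i /andP[h1 h2]; exfalso; have := nk i; rewrite -leNgt le_eqVlt eq_sym (negPf h1).
    by rewrite (negPf h2).
  by congr ((_ && _) : nat)%:Z; apply: eq_forallb => j; rewrite (negPf (nk j)).
(* The only possible entry is at the latest of the times with [al < 0]. *)
pose M := [arg max_(i > k0 | al i < 0) t i]%O.
have [hM Mmax] : al M < 0 /\ forall j, al j < 0 -> t j <= t M.
  by rewrite /M; case: arg_maxP => // i hi h; split.
have tM0 : t M != 0 by rewrite mulf_neq0 // invr_eq0 lt_eqF.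
have -> : \sum_(i | (al i != 0) && ~~ (0 < al i)) sgz (al i) * (cnd i : nat)%:Z =
   - (((0 < t M) && (t M < t m)) : nat)%:Z.
  rewrite (bigD1 M) /=; last by rewrite lt_eqF //= -leNgt ltW.
  rewrite ltr0_sgz // mulN1r cndN // (_ : [forall j, (al j < 0) ==> _] = true); last first.
    by apply/forallP => j; apply/implyP; apply: Mmax.
  rewrite (_ : [forall j, (0 < al j) ==> _] = (t M < t m)); last first.
    apply/forallP/idP => [/(_ m)|h j]; first by rewrite hm.
    by apply/implyP => aj; apply: lt_le_trans h (mmin _ aj).
  rewrite andbT big1 ?addr0 // => i /andP[/andP[h1 h2] ne].
  have h3 : al i < 0 by rewrite lt_neqAle h1 leNgt.
  rewrite cndN // (_ : [forall j, (al j < 0) ==> _] = false) ?andbF ?mulr0 //.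
  apply/negbTE; rewrite negb_forall; apply/existsP; exists M; rewrite hM /= -ltNge.
  by rewrite lt_neqAle Mmax // andbT; apply: tne; [by []|by rewrite lt_eqF|by rewrite lt_eqF].
have E c : [forall j, (al j < 0) ==> (t j < c)] = (t M < c).
  apply/forallP/idP => [/(_ M)|h j]; first by rewrite hM.
  by apply/implyP => aj; apply: le_lt_trans (Mmax _ aj) h.
rewrite !E; have nmM : t m != t M.
  by apply: tne; [apply: contraL hm => /eqP ->; rewrite -leNgt ltW|rewrite gt_eqF|rewrite lt_eqF].
case: (ltrgtP (t M) 0) tM0 => // hM0 _; case: (ltrgtP (t m) 0) tm0 => // hm0 _;
  case: (ltrgtP (t M) (t m)) nmM => // hh _; rewrite ?eqxx //=; exfalso; lra.
Qed.
End SignedStep.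

Section Cones.
Variable n : nat.
Local Notation N := n.+1.
Implicit Types (B : 'M[int]_N) (v w : 'rV[int]_N).

(* The rows of [B] generate the cone; [dualmx B] is [|det B| B^-1]. *)
Definition dualmx B : 'M[int]_N := sgz (\det B) *: \adj B.

Definition coords B v i : seq int :=
  (v *m dualmx B) 0 i :: [seq dualmx B k i | k <- enum 'I_N].

(** The point [v] moved by [(e, e^2, ...)], with [e] infinitesimal, lies in the open cone. A nonzero
    linear form does not vanish identically along the moment curve, so moved points avoid all
    facets, and [hc B] is the indicator of a half-open cone. *)
Definition hc B v : bool := [forall i, lexpos (coords B v i)].

Definition ppt (e : rat) v : 'rV[rat]_N := qm v + \row_k e ^+ k.+1.

Lemma ev_sum e (m : nat) (f : 'I_m -> int) :
  ev e [seq f k | k <- enum 'I_m] = \sum_k (f k)%:~R * e ^+ k.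
Proof.
elim: m f => [|m IH] f; first by rewrite big_ord0 enum_ord0.
rewrite enum_ordSl /= big_ord_recl expr0 mulr1 -map_comp IH mulr_sumr.
by congr (_ + _); apply: eq_bigr => k _; rewrite /= exprS mulrCA.
Qed.

Lemma ev_coords e B v i : ev e (coords B v i) = (ppt e v *m qm (dualmx B)) 0 i.
Proof.
rewrite /coords /= ev_sum mulmxDl [RHS]mxE -qm_mul qmE; congr (_ + _).
rewrite mxE mulr_sumr; apply: eq_bigr => k _.
by rewrite mxE qmE exprS; ring.
Qed.

Lemma dualmxK B : B *m dualmx B = `|\det B|%:M.
Proof.
rewrite /dualmx -scalemxAr mul_mx_adj scale_scalar_mx; congr _%:M.
have [h|h|->] := ltrgtP (\det B) 0; last by rewrite mulr0 normr0.
  by rewrite ltr0_sgz // ltr0_norm // mulN1r.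
by rewrite gtr0_sgz // gtr0_norm // mul1r.
Qed.

Lemma qdual B : \det B != 0 -> qm (dualmx B) = `|\det B|%:~R *: invmx (qm B).
Proof.
move=> d0; have uB : qm B \in unitmx by rewrite unitmxE unitfE det_map_mx intr_eq0.
have := congr1 (@qm _ _) (dualmxK B); rewrite qm_mul => /(congr1 (mulmx (invmx (qm B)))).
rewrite mulKmx // => ->; rewrite (_ : qm _%:M = `|\det B|%:~R%:M); last exact: map_scalar_mx.
by rewrite mul_mx_scalar.
Qed.

Lemma dual_col B i : \det B != 0 -> has (predC1 0) [seq dualmx B k i | k <- enum 'I_N].
Proof.
move=> d0; apply/negPn/negP; rewrite -all_predC => /allP h.
have := congr1 (fun M : 'M[int]_N => M i i) (dualmxK B); rewrite mxE [RHS]mxE eqxx mulr1n.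
rewrite big1 => [/esym/eqP|k _]; first by rewrite normr_eq0 (negPf d0).
have /= := h (dualmx B k i) (map_f _ (mem_enum _ _)).
by rewrite negbK => /eqP ->; rewrite mulr0.
Qed.

(** One rational [e] realises the infinitesimal signs for finitely many cones and for one further
    form [a], which serves for half-spaces. *)
Lemma hc_eps (L : seq 'M[int]_N) v (a : seq int) : all (fun B => \det B != 0) L ->
  has (predC1 0) a ->
  exists2 e : rat, 0 < e & (lexpos a = (0 < ev e a)) /\ forall B, B \in L ->
    (forall i, (ppt e v *m invmx (qm B)) 0 i != 0) /\
    hc B v = [forall i, 0 < (ppt e v *m invmx (qm B)) 0 i].
Proof.
move=> hL ha; pose LL := a :: [seq coords B v i | B <- L, i <- enum 'I_N].
have hLL : all (has (predC1 0)) LL.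
  rewrite /= ha; apply/allP => s /allpairsP[[B i] [/= hB _ ->]].
  by rewrite /coords /= dual_col ?orbT // (allP hL).
have [e e0 /= /andP[/andP[_ /eqP h1] h2]] := lexpos_ev_seq hLL.
exists e => //; split=> // B hB; have d0 := allP hL _ hB.
have c0 : 0 < `|\det B|%:~R :> rat by rewrite ltr0z normr_gt0.
have E i : ev e (coords B v i) = `|\det B|%:~R * (ppt e v *m invmx (qm B)) 0 i.
  by rewrite ev_coords qdual // -scalemxAr mxE.
have h i : (ev e (coords B v i) != 0) && (lexpos (coords B v i) == (0 < ev e (coords B v i))).
  by apply: (allP h2); apply/allpairsP; exists (B, i); rewrite /= mem_enum.
split=> [i|].
  by have /andP[+ _] := h i; rewrite E mulf_eq0 gt_eqF.
apply: eq_forallb => i; have /andP[_ /eqP ->] := h i.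
by rewrite E pmulr_rgt0.
Qed.

Definition reprow B i w : 'M[int]_N := \matrix_(k, l) (if k == i then w 0 l else B k l).

Lemma det_reprow B i w : \det (reprow B i w) = (w *m \adj B) 0 i.
Proof.
rewrite (expand_det_row _ i) mxE; apply: eq_bigr => l _; rewrite !mxE eqxx; congr (_ * _).
rewrite /cofactor; congr (_ * \det _); apply/matrixP => k k'; rewrite !mxE.
by rewrite eq_sym (negPf (neq_lift _ _)).
Qed.

Lemma coords_reprow B i w (p : 'rV[rat]_N) : \det B != 0 -> \det (reprow B i w) != 0 ->
  let be := p *m invmx (qm B) in let al := qm w *m invmx (qm B) in
  al 0 i != 0 /\
  p *m invmx (qm (reprow B i w)) = \row_j (if j == i then be 0 i / al 0 i
     else be 0 j - al 0 j * (be 0 i / al 0 i)).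
Proof.
move=> dB dR be al.
have uB : qm B \in unitmx by rewrite unitmxE unitfE det_map_mx intr_eq0.
have uR : qm (reprow B i w) \in unitmx by rewrite unitmxE unitfE det_map_mx intr_eq0.
have ai : al 0 i != 0.
  have := dR; rewrite det_reprow -(intr_eq0 rat) -qmE qm_mul => h.
  apply: contra h => /eqP e0; have : al = (\det B)%:~R^-1 *: (qm w *m qm (\adj B)).
    by rewrite /al /invmx uB -scalemxAr /qm det_map_mx map_mx_adj.
  move/(congr1 (fun M : 'rV[rat]_N => M 0 i)); rewrite e0 mxE => /esym/eqP.
  by rewrite mulf_eq0 invr_eq0 intr_eq0 (negPf dB).
split=> //; set ti := be 0 i / al 0 i; set b' := \row_j _.
suff <- : b' *m qm (reprow B i w) = p by rewrite mulmxK.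
have hp : p = be *m qm B by rewrite mulmxKV.
have hw : qm w = al *m qm B by rewrite mulmxKV.
clearbody be al; apply/rowP => l; rewrite hp !mxE (bigD1 i) //= [RHS](bigD1 i) //= !mxE eqxx.
have -> : (w 0 l)%:~R = \sum_j al 0 j * qm B j l.
  by rewrite -qmE hw mxE.
rewrite (bigD1 i) //= mulrDr -addrA mulrA divfK //; congr (_ + _); first by rewrite mxE.
rewrite mulr_sumr -big_split; apply: eq_bigr => j ne /=.
by rewrite !mxE (negPf ne) /=; ring.
Qed.

Definition csplit B w : seq (int * 'M[int]_N) :=
  [seq (sgz (\det (reprow B i w) * \det B), reprow B i w) |
     i <- enum 'I_N & \det (reprow B i w) != 0].

Definition cval (L : seq (int * 'M[int]_N)) v : int :=
  \sum_(c <- L) c.1 * (hc c.2 v : nat)%:Z.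

(** By Cramer's rule, coordinate [i] of [w] in the basis [B] is the ratio of the two determinants.
    The second hypothesis thus says that some coordinate of [w] is positive, as [signed_step]
    requires. *)
Lemma csplitP B w v : \det B != 0 ->
  (exists i, 0 < \det (reprow B i w) * \det B) ->
  cval (csplit B w) v = (hc B v : nat)%:Z.
Proof.
move=> dB [i0 hi0].
have hL : all (fun B => \det B != 0) (B :: [seq c.2 | c <- csplit B w]).
  rewrite /= dB; apply/allP => x /mapP[c /mapP[i]]; rewrite mem_filter => /andP[h _] -> -> //.
have [e _ [_ hE]] := @hc_eps _ v [:: 1] hL isT.
set p := ppt e v in hE.
have [b0 hB] := hE B (mem_head _ _); set be := p *m invmx (qm B) in b0 hB.
pose al := qm w *m invmx (qm B).
have uB : qm B \in unitmx by rewrite unitmxE unitfE det_map_mx intr_eq0.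
have alE i : al 0 i = (\det (reprow B i w))%:~R / (\det B)%:~R.
  rewrite /al /invmx uB -scalemxAr /qm det_map_mx -map_mx_adj -map_mxM mxE mxE.
  by rewrite -det_reprow mulrC.
have sal i : sgz (al 0 i) = sgz (\det (reprow B i w) * \det B).
  rewrite alE; have -> : (\det (reprow B i w))%:~R / (\det B)%:~R =
     (\det (reprow B i w) * \det B)%:~R / ((\det B)%:~R ^+ 2) :> rat.
    by rewrite intrM; field; rewrite intr_eq0.
  have h : 0 < ((\det B)%:~R ^+ 2)^-1 :> rat by rewrite invr_gt0 exprn_even_gt0 //= intr_eq0.
  by rewrite sgzM sgz_int (gtr0_sgz h) mulr1.
have al0 i : (al 0 i == 0) = (\det (reprow B i w) == 0).
  by rewrite alE mulf_eq0 invr_eq0 !intr_eq0 (negPf dB) orbF.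
have hR i : \det (reprow B i w) != 0 ->
   (forall j, j != i -> be 0 j - al 0 j * (be 0 i / al 0 i) != 0) /\
   hc (reprow B i w) v = (0 < be 0 i / al 0 i) &&
     [forall j, (j != i) ==> (0 < be 0 j - al 0 j * (be 0 i / al 0 i))].
  move=> di; have /hE[h1 h2] : reprow B i w \in B :: [seq c.2 | c <- csplit B w].
    rewrite inE; apply/orP; right; apply/mapP.
    exists (sgz (\det (reprow B i w) * \det B), reprow B i w) => //.
    by apply/mapP; exists i => //; rewrite mem_filter di mem_enum.
  have [_ hc'] := coords_reprow p dB di; rewrite {}hc' -/al -/be in h1 h2.
  split=> [j ne|]; first by have := h1 j; rewrite mxE (negPf ne).
  rewrite h2; apply/forallP/andP => [h|[h3 /forallP h4] j].
    split; first by have := h i; rewrite mxE eqxx.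
    by apply/forallP => j; apply/implyP => ne; have := h j; rewrite mxE (negPf ne).
  by rewrite mxE; case: eqVneq => [//|ne]; have := h4 j; rewrite ne.
rewrite hB (@signed_step _ (fun i => al 0 i) (fun i => be 0 i)) //.
- rewrite /cval /csplit big_map big_filter /= big_enum_cond /=.
  apply: eq_big => [i|i]; first by rewrite al0.
  by move=> di; rewrite sal; have [_ ->] := hR i di.
- by exists i0; rewrite -sgz_gt0 sal sgz_gt0.
- by move=> i j ne; rewrite al0 => /hR[h _]; apply: h; rewrite eq_sym.
Qed.

Definition expand (f : 'M[int]_N -> seq (int * 'M[int]_N)) L : seq (int * 'M[int]_N) :=
  flatten [seq [seq (c.1 * d.1, d.2) | d <- f c.2] | c <- L].

Lemma cval_expand f L v (x : int) :
  (forall c, c \in L -> cval (f c.2) v = (hc c.2 v : nat)%:Z * x) ->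
  cval (expand f L) v = cval L v * x.
Proof.
move=> h; rewrite /cval /expand big_flatten big_map mulr_suml big_seq [RHS]big_seq.
apply: eq_bigr => c hc'; rewrite big_map -mulrA -(h c hc') /cval mulr_sumr.
by apply: eq_bigr => d _; rewrite mulrA.
Qed.

Lemma expandP (P Q : 'M[int]_N -> Prop) f L :
  (forall c, c \in L -> P c.2) -> (forall B d, P B -> d \in f B -> Q d.2) ->
  forall c, c \in expand f L -> Q c.2.
Proof.
move=> h1 h2 c /flattenP[s /mapP[c0 /h1 hc0 ->] /mapP[d hd ->]] /=.
exact: h2 hc0 hd.
Qed.

(** Coordinate 0 is the homogenising one. Nonnegative heights are what later make the slice at
    height one a finite union of translated semigroups. *)
Definition good B := (\det B != 0) && [forall i, 0 <= B i 0].

Lemma csplit_good B w d : good B -> 0 <= w 0 0 -> d \in csplit B w -> good d.2.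
Proof.
move=> /andP[_ /forallP h] hw /mapP[i]; rewrite mem_filter => /andP[di _] -> /=.
rewrite /good di; apply/forallP => k; rewrite mxE; by case: eqP.
Qed.

End Cones.

Lemma zscale_eq0 m n (c : int) (M : 'M[int]_(m, n)) : c != 0 -> c *: M = 0 -> M = 0.
Proof.
move=> c0 /matrixP h; apply/matrixP => i j; have := h i j; rewrite !mxE => /eqP.
by rewrite mulf_eq0 (negPf c0) => /eqP.
Qed.

Lemma oppmxE (V : zmodType) m n (M : 'M[V]_(m, n)) i j : (- M) i j = - M i j.
Proof. by rewrite mxE. Qed.

(** * Intersection of signed cones with a half-space *)

Section HalfSpace.
Variable n : nat.
Local Notation N := n.+1.
Implicit Types (B : 'M[int]_N) (v w : 'rV[int]_N) (a : 'cV[int]_N).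

Lemma det_reprow_comb B k (c : 'rV[int]_N) : \det (reprow B k (c *m B)) = c 0 k * \det B.
Proof. by rewrite det_reprow -mulmxA mul_mx_adj mul_mx_scalar mxE mulrC. Qed.

Definition hpick B a : option ('I_N * 'I_N) :=
  [pick ij | (0 < (B *m a) ij.1 0) && ((B *m a) ij.2 0 < 0)].

(** A positive combination of two generators on opposite sides, lying on the hyperplane. Splitting
    by it replaces one of these two, so each piece has fewer generators off the hyperplane. *)
Definition hvec B a (ij : 'I_N * 'I_N) : 'rV[int]_N :=
  \row_l ((B *m a) ij.1 0 * B ij.2 l - (B *m a) ij.2 0 * B ij.1 l).

Definition hstep a B :=
  if hpick B a is Some ij then csplit B (hvec B a ij) else [:: (1, B)].

Definition hfin a B := if [forall k, 0 <= (B *m a) k 0] then [:: (1 : int, B)] else [::].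

Definition hfilter a L := expand (hfin a) (iter N (expand (hstep a)) L).

Lemma cval1 B v : cval [:: (1, B)] v = (hc B v : nat)%:Z.
Proof. by rewrite /cval big_seq1 mul1r. Qed.

Lemma hvecE B a ij : hvec B a ij =
  ((B *m a) ij.1 0 *: delta_mx 0 ij.2 - (B *m a) ij.2 0 *: delta_mx 0 ij.1) *m B.
Proof.
rewrite mulmxBl -!scalemxAl -!rowE; apply/rowP => l; rewrite [LHS]mxE.
by move: (B *m a) => g; rewrite !mxE.
Qed.

Lemma hvec_det B a i j k : \det (reprow B k (hvec B a (i, j))) =
  ((B *m a) i 0 * (k == j)%:R - (B *m a) j 0 * (k == i)%:R) * \det B.
Proof.
rewrite hvecE det_reprow_comb /=; congr (_ * _).
by move: (B *m a) => g; rewrite !mxE eqxx.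
Qed.

Lemma hstepP a B v : good B ->
  cval (hstep a B) v = (hc B v : nat)%:Z /\ (forall d, d \in hstep a B -> good d.2).
Proof.
move=> gB; have /andP[dB /forallP tB] := gB.
rewrite /hstep /hpick; case: pickP => [[i j] /= /andP[h1 h2]|_]; last first.
  by rewrite cval1; split=> // d; rewrite inE => /eqP ->.
have ne : i != j by apply: contraTneq h1 => ->; rewrite -leNgt ltW.
split.
  apply: csplitP => //; exists j; rewrite hvec_det eqxx eq_sym (negPf ne).
  by rewrite mulr1 mulr0 subr0 -mulrA pmulr_lgt0 // -expr2 exprn_even_gt0.
move=> d; apply: csplit_good => //.
rewrite [hvec _ _ _ _ _]mxE /=; have := tB i; have := tB j; move: h1 h2.
move: (B *m a) => g h1 h2 hj hi.
by rewrite addr_ge0 ?mulr_ge0 ?(ltW h1) // -mulNr mulr_ge0 // oppr_ge0 ltW.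
Qed.

Definition nzc B a := #|[set k | (B *m a) k 0 != 0]|.

Lemma hstep_nz a B d : good B -> d \in hstep a B -> hpick d.2 a != None ->
  hpick B a != None /\ (nzc d.2 a < nzc B a)%N.
Proof.
move=> gB; rewrite {1}/hstep; case E: (hpick B a) => [[i j]|]; last first.
  by rewrite inE => /eqP -> /=; rewrite E.
move: E; rewrite /hpick; case: pickP => // -[i' j'] /= /andP[h1 h2] [ei ej]; subst i' j'.
have ne : i != j by apply: contraTneq h1 => ->; rewrite -leNgt ltW.
move=> /mapP[k]; rewrite mem_filter => /andP[dk _] -> /= _; split=> //.
have hk : (k == i) || (k == j).
  by move: dk; rewrite hvec_det mulf_eq0 negb_or => /andP[+ _]; case: (k == i); case: (k == j) => //; rewrite mulr0n !mulr0 subrr eqxx.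
have gk : (B *m a) k 0 != 0 by case/orP: hk => /eqP ->; [rewrite gt_eqF|rewrite lt_eqF].
have rE l : (reprow B k (hvec B a (i, j)) *m a) l 0 = if l == k then 0 else (B *m a) l 0.
  rewrite mxE; case: eqP => [->|/eqP nl]; last first.
    by rewrite mxE; apply: eq_bigr => m _; rewrite mxE (negPf nl).
  transitivity ((hvec B a (i, j) *m a) 0 0).
    by rewrite mxE; apply: eq_bigr => m _; rewrite [reprow _ _ _ _ _]mxE eqxx.
  rewrite hvecE -mulmxA; move: (B *m a) => g.
  by rewrite mulmxBl -!scalemxAl -!rowE !mxE /=; ring.
apply: proper_card; apply/properP; split.
  apply/fintype.subsetP => l; by rewrite !inE rE; case: (l == k); rewrite ?eqxx.
by exists k; rewrite !inE ?rE ?eqxx.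
Qed.

(** After [N] rounds no cone has generators strictly on both sides, and [hfin] keeps those on the
    nonnegative side. Since [a] does not vanish at [v], the perturbation does not change its sign
    there. *)
Lemma hfilterP a L v : (forall c, c \in L -> good c.2) -> a != 0 -> (v *m a) 0 0 != 0 ->
  cval (hfilter a L) v = cval L v * (nat_of_bool (0 < (v *m a) 0 0))%:Z /\
  (forall c, c \in hfilter a L -> good c.2).
Proof.
move=> gL a0 va; pose Lk k := iter k (expand (hstep a)) L.
have hk k : [/\ cval (Lk k) v = cval L v, forall c, c \in Lk k -> good c.2
   & forall c, c \in Lk k -> hpick c.2 a != None -> (nzc c.2 a + k <= N)%N].
  elim: k => [|k [h1 h2 h3]].
    split=> // c _ _; rewrite addn0 -[X in (_ <= X)%N]card_ord; exact: max_card.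
  split.
  - rewrite /Lk iterS (@cval_expand _ _ _ _ 1) ?mulr1 // => c hc'.
    by have [-> _] := hstepP a v (h2 _ hc'); rewrite mulr1.
  - apply: (@expandP _ (fun B => good B) (fun B => good B)) => // B d gB; have [_] := hstepP a v gB; exact.
  - move=> c hc' hp.
    have [c0 [hc0 hd]] : exists c0, c0 \in Lk k /\ c.2 \in [seq d.2 | d <- hstep a c0.2].
      move: hc' => /flattenP[s /mapP[c0 h ->] /mapP[d hd e]].
      by exists c0; split=> //; rewrite e /=; apply: map_f.
    case/mapP: hd => d hd e; rewrite e in hp *.
    have [p1 p2] := hstep_nz (h2 _ hc0) hd hp.
    by apply: leq_trans (h3 _ hc0 p1); rewrite addnS -addSn leq_add2r.
have [h1 h2 h3] := hk N; rewrite -h1; split; last first.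
  by apply: (@expandP _ (fun B => good B) (fun B => good B)) => // B d gB; rewrite /hfin; case: ifP => // _; rewrite inE => /eqP ->.
apply: cval_expand => c hc'; set B := c.2.
have /andP[dB _] := h2 _ hc'; rewrite -/B in dB.
have nm : hpick B a = None.
  case E: (hpick B a) => [ij|] //; have := h3 _ hc'; rewrite -/B E => /(_ isT).
  have : (0 < nzc B a)%N.
    apply/card_gt0P; exists ij.1; rewrite inE.
    by move: E; rewrite /hpick; case: pickP => // ij' /andP[h _] [<-]; rewrite gt_eqF.
  by lia.
(* The value of [a] at the perturbed point, as a polynomial in [e]. *)
pose s := (v *m a) 0 0 :: [seq a k 0 | k <- enum 'I_N].
have hB0 : all (fun B => \det B != 0) [:: B] by rewrite /= dB.
have hs0 : has (predC1 0) s by rewrite /s /= va.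
have [e e0 [he hE]] := hc_eps v hB0 hs0.
have [b0 hB] := hE B (mem_head _ _); set be := _ *m invmx _ in b0 hB.
have uB : qm B \in unitmx by rewrite unitmxE unitfE det_map_mx intr_eq0.
have evs : ev e s = \sum_i be 0 i * ((B *m a) i 0)%:~R.
  rewrite /s /= ev_sum.
  have -> : \sum_i be 0 i * ((B *m a) i 0)%:~R = (be *m (qm (B *m a))) 0 0.
    by rewrite mxE; apply: eq_bigr => i _; rewrite [qm _ i 0]mxE.
  rewrite qm_mul mulmxA mulmxKV // /ppt mulmxDl -qm_mul [RHS]mxE qmE; congr (_ + _).
  by rewrite [RHS]mxE mulr_sumr; apply: eq_bigr => k _; rewrite !mxE exprS; ring.
have lp : lexpos s = (0 < (v *m a) 0 0) by rewrite /s /= (negPf va) orbF.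
rewrite -lp he evs hB /hfin.
case: ifP => [/forallP hg|hg].
  rewrite cval1 hB; case: (boolP [forall i, 0 < be 0 i]) => [/forallP hb|_]; last by rewrite mul0r.
  rewrite (_ : (0 < _) = true) //.
  have [k hk0] : exists k, (B *m a) k 0 != 0.
    apply/existsP; apply: contraNT a0 => /existsPn z; apply/eqP.
    have : B *m a = 0 by apply/colP => k; rewrite [RHS]mxE; apply/eqP; have := z k; rewrite negbK.
    move/(congr1 (mulmx (\adj B))); rewrite mulmx0 mulmxA mul_adj_mx mul_scalar_mx.
    exact: zscale_eq0.
  rewrite (bigD1 k) //=; apply: ltr_wpDr.
    by apply: sumr_ge0 => i _; apply: mulr_ge0; [exact/ltW/hb|rewrite ler0z; exact: hg].
  by rewrite mulr_gt0 // ltr0z lt_neqAle eq_sym hk0 hg.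
have {}hg : [exists k, (B *m a) k 0 < 0].
  by move/negbT: hg; rewrite negb_forall => /existsP[k h]; apply/existsP; exists k; rewrite ltNge.
have {}hg k : (B *m a) k 0 <= 0.
  case/existsP: hg => j hj; rewrite leNgt; apply/negP => hi.
  by move: nm; rewrite /hpick; case: pickP => // /(_ (k, j)) /=; rewrite hi hj.
rewrite /cval big_nil; case: (boolP [forall i, 0 < be 0 i]) => [/forallP hb|_]; last by rewrite mul0r.
rewrite (_ : (0 < _) = false) // le_gtF //.
by apply: sumr_le0 => i _; apply: mulr_ge0_le0; [exact/ltW/hb|rewrite lerz0; exact: hg].
Qed.

Definition orth (s : {ffun 'I_n -> bool}) : 'M[int]_N :=
  diag_mx (\row_i (if unlift ord0 i is Some j then (if s j then 1 else -1) else 1)).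

Definition orths : seq (int * 'M[int]_N) := [seq (1, orth s) | s <- enum {ffun 'I_n -> bool}].

Lemma orth_sq s : orth s *m orth s = 1%:M.
Proof.
rewrite /orth mulmx_diag -diag_const_mx; congr diag_mx; apply/rowP => i; rewrite !mxE.
by case: unlift => [j|//]; case: (s j).
Qed.

Lemma orth_det s : \det (orth s) != 0.
Proof.
by apply/eqP => h; have := congr1 determinant (orth_sq s); rewrite det_mulmx h mul0r det1.
Qed.

(** The perturbed point has no zero coordinate, hence lies in exactly one of the open orthants of
    positive height. *)
Lemma orthsP v : v 0 0 = 1 ->
  cval orths v = 1 /\ (forall c, c \in orths -> good c.2).
Proof.
move=> v1; split; last first.
  move=> c /mapP[s _ ->] /=; rewrite /good orth_det; apply/forallP => i.
  by rewrite !mxE; case: unliftP => [j ->|->] //=; rewrite mulr0n.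
have hL : all (fun B => \det B != 0) [seq c.2 | c <- orths].
  by apply/allP => x /mapP[c /mapP[s _ ->] ->]; apply: orth_det.
have [e e0 [_ hE]] := @hc_eps _ _ v [:: 1] hL isT; set p := ppt e v in hE.
have hs s : (forall i, (p *m qm (orth s)) 0 i != 0) /\
   hc (orth s) v = [forall i, 0 < (p *m qm (orth s)) 0 i].
  have -> : qm (orth s) = invmx (qm (orth s)).
    have := congr1 (@qm _ _) (orth_sq s); rewrite qm_mul => h.
    have e1 : qm (orth s) *m qm (orth s) = 1%:M by rewrite h /qm map_mx1.
    have [u _] := mulmx1_unit e1; by rewrite -[RHS]mulmx1 -e1 mulmxA mulVmx // mul1mx.
  apply: hE; apply/mapP; exists (1, orth s) => //.
  by apply/mapP; exists s; rewrite ?mem_enum.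
have pE s i : (p *m qm (orth s)) 0 i = p 0 i * (if unlift ord0 i is Some j then (if s j then 1 else -1) else 1).
  rewrite mxE (bigD1 i) //= big1 ?addr0; last first.
    by move=> k ne; rewrite !mxE (negPf ne) mulr0n mulr0.
  by rewrite !mxE eqxx mulr1n; case: unlift => [j|//]; case: (s j).
pose s0 : {ffun 'I_n -> bool} := [ffun j => 0 < p 0 (lift ord0 j)].
have p0 j : p 0 (lift ord0 j) != 0.
  by have [h _] := hs s0; have := h (lift ord0 j); rewrite pE mulf_eq0 negb_or => /andP[].
rewrite /cval /orths big_map big_enum /= (bigD1 s0) //= big1 ?addr0 ?mul1r; last first.
  move=> s ne; have [_ ->] := hs s; rewrite (_ : [forall i, _] = false) ?mulr0 //.
  apply/negbTE; rewrite negb_forall; have /existsP[j hj] : [exists j, s j != s0 j].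
    by apply: contraNT ne => /existsPn h; apply/eqP/ffunP => j; apply/eqP; rewrite -[_ == _]negbK h.
  apply/existsP; exists (lift ord0 j); rewrite pE liftK; move: hj; rewrite ffunE -leNgt.
  by case: (s j); case: ltrgtP (p0 j) => //= h _ _; rewrite ?mulr1 ?mulrN1 ?oppr_le0 ltW.
have [_ ->] := hs s0; rewrite (_ : [forall i, _] = true) //; apply/forallP => i.
rewrite pE; case: (unliftP ord0 i) => [j ->|->]; last first.
  by rewrite mulr1 !mxE v1 ltr_wpDr // expr1 ltW.
rewrite ffunE; have [h|h|h] := ltrgtP 0 (p 0 (lift ord0 j)); rewrite ?mulr1 ?mulrN1 ?oppr_gt0 //.
by have := p0 j; rewrite -h eqxx.
Qed.

End HalfSpace.

(** * Decreasing the indices of the cones *)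

Section Reduction.
Variable n : nat.
Local Notation N := n.+1.
Implicit Types (B : 'M[int]_N) (v w : 'rV[int]_N).

Definition thr : nat := 2 ^ (N * N + N).

(** The entries of [w *m \adj B] are the signed indices of the cones produced by [w], so a short
    vector for this form makes them all small. The sign is chosen to give [w] nonnegative height and
    a positive coordinate in [B]. *)
Definition rvec B : 'rV[int]_N :=
  let w := row 0 (Red (\adj B *m (\adj B)^T)) in
  if (0 < w 0 0) || ((w 0 0 == 0) && [exists i, 0 < \det (reprow B i w) * \det B])
  then w else - w.

(** Implied by [rvec_bound] for good cones of index above [thr]. Testing it keeps the signed
    identity valid and lets entries grow by a factor at most [N] per round on every input. *)
Definition rguard B w :=
  [&& 0 <= w 0 0, [forall l, `|w 0 l| <= \sum_k `|B k l|]
    & [exists i, 0 < \det (reprow B i w) * \det B]].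

Definition rdstep B : seq (int * 'M[int]_N) :=
  if `|\det B| <= thr%:Z then [:: (1, B)] else
  if rguard B (rvec B) then csplit B (rvec B) else [:: (1, B)].

Lemma rdstepP B v : good B ->
  cval (rdstep B) v = (hc B v : nat)%:Z /\ (forall d, d \in rdstep B -> good d.2).
Proof.
move=> gB; have gd : forall d : int * 'M[int]_N, d \in [:: (1, B)] -> good d.2.
  by move=> d; rewrite inE => /eqP ->.
rewrite /rdstep; case: ifP => _; first by rewrite cval1.
case: ifP => [/and3P[h1 _ /existsP h2]|_]; last by rewrite cval1.
split; first by apply: csplitP => //; case/andP: gB.
by move=> d; apply: csplit_good.
Qed.

(** [red_det] applied to the form of [\adj B], whose determinant is [\det B ^+ (2 * n)]: the new
    indices are about the power [n / N] of the old one. *)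
Lemma rvec_bound B : good B -> thr%:Z < `|\det B| ->
  rguard B (rvec B) /\
  forall i, `|\det (reprow B i (rvec B))| ^+ (2 * N) <= 2 ^+ (N * N) * `|\det B| ^+ (2 * n).
Proof.
move=> /andP[dB /forallP tB] hD; set A := \adj B; set S := A *m A^T; set U := Red S.
pose w0 := row 0 U.
have dA : \det A * \det B = \det B ^+ N.
  by rewrite -det_mulmx mul_adj_mx det_scalar.
have dA' : \det A = \det B ^+ n by apply: (mulIf dB); rewrite dA exprSr.
have dA0 : \det A != 0 by rewrite dA' expf_neq0.
have uA : qm A \in unitmx by rewrite unitmxE unitfE det_map_mx intr_eq0.
have qS x : qf (qm S) x = \sum_i ((x *m qm A) 0 i) ^+ 2.
  rewrite /qf bilE qm_mul qm_tr mulmxA -mulmxA -trmx_mul mxE.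
  by apply: eq_bigr => i _; rewrite [_^T i 0]mxE expr2.
have pS : pd (qm S).
  split; first by rewrite qm_mul qm_tr trmx_mul trmxK.
  move=> x x0; rewrite qS lt_def sumr_ge0 ?andbT => [|i _]; last exact: sqr_ge0.
  apply: contra x0; rewrite psumr_eq0 => [/allP h|i _]; last exact: sqr_ge0.
  apply/eqP; rewrite -(mulmxK uA x); suff -> : x *m qm A = 0 by rewrite mul0mx.
  by apply/rowP => i; rewrite [RHS]mxE; apply/eqP; rewrite -sqrf_eq0; exact: (h i (mem_index_enum i)).
have [uU hr] := Red_correct pS; rewrite -/U in uU hr.
set T := cob S U in hr; have pT : pd (qm T) by exact: pd_cob.
have T00 : qm T 0 0 = \sum_i ((w0 *m A) 0 i)%:~R ^+ 2.
  rewrite -qf_delta qm_cob qf_mul qS; apply: eq_bigr => i _.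
  by rewrite -rowE (_ : row 0 (qm U) = qm w0) -?qm_mul ?qmE // /qm map_row.
have detT : \det (qm T) = (\det B)%:~R ^+ (2 * n).
  rewrite /qm det_map_mx /T /cob /S !det_mulmx !det_tr dA' -rmorphXn; congr _%:~R.
  have : \det U ^+ 2 = 1.
    by move: uU; rewrite unitmxE => /orP[]/eqP ->.
  move=> hU; rewrite mulnC exprM; set y := _ ^+ n.
  by transitivity (\det U ^+ 2 * y ^+ 2); [ring|rewrite hU mul1r].
have key i : `|(w0 *m A) 0 i| ^+ (2 * N) <= 2 ^+ (N * N) * `|\det B| ^+ (2 * n).
  have : ((w0 *m A) 0 i)%:~R ^+ 2 <= qm T 0 0.
    by rewrite T00 (bigD1 i) //= lerDl sumr_ge0 // => j _; exact: sqr_ge0.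
  have t0 : 0 <= qm T 0 0 by exact/ltW/pd_diag.
  move=> h; have h2 : (((w0 *m A) 0 i)%:~R ^+ 2) ^+ N <= qm T 0 0 ^+ N.
    by apply: lerXn2r; rewrite ?nnegrE ?sqr_ge0.
  have := le_trans h2 (red_det pT hr); rewrite detT -exprM.
  rewrite -(ler_int rat) intrM !rmorphXn /= !intr_norm.
  by rewrite !exprM !real_normK ?num_real.
have wA i w : \det (reprow B i w) = (w *m A) 0 i by rewrite det_reprow.
(* Above the threshold the indices do not grow, so the coordinates of [w0] in the basis [B] lie
   between -1 and 1; this bounds its entries. *)
have small i : `|(w0 *m A) 0 i| <= `|\det B|.
  rewrite leNgt; apply/negP => hlt; have := key i; rewrite leNgt => /negP; apply.
  have D0 : 0 < `|\det B| by rewrite normr_gt0.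
  apply: (@lt_trans _ _ (`|\det B| ^+ 2 * `|\det B| ^+ (2 * n))); last first.
    by rewrite -exprD -[(2 + _)%N]mulnS ltr_pXn2r ?nnegrE ?normr_ge0.
  rewrite ltr_pM2r ?exprn_gt0 //; apply: le_lt_trans (_ : thr%:Z ^+ 2 < _); last first.
    by rewrite ltr_pXn2r ?nnegrE ?normr_ge0.
  rewrite /thr -natz natrX -exprM; apply: ler_weXn2l => //; lia.
have w0w : rvec B = w0 \/ rvec B = - w0 by rewrite /rvec -/A -/S -/U -/w0; case: ifP; [left|right].
have w0A : w0 *m A != 0.
  apply/eqP => h; have : w0 = 0.
    by apply: (zscale_eq0 dB); rewrite -mul_mx_scalar -mul_adj_mx mulmxA h mul0mx.
  move=> w00; have := T00; rewrite w00 mul0mx big1 => [|i _]; last by rewrite mxE expr0n.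
  by move=> t; have := pd_diag 0 pT; rewrite t ltxx.
split; last first.
  by move=> i; rewrite wA; case: w0w => ->; rewrite ?mulNmx ?oppmxE ?normrN key.
have comb w l : w 0 l * \det B = \sum_k (w *m A) 0 k * B k l.
  transitivity ((w *m A *m B) 0 l); last by rewrite mxE.
  by rewrite -mulmxA mul_adj_mx mul_mx_scalar mxE mulrC.
have tpos w : 0 < w 0 0 -> [exists i, 0 < \det (reprow B i w) * \det B].
  move=> hw; apply: contraLR hw => /existsPn h; rewrite -leNgt.
  have D2 : 0 < \det B * \det B by rewrite -expr2 exprn_even_gt0.
  rewrite -(pmulr_lle0 _ D2) mulrA comb mulr_suml; apply: sumr_le0 => k _.
  by rewrite mulrAC mulr_le0_ge0 ?tB // -wA leNgt h.
have negE : [forall i, ~~ (0 < \det (reprow B i w0) * \det B)] ->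
   [exists i, 0 < \det (reprow B i (- w0)) * \det B].
  move=> /forallP h; have [k hk] : exists k, (w0 *m A) 0 k != 0.
    apply/existsP; apply: contraNT w0A => /existsPn z; apply/eqP/rowP => k; rewrite [RHS]mxE.
    by apply/eqP; have := z k; rewrite negbK.
  apply/existsP; exists k; have := h k; rewrite !wA mulNmx oppmxE mulNr oppr_gt0 -leNgt.
  by rewrite lt_neqAle mulf_eq0 (negPf hk) (negPf dB).
rewrite /rguard; apply/and3P; split.
- rewrite /rvec -/A -/S -/U -/w0; case: ifP => [/orP[/ltW//|/andP[/eqP -> //]]|].
  by move/negbT; rewrite negb_or -leNgt => /andP[h _]; rewrite oppmxE oppr_ge0.
- apply/forallP => l.
  have -> : `|rvec B 0 l| = `|w0 0 l| by case: w0w => ->; rewrite ?oppmxE ?normrN.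
  have D0 : 0 < `|\det B| by rewrite normr_gt0.
  rewrite -(ler_pM2r D0) -normrM comb mulr_suml; apply: le_trans (ler_norm_sum _ _ _) _.
  by apply: ler_sum => k _; rewrite normrM mulrC ler_wpM2l.
- rewrite /rvec -/A -/S -/U -/w0; case: ifP => [/orP[/tpos//|/andP[_ //]]|].
  move/negbT; rewrite negb_or => /andP[]; rewrite -leNgt le_eqVlt => /orP[e|lt] h2.
    by apply: negE; move: h2; rewrite e /= negb_exists.
  by apply: tpos; rewrite oppmxE oppr_gt0.
Qed.

(** If [2 ^ (N * N + x)] bounds an index, then [2 ^ (N * N + gx x)] bounds the new ones that still
    exceed the threshold. *)
Definition gx (x : nat) : nat := (x - x %/ N)%N.

Lemma gx_iter x m : (x < 2 ^ m)%N -> (iter (N * m) gx x < N)%N.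
Proof.
pose y k := (iter k gx x - n)%N.
have st k : (N * y k.+1 <= n * y k)%N.
  rewrite /y iterS; set z := iter k gx x; rewrite /gx.
  have := divn_eq z N; have := ltn_pmod z (isT : (0 < N)%N).
  set q := (z %/ N)%N; set r := (z %% N)%N => h1 e; nia.
have h k : (N ^ k * y k <= n ^ k * x)%N.
  elim: k => [|k IH]; first by rewrite !expn0 !mul1n /y /= leq_subr.
  have := st k; rewrite !expnS => h1.
  have h2 : (N ^ k * (N * y k.+1) <= N ^ k * (n * y k))%N by rewrite leq_mul2l h1 orbT.
  have h3 : (n * (N ^ k * y k) <= n * (n ^ k * x))%N by rewrite leq_mul2l IH orbT.
  nia.
(* [(1 - 1 / N) ^ N <= 1 / 2], from Bernoulli's inequality [B]: the excess exponent is halved every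
   [N] rounds. *)
have b2 : (2 * n ^ N <= N ^ N)%N.
  have B k : (n ^ k * (n + k) <= N ^ k * n)%N.
    elim: k => [|k IH]; first by rewrite addn0.
    have := leq_mul (leqnn N) IH; rewrite !expnS => h1; apply: leq_trans (_ : _ <= N * (n ^ k * (n + k)))%N _; last by nia.
    have : (n * (n + k.+1) <= N * (n + k))%N by nia.
    by move=> h2; have := leq_mul (leqnn (n ^ k)) h2; nia.
  case: (n) B => [|m'] B; first by rewrite exp0n.
  have := B m'.+2; rewrite -[(_ ^ m'.+2 * m'.+1)%N]mulnC.
  set a := (m'.+1 ^ m'.+2)%N; set b := (m'.+2 ^ m'.+2)%N; nia.
move=> hx; have hm := h (N * m)%N.
have : (2 ^ m * (N ^ (N * m) * y (N * m)) <= N ^ (N * m) * x)%N.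
  apply: (@leq_trans (2 ^ m * (n ^ (N * m) * x))%N); first by rewrite leq_mul2l hm orbT.
  rewrite mulnA leq_mul2r !expnM -expnMn; apply/orP; right.
  by case: (m) => // m'; rewrite leq_exp2r.
rewrite mulnCA leq_pmul2l ?expn_gt0 // => h2.
have : y (N * m)%N = 0%N by case: (y _) h2 => // j; nia.
by rewrite /y; lia.
Qed.

Lemma rdstep_det B d x : good B -> `|\det B| <= (2 ^ (N * N + x))%N%:Z -> d \in rdstep B ->
  `|\det d.2| <= thr%:Z \/ `|\det d.2| <= (2 ^ (N * N + gx x))%N%:Z.
Proof.
move=> gB hB; rewrite /rdstep; case: ifP => [h|/negbT]; first by rewrite inE => /eqP ->; left.
rewrite -ltNge => h; have [-> hd] := rvec_bound gB h.
move=> /mapP[i _ ->]; right; have := hd i; set z := `|_|; set D := `|_| in hB * => hz.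
rewrite leNgt; apply/negP => hlt; set E := (N * N + gx x)%N in hlt.
have P (k : nat) : (2 ^ k)%N%:Z = 2 ^+ k :> int by rewrite -natz natrX.
have z0 : 0 <= z by exact: normr_ge0.
have h1 : (2 ^+ E) ^+ (2 * N) < z ^+ (2 * N).
  by rewrite ltr_pXn2r ?nnegrE ?exprn_ge0 // -P.
have h2 : D ^+ (2 * n) <= (2 ^+ (N * N + x)) ^+ (2 * n).
  by apply: lerXn2r; rewrite ?nnegrE ?exprn_ge0 ?normr_ge0 // -P.
have := lt_le_trans h1 hz; rewrite ltNge => /negP; apply.
apply: (@le_trans _ _ (2 ^+ (N * N) * (2 ^+ (N * N + x)) ^+ (2 * n))).
  by rewrite ler_pM2l ?exprn_gt0.
rewrite -!exprM -exprD; apply: ler_weXn2l => //; rewrite /E /gx.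
have e := divn_eq x N; move: e; set q := (x %/ N)%N; set r := (x %% N)%N => e.
have -> : (x - q = q * n + r)%N by rewrite {1}e mulnS -addnA addKn.
rewrite e; clearbody q r; clear.
have E : ((n + 1) * (n + 1) + ((n + 1) * (n + 1) + (q * (n + 1) + r)) * (2 * n) +
  ((n + 1) * (n + 1) + 2 * r) = ((n + 1) * (n + 1) + (q * n + r)) * (2 * (n + 1)))%N by ring.
by rewrite -(addn1 n) -E leq_addr.
Qed.

Definition bnum (L : seq (int * 'M[int]_N)) : nat := N * (sz L + 2 + N).

(** [bnum L] bounds the logarithms of the indices, so the number of rounds is doubly logarithmic in
    them. Each round multiplies the number of cones by at most [N]; the total therefore stays
    polynomial. *)
Definition bclk (L : seq (int * 'M[int]_N)) : seq unit :=
  nseq (N * size (bits (bnum L))) tt.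

Definition rdloop L := iter (size (bclk L)) (expand rdstep) L.

Lemma rdloopP (L : seq (int * 'M[int]_N)) v x : (forall c, c \in L -> good c.2) ->
  (forall c, c \in L -> `|\det c.2| <= (2 ^ (N * N + x))%N%:Z) -> (x < 2 ^ size (bits (bnum L)))%N ->
  [/\ cval (rdloop L) v = cval L v, forall c, c \in rdloop L -> good c.2
    & forall c, c \in rdloop L -> `|\det c.2| <= thr%:Z].
Proof.
move=> gL dL hx; pose Lk k := iter k (expand rdstep) L.
have hk k : [/\ cval (Lk k) v = cval L v, forall c, c \in Lk k -> good c.2
   & forall c, c \in Lk k -> `|\det c.2| <= thr%:Z \/ `|\det c.2| <= (2 ^ (N * N + iter k gx x))%N%:Z].
  elim: k => [|k [h1 h2 h3]]; first by split=> // c hc'; right; apply: dL.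
  split.
  - rewrite /Lk iterS (@cval_expand _ _ _ _ 1) ?mulr1 // => c hc'.
    by have [-> _] := rdstepP v (h2 _ hc'); rewrite mulr1.
  - by apply: (@expandP _ (fun B => good B) (fun B => good B)) => // B d gB; have [_] := rdstepP v gB; exact.
  - pose P B := good B /\ (`|\det B| <= thr%:Z \/ `|\det B| <= (2 ^ (N * N + iter k gx x))%N%:Z).
    pose Q B := `|\det B| <= thr%:Z \/ `|\det B| <= (2 ^ (N * N + iter k.+1 gx x))%N%:Z.
    apply: (@expandP _ P Q) => [c hc'|B d [gB [hB|hB]] hd]; first by split; [exact: h2|exact: h3].
      by left; move: hd; rewrite /rdstep hB inE => /eqP ->.
    exact: rdstep_det hB hd.
have [h1 h2 h3] := hk (size (bclk L)); split=> // c hc'.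
case: (h3 c hc') => // h; apply: le_trans h _; rewrite size_nseq /thr lez_nat leq_exp2l //.
by rewrite leq_add2l ltnW // gx_iter.
Qed.

End Reduction.

(** * Rational cones as disjoint unions of free semigroups *)

Fixpoint conein (n : nat) (p : 'rV[int]_n) (gs : seq 'rV[int]_n) (v : 'rV[int]_n) : Prop :=
  if gs is g :: gs' then exists k : nat, conein p gs' (v - g *+ k) else v = p.

Definition indep (n : nat) (gs : seq 'rV[int]_n) := forall c : nat -> int,
  \sum_(i < size gs) c i *: nth 0 gs i = 0 -> forall i, (i < size gs)%N -> c i = 0.

Lemma coneinP n (I : eqType) (l : seq I) (g : I -> 'rV[int]_n) p v : uniq l ->
  conein p [seq g i | i <- l] v <->
  exists s : I -> nat, v = p + \sum_(i <- l) g i *+ s i.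
Proof.
elim: l v => [|i l IH] v /=.
  by move=> _; split=> [->|[s]]; rewrite ?big_nil ?addr0 //; exists (fun=> 0%N); rewrite big_nil addr0.
move=> /andP[il ul]; split=> [[k /(IH _ ul)[s e]]|[s e]].
  exists (fun j => if j == i then k else s j); rewrite big_cons eqxx.
  have -> : \sum_(j <- l) g j *+ (if j == i then k else s j) = \sum_(j <- l) g j *+ s j.
    rewrite big_seq [RHS]big_seq; apply: eq_bigr => j hj.
    by case: eqP => // ej; move: il; rewrite -ej hj.
  by rewrite addrCA -e addrC subrK.
exists (s i); apply/(IH _ ul); exists s.
by rewrite e big_cons addrCA [LHS]addrC addKr.
Qed.

Section Terms.
Variable n : nat.
Local Notation N := n.+1.
Implicit Types (B : 'M[int]_N).

Definition tl (r : 'rV[int]_N) : 'rV[int]_n := \row_j r 0 (lift ord0 j).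
Definition hom (v : 'rV[int]_n) : 'rV[int]_N :=
  \row_i (if unlift ord0 i is Some j then v 0 j else 1).

Lemma hom0 v : hom v 0 0 = 1.
Proof. by rewrite mxE unlift_none. Qed.

Lemma homS v j : hom v 0 (lift ord0 j) = v 0 j.
Proof. by rewrite mxE liftK. Qed.

Lemma rowN_eq (x y : 'rV[int]_N) : x 0 0 = y 0 0 -> tl x = tl y -> x = y.
Proof.
move=> h0 h; apply/rowP => i; case: (unliftP ord0 i) => [j ->|->] //.
by have /rowP/(_ j) := h; rewrite !mxE.
Qed.

Definition zdiv (a b : int) : int := if 0 < b then (a %/ b)%Z else 0.
(** Facet [i] belongs to the half-open cone iff the perturbation points inwards there. *)
Definition closedc B i := lexpos [seq dualmx B k i | k <- enum 'I_N].

Definition Kt := {ffun 'I_N -> 'I_(thr n).+1}.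
Definition kvec (k : Kt) : 'rV[int]_N := \row_i (k i : nat)%:Z.
Definition pvec B k : 'rV[int]_N := \row_l zdiv ((kvec k *m B) 0 l) `|\det B|.

(** [k / |\det B|] are the coordinates of an integer point of the half-open parallelepiped: in
    [[0, 1)] along closed facets, in [(0, 1]] along open ones. Bounded index makes [Kt] a fixed
    finite set. *)
Definition valid B k :=
  [forall i, if closedc B i then kvec k 0 i < `|\det B|
             else (0 < kvec k 0 i) && (kvec k 0 i <= `|\det B|)]
  && [forall l, pvec B k 0 l * `|\det B| == (kvec k *m B) 0 l].

Lemma dualmxKl B : dualmx B *m B = `|\det B|%:M.
Proof.
rewrite /dualmx -scalemxAl mul_adj_mx -mul_mx_adj scalemxAr; exact: dualmxK.
Qed.

Lemma validP B k : \det B != 0 -> valid B k -> `|\det B| *: pvec B k = kvec k *m B.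
Proof.
move=> dB /andP[_ /forallP h]; apply/rowP => l; have /eqP := h l => <-.
by rewrite [LHS]mxE mulrC.
Qed.

Definition comb B (s : 'I_N -> nat) : 'rV[int]_N := (\row_i (s i)%:Z) *m B.

Lemma coords_comb B k s V : \det B != 0 -> valid B k -> V = pvec B k + comb B s ->
  forall i, (V *m dualmx B) 0 i = kvec k 0 i + `|\det B| * (s i)%:Z.
Proof.
move=> dB hk eV i; have D0 : `|\det B| != 0 by rewrite normr_eq0.
have : `|\det B| *: (V *m dualmx B) = `|\det B| *: (kvec k + `|\det B| *: \row_i (s i)%:Z).
  rewrite eV mulmxDl scalerDr scalemxAl validP // -!mulmxA dualmxK !mul_mx_scalar.
  by rewrite scalerDr.
move/(congr1 (fun M : 'rV[int]_N => M 0 i)); rewrite [LHS]mxE [RHS]mxE => /(mulfI D0) ->.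
by rewrite [LHS]mxE; congr (_ + _); rewrite !mxE.
Qed.

Lemma valid_range B k i : valid B k ->
  if closedc B i then kvec k 0 i < `|\det B| else (0 < kvec k 0 i) && (kvec k 0 i <= `|\det B|).
Proof. by case/andP => /forallP/(_ i). Qed.

Lemma kvec_ge0 k i : 0 <= kvec k 0 i.
Proof. by rewrite mxE. Qed.

Lemma comb_unique B k k' s s' : \det B != 0 -> valid B k -> valid B k' ->
  pvec B k + comb B s = pvec B k' + comb B s' -> k = k' /\ s =1 s'.
Proof.
move=> dB hk hk' e.
have E i : kvec k 0 i = kvec k' 0 i /\ s i = s' i.
  have D0 : 0 < `|\det B| by rewrite normr_gt0.
  have h1 := coords_comb dB hk erefl i; have h2 := coords_comb dB hk' e i.
  rewrite h1 in h2; have r1 := valid_range i hk; have r2 := valid_range i hk'.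
  have := kvec_ge0 k i; have := kvec_ge0 k' i; move: h2 r1 r2 D0.
  move: (kvec k 0 i) (kvec k' 0 i) `|\det B| => x y D.
  move: (s i) (s' i) => a b h2 r1 r2 D0 hy hx; have M (c d : nat) : (c < d)%N -> D * c%:Z + D <= D * d%:Z.
    by move=> cd; rewrite -[X in _ + X]mulr1 -mulrDr ler_pM2l //; lia.
  case: (ltngtP a b) => [/M|/M|eab]; last by subst b; split=> //; lia.
    by move: r1 r2; case: (closedc B i); lia.
  by move: r1 r2; case: (closedc B i); lia.
split=> [|i]; last by have [] := E i.
apply/ffunP => i; apply: val_inj; have [] := E i; rewrite !mxE => -[] //.
Qed.

(** Euclidean division of the coordinates by [|\det B|], shifted by 1 along open facets, separates
    the parallelepiped point from the combination of generators. *)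
Lemma hc_comb B V : \det B != 0 -> `|\det B| <= (thr n)%:Z ->
  hc B V <-> exists k s, valid B k /\ V = pvec B k + comb B s.
Proof.
move=> dB hB; have D0 : 0 < `|\det B| by rewrite normr_gt0.
have Dn : `|\det B| != 0 by rewrite gt_eqF.
split=> [/forallP h|[k [s [hk eV]]]]; last first.
  apply/forallP => i; rewrite /coords /= (coords_comb dB hk eV) -/(closedc B i).
  have := valid_range i hk; have := kvec_ge0 k i.
  have : 0 <= `|\det B| * (s i)%:Z by rewrite mulr_ge0.
  move: (`|\det B| * _) (kvec k 0 i) => y x hy hx; case: (closedc B i) => hr.
    by case: ltrgtP => //; lia.
  by rewrite (_ : 0 < _) //; lia.
pose x i := (V *m dualmx B) 0 i.
have hx i : if closedc B i then 0 <= x i else 1 <= x i.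
  have := h i; rewrite /coords /= -/(closedc B i) -/(x i).
  by case: (closedc B i); rewrite ?andbF ?andbT; lia.
pose c i : int := if closedc B i then 0 else 1.
have hc0 i : 0 <= x i - c i by have := hx i; rewrite /c; case: (closedc B i); lia.
pose r i := ((x i - c i) %% `|\det B|)%Z + c i.
have r1 i : 0 <= ((x i - c i) %% `|\det B|)%Z < `|\det B|.
  by rewrite modz_ge0 // ltz_pmod.
have r2 i : (absz (r i) < (thr n).+1)%N.
  rewrite ltnS -lez_nat; apply: le_trans hB.
  by have := r1 i; rewrite /r /c; case: (closedc B i); lia.
pose k : Kt := [ffun i => Ordinal (r2 i)].
have kE i : kvec k 0 i = r i.
  by rewrite mxE ffunE /=; have := r1 i; rewrite /r /c; case: (closedc B i); lia.
pose s i := absz ((x i - c i) %/ `|\det B|)%Z.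
have sE i : (s i)%:Z = ((x i - c i) %/ `|\det B|)%Z.
  by rewrite /s gez0_abs // divz_ge0.
have xE : V *m dualmx B = kvec k + `|\det B| *: \row_i (s i)%:Z.
  apply/rowP => i; rewrite -/(x i) [RHS]mxE kE [X in _ + X]mxE mxE sE /r.
  by have := divz_eq (x i - c i) `|\det B|; lia.
have kB : kvec k *m B = `|\det B| *: (V - comb B s).
  have -> : kvec k = V *m dualmx B - `|\det B| *: \row_i (s i)%:Z by rewrite xE addrK.
  by rewrite mulmxBl -mulmxA dualmxKl mul_mx_scalar scalerBr -scalemxAl.
have pE : pvec B k = V - comb B s.
  apply/rowP => l; rewrite [LHS]mxE kB [X in zdiv X]mxE /zdiv D0 mulrC.
  by rewrite mulzK.
exists k, s; split; last by rewrite pE subrK.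
apply/andP; split; apply/forallP => i.
  by rewrite kE /r /c; have := r1 i; case: (closedc B i); lia.
by rewrite pE kB [X in _ == X]mxE mulrC.
Qed.

(** The optional index names the single generator of height one used when the parallelepiped point
    has height zero. *)
Definition Jt := (Kt * option 'I_N)%type.

Definition jok B (j : Jt) := valid B j.1 &&
  (if j.2 is Some i then (pvec B j.1 0 0 == 0) && (B i 0 == 1) else pvec B j.1 0 0 == 1).

Definition jpt B (j : Jt) : 'rV[int]_n :=
  tl (pvec B j.1 + (if j.2 is Some i then row i B else 0)).

Definition gens B := [seq tl (row i B) | i <- enum 'I_N & B i 0 == 0].

Definition cterms B := [seq (jpt B j, gens B) | j <- enum {: Jt} & jok B j].

Lemma tl_hom v : tl (hom v) = v.
Proof. by apply/rowP => j; rewrite mxE homS. Qed.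

Lemma tlD x y : tl (x + y) = tl x + tl y.
Proof. by apply/rowP => j; rewrite !mxE. Qed.

Lemma combE B s : comb B s = \sum_i row i B *+ s i.
Proof.
rewrite /comb mulmx_sum_row; apply: eq_bigr => i _; rewrite mxE.
by rewrite -[(s i)%:Z]natz scaler_nat.
Qed.

Lemma tl_sum (I : Type) (l : seq I) (P : pred I) F : tl (\sum_(i <- l | P i) F i) = \sum_(i <- l | P i) tl (F i).
Proof. by apply: (big_morph tl tlD); apply/rowP => j; rewrite !mxE. Qed.

Lemma tlMn x k : tl (x *+ k) = tl x *+ k.
Proof. by apply/rowP => j; rewrite !mxE !mulmxnE !mxE. Qed.

Lemma jok_contains B j v : jok B j ->
  conein (jpt B j) (gens B) v <-> exists s, hom v = pvec B j.1 + comb B s /\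
    forall i, B i 0 != 0 -> s i = (j.2 == Some i) :> nat.
Proof.
move=> /andP[_ hj]; have ue : uniq [seq i <- enum 'I_N | B i 0 == 0] by rewrite filter_uniq ?enum_uniq.
have E s : (forall i, B i 0 != 0 -> s i = (j.2 == Some i) :> nat) ->
   comb B s = \sum_(i <- enum 'I_N | B i 0 == 0) row i B *+ s i +
      (if j.2 is Some i then row i B else 0).
  move=> hs; rewrite combE (bigID (fun i => B i 0 == 0)) /= big_enum_cond /=; congr (_ + _).
  case: (j.2) hj hs => [i0|] hj hs.
    have b1 : B i0 0 != 0 by case/andP: hj => _ /eqP ->.
    rewrite (bigD1 i0) //= hs // eqxx mulr1n big1 ?addr0 // => i /andP[b ne].
    by rewrite hs // (_ : (Some i0 == Some i) = false) ?mulr0n //; apply/negbTE; rewrite eq_sym.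
  by rewrite big1 // => i b; rewrite hs.
have row0 s : (\sum_(i <- enum 'I_N | B i 0 == 0) row i B *+ s i) 0 0 = 0.
  rewrite summxE big1 // => i /eqP b; rewrite mulmxnE mxE b mul0rn //.
have p0 : (pvec B j.1 + (if j.2 is Some i then row i B else 0)) 0 0 = 1.
  rewrite [LHS]mxE; case: (j.2) hj => [i|] /=.
    by move=> /andP[/eqP -> /eqP b]; rewrite mxE b.
  by move=> /eqP ->; rewrite mxE.
split=> [/(coneinP _ _ _ ue)[s e]|[s [e hs]]].
  pose s' i : nat := if B i 0 == 0 then s i else j.2 == Some i.
  have hs' i : B i 0 != 0 -> s' i = (j.2 == Some i) :> nat by rewrite /s' => /negPf ->.
  exists s'; split=> //; rewrite E // [X in _ + X]addrC addrA; apply: rowN_eq.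
    by rewrite hom0 [RHS]mxE p0 row0 addr0.
  rewrite tl_hom e tlD; congr (_ + _); rewrite tl_sum big_filter; apply: eq_bigr => i b.
  by rewrite tlMn /s' b.
apply/(coneinP _ _ _ ue); exists s; rewrite -[LHS]tl_hom e E // [X in _ + X]addrC addrA tlD.
by congr (_ + _); rewrite tl_sum big_filter; apply: eq_bigr => i b; rewrite tlMn.
Qed.

Lemma gens_indep B : \det B != 0 -> indep (gens B).
Proof.
move=> dB c; rewrite /gens; set l := [seq i <- _ | _].
have ul : uniq l by rewrite filter_uniq ?enum_uniq.
rewrite size_map => h i hi.
pose cc : 'rV[int]_N := \row_k (if k \in l then c (index k l) else 0).
have ccB : cc *m B = 0.
  have e : cc *m B = \sum_(k <- l) c (index k l) *: row k B.
    rewrite mulmx_sum_row big_filter [RHS]big_enum_cond /= [RHS]big_mkcond /=.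
    apply: eq_bigr => k _; rewrite mxE mem_filter mem_enum andbT.
    by case: ifP => // _; rewrite scale0r.
  apply: rowN_eq.
    rewrite e [RHS]mxE summxE big_seq big1 // => k; rewrite mem_filter => /andP[/eqP b _].
    by rewrite !mxE b mulr0.
  have -> : tl (0 : 'rV[int]_N) = 0 by apply/rowP => q; rewrite !mxE.
  apply: etrans h; rewrite e tl_sum (big_nth ord0) big_mkord; apply: eq_bigr => q _.
  rewrite index_uniq ?size_map // (nth_map ord0) //.
  by apply/rowP => z; rewrite !mxE.
have : cc = 0.
  apply: (zscale_eq0 dB); rewrite -mul_mx_scalar -mul_mx_adj mulmxA ccB mul0mx //.
move/rowP/(_ (nth ord0 l i)); rewrite !mxE mem_nth // index_uniq //.
Qed.

(** Height one is a sum of nonnegative integers: either the parallelepiped point has height one, or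
    exactly one generator of height one occurs, once. All other generators that occur have height
    zero. *)
Lemma cterms_sum B v : good B -> `|\det B| <= (thr n)%:Z ->
  \sum_(T <- cterms B) (nat_of_bool `[< conein T.1 T.2 v >])%:Z = (hc B (hom v) : nat)%:Z.
Proof.
move=> /andP[dB /forallP tB] hB; rewrite /cterms big_map big_filter big_enum_cond /=.
have sum1 k s : valid B k -> hom v = pvec B k + comb B s ->
    1 = pvec B k 0 0 + \sum_i (s i)%:Z * B i 0 /\ 0 <= pvec B k 0 0.
  move=> hk e; split.
    by rewrite -(hom0 v) e [LHS]mxE; congr (_ + _); rewrite mxE; apply: eq_bigr => i _; rewrite [X in X * _]mxE.
  have D0 : 0 < `|\det B| by rewrite normr_gt0.
  rewrite -(pmulr_rge0 _ D0); have := congr1 (fun M : 'rV[int]_N => M 0 0) (validP dB hk).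
  rewrite [LHS]mxE => ->; rewrite mxE; apply: sumr_ge0 => i _.
  by rewrite mulr_ge0 ?kvec_ge0 ?tB.
have [h|h] := boolP (hc B (hom v)); last first.
  rewrite big1 // => j hj; rewrite asboolF // => /(jok_contains _ hj)[s [e _]].
  case/negP: h; apply/(hc_comb _ dB hB); exists j.1, s; split=> //; by case/andP: hj.
have [k [s [hk e]]] := (hc_comb _ dB hB).1 h.
have [s1 p0] := sum1 _ _ hk e.
have nn i : 0 <= (s i)%:Z * B i 0 by rewrite mulr_ge0 ?tB.
pose o : option 'I_N := [pick i | (s i)%:Z * B i 0 != 0].
have [hok hs] : jok B (k, o) /\ forall i, B i 0 != 0 -> s i = (o == Some i) :> nat.
  rewrite /jok /= hk /= /o; case: pickP => [i0 hi0|hz]; last first.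
    split; first by apply/eqP; rewrite [RHS]s1 big1 ?addr0 // => i _; apply/eqP; rewrite -[_ == _]negbK hz.
    by move=> i b; have := hz i; rewrite mulf_eq0 (negPf b) orbF => /eqP/eqP; rewrite eqz_nat => /eqP.
  have hi1 : 1 <= (s i0)%:Z * B i0 0 by have := nn i0; move: hi0; lia.
  rewrite (bigD1 i0) //= in s1; have r0 : 0 <= \sum_(i < N | i != i0) (s i)%:Z * B i 0 by apply: sumr_ge0.
  have [e1 e0 pz] : [/\ (s i0)%:Z * B i0 0 = 1, \sum_(i < N | i != i0) (s i)%:Z * B i 0 = 0 & pvec B k 0 0 = 0].
    move: s1 p0 hi1 r0; move: (pvec B k 0 0) (_ * _) (\sum_(i < N | _) _) => P Q R s1 p0 hi1 r0.
    by split; lia.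
  have b1 : B i0 0 = 1.
    by have := tB i0; case: (B i0 0) e1 => // m; rewrite -PoszM => -[] /eqP; rewrite muln_eq1 => /andP[_ /eqP ->].
  split; first by apply/andP; split; [apply/eqP|apply/eqP].
  move=> i b; have [->|ne] := eqVneq i i0.
    by rewrite eqxx; move: e1; rewrite b1 mulr1 => -[].
  rewrite (_ : (Some i0 == Some i) = false); last by apply/negbTE; rewrite eq_sym.
  have /allP/(_ i (mem_index_enum _)) : all (fun i => (i != i0) ==> ((s i)%:Z * B i 0 == 0)) (index_enum 'I_N).
    by rewrite -psumr_eq0 ?e0.
  by rewrite ne /= mulf_eq0 (negPf b) orbF eqz_nat => /eqP.
rewrite (bigD1 (k, o)) //= asboolT; last by apply/(jok_contains _ hok); exists s.
rewrite big1 ?addr0 // => j /andP[hj ne]; rewrite asboolF // => /(jok_contains _ hj)[s' [e' hs']].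
have vj : valid B j.1 by case/andP: hj.
have [ek es] := comb_unique dB hk vj (etrans (esym e) e').
case/eqP: ne; rewrite [j]surjective_pairing -ek; congr (_, _).
have so i : B i 0 != 0 -> (o == Some i) = (j.2 == Some i).
  by move=> b; have := hs i b; rewrite es hs' //; case: (_ == _); case: (_ == _).
have nzo (j' : Jt) i : jok B j' -> j'.2 = Some i -> B i 0 != 0.
  by move=> /andP[_ h2] e2; move: h2; rewrite e2 => /andP[_ /eqP ->].
case e2: (j.2) => [i|].
  by have := so i (nzo _ _ hj e2); rewrite e2 eqxx => /eqP ->.
case e3: o => [i|] //; have := so i (nzo (k, o) _ hok e3).
by rewrite e2 e3 eqxx.
Qed.

End Terms.

(** * Polynomial time of the cone decompositions *)

Lemma PT_mapfc (X Y : encType) (T : Type) (F : X -> T -> Y) (P : X -> T -> bool) (s : seq T) :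
  (forall t, PT (F^~ t)) -> (forall t, PT (P^~ t)) ->
  PT (fun x => [seq F x t | t <- s & P x t]).
Proof.
move=> hF hP; elim: s => [|t s IH] /=; first exact: PT_cst.
by apply: PT_ext (PT_if (hP t) (PT_cons (hF t) IH) IH) => x /=; case: (P x t).
Qed.

Lemma PT_sgz (X : encType) (f : X -> int) : PT f -> PT (fun x => sgz (f x)).
Proof.
move=> hf; have c (z : int) := PT_cst X z.
apply: PT_ext (PT_if (PT_ltz0 hf) (c (-1)) (PT_if (PT_eqz hf (c 0)) (c 0) (c 1))) => x.
by case: (ltrgtP (f x) 0) => h; rewrite ?(ltr0_sgz h) ?(gtr0_sgz h) ?h.
Qed.

Lemma PT_normz (X : encType) (f : X -> int) : PT f -> PT (fun x => `|f x|).
Proof. by move=> hf; apply: PT_ext (PT_posz (PT_absz hf)) => x; rewrite abszE. Qed.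

Lemma PT_row (X : encType) m n (A : X -> 'M[int]_(m, n)) i : PT A -> PT (fun x => row i (A x)).
Proof. by move=> hA; apply: PT_mx => k l; apply: PT_ext (PT_mxE i l hA) => x; rewrite [RHS]mxE. Qed.

Lemma PT_reprow (X : encType) n (B : X -> 'M[int]_n.+1) i w : PT B -> PT w ->
  PT (fun x => reprow (B x) i (w x)).
Proof.
move=> hB hw; apply: PT_mx => k l; case e: (k == i).
  by apply: PT_ext (PT_mxE 0 l hw) => x; rewrite [RHS]mxE e.
by apply: PT_ext (PT_mxE k l hB) => x; rewrite [RHS]mxE e.
Qed.

Lemma PT_csplit (X : encType) n (B : X -> 'M[int]_n.+1) w : PT B -> PT w ->
  PT (fun x => csplit (B x) (w x)).
Proof.
move=> hB hw; apply: PT_mapfc => i; have hd := PT_det (PT_reprow i hB hw).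
  by apply: PT_pair; [apply/PT_sgz/PT_mulz => //; exact: PT_det|exact: PT_reprow].
by apply/PT_negb/PT_eqz => //; exact: PT_cst.
Qed.

Lemma PT_expand (X : encType) n (f : X -> 'M[int]_n.+1 -> seq (int * 'M[int]_n.+1)) L :
  PT (fun p : X * 'M[int]_n.+1 => f p.1 p.2) -> PT L -> PT (fun x => expand (f x) (L x)).
Proof.
move=> hf hL; apply: PT_flatten.
apply: (PT_map (F := fun (x : X) (c : int * 'M[int]_n.+1) => [seq (c.1 * d.1, d.2) | d <- f x c.2])) => //.
apply: (PT_map (F := fun (p : X * (int * 'M[int]_n.+1)) (d : int * 'M[int]_n.+1) => (p.2.1 * d.1, d.2))).
  apply: PT_pair; last exact/PT_snd/PT_snd/PT_id.
  by apply: PT_mulz; [exact/PT_fst/PT_snd/PT_fst/PT_id|exact/PT_fst/PT_snd/PT_id].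
apply: (PT_app2 hf); [exact/PT_fst/PT_id|exact/PT_snd/PT_snd/PT_id].
Qed.

Lemma PT_hfilter (X : encType) n (a : X -> 'cV[int]_n.+1) L : PT a -> PT L ->
  PT (fun x => hfilter (a x) (L x)).
Proof.
move=> ha hL; pose E := (X * 'M[int]_n.+1)%type.
have ha' : PT (fun p : E => a p.1) by exact: (PT_comp (PT_fst (PT_id _)) ha).
have hB : PT (fun p : E => p.2) by exact/PT_snd/PT_id.
have hg := PT_mulmx hB ha'; have c0 := PT_cst E (0 : int).
apply: PT_expand.
  apply: PT_if; last exact: PT_cst.
    by apply: PT_forall => k; apply: PT_lez => //; apply: PT_mxE.
  by apply: PT_cons; [apply: PT_pair => //; exact: PT_cst|exact: PT_cst].
suff h k : PT (fun x => iter k (expand (hstep (a x))) (L x)) by exact: h.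
elim: k => [|k IH] //=; apply: PT_expand => //.
rewrite /hstep /hpick; apply: (@PT_pick _ _ _ _
  (fun p o => if o is Some ij then csplit p.2 (hvec p.2 (a p.1) ij) else [:: (1, p.2)])).
  by move=> ij; apply: PT_andb; apply: PT_ltz => //; apply: PT_mxE.
case=> [ij|]; last by apply: PT_cons; [apply: PT_pair => //; exact: PT_cst|exact: PT_cst].
apply: PT_csplit => //; apply: PT_mx => i l.
have := PT_subz (PT_mulz (PT_mxE ij.1 0 hg) (PT_mxE ij.2 l hB)) (PT_mulz (PT_mxE ij.2 0 hg) (PT_mxE ij.1 l hB)).
by apply: PT_ext => p; rewrite [RHS]mxE.
Qed.

Lemma PT_posdet (X : encType) n (B : X -> 'M[int]_n.+1) w : PT B -> PT w ->
  PT (fun x => [exists i, 0 < \det (reprow (B x) i (w x)) * \det (B x)]).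
Proof.
move=> hB hw; apply: PT_exists => i; apply: PT_ltz; first exact: PT_cst.
by apply: PT_mulz; [exact/PT_det/PT_reprow|exact: PT_det].
Qed.

Lemma PT_oppmx (X : encType) m n (A : X -> 'M[int]_(m, n)) : PT A -> PT (fun x => - A x).
Proof. by move=> hA; apply: PT_mx => i j; apply: PT_ext (PT_oppz (PT_mxE i j hA)) => x; rewrite oppmxE. Qed.

Lemma PT_rvec n : PT (@rvec n).
Proof.
have hB := PT_id (mx_enc n.+1 n.+1); have ha := PT_adj hB.
have hw : PT (fun B : 'M[int]_n.+1 => row 0 (Red (\adj B *m (\adj B)^T))).
  by apply/PT_row/(PT_comp _ (@PT_Red _))/PT_mulmx => //; exact: PT_trmx.
have c0 := PT_cst (mx_enc n.+1 n.+1) (0 : int).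
apply: PT_if => //; last exact: PT_oppmx.
apply: PT_orb; first by apply: PT_ltz => //; exact: PT_mxE.
by apply: PT_andb; [apply: PT_eqz => //; exact: PT_mxE|exact: PT_posdet].
Qed.

Lemma PT_rdstep n : PT (@rdstep n).
Proof.
have hB := PT_id (mx_enc n.+1 n.+1); have hw := PT_rvec n.
have h1 : PT (fun B : 'M[int]_n.+1 => [:: ((1 : int), B)]).
  by apply: PT_cons; [apply: PT_pair => //; exact: PT_cst|exact: PT_cst].
apply: PT_if => //; first by apply: PT_lez; [exact/PT_normz/PT_det|exact: PT_cst].
apply: PT_if => //; last exact: PT_csplit.
apply: PT_andb; first by apply: PT_lez; [exact: PT_cst|exact: PT_mxE].
apply: PT_andb; last exact: PT_posdet.
apply: PT_forall => l; apply: PT_lez; first exact/PT_normz/PT_mxE.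
by apply: PT_sumz => k; [exact/PT_normz/PT_mxE|exact: PT_cst].
Qed.

Lemma PT_sizen (X Y : encType) (l : X -> seq Y) : PT l -> PT (fun x => size (l x)).
Proof.
move=> hl; pose op (x : X) (m : nat) (y : Y) := (m + 1)%N.
have e x s m : foldl (op x) m s = (m + size s)%N by elim: s m => [|y s IH] m /=; rewrite ?addn0 // IH /op; lia.
have h : PT (fun x => foldl (op x) 0%N (l x)).
  apply: (@PT_foldl _ _ _ op (fun=> 0%N) l (fun x => 4 * sz (l x) + 1)%N) => //.
  - by apply: PT_addn; [exact/PT_fst/PT_snd/PT_id|exact: PT_cst].
  - exact: PT_cst.
  - by pbdt.
  - move=> x k; rewrite e add0n; apply: sz_nat_le; apply: leq_trans (ltn_expl _ (isT : (1 < 2)%N)) _.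
    by rewrite leq_exp2l // size_take_min geq_min (ltnW (sz_size _)) orbT.
by apply: PT_ext h => x; rewrite e.
Qed.

Lemma PT_bnum n : PT (@bnum n).
Proof.
apply: PT_muln; first exact: PT_cst; apply: PT_addn; last exact: PT_cst.
by apply: PT_ext (PT_sizen (PT_clock _)) => L; rewrite size_nseq.
Qed.

Lemma PT_bclk n : PT (@bclk n).
Proof.
have h := PT_bits (PT_bnum n).
have h1 := PT_map (F := fun _ _ => tt) (PT_cst _ tt) h.
have : PT (fun L : seq (int * 'M[int]_n.+1) => flatten [seq [seq tt | y <- bits (bnum L)] | i <- iota 0 n.+1]).
  by apply: PT_flatten; apply: (@PT_mapc _ _ _ (fun L _ => [seq tt | y <- bits (bnum L)])).
apply: PT_ext => L; rewrite /bclk -[in RHS](size_iota 0 n.+1).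
have e (s : seq bool) : [seq tt | _ <- s] = nseq (size s) tt by elim: s => //= b s ->.
by elim: (iota _ _) => [|i s IH] //=; rewrite IH e mulSn nseqD.
Qed.

Lemma size_csplit n (B : 'M[int]_n.+1) w : (size (csplit B w) <= n.+1)%N.
Proof. by rewrite size_map size_filter (leq_trans (count_size _ _)) // size_enum_ord. Qed.

Section LoopBound.
Variable n : nat.
Local Notation N := n.+1.

Definition bounded (M K : nat) (L : seq (int * 'M[int]_N)) :=
  all (fun c : int * 'M[int]_N => (absz c.1 <= M)%N && [forall i, forall j, (absz (c.2 i j) <= K)%N]) L.

Lemma rdstep_size (B : 'M[int]_N) : (size (rdstep B) <= N)%N.
Proof. by rewrite /rdstep; case: ifP => // _; case: ifP => // _; apply: size_csplit. Qed.

Lemma rdstep_bounded (B : 'M[int]_N) K : (forall i j, (absz (B i j) <= K)%N) ->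
  bounded 1 (N * K) (rdstep B).
Proof.
move=> h; have h0 : bounded 1 (N * K) [:: (1, B)].
  rewrite /bounded /= andbT; apply/forallP => i; apply/forallP => j.
  by apply: leq_trans (h i j) _; rewrite leq_pmull.
rewrite /rdstep; case: ifP => // _; case: ifP => // /and3P[_ /forallP hw _].
apply/allP => d /mapP[i _ ->] /=; apply/andP; split.
  by case: (ltrgtP (\det (reprow B i (rvec B)) * \det B) 0) => s; rewrite ?(ltr0_sgz s) ?(gtr0_sgz s) ?s.
apply/forallP => k; apply/forallP => l; rewrite mxE; case: eqP => _; last first.
  by apply: leq_trans (h k l) _; rewrite leq_pmull.
rewrite -lez_nat abszE; apply: le_trans (hw l) _.
apply: (@le_trans _ _ (\sum_(k < N) K%:Z)).
  by apply: ler_sum => q _; rewrite -abszE lez_nat.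
by rewrite sumr_const card_ord -mulr_natl natz PoszM.
Qed.

Lemma expand_bounded M K L : bounded M K L ->
  bounded M (N * K) (expand (@rdstep n) L) /\ (size (expand (@rdstep n) L) <= N * size L)%N.
Proof.
move=> /allP h; split.
  apply/allP => c /flattenP[s /mapP[c0 hc0 ->] /mapP[d hd ->]] /=.
  have /andP[m1 /forallP k1] := h _ hc0.
  have /allP/(_ d hd)/andP[m2 k2] := rdstep_bounded (fun i j => forallP (k1 i) j).
  rewrite k2 andbT abszM; apply: leq_trans (leq_mul m1 m2) _; by rewrite muln1.
rewrite /expand; elim: L {h} => [|c L IH] //=.
by rewrite size_cat size_map mulnS leq_add // rdstep_size.
Qed.

Lemma sz_bounded (k : nat) L : bounded (2 ^ k) (2 ^ k) L ->
  (sz L <= size L * (N * N * (4 * k.+1 + 6) + 4 * k.+1 + 8) + 1)%N.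
Proof.
move=> /allP h.
apply: leq_trans (@sz_seq_le _ L (N * N * (4 * k.+1 + 6) + 4 * k.+1 + 7) _) _; last first.
  by rewrite -addnS.
move=> s1 c s2 e; have /h /andP[h1 /forallP h2] : c \in L by rewrite e mem_cat inE eqxx orbT.
have a1 : (sz c.1 <= 4 * k.+1 + 5)%N by apply: sz_int_le; apply: leq_ltn_trans h1 _; rewrite ltn_exp2l.
have a2 : (sz c.2 <= N * N * (4 * k.+1 + 6) + 1)%N.
  by apply: sz_mx_le => i j; apply: leq_ltn_trans (forallP (h2 i) j) _; rewrite ltn_exp2l.
have -> : sz c = (sz c.1 + sz c.2).+1 by case: (c) => ? ?; exact: sz_pair.
by have := leq_add a1 a2; move: (sz _ + sz _)%N => q; lia.
Qed.

Lemma PT_rdloop : PT (@rdloop n).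
Proof.
pose B (L : seq (int * 'M[int]_N)) : nat :=
  (((4 * bnum L) ^ (N * N) * sz L) * (N * N * (4 * (N * (N * (4 * bnum L)) + sz L).+1 + 6) + 4 * (N * (N * (4 * bnum L)) + sz L).+1 + 8) + 1)%N.
have hb := PT_bnum n; have hid := PT_id (seq_enc (prod_enc int_enc (mx_enc N N))).
apply: (@PT_loop _ _ (@bclk n) id (fun _ => expand (@rdstep n)) B).
- exact: PT_bclk.
- exact: PT_id.
- apply: PT_expand; last exact/PT_snd/PT_id.
  exact: (PT_comp (PT_snd (PT_id _)) (PT_rdstep n)).
- have hn : pbd (@bnum n).
    apply: (@pbd_le _ _ (fun L => N * (sz L + 2 + N))%N) => //.
    by apply: pbd_mul; [exact: pbd_cst|apply: pbd_add; [apply: pbd_add; [exact: pbd_sz|exact: pbd_cst]|exact: pbd_cst]].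
  have hs : pbd (fun L : seq (int * 'M[int]_N) => sz L) by exact: pbd_sz.
  apply: (@pbd_le _ _ (fun L => ((4 * bnum L) ^ (N * N) * sz L) * (N * N * (4 * (N * (N * (4 * bnum L)) + sz L + 1) + 6) + 4 * (N * (N * (4 * bnum L)) + sz L + 1) + 8) + 1)%N).
    by move=> L; rewrite /B !addn1.
  by do ![apply: pbd_add|apply: pbd_mul|apply: pbd_exp|exact: pbd_cst|exact: hn|exact: hs].
move=> L k; rewrite size_nseq; set m := size (bits (bnum L)) => lek.
have b0 : bounded (2 ^ sz L) (2 ^ sz L) L.
  apply/allP => c hc'; have [s1 [s2 e]] : exists s1 s2, L = s1 ++ c :: s2.
    by case/splitPr: hc' => s1 s2; exists s1, s2.
  have hlt : (sz c < sz L)%N by rewrite e; exact: (@sz_mem (prod_enc int_enc (mx_enc N N))).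
  have e2 : sz c = (sz c.1 + sz c.2).+1 by case: (c) => ? ?; exact: sz_pair.
  apply/andP; split.
    apply: ltnW; apply: leq_trans (ltn_sz _) _; rewrite leq_exp2l //.
    apply: leq_trans (sz_absz c.1) _; apply: leq_trans (ltnW hlt); rewrite e2.
    exact: leq_trans (leq_addr _ _) (leqnSn _).
  apply/forallP => i; apply/forallP => j; apply: ltnW; apply: leq_trans (absz_entry _ _ _) _.
  rewrite leq_exp2l //; apply: leq_trans (ltnW hlt); rewrite e2.
  exact: leq_trans (leq_addl _ _) (leqnSn _).
have hk i : bounded (2 ^ sz L) (N ^ i * 2 ^ sz L) (iter i (expand (@rdstep n)) L) /\
    (size (iter i (expand (@rdstep n)) L) <= N ^ i * size L)%N.
  elim: i => [|i [h1 h2]]; first by rewrite expn0 !mul1n.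
  have [h3 h4] := expand_bounded h1; rewrite iterS expnS -!mulnA; split=> //.
  by apply: leq_trans h4 _; rewrite leq_mul2l h2 orbT.
have [h1 h2] := hk k; set Lk := iter k _ _ in h1 h2 *.
have m2 : (2 ^ m <= 4 * bnum L)%N.
  have b1 : (0 < bnum L)%N by rewrite /bnum muln_gt0 /= addnS.
  have : ~~ (size (bits (bnum L)) <= m.-1)%N.
    by rewrite -ltnNge prednK // /m ltnNge size_bits -ltnNge expn0.
  rewrite size_bits -leqNgt; case: (m) => [|m'] /=; first by lia.
  by rewrite expnS; lia.
(* From [k <= N * m] and [N <= 2 ^ N]; by [m2] the right-hand side is polynomial in [bnum L]. *)
have Nk : (N ^ k <= (2 ^ m) ^ (N * N))%N.
  apply: (@leq_trans (N ^ (N * m))); first by rewrite leq_pexp2l.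
  rewrite -expnM [(m * _)%N]mulnC -mulnA expnM; apply: (@leq_trans ((2 ^ N) ^ (N * m))); last by rewrite -expnM mulnA.
  by rewrite -expnM; apply: leq_trans (_ : _ <= (2 ^ N) ^ (N * m))%N _; [case: (N * m)%N => // q; rewrite leq_exp2r // ltnW // ltn_expl|rewrite -expnM].
have Nk' : (N ^ k <= 2 ^ (N * (N * (4 * bnum L))))%N.
  apply: leq_trans Nk _; rewrite -expnM leq_exp2l // [(m * _)%N]mulnC -mulnA !leq_mul2l.
  by apply/orP; right; apply/orP; right; apply: leq_trans (ltnW (ltn_expl m (isT : (1 < 2)%N))) m2.
have h3 : bounded (2 ^ (N * (N * (4 * bnum L)) + sz L)) (2 ^ (N * (N * (4 * bnum L)) + sz L)) Lk.
  apply/allP => c /(allP h1)/andP[a1 /forallP a2]; apply/andP; split.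
    by apply: leq_trans a1 _; rewrite leq_exp2l // leq_addl.
  apply/forallP => i; apply/forallP => j; apply: leq_trans (forallP (a2 i) j) _.
  by rewrite expnD leq_mul2r Nk' orbT.
apply: leq_trans (sz_bounded h3) _; rewrite /B leq_add2r leq_mul2r; apply/orP; right.
apply: leq_trans h2 _; apply: leq_mul; last exact/ltnW/sz_size.
apply: leq_trans Nk _; rewrite leq_exp2r //.
Qed.

End LoopBound.

Lemma PT_lexposc (X : encType) (T : Type) (F : X -> T -> int) (s : seq T) :
  (forall t, PT (F^~ t)) -> PT (fun x => lexpos [seq F x t | t <- s]).
Proof.
move=> hF; elim: s => [|t s IH] /=; first exact: PT_cst.
have c0 := PT_cst X (0 : int).
by apply: PT_orb; [exact: PT_ltz|apply: PT_andb => //; exact: PT_eqz].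
Qed.

Lemma PT_dualmx (X : encType) n (B : X -> 'M[int]_n.+1) : PT B -> PT (fun x => dualmx (B x)).
Proof.
move=> hB; apply: PT_mx => i j.
have := PT_mulz (PT_sgz (PT_det hB)) (PT_mxE i j (PT_adj hB)).
by apply: PT_ext => x; rewrite /dualmx [RHS]mxE.
Qed.

Lemma PT_tl (X : encType) n (r : X -> 'rV[int]_n.+1) : PT r -> PT (fun x => tl (r x)).
Proof. by move=> hr; apply: PT_mx => i j; apply: PT_ext (PT_mxE 0 (lift ord0 j) hr) => x; rewrite [RHS]mxE. Qed.

Lemma PT_addmx (X : encType) m n (A B : X -> 'M[int]_(m, n)) : PT A -> PT B -> PT (fun x => A x + B x).
Proof.
move=> hA hB; apply: PT_mx => i j; apply: PT_ext (PT_addz (PT_mxE i j hA) (PT_mxE i j hB)) => x.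
by rewrite [RHS]mxE.
Qed.

Lemma PT_cterms n : PT (@cterms n).
Proof.
have hB := PT_id (mx_enc n.+1 n.+1); have hD := PT_normz (PT_det hB).
have hk (k : Kt n) : PT (fun B : 'M[int]_n.+1 => kvec k *m B) by apply: PT_mulmx => //; exact: PT_cst.
have hp (k : Kt n) : PT (fun B : 'M[int]_n.+1 => pvec B k).
  by apply: PT_mx => i l; apply: PT_ext (PT_divz (PT_mxE 0 l (hk k)) hD) => B; rewrite [RHS]mxE.
have c (z : int) := PT_cst (mx_enc n.+1 n.+1) z.
apply: PT_mapfc => j.
  apply: PT_pair.
    apply: PT_tl; apply: PT_addmx => //; case: (j.2) => [i|]; [exact: PT_row|exact: PT_cst].
  apply: PT_mapfc => i; first exact/PT_tl/PT_row.
  by apply: PT_eqz => //; apply: PT_mxE.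
apply: PT_andb; last first.
  case: (j.2) => [i|]; last by apply: PT_eqz => //; apply: PT_mxE.
  by apply: PT_andb; apply: PT_eqz => //; apply: PT_mxE.
apply: PT_andb; apply: PT_forall => i; last first.
  by apply: PT_eqz; [apply: PT_mulz => //|]; apply: PT_mxE.
apply: PT_if; first by apply: PT_lexposc => q; apply/PT_mxE/PT_dualmx.
  by apply: PT_ltz => //; exact: PT_cst.
by apply: PT_andb; [exact: PT_cst|apply: PT_lez => //; exact: PT_cst].
Qed.

(** * Integer points of a polyhedron as signed free semigroups *)

Section Barvinok.
Variables n r : nat.
Local Notation N := n.+1.

(* The half-space [a >= 0] is replaced by [2a + 1 > 0], so that integer points
   are never on a bounding hyperplane. *)
Definition hcol (H : 'M[int]_(N, r)) (k : 'I_r) : 'cV[int]_N :=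
  \col_i (2 * H i k + (i == 0)%:R).

Definition coneL (H : 'M[int]_(N, r)) :=
  foldl (fun L k => hfilter (hcol H k) L) (orths n) (enum 'I_r).

Definition barv (H : 'M[int]_(N, r)) : seq (int * ('rV[int]_n * seq 'rV[int]_n)) :=
  flatten [seq [seq (c.1, T) | T <- cterms c.2] | c <- rdloop (coneL H)].

Definition inpoly (H : 'M[int]_(N, r)) (v : 'rV[int]_n) := [forall k, 0 <= (hom v *m H) 0 k].

Lemma hcolE H k v : (hom v *m hcol H k) 0 0 = 2 * (hom v *m H) 0 k + 1.
Proof.
rewrite !mxE mulr_sumr; transitivity (\sum_i (2 * (hom v 0 i * H i k) + hom v 0 i * (i == 0)%:R)).
  by apply: eq_bigr => i _; rewrite [hcol _ _ _ _]mxE; ring.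
rewrite big_split /=; congr (_ + _); rewrite (bigD1 0) //= ?eqxx hom0 mulr1 big1 ?addr0 // => i ne.
by rewrite (negPf ne) mulr0.
Qed.

Lemma coneLP H v : cval (coneL H) (hom v) = (inpoly H v : nat)%:Z /\
  (forall c, c \in coneL H -> good c.2).
Proof.
have [o1 o2] := orthsP (hom0 v).
have h (s : seq 'I_r) : cval (foldl (fun L k => hfilter (hcol H k) L) (orths n) s) (hom v) =
    (all (fun k => 0 <= (hom v *m H) 0 k) s : nat)%:Z /\
    (forall c, c \in foldl (fun L k => hfilter (hcol H k) L) (orths n) s -> good c.2).
  elim/last_ind: s => [|s k [h1 h2]]; first by rewrite /= o1.
  rewrite foldl_rcons all_rcons; set L := foldl _ _ s in h1 h2 *.
  have a0 : hcol H k != 0.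
    apply/eqP => /matrixP/(_ 0 0); rewrite !mxE eqxx; lia.
  have va : (hom v *m hcol H k) 0 0 != 0 by rewrite hcolE; lia.
  have [-> h3] := hfilterP h2 a0 va; split=> //; rewrite h1 hcolE.
  have -> : (0 < 2 * (hom v *m H) 0 k + 1) = (0 <= (hom v *m H) 0 k) by lia.
  by case: (0 <= _); case: (all _ _).
have [h1 h2] := h (enum 'I_r); split=> //; rewrite /coneL h1; congr (nat_of_bool _)%:Z.
by apply/allP/forallP => [hh k|hh k _]; apply: hh; rewrite ?mem_enum.
Qed.

Lemma det_bound (B : 'M[int]_N) K : (forall i j, (absz (B i j) <= K)%N) ->
  `|\det B| <= (N`! * K ^ N)%N%:Z.
Proof.
move=> h; apply: le_trans (ler_norm_sum _ _ _) _.
apply: (@le_trans _ _ (\sum_(s : 'S_N) (K ^ N)%N%:Z)).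
  apply: ler_sum => s _; rewrite normrM normrX normrN1 expr1n mul1r normr_prod.
  rewrite -[(K ^ N)%N%:Z]natz natrX natz; apply: (@le_trans _ _ (\prod_(i < N) K%:Z)).
    by apply: ler_prod => i _; rewrite normr_ge0 /= -abszE lez_nat.
  by rewrite prodr_const card_ord.
by rewrite sumr_const card_Sn -mulr_natl natz PoszM.
Qed.

Lemma leq_fact_exp m : (m`! <= m ^ m)%N.
Proof.
suff h k : (k <= m -> k`! <= m ^ k)%N by exact: h.
by elim: k => //= k IH lt; rewrite factS expnS leq_mul // IH // ltnW.
Qed.

Lemma barvP H v :
  \sum_(T <- barv H) T.1 * (nat_of_bool `[< conein T.2.1 T.2.2 v >])%:Z = (inpoly H v : nat)%:Z
  /\ (forall T, T \in barv H -> indep T.2.2).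
Proof.
have [h1 h2] := coneLP H v; set L := coneL H in h1 h2.
have dL c : c \in L -> `|\det c.2| <= (2 ^ (N * N + bnum L))%N%:Z.
  move=> hc'; have [s1 [s2 e]] : exists s1 s2, L = s1 ++ c :: s2.
    by case/splitPr: hc' => s1 s2; exists s1, s2.
  have hlt : (sz c < sz L)%N by rewrite e; exact: (@sz_mem (prod_enc int_enc (mx_enc N N))).
  have e2 : sz c = (sz c.1 + sz c.2).+1 by case: (c) => ? ?; exact: sz_pair.
  apply: le_trans (@det_bound _ (2 ^ sz L) _) _.
    by move=> i j; apply: ltnW; apply: leq_trans (absz_entry _ _ _) _; rewrite leq_exp2l //; apply: leq_trans (ltnW hlt); rewrite e2; exact: leq_trans (leq_addl _ _) (leqnSn _).
  rewrite lez_nat expnD leq_mul //; last by rewrite -expnM leq_exp2l // /bnum mulnC leq_mul2l -addnA leq_addr orbT.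
  apply: (@leq_trans (N ^ N)); last by rewrite expnM leq_exp2r // ltnW // ltn_expl.
  by apply: leq_fact_exp.
have lt : (bnum L < 2 ^ size (bits (bnum L)))%N by rewrite -size_bits.
have [r1 r2 r3] := rdloopP (hom v) h2 dL lt.
split.
  rewrite -h1 -r1 /barv big_flatten big_map /cval; apply: eq_big_seq => c hc'.
  by rewrite big_map -mulr_sumr cterms_sum ?r2 ?r3.
move=> T /flattenP[s /mapP[c hc' ->] /mapP[U /mapP[j _ ->] ->]] /=.
by apply: gens_indep; have /andP[] := r2 c hc'.
Qed.

Lemma PT_barv : PT barv.
Proof.
have hid := PT_id (mx_enc N r).
have hL : PT coneL.
  rewrite /coneL; elim/last_ind: (enum _) => [|s k IH]; first exact: PT_cst.
  have : PT (fun H => hfilter (hcol H k) (foldl (fun L k => hfilter (hcol H k) L) (orths n) s)).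
    apply: PT_hfilter => //; apply: PT_mx => i j.
    have := PT_addz (PT_mulz (PT_cst _ (2 : int)) (PT_mxE i k hid)) (PT_cst _ ((i == 0)%:R : int)).
    by apply: PT_ext => H; rewrite [RHS]mxE.
  by apply: PT_ext => H; rewrite foldl_rcons.
apply: PT_flatten; apply: (PT_map (F := fun _ (c : int * 'M[int]_N) => [seq (c.1, T) | T <- cterms c.2])).
  apply: (PT_map (F := fun (p : 'M[int]_(N, r) * (int * 'M[int]_N)) (T : 'rV[int]_n * seq 'rV[int]_n) => (p.2.1, T))).
    by apply: PT_pair; [exact/PT_fst/PT_snd/PT_fst/PT_id|exact/PT_snd/PT_id].
  exact: (PT_comp (PT_snd (PT_snd (PT_id _))) (PT_cterms n)).
exact: (PT_comp hL (PT_rdloop n)).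
Qed.

End Barvinok.

(** * Parametric integer feasibility *)

Section LP.
Variables (m n : nat).
Implicit Types (A : 'M[rat]_(m, n)) (b : 'cV[rat]_m) (y : 'cV[rat]_n).

Definition slack A b y k : rat := (A *m y) k 0 + b k 0.
(** The recession cone is trivial, so the polytopes are bounded for every right-hand side. *)
Definition norec A := forall g : 'cV[rat]_n, (forall k, 0 <= (A *m g) k 0) -> g = 0.
Definition tightmx A b y : 'M[rat]_(m, n) := \matrix_(i, j) (if slack A b y i == 0 then A i j else 0).

Lemma tightmxE A b y (g : 'cV[rat]_n) i :
  (tightmx A b y *m g) i 0 = if slack A b y i == 0 then (A *m g) i 0 else 0.
Proof.
rewrite !mxE; case: ifP => e; first by apply: eq_bigr => j _; rewrite mxE e.
by rewrite big1 // => j _; rewrite mxE e mul0r.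
Qed.

(* From a feasible point whose tight constraints do not determine it, moving in
   a direction that kills them and does not decrease the [k]-th slack must hit
   a new constraint. *)
Lemma lp_vertex A b y k : norec A -> (forall i, 0 <= slack A b y i) ->
  exists y', [/\ forall i, 0 <= slack A b y' i, slack A b y k <= slack A b y' k
    & row_full (tightmx A b y')].
Proof.
move=> hr; have [r] := ubnP (n - \rank (tightmx A b y))%N.
elim: r y => // r IH y hlt hy; set M := tightmx A b y.
have [full|nf] := boolP (row_full M); first by exists y.
have lt : (\rank M < n)%N by rewrite ltn_neqAle rank_leq_col andbT.
have [g g0 Mg] : exists2 g : 'cV[rat]_n, g != 0 & M *m g = 0.
  have : cokermx M != 0 by rewrite -mxrank_eq0 mxrank_coker subn_eq0 -ltnNge.
  move=> /eqP c0; apply: contrapT => /forallPNP hn; apply: c0; apply/matrixP => i j; rewrite mxE.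
  have [/matrixP/(_ i 0)|/hn[]] := eqVneq (col j (cokermx M)) 0; first by rewrite !mxE.
  by rewrite colE mulmxA mulmx_coker mul0mx.
wlog gk : g g0 Mg / 0 <= (A *m g) k 0.
  move=> h; have [/h|lt0] := leP 0 ((A *m g) k 0); first exact.
  apply: (h (- g)); rewrite ?oppr_eq0 ?mulmxN ?Mg ?oppr0 //.
  by rewrite [X in _ <= X]mxE oppr_ge0 ltW.
have [i0 hi0] : exists i, (A *m g) i 0 < 0.
  apply: contrapT => hn; move/eqP: g0; apply; apply: hr => i; rewrite leNgt.
  by apply/negP => h; apply: hn; exists i.
pose rt i := slack A b y i / - (A *m g) i 0.
case: (arg_minP rt (hi0 : (fun i => (A *m g) i 0 < 0) i0)) => i1 h1 hmin.
pose y' := y + rt i1 *: g.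
have sl i : slack A b y' i = slack A b y i + rt i1 * (A *m g) i 0.
  rewrite /slack /y' mulmxDr -scalemxAr; set u := A *m y; set v := A *m g.
  by rewrite [(u + _) i 0]mxE [(_ *: v) i 0]mxE; ring.
have rt0 : 0 <= rt i1 by rewrite divr_ge0 // oppr_ge0 ltW.
have tg i : slack A b y i == 0 -> (A *m g) i 0 = 0.
  by move=> e; have := tightmxE A b y g i; rewrite e -/M Mg mxE.
have s1 : slack A b y' i1 = 0.
  by rewrite sl /rt; field; rewrite lt_eqF.
have fe i : 0 <= slack A b y' i.
  rewrite sl; have [h|h] := leP 0 ((A *m g) i 0); first by rewrite addr_ge0 // mulr_ge0.
  have := hmin i h; rewrite {2}/rt ler_pdivlMr ?oppr_gt0 //; lra.
have rk : (\rank M < \rank (tightmx A b y'))%N.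
  apply: rank_ltmx; rewrite ltmxE; apply/andP; split.
    apply/row_subP => i; have [e|ne] := boolP (slack A b y i == 0).
      have -> : row i M = row i (tightmx A b y').
        apply/rowP => j; rewrite !mxE e ifT // sl (eqP e) tg // mulr0 addr0 //.
      exact: row_sub.
    have -> : row i M = 0 by apply/rowP => j; rewrite !mxE (negPf ne).
    exact: sub0mx.
  apply/negP => /submxP[D e]; have := tightmxE A b y' g i1.
  rewrite s1 eqxx e -mulmxA Mg mulmx0 mxE => e0; by rewrite -e0 ltxx in h1.
have [|y2 [f1 f2 f3]] := IH y' _ fe; first by
  have := rank_leq_col (tightmx A b y'); move: rk hlt; rewrite -/M; move: (\rank M) (\rank _) => p q; lia.
exists y2; split=> //; apply: le_trans f2; rewrite sl; by rewrite lerDl mulr_ge0.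
Qed.

End LP.

Section Vertices.
Variables (m n : nat) (A : 'M[int]_(m, n)).
Local Notation choice := {ffun 'I_n -> 'I_m}.
Implicit Types (f : choice) (b : 'cV[int]_m).

Definition vsub f : 'M[int]_n := \matrix_(i, j) A (f i) j.
Definition dt f : int := \det (vsub f).
Definition selm f : 'M[int]_(n, m) := \matrix_(i, j) (f i == j)%:R.

(* When [dt f != 0], the vertex at which the constraints chosen by [f] are
   tight is [dt f ^- 2 *: (Vc f *m b)], and its slacks are
   [dt f ^- 2 *: (Fc f *m b)]. *)
Definition Vc f : 'M[int]_(n, m) := \matrix_(i, j) (- dt f * (\adj (vsub f) *m selm f) i j).
Definition Fc f : 'M[int]_m := \matrix_(i, j) ((i == j)%:R * dt f ^+ 2 + (A *m Vc f) i j).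

Lemma VcE f b : Vc f *m b = - dt f *: (\adj (vsub f) *m (selm f *m b)).
Proof.
rewrite mulmxA scalemxAl; congr (_ *m _); apply/matrixP => i j.
by rewrite [LHS]mxE [RHS]mxE.
Qed.

Lemma FcE f b k : (Fc f *m b) k 0 = dt f ^+ 2 * b k 0 + (A *m (Vc f *m b)) k 0.
Proof.
have -> : Fc f = (dt f ^+ 2)%:M + A *m Vc f.
  apply/matrixP => i j; rewrite [LHS]mxE [RHS]mxE [_%:M _ _]mxE.
  by congr (_ + _); case: eqP => _; rewrite ?mul1r ?mul0r.
by rewrite mulmxDl mul_scalar_mx mulmxA; set u := _ *: b; rewrite [LHS]mxE [u _ _]mxE.
Qed.

Definition zslack b (y : 'cV[int]_n) k : int := (A *m y) k 0 + b k 0.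

Lemma qm_slack b (y : 'cV[int]_n) k : slack (qm A) (qm b) (qm y) k = (zslack b y k)%:~R.
Proof. by rewrite /slack /zslack intrD -qm_mul !qmE. Qed.

(** A vertex with a slack at least as large comes from [lp_vertex]; [f] selects independent rows
    among its tight constraints, and Cramer's rule identifies it. *)
Lemma lp_choice b (y : 'cV[rat]_n) k : norec (qm A) ->
  (forall i, 0 <= slack (qm A) (qm b) y i) ->
  exists f, [/\ dt f != 0, forall i, 0 <= (Fc f *m b) i 0 &
    slack (qm A) (qm b) y k * (dt f ^+ 2)%:~R <= ((Fc f *m b) k 0)%:~R].
Proof.
move=> hr /(lp_vertex k hr)[y' [h1 h2 h3]].
pose f : choice := [ffun i => fullrankfun h3 i]; set M := tightmx _ _ _ in h3 f.
have tf i : slack (qm A) (qm b) y' (f i) = 0.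
  have un := fullrowsub_unit h3; apply/eqP/negP => ne.
  have : row i (rowsub (fullrankfun h3) M) = 0.
    by apply/rowP => j; rewrite !mxE -[fullrankfun h3 i](ffunE (fun i => fullrankfun h3 i)) -/f (negPf (introN idP ne)).
  move/(congr1 (fun r => r *m invmx (rowsub (fullrankfun h3) M))).
  rewrite -row_mul mulmxV // mul0mx => /matrixP/(_ 0 i); rewrite !mxE eqxx => /eqP.
  by rewrite oner_eq0.
have e1 : qm (vsub f) = rowsub (fullrankfun h3) M.
  apply/matrixP => i j; rewrite !mxE -[fullrankfun h3 i](ffunE (fun i => fullrankfun h3 i)) -/f.
  by rewrite tf eqxx.
have d0 : dt f != 0.
  have := fullrowsub_unit h3; rewrite -e1 unitmxE unitfE /qm det_map_mx intr_eq0.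
  exact.
have e2 : qm (vsub f) *m y' = - qm (selm f *m b).
  apply/matrixP => i j; rewrite ord1; have /eqP := tf i; rewrite /slack addr_eq0 => /eqP e.
  rewrite [RHS]mxE qmE.
  have -> : (selm f *m b) i 0 = b (f i) 0.
    rewrite mxE (bigD1 (f i)) //= mxE eqxx mul1r big1 ?addr0 // => l ne.
    by rewrite mxE eq_sym (negPf ne) mul0r.
  rewrite -qmE -e !mxE; apply: eq_bigr => l _; congr (_ * _); by rewrite !mxE.
have e3 : qm (Vc f *m b) = (dt f ^+ 2)%:~R *: y'.
  have -> : qm (Vc f *m b) = (- dt f)%:~R *: (qm (\adj (vsub f)) *m qm (selm f *m b)).
    by rewrite VcE -qm_mul /qm map_mxZ.
  rewrite -[qm (selm f *m b)]opprK -e2 mulmxN mulmxA.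
  have -> : qm (\adj (vsub f)) *m qm (vsub f) = (dt f)%:~R%:M.
    by rewrite -qm_mul mul_adj_mx /qm map_scalar_mx.
  by rewrite mul_scalar_mx scalerN rmorphN /= scaleNr opprK scalerA rmorphXn expr2.
have e4 i : ((Fc f *m b) i 0)%:~R = (dt f ^+ 2)%:~R * slack (qm A) (qm b) y' i.
  rewrite FcE intrD intrM -qmE -[((A *m _) i 0)%:~R]qmE qm_mul e3 -scalemxAr.
  by rewrite /slack; set u := qm A *m y'; rewrite [(_ *: u) _ _]mxE; ring.
have p2 : 0 < ((dt f ^+ 2)%:~R : rat) by rewrite ltr0z exprn_even_gt0.
exists f; split=> // [i|]; last by rewrite e4 mulrC ler_wpM2l // ltW.
by rewrite -(ler0z rat) e4 mulr_ge0 // ltW.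
Qed.

Definition Dlt : int := \prod_(f | dt f != 0) dt f ^+ 2.
Definition Dof f : int := \prod_(g | (dt g != 0) && (g != f)) dt g ^+ 2.

Lemma Dof_gt0 f : 0 < Dof f.
Proof. by apply: prodr_gt0 => g /andP[h _]; rewrite exprn_even_gt0. Qed.

Lemma DltE f : dt f != 0 -> Dlt = dt f ^+ 2 * Dof f.
Proof. by move=> h; rewrite /Dlt (bigD1 f). Qed.

Lemma Dlt_gt0 : 0 < Dlt.
Proof. by apply: prodr_gt0 => g h; rewrite exprn_even_gt0. Qed.

(** When [P] selects nonsingular choices, [Rc P *m b] is [Dlt] times the sum of the slack vectors of
    their vertices: up to a factor, the slacks at the average vertex, as linear forms in [b]. *)
Definition Rc (P : pred choice) : 'M[int]_m := \matrix_(i, j) \sum_(f | P f) Dof f * Fc f i j.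

Lemma RcE (P : pred choice) b k : (Rc P *m b) k 0 = \sum_(f | P f) Dof f * (Fc f *m b) k 0.
Proof.
rewrite mxE; under eq_bigr do rewrite mxE mulr_suml.
rewrite exchange_big /=; apply: eq_bigr => f _; rewrite mxE mulr_sumr.
by apply: eq_bigr => j _; rewrite mulrA.
Qed.

End Vertices.

(** * Comparing the polytope with an ellipsoid *)

Section Decision.
Variables (m n : nat) (A : 'M[int]_(m, n.+1)) (b : 'cV[int]_m).
Local Notation choice := {ffun 'I_n.+1 -> 'I_m}.
Variables (P : pred choice) (hi wt : 'I_m -> int) (T : nat).
Hypothesis hA : norec (qm A).
Hypothesis PP : forall f, P f = (dt A f != 0) && [forall k, 0 <= (Fc A f *m b) k 0].
Hypothesis hlo : forall k, (hi k %/ 2)%Z <= (Rc A P *m b) k 0.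
Hypothesis hhi : forall k, (Rc A P *m b) k 0 < hi k.
Hypothesis hwt : forall k, hi k ^+ 2 * wt k = 4 ^+ T.
Hypothesis hi1 : forall k, hi k = 1 \/ 2 * (hi k %/ 2)%Z = hi k.
Hypothesis hi_gt0 : forall k, 0 < hi k.

(** Each constraint is weighted by [4 ^ T / hi k ^ 2], hence measured relative to its slack at the
    average vertex. [T] only serves to keep the weights integral. *)
Definition wform (wt : 'I_m -> int) : 'M[int]_n.+1 := \matrix_(i, j) \sum_k wt k * A k i * A k j.

Local Notation S := (wform wt).
Local Notation U := (Red S).
Definition nch : nat := #|{: choice}|.

Lemma wt_gt0 k : 0 < wt k.
Proof.
have := hwt k; have : (0 : int) < 4 ^+ T by rewrite exprn_gt0.
by move=> h e; rewrite -e pmulr_rgt0 ?exprn_gt0 // in h.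
Qed.

Lemma qf_wform (x : 'rV[rat]_n.+1) : qf (qm S) x = \sum_k (wt k)%:~R * ((qm A *m x^T) k 0) ^+ 2.
Proof.
rewrite /qf /bil; transitivity (\sum_i \sum_j \sum_k (wt k)%:~R * ((A k i)%:~R * x 0 i) * ((A k j)%:~R * x 0 j)).
  apply: eq_bigr => i _; apply: eq_bigr => j _; rewrite qmE mxE rmorph_sum /= mulr_sumr mulr_suml.
  by apply: eq_bigr => k _; rewrite !intrM; ring.
under eq_bigr do rewrite exchange_big.
rewrite exchange_big /=; apply: eq_bigr => k _; rewrite mxE expr2 mulr_suml mulr_sumr.
apply: eq_bigr => i _; rewrite !mulr_sumr; apply: eq_bigr => j _; rewrite !mxE; ring.
Qed.

Lemma pd_wform : pd (qm S).
Proof.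
split.
  apply/matrixP => i j; rewrite !mxE; congr (_%:~R); apply: eq_bigr => k _; ring.
move=> x x0; rewrite qf_wform lt0r; apply/andP; split; last first.
  by apply: sumr_ge0 => k _; rewrite mulr_ge0 ?sqr_ge0 // ler0z ltW // wt_gt0.
rewrite psumr_eq0; last by move=> k _; rewrite mulr_ge0 ?sqr_ge0 // ler0z ltW // wt_gt0.
apply/negP => /allP h; move/eqP: x0; apply; apply: trmx_inj; rewrite trmx0; apply: hA => k.
have := h k (mem_index_enum _); rewrite /= mulf_eq0 intr_eq0 gt_eqF ?wt_gt0 //=.
by rewrite sqrf_eq0 => /eqP ->.
Qed.

Lemma wform_le k (x : 'rV[rat]_n.+1) : (wt k)%:~R * ((qm A *m x^T) k 0) ^+ 2 <= qf (qm S) x.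
Proof.
rewrite qf_wform (bigD1 k) //= lerDl; apply: sumr_ge0 => i _.
by rewrite mulr_ge0 ?sqr_ge0 // ler0z ltW // wt_gt0.
Qed.

Lemma R_ge f k : P f -> Dof A f * (Fc A f *m b) k 0 <= (Rc A P *m b) k 0.
Proof.
move=> hf; rewrite RcE (bigD1 f) //= lerDl; apply: sumr_ge0 => g /andP[hg _].
by rewrite mulr_ge0 ?(ltW (Dof_gt0 _ _)) //; move: hg; rewrite PP => /andP[_ /forallP].
Qed.

(** A slack is at most that of some vertex, hence at most their sum, all of them being
    nonnegative. *)
Lemma slack_le (y : 'cV[int]_n.+1) k : (forall i, 0 <= zslack A b y i) ->
  Dlt A * zslack A b y k <= (Rc A P *m b) k 0.
Proof.
move=> hy.
have [|f [f1 f2 f3]] := @lp_choice _ _ A b (qm y) k hA.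
  by move=> i; rewrite qm_slack ler0z.
have hf : P f by rewrite PP f1; apply/forallP.
apply: le_trans (R_ge k hf); rewrite (DltE f1) [_ * Dof _ _]mulrC -mulrA.
rewrite ler_pM2l ?Dof_gt0 //; move: f3; rewrite qm_slack -intrM ler_int mulrC; exact.
Qed.

Section Yes.
Variable f0 : choice.
Hypothesis Pf0 : P f0.
Hypothesis test : (n.+1)%:R * \tr (cob S U) * Dlt A ^+ 2 * nch%:R ^+ 2 <= 4 ^+ T.

(** Round the average vertex [p] in the reduced basis. Its slack [k] is at least
    [(hi k %/ 2) / (Dlt * nch)], and by the test rounding changes it by at most
    [hi k / (2 * Dlt * nch)]. *)
Lemma decide_yes : exists y : 'cV[int]_n.+1, forall k, 0 <= zslack A b y k.
Proof.
have hS := pd_wform; have [hU hr] := Red_correct hS; have hQ := qm_unit hU.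
pose PS : 'cV[int]_n.+1 := \sum_(f | P f) Dof A f *: (Vc A f *m b).
pose c := #|[pred f | P f]|; have c0 : (0 < c)%N by apply/card_gt0P; exists f0.
have cN : (c <= nch)%N by exact: max_card.
pose M : rat := (Dlt A)%:~R * c%:R.
have D0 : 0 < (Dlt A)%:~R :> rat by rewrite ltr0z Dlt_gt0.
have M0 : 0 < M by rewrite mulr_gt0 // ltr0n.
pose p : 'rV[rat]_n.+1 := M^-1 *: (qm PS)^T.
have MP k : M * ((qm A *m p^T) k 0 + (b k 0)%:~R) = ((Rc A P *m b) k 0)%:~R.
  rewrite mulrDr /p linearZ /= trmxK -scalemxAr -qm_mul.
  set u := qm (A *m PS); rewrite [(_ *: u) _ _]mxE mulrA mulfV ?gt_eqF // mul1r qmE.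
  rewrite RcE; transitivity ((\sum_(f | P f) (Dof A f * (A *m (Vc A f *m b)) k 0 + Dlt A * b k 0))%:~R : rat).
    rewrite big_split intrD /=; congr (_ + _); last first.
      by rewrite sumr_const rmorphMn /= intrM -[in RHS]mulr_natl /M; ring.
    congr (_%:~R); rewrite mulmx_sumr summxE; apply: eq_bigr => f _.
    by rewrite -scalemxAr mxE.
  congr (_%:~R); apply: eq_bigr => f; rewrite PP => /andP[d _].
  by rewrite FcE (DltE d); ring.
pose x := p *m invmx (qm U).
have [z hz] : exists z : 'rV[int]_n.+1, forall i, `|(x - zrow z) 0 i| <= 1 / 2.
  have [z hz] := boolp.choice (fun i => round_rat (x 0 i)).
  by exists (\row_i z i) => i; have := hz i; rewrite [(x - _) 0 i]mxE [(- zrow _) 0 i]mxE [zrow _ 0 i]mxE [(\row_i z i) 0 i]mxE.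
have h1 := qf_le_trace (pd_cob hS hU) hz; rewrite qm_cob qf_mul mulmxBl /x mulmxKV // in h1.
pose y := (z *m U)^T; exists y => k.
have e1 : p - zrow z *m qm U = (p^T - qm y)^T.
  by rewrite linearB /= trmxK /y qm_tr trmxK qm_mul.
have h2 := le_trans (wform_le k _) h1; rewrite e1 trmxK in h2.
set a := (qm A *m (p^T - qm y)) k 0 in h2.
have ea : (zslack A b y k)%:~R = (qm A *m p^T) k 0 + (b k 0)%:~R - a :> rat.
  rewrite /zslack intrD /a mulmxBr -[((A *m y) k 0)%:~R]qmE qm_mul.
  set u := qm A *m p^T; set v := qm A *m qm y; rewrite [(u - v) k 0]mxE [(- v) k 0]mxE; ring.
have h3 : (2 * (Dlt A)%:~R * nch%:R * a) ^+ 2 <= (hi k)%:~R ^+ 2.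
  have w0 : 0 < (wt k)%:~R :> rat by rewrite ltr0z wt_gt0.
  rewrite -(ler_pM2r w0) -[_ ^+ 2 * (wt k)%:~R in X in _ <= X]/((hi k)%:~R ^+ 2 * (wt k)%:~R).
  have -> : (hi k)%:~R ^+ 2 * (wt k)%:~R = (4 ^+ T)%:~R :> rat by rewrite -(hwt k) intrM rmorphXn.
  move: test; rewrite -(ler_int rat) => t; apply: le_trans t.
  rewrite !expr2 !intrM !rmorph_nat -mxtrace_qm qm_cob -!expr2.
  move: h2; set t := \tr _ => h2.
  apply: (@le_trans _ _ (4 * ((Dlt A)%:~R * nch%:R) ^+ 2 * ((wt k)%:~R * a ^+ 2))).
    by rewrite le_eqVlt; apply/orP; left; apply/eqP; ring.
  apply: (@le_trans _ _ (4 * ((Dlt A)%:~R * nch%:R) ^+ 2 * ((n.+1)%:R / 4 * t))).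
    by rewrite ler_wpM2l // mulr_ge0 // sqr_ge0.
  by rewrite le_eqVlt; apply/orP; left; apply/eqP; field.
have N0 : 0 < nch%:R :> rat by rewrite ltr0n (leq_trans c0).
have h4 : 2 * (Dlt A)%:~R * nch%:R * a <= (hi k)%:~R.
  by rewrite (le_trans (ler_norm _)) // -ler_sqr ?nnegrE ?ler0z ?(ltW (hi_gt0 k)) // -normrX ger0_norm // sqr_ge0.
have l0 : 0 <= (hi k %/ 2)%Z by rewrite divz_ge0 // ltW.
have h5 : (hi k %/ 2)%Z%:~R <= M * ((zslack A b y k)%:~R + a).
  by rewrite ea subrK MP ler_int.
have h6 : (hi k %/ 2)%Z%:~R <= (Dlt A)%:~R * nch%:R * ((zslack A b y k)%:~R + a).
  apply: le_trans h5 _; rewrite ler_wpM2r //; last by rewrite ler_pM2l // ler_nat.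
  by rewrite ea subrK -(pmulr_rge0 _ M0) MP ler0z (le_trans l0).
rewrite leNgt; apply/negP => neg.
have z1 : (zslack A b y k)%:~R <= -1 :> rat.
  have : zslack A b y k <= -1 by rewrite -ltzD1 addNr.
  by rewrite -(ler_int rat) rmorphN1.
have G : 1 <= (Dlt A)%:~R * nch%:R :> rat.
  rewrite -[1]mulr1 ler_pM // ?ler1n ?(leq_trans c0 cN) //.
  have : 1 <= Dlt A by rewrite -gtz0_ge1 Dlt_gt0.
  by rewrite -(ler_int rat).
set GG := (Dlt A)%:~R * nch%:R in G h6 h4; rewrite -[2 * _ * _]mulrA -/GG in h4.
have h7 : GG * (zslack A b y k)%:~R <= -1.
  by apply: le_trans (_ : GG * -1 <= -1); [rewrite ler_wpM2l //; lra|lra].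
(* For [hi k = 1] the slack at [p] is zero, and integrality finishes: an integer above -1 is
   nonnegative. *)
case: (hi1 k) => [e|e].
  by move: h4 h6; rewrite e mulrDr (_ : (1 %/ 2)%Z = 0) //; lra.
move: h4; rewrite -e intrM -mulrA ler_pM2l // => h4.
by move: h6; rewrite mulrDr; lra.
Qed.

End Yes.

Definition slabC : nat := m * n.+1 ^ 2 * nch ^ 2 * 2 ^ n.+1.

(** The inverse of a unimodular matrix, whose determinant is its own inverse, written so that it is
    visibly computable. *)
Definition uinv (V : 'M[int]_n.+1) : 'M[int]_n.+1 := \matrix_(i, j) (\det V * (\adj V) i j).

Lemma uinvE (V : 'M[int]_n.+1) : V \in unitmx -> V *m uinv V = 1%:M.
Proof.
move=> hV; have -> : uinv V = \det V *: \adj V by apply/matrixP => i j; rewrite !mxE.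
rewrite -scalemxAr mul_mx_adj scale_scalar_mx.
by move: hV; rewrite unitmxE => /orP[] /eqP ->.
Qed.

(** [y] and the vertex of [f0] have slacks between 0 and the [Rc] values, so their difference has
    bounded value under the form. Failure of the test makes the last Gram-Schmidt vector long, and
    [qf_last] then bounds the last coordinate of the difference. *)
Lemma decide_slab f0 (y : 'cV[int]_n.+1) : P f0 ->
  4 ^+ T < (n.+1)%:R * \tr (cob S U) * Dlt A ^+ 2 * nch%:R ^+ 2 ->
  (forall k, 0 <= zslack A b y k) ->
  `|dt A f0 ^+ 2 * ((uinv U)^T *m y) ord_max 0 - ((uinv U)^T *m (Vc A f0 *m b)) ord_max 0|
     <= slabC%:Z * dt A f0 ^+ 2.
Proof.
move=> hf test hy; have hS := pd_wform; have [hU hr] := Red_correct hS; have hQ := qm_unit hU.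
have d0 : dt A f0 != 0 by move: hf; rewrite PP => /andP[].
set D := dt A f0 ^+ 2; have D0 : 0 < D by rewrite exprn_even_gt0.
pose z : 'cV[int]_n.+1 := D *: y - Vc A f0 *m b.
pose x := (uinv U)^T *m z.
have -> : D * ((uinv U)^T *m y) ord_max 0 - ((uinv U)^T *m (Vc A f0 *m b)) ord_max 0 = x ord_max 0.
  rewrite /x /z mulmxBr -scalemxAr; set u := _ *m y; set v := _ *m (_ *m b).
  by rewrite [RHS]mxE [in RHS]mxE [(- v) _ _]mxE.
have zx : z = U^T *m x by rewrite /x mulmxA -trmx_mul -[_ *m U]/(_ *m U) (mulmx1C (uinvE hU)) trmx1 mul1mx.
have az k : `|Dlt A * (A *m z) k 0| <= D * (Rc A P *m b) k 0.
  have -> : (A *m z) k 0 = D * zslack A b y k - (Fc A f0 *m b) k 0.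
    rewrite FcE -/D /z mulmxBr -scalemxAr /zslack; set u := A *m y; set v := A *m _.
    rewrite [LHS]mxE [(- v) k 0]mxE [(D *: u) k 0]mxE; ring.
  have s1 := slack_le k hy; have s2 := R_ge k hf; have s3 := hy k.
  have s4 : 0 <= (Fc A f0 *m b) k 0 by move: hf; rewrite PP => /andP[_ /forallP].
  have Do := Dof_gt0 A f0; have eD := DltE d0; rewrite -/D in eD.
  have e : Dlt A * (D * zslack A b y k - (Fc A f0 *m b) k 0) =
    D * (Dlt A * zslack A b y k - Dof A f0 * (Fc A f0 *m b) k 0) by rewrite eD; ring.
  rewrite e normrM gtr0_norm // ler_pM2l //.
  have q1 : 0 <= Dlt A * zslack A b y k by rewrite mulr_ge0 // ltW // Dlt_gt0.
  have q2 : 0 <= Dof A f0 * (Fc A f0 *m b) k 0 by rewrite mulr_ge0 // ltW.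
  by rewrite ler_norml; apply/andP; split; lia.
have h1 : (Dlt A ^+ 2)%:~R * qf (qm S) (qm z)^T <= (m%:Z * D ^+ 2 * 4 ^+ T)%:~R.
  rewrite qf_wform mulr_sumr trmxK -qm_mul.
  apply: (@le_trans _ _ (\sum_(k < m) (D ^+ 2 * 4 ^+ T)%:~R)); last first.
    by rewrite sumr_const card_ord -mulrA [(m%:Z * _)%:~R]intrM -pmulrn mulr_natl.
  apply: ler_sum => k _; rewrite qmE -(hwt k); have w0 := wt_gt0 k.
  have key : (Dlt A * (A *m z) k 0) ^+ 2 <= (D * hi k) ^+ 2.
    rewrite -[X in X <= _]ger0_norm ?sqr_ge0 // normrX; apply: lerXn2r; rewrite ?nnegrE ?normr_ge0 //.
      by rewrite mulr_ge0 // ltW.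
    by apply: le_trans (az k) _; rewrite ler_pM2l // ltW.
  have := ler_wpM2r (ltW w0) key; rewrite -(ler_int rat) => h; apply: le_trans (le_trans _ h) _.
    by rewrite le_eqVlt; apply/orP; left; apply/eqP; rewrite !expr2 !intrM; ring.
  by rewrite le_eqVlt; apply/orP; left; apply/eqP; congr (_%:~R); ring.
set t := \tr (cob S U) in test *.
have eqx : qf (qm S) (qm z)^T = qf (qm (cob S U)) (qm x)^T.
  by rewrite qm_cob qf_mul zx qm_mul trmx_mul qm_tr trmxK.
have hT := pd_cob hS hU; have h2 := qf_last (qm x)^T hT; rewrite -eqx in h2.
have [_ h3] := red_glast hT hr; set g := glast _ in h2 h3; have g0 : 0 < g by apply: glast_gt0.
have h4 : t%:~R <= (n.+1 * 2 ^ n.+1)%:R * g.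
  rewrite -mxtrace_qm /mxtrace; apply: (@le_trans _ _ (\sum_(i < n.+1) 2 ^+ n.+1 * g)).
    by apply: ler_sum => i _; apply: le_trans (red_diag i hT hr) h3.
  by rewrite sumr_const card_ord natrM natrX -mulrA mulr_natl.
rewrite mxE qmE in h2.
have dl0 : 0 < (Dlt A ^+ 2)%:~R :> rat by rewrite ltr0z exprn_gt0 // Dlt_gt0.
have h5 : (Dlt A ^+ 2)%:~R * (g * (x ord_max 0)%:~R ^+ 2) <= (Dlt A ^+ 2)%:~R * (g * (slabC%:Z * D ^+ 2)%:~R).
  apply: le_trans (ler_wpM2l (ltW dl0) h2) _; apply: le_trans h1 _.
  have := ltW test; rewrite -(ler_int rat) => test'.
  rewrite intrM; apply: le_trans (ler_wpM2l _ test') _; first by rewrite ler0z mulr_ge0 // sqr_ge0.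
  rewrite /slabC !expr2 !intrM -!pmulrn !natrM !natrX -!expr2; rewrite natrM natrX in h4.
  rewrite !rmorph_nat.
  set mq : rat := m%:R; set Dq := (dt A f0)%:~R ^+ 2; set dl := (Dlt A)%:~R; set nq := (n.+1)%:R in h4 *; set Nq := nch%:R.
  have k0 : 0 <= mq * Dq ^+ 2 * dl ^+ 2 * nq * Nq ^+ 2 by do ![exact: sqr_ge0|exact: ler0n|apply: mulr_ge0].
  have := ler_wpM2l k0 h4; set tq := t%:~R; set q2 := 2 ^+ n.+1 => h.
  suff -> : dl ^+ 2 * (g * (mq * nq ^+ 2 * Nq ^+ 2 * q2 * Dq ^+ 2)) = mq * Dq ^+ 2 * dl ^+ 2 * nq * Nq ^+ 2 * (nq * q2 * g).
    by apply: le_trans h; rewrite le_eqVlt; apply/orP; left; apply/eqP; ring.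
  by ring.
rewrite ler_pM2l // ler_pM2l // in h5.
have h6 : x ord_max 0 ^+ 2 <= slabC%:Z * D ^+ 2 by rewrite -(ler_int rat) rmorphXn.
have h7 : `|x ord_max 0| ^+ 2 <= (slabC%:Z * D) ^+ 2.
  rewrite -normrX ger0_norm ?sqr_ge0 //; apply: le_trans h6 _.
  have sl : slabC%:Z <= slabC%:Z ^+ 2 by rewrite expr2; case: (slabC) => // q; rewrite ler_peMl.
  by apply: le_trans (ler_wpM2r (sqr_ge0 D) sl) _; rewrite -exprMn.
by move: h7; rewrite ler_sqr ?nnegrE ?normr_ge0 // mulr_ge0 // ltW.
Qed.

End Decision.

(** * Cells of parameters and their refinements *)

Definition acell := (seq (seq int) * seq unit)%type.

(** Parameters are kept in a list, since their number changes along the recursion, and homogenised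
    by a leading 1. *)
Definition hw q (w : seq int) : 'cV[int]_q.+1 := \col_i nth 0 (1 :: w) i.
Definition av q (f : seq int) (w : seq int) : int := \sum_(i < q.+1) nth 0 f i * nth 0 (1 :: w) i.
Definition sat q (c : seq (seq int)) w := all (fun f => 0 <= av q f w) c.
(** The second component of a cell bounds the bit length of its parameters in unary; it decides how
    many dyadic intervals must be tried. *)
Definition bdd (t : seq unit) (w : seq int) := all (fun z : int => (absz z < 2 ^ size t)%N) w.

Definition rsc q k (s c : int) (M : 'M[int]_(k, q.+1)) (i : 'I_k) : seq int :=
  [seq s * M i j + c * (j == 0)%:R | j <- enum 'I_q.+1].

Lemma av_rsc q k s c (M : 'M[int]_(k, q.+1)) i w :
  av q (rsc s c M i) w = s * (M *m hw q w) i 0 + c.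
Proof.
rewrite mxE mulr_sumr /av; transitivity (\sum_(j < q.+1) (s * (M i j * hw q w j 0) + c * ((j == 0)%:R * nth 0 (1 :: w) j))).
  apply: eq_bigr => j _; rewrite (nth_map j) ?size_enum_ord // nth_ord_enum [hw _ _ _ _]mxE; ring.
rewrite big_split /= -mulr_sumr; congr (_ + _); rewrite (bigD1 0) //= ?eqxx mul1r big1 ?addr0.
  by rewrite /= mulr1.
by move=> j ne; rewrite (negPf ne) mul0r mulr0.
Qed.

(** New parameters are put in front of the old ones, after the constant term. *)
Definition liftf E (f : seq int) : seq int := head 0 f :: nseq E 0 ++ behead f.

Lemma av_liftf q E f e w : size e = E -> av (E + q) (liftf E f) (e ++ w) = av q f w.
Proof.
move=> se; rewrite /av big_ord_recl [RHS]big_ord_recl /=; congr (_ + _).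
rewrite -(big_mkord xpredT (fun i => nth 0 (nseq E 0 ++ behead f) i * nth 0 (e ++ w) i)).
rewrite -(big_mkord xpredT (fun i => nth 0 f i.+1 * nth 0 w i)).
rewrite (big_cat_nat (leq0n E) (leq_addr q E)) /= big_nat_cond big1 ?add0r; last first.
  by move=> i /andP[/andP[_ lt] _]; rewrite nth_cat size_nseq lt nth_nseq lt mul0r.
rewrite -{1}[E]add0n [(E + q)%N]addnC big_addn addnK; apply: eq_bigr => i _.
by rewrite !nth_cat size_nseq se ltnNge leq_addl /= addnK nth_behead.
Qed.

Definition liftc E (c : seq (seq int)) := map (liftf E) c.

Lemma sat_liftc q E c e w : size e = E -> sat (E + q) (liftc E c) (e ++ w) = sat q c w.
Proof. by move=> se; rewrite /sat all_map; apply: eq_all => f /=; rewrite av_liftf. Qed.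

Lemma sat_cat q c c' w : sat q (c ++ c') w = sat q c w && sat q c' w.
Proof. exact: all_cat. Qed.

Definition liftB E q k (M : 'M[int]_(k, q.+1)) : 'M[int]_(k, (E + q).+1) :=
  \matrix_(i, j) nth 0 (liftf E [seq M i l | l <- enum 'I_q.+1]) j.

Lemma liftBE E q k (M : 'M[int]_(k, q.+1)) i e w : size e = E ->
  (liftB E M *m hw (E + q) (e ++ w)) i 0 = (M *m hw q w) i 0.
Proof.
move=> se; have := @av_liftf q E [seq M i l | l <- enum 'I_q.+1] e w se.
rewrite /av => h; rewrite [LHS]mxE [RHS]mxE; transitivity (\sum_(j < (E + q).+1) nth 0 (liftf E [seq M i l | l <- enum 'I_q.+1]) j * nth 0 (1 :: e ++ w) j).
  by apply: eq_bigr => j _; rewrite [liftB _ _ _ _]mxE [hw _ _ _ _]mxE.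
rewrite h; apply: eq_bigr => j _; rewrite (nth_map j) ?size_enum_ord // nth_ord_enum.
by rewrite [hw _ _ _ _]mxE.
Qed.

Definition has_ext q E (L : acell) w := exists e, size e = E /\ sat (E + q) L.1 (e ++ w).

(* The cells in [Ls], with [E] further parameters, cover once each of the points
   of [c] that satisfy [Q], and none of the others. *)
Definition refines q E (c : acell) (Ls : seq acell) (Q : seq int -> Prop) :=
  (forall L w e, L \in Ls -> size w = q -> size e = E -> sat (E + q) L.1 (e ++ w) -> sat q c.1 w) /\
  forall w, size w = q -> sat q c.1 w -> bdd c.2 w ->
  \sum_(L <- Ls) (`[< has_ext q E L w >] : nat) = (`[< Q w >] : nat) /\
  forall L e, L \in Ls -> size e = E -> sat (E + q) L.1 (e ++ w) ->
    bdd L.2 (e ++ w) /\ forall e', size e' = E -> sat (E + q) L.1 (e' ++ w) -> e' = e.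

Lemma refines_ext q E c Ls Q Q' :
  (forall w, size w = q -> sat q c.1 w -> bdd c.2 w -> (Q w <-> Q' w)) ->
  refines q E c Ls Q -> refines q E c Ls Q'.
Proof.
move=> h [h1 h2]; split=> // w sw sc bc; have [h3 h4] := h2 w sw sc bc; split=> //.
by rewrite h3; congr (nat_of_bool _); apply: asbool_equiv_eq; exact: h.
Qed.

Lemma refines_nil q E c Q : (forall w, size w = q -> sat q c.1 w -> bdd c.2 w -> ~ Q w) ->
  refines q E c [::] Q.
Proof.
move=> h; split=> // w sw sc bc; split=> //; rewrite big_nil.
by case: asboolP => // /(h w sw sc bc).
Qed.

Lemma refines_self q c (Q : seq int -> Prop) :
  (forall w, size w = q -> sat q c.1 w -> bdd c.2 w -> Q w) -> refines q 0 c [:: c] Q.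
Proof.
move=> h; split=> [L w e|w sw sc bc].
  by rewrite inE => /eqP -> _ /size0nil ->.
rewrite big_seq1; split.
  by do 2! [case: asboolP => //] => // h1 h2; [case: h1; exact: h|case: h2; exists [::]].
move=> L e; rewrite inE => /eqP -> /size0nil -> _; split=> // e' /size0nil -> //.
Qed.

(** On a leaf of the first refinement the first extension is a function of [w], so the second
    condition is well defined there and every point is again counted once. *)
Lemma refines_comp q E1 E2 c Ls (G : acell -> seq acell) Q1 Q2 :
  refines q E1 c Ls Q1 ->
  (forall L, L \in Ls -> refines (E1 + q) E2 L (G L) (fun w => Q2 (drop E1 w))) ->
  refines q (E2 + E1) c (flatten [seq G L | L <- Ls]) (fun w => Q1 w /\ Q2 w).
Proof.
move=> [h1 h2] hG.
have spl (e : seq int) : size e = (E2 + E1)%N -> [/\ size (take E2 e) = E2, size (drop E2 e) = E1 & e = take E2 e ++ drop E2 e].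
  by move=> s; rewrite size_takel ?s ?leq_addr // size_drop s addnC addnK cat_take_drop.
split.
  move=> L' w e /flattenP[s /mapP[L hL ->] hL'] sw se hs.
  have [s1 s2 s3] := spl e se; rewrite s3 -addnA -catA in hs.
  have [h3 _] := hG L hL; apply: (h1 L w (drop E2 e)) => //.
  by apply: h3 hs => //; rewrite size_cat s2 sw.
move=> w sw sc bc; have [h3 h4] := h2 w sw sc bc.
have sub L : L \in Ls -> (\sum_(L' <- G L) (`[< has_ext q (E2 + E1) L' w >] : nat) =
    `[< has_ext q E1 L w /\ Q2 w >])%N.
  move=> hL; have [g1 g2] := hG L hL; case: (asboolP (has_ext q E1 L w)) => hx; last first.
    rewrite asboolF; last by case.
    rewrite big_seq big1 // => L' hL'; rewrite asboolF // => -[e [se hs]]; apply: hx.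
    have [s1 s2 s3] := spl e se; rewrite s3 -addnA -catA in hs; exists (drop E2 e); split=> //.
    by apply: g1 hs => //; rewrite size_cat s2 sw.
  have [e [se hs]] := hx; have [b1 u1] := h4 L e hL se hs.
  have [|g3 g4] := g2 (e ++ w) _ hs b1; first by rewrite size_cat se sw.
  rewrite -(drop_size_cat w se : drop E1 (e ++ w) = w) in hx *.
  transitivity (`[< Q2 (drop E1 (e ++ w)) >] : nat); last first.
    by congr (nat_of_bool _); apply: asbool_equiv_eq; rewrite drop_size_cat // in hx *; split=> // -[].
  rewrite -g3; apply: eq_big_seq => L' hL'; congr (nat_of_bool _); apply: asbool_equiv_eq.
  rewrite drop_size_cat //; split=> -[e2 [se2 hs2]].
    have [s1 s2 s3] := spl e2 se2; rewrite s3 -addnA -catA in hs2; exists (take E2 e2); split=> //.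
    have e3 : sat (E1 + q) L.1 (drop E2 e2 ++ w) by apply: g1 hs2 => //; rewrite size_cat s2 sw.
    by rewrite -(u1 _ s2 e3).
  by exists (e2 ++ e); rewrite size_cat se se2 -addnA -catA.
split.
  rewrite big_flatten big_map (eq_big_seq _ sub) /=.
  have [q2|nq2] := pselect (Q2 w); last first.
    by rewrite big1 => [|L _]; rewrite asboolF //; case.
  transitivity (`[< Q1 w >] : nat); last by congr (nat_of_bool _); apply: asbool_equiv_eq; split=> // -[].
  by rewrite -h3; apply: eq_bigr => L _; congr (nat_of_bool _); apply: asbool_equiv_eq; split=> // -[].
move=> L' e /flattenP[s /mapP[L hL ->] hL'] se hs.
have [s1 s2 s3] := spl e se; rewrite s3 -addnA -catA in hs *.
have [g1 g2] := hG L hL; have sw' : size (drop E2 e ++ w) = (E1 + q)%N by rewrite size_cat s2 sw.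
have hs' := g1 _ _ _ hL' sw' s1 hs.
have [b1 u1] := h4 L _ hL s2 hs'; have [_ g4] := g2 _ sw' hs' b1.
have [b2 u2] := g4 _ _ hL' s1 hs; split=> // e' se' hs2.
have [t1 t2 t3] := spl e' se';
rewrite t3 -?addnA -?catA in hs2; rewrite t3.
have sw2 : size (drop E2 e' ++ w) = (E1 + q)%N by rewrite size_cat t2 sw.
have hs3 := g1 _ _ _ hL' sw2 t1 hs2; have e1 := u1 _ t2 hs3.
by rewrite e1 in hs2 *; rewrite (u2 _ t1 hs2).
Qed.

Definition addc (c : acell) (fs : seq (seq int)) : acell := (fs ++ c.1, c.2).

Lemma refines_split q E c (I : eqType) (xs : seq I) (fs : I -> seq (seq int)) (G : I -> seq acell) Q :
  (forall w, size w = q -> sat q c.1 w -> bdd c.2 w -> (\sum_(x <- xs) (sat q (fs x) w : nat) = 1)%N) ->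
  (forall x, x \in xs -> refines q E (addc c (fs x)) (G x) Q) ->
  refines q E c (flatten [seq G x | x <- xs]) Q.
Proof.
move=> h1 hG; split.
  move=> L w e /flattenP[s /mapP[x hx ->] hL] sw se hs; have [g1 _] := hG x hx.
  by have := g1 L w e hL sw se hs; rewrite sat_cat => /andP[].
move=> w sw sc bc; have h2 := h1 w sw sc bc.
have sx x : sat q (addc c (fs x)).1 w = sat q (fs x) w by rewrite sat_cat sc andbT.
split.
  rewrite big_flatten big_map /=.
  transitivity (\sum_(x <- xs) (sat q (fs x) w : nat) * `[< Q w >])%N; last by rewrite -big_distrl /= h2 mul1n.
  apply: eq_big_seq => x hx; have [g1 g2] := hG x hx.
  have [s1|s1] := boolP (sat q (fs x) w).
    by rewrite mul1n; have [|->] := g2 w sw _ bc; rewrite ?sx.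
  rewrite mul0n big_seq big1 // => L hL; rewrite asboolF // => -[e [se hs]].
  by have := g1 L w e hL sw se hs; rewrite sx (negPf s1).
move=> L e /flattenP[s /mapP[x hx ->] hL] se hs; have [g1 g2] := hG x hx.
have hs' := g1 L w e hL sw se hs; have [_ g3] := g2 w sw hs' bc; exact: g3.
Qed.

(** A leaf reached early is padded to the common number of parameters; fixing the new ones at 0
    keeps its extensions unique. *)
Definition zforms E : seq (seq int) :=
  flatten [seq [:: [seq (j == i.+1)%:R | j <- iota 0 E.+1]; [seq - (j == i.+1)%:R | j <- iota 0 E.+1]] | i <- iota 0 E].

Lemma sat_zforms E q e w : size e = E -> sat (E + q) (zforms E) (e ++ w) = (e == nseq E 0).
Proof.
move=> se.
have uv (s : int) i : (i < E)%N -> av (E + q) [seq s * (j == i.+1)%:R | j <- iota 0 E.+1] (e ++ w) = s * nth 0 e i.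
  move=> lt; have lt' : (i.+1 < (E + q).+1)%N by rewrite ltnS ltn_addr.
  set g := [seq _ | _ <- _]; have gE j : nth 0 g j = s * (j == i.+1)%:R.
    have [hj|hj] := ltnP j E.+1; first by rewrite (nth_map 0%N) ?size_iota // nth_iota.
    rewrite nth_default ?size_map ?size_iota //; case: eqP hj => [->|_ _]; last by rewrite mulr0.
    by rewrite ltnS => h; have := leq_ltn_trans h lt; rewrite ltnn.
  rewrite /av (bigD1 (Ordinal lt')) // gE eqxx mulr1 big1 ?addr0 => [|j ne].
    by rewrite [LHS]addr0 /= nth_cat se lt.
  by rewrite gE; case: eqP => e0; [case/eqP: ne; apply: val_inj|rewrite mulr0 mul0r].
have -> : zforms E = flatten [seq [:: [seq 1 * (j == i.+1)%:R | j <- iota 0 E.+1]; [seq -1 * (j == i.+1)%:R | j <- iota 0 E.+1]] | i <- iota 0 E] :> seq (seq int).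
  congr flatten; apply: eq_map => i; congr [:: _; _]; apply: eq_map => j; by rewrite ?mul1r ?mulN1r.
apply/idP/eqP => [/allP h|ee].
  apply: (@eq_from_nth _ 0); rewrite ?size_nseq // se => i lt; rewrite nth_nseq lt.
  have mi (s : int) : s \in [:: 1; -1] -> 0 <= s * nth 0 e i.
    move=> hs; rewrite -(uv s i lt); apply: h; apply/flattenP; eexists.
      by apply/mapP; exists i; [rewrite mem_iota|reflexivity].
    by move: hs; rewrite !inE => /orP[] /eqP ->; rewrite eqxx ?orbT.
  have := mi 1; have := mi (-1); rewrite !inE !eqxx /= => /(_ isT) h1 /(_ isT) h2; lia.
apply/allP => f /flattenP[s /mapP[i]]; rewrite mem_iota add0n => /andP[_ lt] -> {s}.
by rewrite !inE => /orP[] /eqP ->; rewrite uv // ee nth_nseq lt mulr0.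
Qed.

Definition padc E (c : acell) : acell := (zforms E ++ liftc E c.1, c.2).

Lemma refines_pad q E c (Q : seq int -> Prop) :
  (forall w, size w = q -> sat q c.1 w -> bdd c.2 w -> Q w) -> refines q E c [:: padc E c] Q.
Proof.
move=> hQ; have sE e w : size e = E -> sat (E + q) (padc E c).1 (e ++ w) = (e == nseq E 0) && sat q c.1 w.
  by move=> se; rewrite sat_cat sat_liftc // sat_zforms.
split=> [L w e|w sw sc bc].
  by rewrite inE => /eqP -> _ se; rewrite sE // => /andP[].
rewrite big_seq1; split.
  rewrite !asboolT //; first exact: hQ.
  by exists (nseq E 0); rewrite size_nseq sE ?size_nseq // eqxx.
move=> L e; rewrite inE => /eqP -> se; rewrite sE // => /andP[/eqP ee _]; split.
  rewrite /bdd all_cat -/(bdd _ w) bc andbT ee; apply/allP => z /nseqP[-> _].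
  by rewrite absz0 expn_gt0.
by move=> e' se'; rewrite sE // => /andP[/eqP -> _].
Qed.

Lemma bdd_hw t w q j : bdd t w -> (absz (hw q w j ord0) <= 2 ^ size t)%N.
Proof.
move=> /allP h; rewrite mxE; case: (j : nat) => [|i] /=; first by rewrite expn_gt0.
have [lt|ge] := ltnP i (size w); last by rewrite nth_default.
by apply: ltnW; apply: h; rewrite mem_nth.
Qed.

Definition uclk q k (M : 'M[int]_(k, q.+1)) (t : seq unit) : seq unit :=
  nseq (sz M + 2) tt ++ t ++ nseq q.+1 tt.

Lemma uclkP q k (M : 'M[int]_(k, q.+1)) t w i : bdd t w ->
  (absz ((M *m hw q w) i ord0) < 2 ^ size (uclk M t))%N.
Proof.
move=> hb; have -> : size (uclk M t) = (sz M + 2 + (size t + q.+1))%N by rewrite !size_cat !size_nseq.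
apply: (@leq_ltn_trans (\sum_(j < q.+1) 2 ^ sz M * 2 ^ size t)%N).
  rewrite mxE; apply: (@leq_trans (\sum_(j < q.+1) absz (M i j * hw q w j ord0)%R)%N).
    elim/big_ind2: _ => // x1 x2 y1 y2 h1 h2.
    by apply: leq_trans (leq_add h1 h2); lia.
  by apply: leq_sum => j _; rewrite abszM leq_mul ?bdd_hw // ltnW // absz_entry.
rewrite sum_nat_const card_ord !expnD; set x := (2 ^ sz M)%N; set y := (2 ^ size t)%N.
have h : (q.+1 < 2 ^ q.+1)%N by rewrite ltn_expl.
have x0 : (0 < x)%N by rewrite expn_gt0.
have y0 : (0 < y)%N by rewrite expn_gt0.
have : (q.+1 * (x * y) < 2 ^ q.+1 * (x * y))%N by rewrite ltn_mul2r muln_gt0 x0 y0 h.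
move=> h2; apply: leq_trans h2 _; apply: (@leq_trans (x * (y * 2 ^ q.+1))); first by rewrite mulnC -mulnA.
by rewrite leq_mul2r leq_pmulr ?orbT.
Qed.

(** The pairs [(2 ^ i, 4 ^ (T - i))] for [i <= T]: the upper end of a dyadic interval and the weight
    of a constraint whose scaled slack lies there. *)
Fixpoint ktab (T : nat) : seq (int * int) :=
  if T is T'.+1 then (1, 4 ^+ T) :: [seq (2 * x.1, x.2) | x <- ktab T'] else [:: (1, 1)].

Lemma ktabP T x : x \in ktab T ->
  [/\ 0 < x.1, x.1 ^+ 2 * x.2 = 4 ^+ T & x.1 = 1 \/ 2 * (x.1 %/ 2)%Z = x.1].
Proof.
elim: T x => [|T IH] x /=; first by rewrite inE => /eqP ->; split=> //; left.
rewrite inE => /orP[/eqP -> /=|/mapP[y /IH[h1 h2 h3] ->]] /=.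
  by split=> //; [rewrite expr1n mul1r|left].
split; first by rewrite mulr_gt0.
  by rewrite [RHS]exprS -h2; ring.
by right; rewrite mulKz.
Qed.

Definition inr (x : int * int) (r : int) := ((x.1 %/ 2)%Z <= r) && (r < x.1).

Lemma ktab_cover T (r : int) : 0 <= r -> r < 2 ^+ T -> (\sum_(x <- ktab T) (inr x r : nat) = 1)%N.
Proof.
elim: T r => [|T IH] r r0 rT; first by rewrite big_seq1 /inr /= (_ : r = 0) //; move: rT; rewrite expr0; lia.
rewrite /= big_cons big_map /=; have [lt|ge] := boolP (r < 1).
  have -> : r = 0 by lia.
  rewrite big_seq big1 => [|x /ktabP[h _ _]]; first by rewrite /inr.
  by rewrite /inr /= mulKz // leNgt h.
rewrite {1}/inr /= (negPf ge) andbF add0n; transitivity (\sum_(x <- ktab T) (inr x (r %/ 2)%Z : nat))%N; last first.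
  by apply: IH; [rewrite divz_ge0|rewrite exprS in rT; rewrite ltz_divLR // mulrC].
apply: eq_big_seq => x /ktabP[h1 _ h2]; congr (nat_of_bool _); rewrite /inr /= mulKz //.
by move: h1 h2; case: x => a b /= h1 h2; apply/idP/idP; case: h2 => h2; lia.
Qed.

Fixpoint kseqs (X : Type) (l : seq X) k : seq (seq X) :=
  if k is k'.+1 then flatten [seq [seq x :: s | s <- kseqs l k'] | x <- l] else [:: [::]].

Lemma kseqs_mem (X : eqType) (l : seq X) k s x0 (i : 'I_k) : s \in kseqs l k -> nth x0 s i \in l.
Proof.
elim: k s i => [|k IH] s; first by case.
move=> i /flattenP[s' /mapP[x hx ->] /mapP[s2 hs2 ->]].
by case: (unliftP ord0 i) => [j ->|->] //=; apply: IH.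
Qed.

Lemma sum_kseqs (X : Type) (l : seq X) k x0 (g : 'I_k -> X -> nat) :
  (\sum_(s <- kseqs l k) \prod_(i < k) g i (nth x0 s i) = \prod_(i < k) \sum_(x <- l) g i x)%N.
Proof.
elim: k g => [|k IH] g; first by rewrite big_seq1 !big_ord0.
rewrite big_flatten big_map [RHS]big_ord_recl big_distrl /=; apply: eq_bigr => x _.
rewrite big_map -(IH (fun i => g (lift ord0 i))) big_distrr /=; apply: eq_bigr => s _.
by rewrite big_ord_recl.
Qed.

Lemma nat_forall (I : finType) (P : pred I) : ([forall i, P i] : nat) = (\prod_i (P i : nat))%N.
Proof.
case: (boolP [forall i, P i]) => [/forallP h|/forallPn[i ni]]; first by rewrite big1 // => i _; rewrite h.
by rewrite (bigD1 i) //= (negPf ni) mul0n.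
Qed.

Lemma slice_mem (X N D : int) (C : nat) : 0 < D -> `|D * X - N| <= C%:Z * D ->
  X - (N %/ D)%Z \in [seq i%:Z - C%:Z | i <- iota 0 (2 * C).+1].
Proof.
move=> D0 hb; have := divz_eq N D; have := modz_ge0 N (lt0r_neq0 D0); have := ltz_pmod N D0.
set r := (N %% D)%Z; set e := (N %/ D)%Z => r2 r1 eN.
have b1 : - C%:Z <= X - e by move: hb; rewrite eN ler_norml => /andP[h1 h2]; clear -h1 h2 r1 r2 D0; nia.
have b2 : X - e <= C%:Z by move: hb; rewrite eN ler_norml => /andP[h1 h2]; clear -h1 h2 r1 r2 D0; nia.
apply/mapP; exists (absz (X - e + C%:Z)); last by lia.
by rewrite mem_iota; lia.
Qed.

Lemma flatten_map1 (T U : Type) (F : T -> seq U) x : flatten [seq F y | y <- [:: x]] = F x.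
Proof. exact: cats0. Qed.

Section Decide.
Variable m : nat.
Local Notation M := m.+1.
Local Notation choice n := {ffun 'I_n -> 'I_M}.

(** The signs of all slacks at all candidate vertices. Once they are fixed, the set of feasible
    choices no longer depends on the parameters. *)
Definition ptn n := {ffun choice n * 'I_M -> bool}.
Definition phi n (A : 'M[int]_(M, n)) (s : ptn n) : pred (choice n) :=
  fun f => (dt A f != 0) && [forall k, s (f, k)].
Definition sgnforms n q (A : 'M[int]_(M, n)) (B : 'M[int]_(M, q.+1)) (s : ptn n) :=
  [seq (if s x then rsc 1 0 (Fc A x.1 *m B) x.2 else rsc (-1) (-1) (Fc A x.1 *m B) x.2)
  | x <- enum {: choice n * 'I_M}].

Lemma sat_sgnforms n q (A : 'M[int]_(M, n)) (B : 'M[int]_(M, q.+1)) s w :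
  sat q (sgnforms A B s) w = (s == [ffun x => 0 <= (Fc A x.1 *m (B *m hw q w)) x.2 0]).
Proof.
rewrite /sat all_map; apply/allP/eqP => [h|-> x _ /=].
  apply/ffunP => x; rewrite ffunE; have := h x (mem_enum _ x) => /=.
  by case: (s x); rewrite av_rsc ?addr0 -mulmxA; move: (fun_of_matrix _ _ _) => z; lia.
by rewrite ffunE; case: ifP => h; rewrite av_rsc -mulmxA ?addr0; move: h; move: (fun_of_matrix _ _ _) => z; lia.
Qed.

(** One new parameter for the rounded coordinate, then those of each slice in turn. *)
Fixpoint EN n := if n is n'.+1 then ((2 * slabC M n').+1 * EN n' + 1)%N else 0%N.

Definition level n q (rest : ptn n -> choice n -> acell -> seq acell) A (B : 'M[int]_(M, q.+1)) c :=
  flatten [seq (let c1 := addc c (sgnforms A B s) in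
    if [pick f | phi A s f] is Some f0 then rest s f0 c1 else [:: padc (EN n) c1])
  | s <- enum {: ptn n}].

Definition nosol n q (A : 'M[int]_(M, n)) (B : 'M[int]_(M, q.+1)) w :=
  ~ exists y, forall k, 0 <= zslack A (B *m hw q w) y k.

Definition phiP n q (A : 'M[int]_(M, n)) (B : 'M[int]_(M, q.+1)) s w := forall f,
  phi A s f = (dt A f != 0) && [forall k, 0 <= (Fc A f *m (B *m hw q w)) k 0].

Lemma level_ok n q rest (A : 'M[int]_(M, n)) (B : 'M[int]_(M, q.+1)) c : norec (qm A) ->
  (forall s f0, phi A s f0 -> let c1 := addc c (sgnforms A B s) in
     (forall w, sat q c1.1 w -> phiP A B s w) ->
     refines q (EN n) c1 (rest s f0 c1) (nosol A B)) ->
  refines q (EN n) c (level rest A B c) (nosol A B).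
Proof.
move=> hA hr; apply: (refines_split (fs := sgnforms A B)) => [w sw sc bc|s _].
  under eq_bigr do rewrite sat_sgnforms.
  rewrite (bigD1_seq [ffun x => 0 <= (Fc A x.1 *m (B *m hw q w)) x.2 0]) ?mem_enum ?enum_uniq //=.
  by rewrite eqxx big1 // => s /negPf ->.
set c1 := addc _ _.
have hp w : sat q c1.1 w -> phiP A B s w.
  rewrite sat_cat sat_sgnforms => /andP[/eqP e _] f; rewrite /phi e; congr (_ && _).
  by apply: eq_forallb => k; rewrite ffunE.
case: pickP => [f0 hf|none]; first by apply: hr.
(* Without a feasible choice the polytope is empty, so the whole cell is kept. *)
apply: refines_pad => w sw sc bc [y hy].
have [|f [f1 f2 _]] := @lp_choice _ _ A (B *m hw q w) (qm y) 0 hA.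
  by move=> i; rewrite qm_slack ler0z.
by have := none f; rewrite (hp w sc f) f1 /=; case: forallP.
Qed.

Definition shiftB q (i : int) (lc : 'cV[int]_M) (B : 'M[int]_(M, q.+1)) : 'M[int]_(M, q.+1) :=
  \matrix_(k, j) (B k j + i * lc k 0 * (j == 0)%:R).

Lemma shiftBE q i lc (B : 'M[int]_(M, q.+1)) w k :
  (shiftB i lc B *m hw q w) k 0 = (B *m hw q w) k 0 + i * lc k 0.
Proof.
rewrite [LHS]mxE; transitivity (\sum_j (B k j * hw q w j 0 + i * lc k 0 * ((j == 0)%:R * hw q w j 0))).
  by apply: eq_bigr => j _; rewrite [shiftB _ _ _ _ _]mxE; ring.
rewrite big_split /= -mulr_sumr [(B *m _) _ _]mxE; congr (_ + _).
rewrite (bigD1 0) //= ?eqxx mul1r [hw _ _ _ _]mxE big1 ?addr0 ?mulr1 //.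
by move=> j ne; rewrite (negPf ne) mul0r.
Qed.

Section Go.
Variables (n E : nat) (D : forall q, 'M[int]_(M, n) -> 'M[int]_(M, q.+1) -> acell -> seq acell).
Variables (A : 'M[int]_(M, n)) (lc : 'cV[int]_M).

(** All slices must be free of integer points: each one is treated on the leaves left by the
    preceding ones, and the parameters accumulate. *)
Fixpoint go (ls : seq int) q (B : 'M[int]_(M, q.+1)) c : seq acell :=
  if ls is i :: ls' then flatten [seq go ls' (liftB E B) L | L <- D A (shiftB i lc B) c] else [:: c].

Lemma go_ok ls q (B : 'M[int]_(M, q.+1)) c :
  (forall q (B : 'M[int]_(M, q.+1)) c, refines q E c (D A B c) (nosol A B)) ->
  refines q (size ls * E) c (go ls B c) (fun w => forall i, i \in ls -> nosol A (shiftB i lc B) w).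
Proof.
move=> hD; elim: ls q B c => [|i ls IH] q B c /=; first exact: refines_self.
rewrite mulSnr; apply: refines_ext (refines_comp (hD _ (shiftB i lc B) c)
  (Q2 := fun w => forall i, i \in ls -> nosol A (shiftB i lc B) w) _).
  move=> w _ _ _; split=> [[h1 h2] j|h]; first by rewrite inE => /orP[/eqP ->|/h2].
  by split=> [|j hj]; apply: h; rewrite inE ?eqxx ?hj ?orbT.
move=> L hL; apply: refines_ext (IH _ _ _) => w sw _ _.
have st : size (take E w) = E by rewrite size_takel // sw leq_addr.
have e j k : (shiftB j lc (liftB E B) *m hw (E + q) w) k 0 = (shiftB j lc B *m hw q (drop E w)) k 0.
  by rewrite !shiftBE -{1}(cat_take_drop E w) liftBE.
have z j y k : zslack A (shiftB j lc (liftB E B) *m hw (E + q) w) y k =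
  zslack A (shiftB j lc B *m hw q (drop E w)) y k by rewrite /zslack e.
by split=> h j hj [y hy]; apply: (h j hj); exists y => k; have := hy k; rewrite z.
Qed.

End Go.

Section Step.
Variables (n q : nat) (A : 'M[int]_(M, n.+1)) (B : 'M[int]_(M, q.+1)).
Variables (U : 'M[int]_n.+1) (f0 : choice n.+1).

(** The constraints in the coordinates [x] of the reduced basis, [y = U^T x]. *)
Definition A1 := A *m U^T.
Definition subA : 'M[int]_(M, n) := \matrix_(k, j) A1 k (widen_ord (leqnSn n) j).
Definition lastA : 'cV[int]_M := \col_k A1 k ord_max.
(** The last coordinate is [e + i]: the new parameter [e] enters here, the offset [i] of a slice
    through [shiftB]. *)
Definition subB : 'M[int]_(M, (1 + q).+1) :=
  \matrix_(k, j) (liftB 1 B k j + lastA k 0 * ((j : nat) == 1%N)%:R).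
Definition numM : 'M[int]_(n.+1, q.+1) := (uinv U)^T *m (Vc A f0 *m B).
Definition numE : 'M[int]_(n.+1, (1 + q).+1) :=
  \matrix_(k, j) (liftB 1 numM k j - dt A f0 ^+ 2 * ((j : nat) == 1%N)%:R).
(** The two forms say [0 <= N - D e <= D - 1], with [D = dt A f0 ^ 2] and [N / D] the last
    coordinate of the vertex; so [e] is the floor of that coordinate, a function of the old
    parameters. *)
Definition xcell (c : acell) : acell :=
  (rsc 1 0 numE ord_max :: rsc (-1) (dt A f0 ^+ 2 - 1) numE ord_max :: liftc 1 c.1, uclk numM c.2).

Lemma addcolE k (Z : 'M[int]_(k, q.+1)) (v : 'I_k -> int) i e w :
  ((\matrix_(i, j) (liftB 1 Z i j + v i * ((j : nat) == 1%N)%:R)) *m hw (1 + q) (e :: w)) i 0 =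
  (Z *m hw q w) i 0 + v i * e.
Proof.
have <- := @liftBE 1 q k Z i [:: e] w erefl; rewrite ![(_ *m _) _ _]mxE.
transitivity (\sum_j (liftB 1 Z i j * hw (1 + q) (e :: w) j 0 + v i * (((j : nat) == 1%N)%:R * hw (1 + q) (e :: w) j 0))).
  by apply: eq_bigr => j _; rewrite [X in X * _]mxE; ring.
rewrite big_split /= -mulr_sumr; congr (_ + _ * _).
have lt : (1 < (1 + q).+1)%N by [].
rewrite (bigD1 (Ordinal lt)) //= mul1r mxE /= big1 ?addr0 // => j ne.
by case: eqP => e1; [case/eqP: ne; apply: val_inj|rewrite mul0r].
Qed.

Lemma subBE e w k : (subB *m hw (1 + q) (e :: w)) k 0 = (B *m hw q w) k 0 + lastA k 0 * e.
Proof. exact: (addcolE B (fun k => lastA k 0)). Qed.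

Lemma numEE e w k : (numE *m hw (1 + q) (e :: w)) k 0 = (numM *m hw q w) k 0 - dt A f0 ^+ 2 * e.
Proof.
have := addcolE numM (fun=> - dt A f0 ^+ 2) k e w; rewrite mulNr => <-.
by congr ((_ *m _) _ _); apply/matrixP => i j; rewrite [LHS]mxE [RHS]mxE mulNr.
Qed.

Definition fl w := ((numM *m hw q w) ord_max ord0 %/ dt A f0 ^+ 2)%Z.

Lemma sat_xcell c e w : dt A f0 != 0 -> sat (1 + q) (xcell c).1 (e :: w) = (e == fl w) && sat q c.1 w.
Proof.
move=> d0; have D0 : 0 < dt A f0 ^+ 2 by rewrite exprn_even_gt0.
have -> : sat (1 + q) (xcell c).1 (e :: w) = (0 <= av (1 + q) (rsc 1 0 numE ord_max) (e :: w)) &&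
    (0 <= av (1 + q) (rsc (-1) (dt A f0 ^+ 2 - 1) numE ord_max) (e :: w)) && sat (1 + q) (liftc 1 c.1) ([:: e] ++ w).
  by rewrite -andbA.
rewrite sat_liftc //; congr (_ && _).
rewrite !av_rsc !numEE /fl; set N := (numM *m _) _ _; set Dd := dt A f0 ^+ 2 in D0 *.
have := divz_eq N Dd; have := modz_ge0 N (lt0r_neq0 D0); have := ltz_pmod N D0.
set r := (N %% Dd)%Z; set p := (N %/ Dd)%Z => r2 r1 eN; rewrite eN.
by apply/idP/eqP => [/andP[h1 h2]|->]; [nia|apply/andP; split; nia].
Qed.

Lemma refines_xcell c : dt A f0 != 0 -> refines q 1 c [:: xcell c] (fun=> True).
Proof.
move=> d0; split=> [L w [|e [|]] //|w sw sc bc].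
  by rewrite inE => /eqP -> _ _; rewrite sat_xcell // => /andP[].
rewrite big_seq1; split.
  by rewrite !asboolT //; exists [:: fl w]; split=> //; rewrite sat_xcell // eqxx.
move=> L [|e [|]] //; rewrite inE => /eqP -> _; rewrite sat_xcell // => /andP[/eqP -> _]; split.
  apply/allP => z; rewrite inE => /orP[/eqP ->|hz]; last first.
    have /allP/(_ z hz) h := bc; apply: leq_trans h _; rewrite leq_exp2l //.
    by rewrite /xcell /= /uclk !size_cat addnCA leq_addr.
  have h := @uclkP q n.+1 numM c.2 w ord_max bc; apply: leq_ltn_trans h; rewrite /fl.
  have D0 : 0 < dt A f0 ^+ 2 by rewrite exprn_even_gt0.
  move: ((numM *m _) _ _) (dt A f0 ^+ 2) D0 => N Dd D0; clear -D0.
  have := divz_eq N Dd; have := modz_ge0 N (lt0r_neq0 D0); have := ltz_pmod N D0.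
  set r := (N %% Dd)%Z; set p := (N %/ Dd)%Z => r2 r1 eN; rewrite eN; nia.
by move=> [|e' [|]] // _; rewrite sat_xcell // => /andP[/eqP -> _].
Qed.

Lemma mulmx_last (x : 'cV[int]_n.+1) k : (A1 *m x) k 0 =
  (subA *m (\col_j x (widen_ord (leqnSn n) j) 0)) k 0 + lastA k 0 * x ord_max 0.
Proof.
rewrite [LHS]mxE big_ord_recr [(subA *m _) _ _]mxE [lastA _ _]mxE /=; congr (_ + _).
by apply: eq_bigr => j _; rewrite [subA _ _]mxE [(\col_j _) _ _]mxE.
Qed.

Definition extx (x' : 'cV[int]_n) (t : int) : 'cV[int]_n.+1 :=
  \col_i (if insub (val i) is Some j then x' j 0 else t).

Lemma extx_max x' t : extx x' t ord_max 0 = t.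
Proof. by rewrite mxE insubN // ltnn. Qed.

Lemma extx_wid x' t : \col_j extx x' t (widen_ord (leqnSn n) j) 0 = x'.
Proof.
apply/matrixP => j k; rewrite ord1 !mxE /=; case: insubP => [l _ e|]; last by rewrite ltn_ord.
by congr (x' _ _); apply: val_inj.
Qed.

Definition slices : seq int := [seq i%:Z - (slabC M n)%:Z | i <- iota 0 (2 * slabC M n).+1].

(** By the slab bound every integer solution lies in one of finitely many slices around the vertex,
    and each slice is a problem in one variable less. *)
Lemma step_equiv w : dt A f0 != 0 -> U \in unitmx ->
  (forall y, (forall k, 0 <= zslack A (B *m hw q w) y k) ->
    `|dt A f0 ^+ 2 * ((uinv U)^T *m y) ord_max 0 - ((uinv U)^T *m (Vc A f0 *m (B *m hw q w))) ord_max 0|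
     <= (slabC M n)%:Z * dt A f0 ^+ 2) ->
  nosol A B w <-> (forall i, i \in slices -> nosol subA (shiftB i lastA subB) (fl w :: w)).
Proof.
move=> d0 hU hs; have uu := uinvE hU.
have sE x' i : forall k, zslack subA (shiftB i lastA subB *m hw (1 + q) (fl w :: w)) x' k =
    zslack A (B *m hw q w) (U^T *m extx x' (fl w + i)) k.
  move=> k; rewrite /zslack shiftBE subBE mulmxA -/A1 mulmx_last extx_wid extx_max; ring.
split=> [h i hi [x' hx']|h [y hy]].
  by apply: h; exists (U^T *m extx x' (fl w + i)) => k; rewrite -sE.
set x := (uinv U)^T *m y.
have yx : y = U^T *m x by rewrite /x mulmxA -trmx_mul (mulmx1C uu) trmx1 mul1mx.
have hb := hs y hy; rewrite -/x in hb.
pose i := x ord_max 0 - fl w; have xe : x = extx (\col_j x (widen_ord (leqnSn n) j) 0) (fl w + i).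
  rewrite /i addrC subrK; apply/matrixP => j k; rewrite ord1 [RHS]mxE; case: insubP => [l _ e|nl].
    by rewrite [RHS]mxE; congr (fun_of_matrix x _ _); apply: val_inj; rewrite /= e.
  by congr (fun_of_matrix x _ _); apply: val_inj; move: nl (ltn_ord j) => /=; lia.
have hi : i \in slices.
  have D0 : 0 < dt A f0 ^+ 2 by rewrite exprn_even_gt0.
  by have := slice_mem D0 hb; rewrite /i /fl /numM -!mulmxA.
apply: (h i hi); exists (\col_j x (widen_ord (leqnSn n) j) 0) => k.
by rewrite sE -xe -yx.
Qed.

Lemma norec_subA : U \in unitmx -> norec (qm A) -> norec (qm subA).
Proof.
move=> hU hA g hg; pose x : 'cV[rat]_n.+1 := \col_i (if insub (val i) is Some j then g j 0 else 0).
have hQ := qm_unit hU.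
have e k : (qm A *m (qm U^T *m x)) k 0 = (qm subA *m g) k 0.
  rewrite mulmxA -qm_mul -/A1 [LHS]mxE big_ord_recr /= [x ord_max 0]mxE insubN ?ltnn // mulr0 addr0.
  rewrite [RHS]mxE; apply: eq_bigr => j _; rewrite [x _ _]mxE /=; case: insubP => [l _ el|]; last by rewrite ltn_ord.
  by rewrite !qmE [subA _ _]mxE; congr (_ * g _ _); apply: val_inj.
have x0 : qm U^T *m x = 0 by apply: hA => k; rewrite e.
have : x = 0.
  have hT : qm U^T \in unitmx by rewrite qm_tr unitmx_tr.
  by rewrite -(mulKmx hT x) x0 mulmx0.
move/matrixP => h; apply/matrixP => j k; rewrite ord1; have := h (widen_ord (leqnSn n) j) 0; rewrite !mxE /=.
by case: insubP => [l _ el <-|]; [congr (g _ _); apply: val_inj|rewrite ltn_ord].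
Qed.

End Step.

Definition kcons q (R : 'M[int]_(M, q.+1)) (ks : seq (int * int)) : seq (seq int) :=
  flatten [seq [:: rsc 1 (- ((nth (1, 1) ks (k : 'I_M)).1 %/ 2)%Z) R k;
                   rsc (-1) ((nth (1, 1) ks k).1 - 1) R k] | k <- enum 'I_M].

Lemma sat_kcons q (R : 'M[int]_(M, q.+1)) ks w :
  sat q (kcons R ks) w = [forall k : 'I_M, inr (nth (1, 1) ks k) ((R *m hw q w) k 0)].
Proof.
apply/allP/forallP => h k.
  have h1 : (rsc 1 (- ((nth (1, 1) ks k).1 %/ 2)%Z) R k) \in kcons R ks.
    by apply/flattenP; eexists; [apply/mapP; exists k; [rewrite mem_enum|reflexivity]|rewrite inE eqxx].
  have h2 : (rsc (-1) ((nth (1, 1) ks k).1 - 1) R k) \in kcons R ks.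
    by apply/flattenP; eexists; [apply/mapP; exists k; [rewrite mem_enum|reflexivity]|rewrite !inE eqxx orbT].
  move: (h _ h1) (h _ h2); rewrite !av_rsc /inr; move: ((R *m hw q w) k 0) ((nth (1, 1) ks k).1) => z a; lia.
move=> /flattenP[s /mapP[l _ ->]]; have := h l; rewrite /inr !inE => hl /orP[] /eqP ->; rewrite av_rsc;
  move: hl; move: ((R *m hw q w) l 0) ((nth (1, 1) ks l).1) => z a; lia.
Qed.

Section Rest.
Variables (n q : nat) (D : forall q, 'M[int]_(M, n) -> 'M[int]_(M, q.+1) -> acell -> seq acell).
Variables (A : 'M[int]_(M, n.+1)) (B : 'M[int]_(M, q.+1)).

(** When the test succeeds a solution exists throughout the cell, so nothing of it is kept. *)
Definition branch (f0 : choice n.+1) (T : int) (ks : seq (int * int)) (c : acell) : seq acell :=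
  let S := wform A (fun k => (nth (1, 1) ks (k : 'I_M)).2) in
  let U := Red S in
  if (n.+1)%:R * \tr (cob S U) * Dlt A ^+ 2 * (nch M n)%:R ^+ 2 <= T then [::]
  else go (EN n) D (subA A U) (lastA A U) (slices n) (subB A B U) (xcell A B U f0 c).

(** [2 ^ size t] exceeds all scaled slacks, so one dyadic interval per constraint covers every case.
    With [M] fixed, the number of combinations is polynomial in the bit length. *)
Definition krest (s : ptn n.+1) (f0 : choice n.+1) (c : acell) : seq acell :=
  let R := Rc A (phi A s) *m B in
  let t := uclk R c.2 in
  flatten [seq branch f0 (4 ^+ size t) ks (addc c (kcons R ks)) | ks <- kseqs (ktab (size t)) M].

Lemma krest_ok s f0 c : norec (qm A) -> phi A s f0 ->
  (forall q (A : 'M[int]_(M, n)) (B : 'M[int]_(M, q.+1)) c, norec (qm A) ->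
     refines q (EN n) c (D A B c) (nosol A B)) ->
  (forall w, sat q c.1 w -> phiP A B s w) ->
  refines q (EN n.+1) c (krest s f0 c) (nosol A B).
Proof.
move=> hA hf hD hp; rewrite /krest; set R := Rc A _ *m B; set t := uclk R c.2.
have d0 : dt A f0 != 0 by case/andP: hf.
have RE w k : (R *m hw q w) k 0 = (Rc A (phi A s) *m (B *m hw q w)) k 0 by rewrite /R mulmxA.
have R0 w k : sat q c.1 w -> 0 <= (R *m hw q w) k 0.
  move=> sw; rewrite RE RcE; apply: sumr_ge0 => f; rewrite (hp w sw) => /andP[_ /forallP h].
  by rewrite mulr_ge0 // ltW // Dof_gt0.
apply: (refines_split (fs := kcons R)) => [w sw sc bc|ks hks].
  under eq_bigr do rewrite sat_kcons nat_forall.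
  rewrite (sum_kseqs (ktab (size t)) (1, 1) (fun k x => inr x ((R *m hw q w) k 0) : nat)) big1 // => k _.
  apply: ktab_cover; first exact: R0.
  have := uclkP R k bc; rewrite -/t -(ltz_nat) => h; have := R0 w k sc.
  have e2 : (2 ^ size t)%N%:Z = 2 ^+ size t by rewrite -[LHS]natz natrX.
  by move: h; rewrite e2; move: (_ ^+ _) (fun_of_matrix _ _ _) => a b; lia.
rewrite /branch; set wt := fun k : 'I_M => _; set S := wform A wt; set U := Red S.
pose hi (k : 'I_M) := (nth (1, 1) ks k).1.
have kp k : [/\ 0 < hi k, hi k ^+ 2 * wt k = 4 ^+ size t & hi k = 1 \/ 2 * (hi k %/ 2)%Z = hi k].
  by apply: ktabP; apply: kseqs_mem.
have hwt k : hi k ^+ 2 * wt k = 4 ^+ size t by case: (kp k).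
have hi1 k : hi k = 1 \/ 2 * (hi k %/ 2)%Z = hi k by case: (kp k).
have hi0 k : 0 < hi k by case: (kp k).
have hS : pd (qm S) := pd_wform hA hwt hi0.
have [hU _] := Red_correct hS.
set c1 := addc c _.
have cp w : sat q c1.1 w -> [/\ phiP A B s w, forall k, (hi k %/ 2)%Z <= (Rc A (phi A s) *m (B *m hw q w)) k 0
    & forall k, (Rc A (phi A s) *m (B *m hw q w)) k 0 < hi k].
  rewrite sat_cat sat_kcons => /andP[/forallP h sc]; split; first exact: hp.
    by move=> k; have /andP[] := h k; rewrite RE.
  by move=> k; have /andP[] := h k; rewrite RE.
case: ifP => test.
  apply: refines_nil => w sw /cp[p1 p2 p3] _; apply: contrapT => hn; apply: hn => -[].
  exact: (decide_yes hA p1 p2 hwt hi1 hi0 hf test).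
have lt : 4 ^+ size t < (n.+1)%:R * \tr (cob S U) * Dlt A ^+ 2 * (nch M n)%:R ^+ 2 by rewrite ltNge test.
have hsl w : sat q c1.1 w -> nosol A B w <-> (forall i, i \in slices n -> nosol (subA A U) (shiftB i (lastA A U) (subB A B U)) (fl A B U f0 w :: w)).
  move=> /cp[p1 p2 p3]; apply: step_equiv => // y hy.
  exact: (decide_slab hA p1 p3 hwt hi0 hf lt hy).
have -> : EN n.+1 = (size (slices n) * EN n + 1)%N by rewrite size_map size_iota.
have := refines_comp (refines_xcell B U c1 d0) (E2 := (size (slices n) * EN n)%N)
  (Q2 := fun w => forall i, i \in slices n -> nosol (subA A U) (shiftB i (lastA A U) (subB A B U)) (fl A B U f0 w :: w))
  (G := go (EN n) D (subA A U) (lastA A U) (slices n) (subB A B U)).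
rewrite flatten_map1 => h; apply: refines_ext (h _) => [w sw sc bc|L].
  by rewrite hsl //; split=> // -[].
rewrite inE => /eqP ->; apply: refines_ext (go_ok _ _ _ _ _) => [w sw sc bc|q' B' c'].
  case: w sw sc {bc} => // e w _; rewrite sat_xcell // => /andP[/eqP -> _] /=.
  by rewrite drop0.
by apply: hD; apply: norec_subA.
Qed.

End Rest.

(** Without variables, a pattern with a feasible choice means that the empty vector is a solution,
    whence the empty list of cells. *)
Fixpoint Dec n : forall q, 'M[int]_(M, n) -> 'M[int]_(M, q.+1) -> acell -> seq acell :=
  if n is n'.+1 then fun q A B => level (krest (@Dec n') A B) A B
  else fun q A B => level (fun _ _ _ => [::]) A B.

Lemma Dec_ok n q (A : 'M[int]_(M, n)) (B : 'M[int]_(M, q.+1)) c : norec (qm A) ->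
  refines q (EN n) c (Dec A B c) (nosol A B).
Proof.
elim: n q A B c => [|n IH] q A B c hA; apply: level_ok => // s f0 hf c1 hp.
  apply: refines_nil => w sw sc bc; apply: contrapT => hn; apply: hn => -[].
  exists 0 => k; rewrite /zslack mulmx0 [(0 : 'M__) _ _]mxE add0r.
  have := hp w sc f0; rewrite hf => /esym/andP[_ /forallP/(_ k)]; rewrite FcE.
  have -> : dt A f0 = 1 by rewrite /dt det_mx00.
  by rewrite expr1n mul1r (_ : Vc A f0 *m _ = 0) ?mulmx0 ?[(0 : 'M__) _ _]mxE ?addr0 //; apply/matrixP => -[].
exact: krest_ok.
Qed.

End Decide.

(** * Polynomial time of the feasibility algorithm *)

Section PTparts.
Variable X : encType.

Lemma PT_rsc q k s (c : X -> int) (Z : X -> 'M[int]_(k, q.+1)) i : PT c -> PT Z ->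
  PT (fun x => rsc s (c x) (Z x) i).
Proof.
move=> hc hZ; apply: (@PT_mapc _ _ _ (fun x j => s * Z x i j + c x * (j == 0)%:R)) => j.
by apply: PT_addz; apply: PT_mulz => //; [exact: PT_cst|exact: PT_mxE|exact: PT_cst].
Qed.

Lemma PT_liftf E (f : X -> seq int) : PT f -> PT (fun x => liftf E (f x)).
Proof.
move=> hf; apply: PT_cons; first exact: PT_head.
by apply: PT_cat; [exact: PT_cst|exact: PT_behead].
Qed.

End PTparts.

Lemma PT_liftc (X : encType) E (c : X -> seq (seq int)) : PT c -> PT (fun x => liftc E (c x)).
Proof. by move=> hc; apply: (PT_map (F := fun _ => liftf E)) => //; exact/PT_liftf/PT_snd/PT_id. Qed.

Section PTparts2.
Variable X : encType.

Lemma PT_liftB E q k (Z : X -> 'M[int]_(k, q.+1)) : PT Z -> PT (fun x => liftB E (Z x)).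
Proof.
move=> hZ; apply: PT_mx => i j.
have : PT (fun x => nth 0 (liftf E [seq Z x i l | l <- enum 'I_q.+1]) j).
  by apply/PT_nth/PT_liftf/PT_mapc => l; apply: PT_mxE.
by apply: PT_ext => x; rewrite [RHS]mxE.
Qed.

Variables (m n : nat) (A : X -> 'M[int]_(m, n)).
Hypothesis hA : PT A.
Local Notation choice := {ffun 'I_n -> 'I_m}.
Implicit Type f : choice.

Lemma PT_dt f : PT (fun x => dt (A x) f).
Proof.
apply: PT_det; apply: PT_mx => i j; apply: PT_ext (PT_mxE (f i) j hA) => x.
by rewrite [RHS]mxE.
Qed.

Lemma PT_Vc f : PT (fun x => Vc (A x) f).
Proof.
have hs : PT (fun x => vsub (A x) f).
  by apply: PT_mx => i j; apply: PT_ext (PT_mxE (f i) j hA) => x; rewrite [RHS]mxE.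
apply: PT_mx => i j.
have h := PT_mulmx (PT_adj hs) (PT_cst X (selm f)).
apply: PT_ext (PT_mulz (PT_oppz (PT_dt f)) (PT_mxE i j h)) => x; by rewrite [RHS]mxE.
Qed.

Lemma PT_Fc f : PT (fun x => Fc (A x) f).
Proof.
apply: PT_mx => i j; have h := PT_mulmx hA (PT_Vc f).
have := PT_addz (PT_mulz (PT_cst X ((i == j)%:R : int)) (PT_expz 2 (PT_dt f))) (PT_mxE i j h).
by apply: PT_ext => x; rewrite [RHS]mxE.
Qed.

Lemma PT_dtn0 f : PT (fun x => dt (A x) f != 0).
Proof. by apply/PT_negb/PT_eqz; [exact: PT_dt|exact: PT_cst]. Qed.

Lemma PT_Dlt : PT (fun x => Dlt (A x)).
Proof. by apply: PT_prodz => f; [exact/PT_expz/PT_dt|exact: PT_dtn0]. Qed.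

Lemma PT_Dof f : PT (fun x => Dof (A x) f).
Proof.
apply: PT_prodz => g; first exact/PT_expz/PT_dt.
by apply: PT_andb; [exact: PT_dtn0|exact: PT_cst].
Qed.

Lemma PT_Rc (P : X -> pred choice) : (forall f, PT (fun x => P x f)) -> PT (fun x => Rc (A x) (P x)).
Proof.
move=> hP; apply: PT_mx => i j.
have : PT (fun x => \sum_(f | P x f) Dof (A x) f * Fc (A x) f i j).
  apply: PT_sumz => f //; apply: PT_mulz; [exact: PT_Dof|exact/PT_mxE/PT_Fc].
by apply: PT_ext => x; rewrite [RHS]mxE.
Qed.

End PTparts2.

Lemma PT_uclk (X : encType) q k (Z : X -> 'M[int]_(k, q.+1)) (t : X -> seq unit) : PT Z -> PT t ->
  PT (fun x => uclk (Z x) (t x)).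
Proof.
move=> hZ ht; apply: PT_cat; first exact: (PT_comp hZ (PT_clock _)).
by apply: PT_cat => //; exact: PT_cst.
Qed.

Definition kstep (s : seq (int * int) * int) : seq (int * int) * int :=
  ((1, 4 * s.2) :: [seq (2 * x.1, x.2) | x <- s.1], 4 * s.2).

Lemma iter_kstep T : iter T kstep ([:: (1, 1)], 1) = (ktab T, 4 ^+ T).
Proof. by elim: T => //= T ->; rewrite /kstep /= exprS. Qed.

Lemma ktab_size T : size (ktab T) = T.+1.
Proof. by elim: T => //= T IH; rewrite size_map IH. Qed.

Lemma ktab_le T x : x \in ktab T -> (absz x.1 <= 2 ^ T)%N && (absz x.2 <= 4 ^ T)%N.
Proof.
have h4 k : absz (4 ^+ k : int) = (4 ^ k)%N by rewrite abszX.
elim: T x => [|T IH] x /=; first by rewrite inE => /eqP ->.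
rewrite inE => /orP[/eqP -> /=|/mapP[y /IH/andP[h1 h2] ->]] /=; first by rewrite h4 leqnn expn_gt0.
by rewrite abszM expnS leq_mul //= expnS (leq_trans h2) // leq_pmull.
Qed.

Lemma PT_kpair (X : encType) (t : X -> seq unit) : PT t ->
  PT (fun x => (ktab (size (t x)), (4 ^+ size (t x) : int))).
Proof.
move=> ht.
have h : PT (fun x => iter (size (t x)) kstep ([:: ((1 : int), (1 : int))], (1 : int))).
  apply: (@PT_loop _ _ t (fun=> ([:: ((1 : int), (1 : int))], (1 : int))) (fun=> kstep)
    (fun x => (sz (t x) + 2) * (2 * (4 * (2 * sz (t x) + 1) + 5) + 4) + (4 * (2 * sz (t x) + 1) + 5) + 5)%N) => //.
  - exact: PT_cst.
  - have h4 : PT (fun p : X * (seq (int * int) * int) => 4 * p.2.2).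
      by apply: PT_mulz; [exact: PT_cst|exact/PT_snd/PT_snd/PT_id].
    apply: PT_pair => //; apply: PT_cons; first by apply: PT_pair => //; exact: PT_cst.
    apply: (PT_map (F := fun _ (y : int * int) => (2 * y.1, y.2))); last exact/PT_fst/PT_snd/PT_id.
    apply: PT_pair; last exact/PT_snd/PT_snd/PT_id.
    by apply: PT_mulz; [exact: PT_cst|exact/PT_fst/PT_snd/PT_id].
  - have hs : pbd (fun x => sz (t x)) by exact: pbd_sz.
    by do ![apply: pbd_add|apply: pbd_mul|exact: pbd_cst|exact: hs].
  move=> x k lek; rewrite iter_kstep sz_pair.
  have le : (k <= sz (t x))%N by apply: leq_trans lek (ltnW (sz_size _)).
  have p4 : (4 ^ k < 2 ^ (2 * sz (t x) + 1))%N.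
    by rewrite -[4%N]/(2 ^ 2)%N -expnM ltn_exp2l // addn1 ltnS leq_mul2l le orbT.
  have a1 : (sz (4 ^+ k : int) <= 4 * (2 * sz (t x) + 1) + 5)%N by apply: sz_int_le; rewrite abszX.
  have a2 : (sz (ktab k) <= size (ktab k) * (2 * (4 * (2 * sz (t x) + 1) + 5) + 1).+1 + 1)%N.
    apply: sz_seq_le => s1 y s2 e.
    have /ktab_le/andP[y1 y2] : y \in ktab k by rewrite e mem_cat inE eqxx orbT.
    have p2 : (2 ^ k <= 4 ^ k)%N by case: (k) => // k'; rewrite leq_exp2r.
    have b1 : (sz y.1 <= 4 * (2 * sz (t x) + 1) + 5)%N.
      by apply: sz_int_le; apply: leq_ltn_trans y1 _; apply: leq_ltn_trans p2 p4.
    have b2 : (sz y.2 <= 4 * (2 * sz (t x) + 1) + 5)%N by apply: sz_int_le; apply: leq_ltn_trans y2 p4.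
    have -> : sz y = (sz y.1 + sz y.2).+1 by case: (y) => ? ?; exact: sz_pair.
    by have := leq_add b1 b2; move: (sz _ + sz _)%N => z; lia.
  rewrite ktab_size in a2.
  have a3 : (k.+1 * (2 * (4 * (2 * sz (t x) + 1) + 5) + 1).+1 <= (sz (t x) + 2) * (2 * (4 * (2 * sz (t x) + 1) + 5) + 4))%N.
    by move: le; clear; move: (sz (t x)) => z le; apply: leq_mul; lia.
  have := leq_add (leq_trans a2 (leq_add a3 (leqnn 1))) a1.
  by move: (sz _ + sz _)%N => u; lia.
by apply: PT_ext h => x; rewrite iter_kstep.
Qed.

Lemma PT_kseqs (X Y : encType) (l : X -> seq Y) k : PT l -> PT (fun x => kseqs (l x) k).
Proof.
move=> hl; elim: k => [|k IH] /=; first exact: PT_cst.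
apply: PT_flatten; apply: (PT_map (F := fun x y => [seq y :: s | s <- kseqs (l x) k])) => //.
apply: (PT_map (F := fun (p : X * Y) s => p.2 :: s)).
  by apply: PT_cons; [exact/PT_snd/PT_fst/PT_id|exact/PT_snd/PT_id].
exact: (PT_comp (PT_fst (PT_id _)) IH).
Qed.

Section PTDec.
Variable m : nat.
Local Notation M := m.+1.
Local Notation choice n := {ffun 'I_n -> 'I_M}.

Lemma PT_addc (X : encType) (c : X -> acell) fs : PT c -> PT fs -> PT (fun x => addc (c x) (fs x)).
Proof. by move=> hc hf; apply: PT_pair; [apply: PT_cat => //; exact: PT_fst|exact: PT_snd]. Qed.

Lemma PT_sgnforms (X : encType) n q (A : X -> 'M[int]_(M, n)) (B : X -> 'M[int]_(M, q.+1)) s :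
  PT A -> PT B -> PT (fun x => sgnforms (A x) (B x) s).
Proof.
move=> hA hB; apply: PT_mapc => f; have h := PT_mulmx (PT_Fc hA f.1) hB.
by case: (s f); apply: PT_rsc => //; exact: PT_cst.
Qed.

Lemma PT_padc (X : encType) E (c : X -> acell) : PT c -> PT (fun x => padc E (c x)).
Proof.
move=> hc; apply: PT_pair; last exact: PT_snd.
by apply: PT_cat; [exact: PT_cst|exact/PT_liftc/PT_fst].
Qed.

Lemma PT_level (X : encType) n q (rest : X -> ptn m n -> choice n -> acell -> seq acell)
    (A : X -> 'M[int]_(M, n)) (B : X -> 'M[int]_(M, q.+1)) (c : X -> acell) : PT A -> PT B -> PT c ->
  (forall s f, PT (fun x => rest x s f (addc (c x) (sgnforms (A x) (B x) s)))) ->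
  PT (fun x => level (rest x) (A x) (B x) (c x)).
Proof.
move=> hA hB hc hr; apply: PT_flatten; apply: PT_mapc => s.
have h1 := PT_addc hc (PT_sgnforms s hA hB).
apply: (@PT_pick _ _ _ (fun x f => phi (A x) s f)
  (fun x o => if o is Some f0 then rest x s f0 (addc (c x) (sgnforms (A x) (B x) s))
    else [:: padc (EN m n) (addc (c x) (sgnforms (A x) (B x) s))])) => [f|[f|]] //.
  by apply: PT_andb; [exact: PT_dtn0|exact: PT_cst].
by apply: PT_cons; [exact: PT_padc|exact: PT_cst].
Qed.

Lemma PT_shiftB (X : encType) q i (lc : X -> 'cV[int]_M) (B : X -> 'M[int]_(M, q.+1)) :
  PT lc -> PT B -> PT (fun x => shiftB i (lc x) (B x)).
Proof.
move=> hl hB; apply: PT_mx => k j.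
have := PT_addz (PT_mxE k j hB) (PT_mulz (PT_mulz (PT_cst X i) (PT_mxE k 0 hl)) (PT_cst X ((j == 0)%:R : int))).
by apply: PT_ext => x; rewrite [RHS]mxE.
Qed.

Definition PTD n (D : forall q, 'M[int]_(M, n) -> 'M[int]_(M, q.+1) -> acell -> seq acell) :=
  forall q, PT (fun p : 'M[int]_(M, n) * ('M[int]_(M, q.+1) * acell) => D q p.1 p.2.1 p.2.2).

Lemma PT_go (X : encType) n E D ls q (A : X -> 'M[int]_(M, n)) lc (B : X -> 'M[int]_(M, q.+1)) c :
  PTD D -> PT A -> PT lc -> PT B -> PT c -> PT (fun x => go E D (A x) (lc x) ls (B x) (c x)).
Proof.
move=> hD; elim: ls q X A lc B c => [|i ls IH] q X A lc B c hA hl hB hc /=.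
  by apply: PT_cons => //; exact: PT_cst.
apply: PT_flatten; apply: (PT_map (F := fun x L => go E D (A x) (lc x) ls (liftB E (B x)) L)); last first.
  exact: (PT_app3 (hD q) hA (PT_shiftB i hl hB) hc).
have f1 (Y : encType) (g : X -> Y) : PT g -> PT (fun p : X * acell => g p.1).
  by move=> hg; exact: (PT_comp (PT_fst (PT_id _)) hg).
apply: (IH _ _ (fun p : X * acell => A p.1) (fun p => lc p.1) (fun p => liftB E (B p.1)) (fun p => p.2)).
- exact: f1.
- exact: f1.
- exact: (f1 _ _ (PT_liftB E hB)).
- exact/PT_snd/PT_id.
Qed.

Section PTStep.
Variables (X : encType) (n q : nat) (A : X -> 'M[int]_(M, n.+1)) (B : X -> 'M[int]_(M, q.+1)).
Variables (U : X -> 'M[int]_n.+1) (f0 : choice n.+1).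
Hypotheses (hA : PT A) (hB : PT B) (hU : PT U).

Lemma PT_A1 : PT (fun x => A1 (A x) (U x)).
Proof. by apply: PT_mulmx => //; exact: PT_trmx. Qed.

Lemma PT_subA : PT (fun x => subA (A x) (U x)).
Proof.
apply: PT_mx => k j; apply: PT_ext (PT_mxE k (widen_ord (leqnSn n) j) PT_A1) => x.
by rewrite [RHS]mxE.
Qed.

Lemma PT_lastA : PT (fun x => lastA (A x) (U x)).
Proof. by apply: PT_mx => k j; apply: PT_ext (PT_mxE k ord_max PT_A1) => x; rewrite [RHS]mxE. Qed.

Lemma PT_subB : PT (fun x => subB (A x) (B x) (U x)).
Proof.
apply: PT_mx => k j; have hl := PT_liftB 1 hB.
have := PT_addz (PT_mxE k j hl) (PT_mulz (PT_mxE k 0 PT_lastA) (PT_cst X (((j : nat) == 1%N)%:R : int))).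
by apply: PT_ext => x; rewrite [RHS]mxE.
Qed.

Lemma PT_uinv : PT (fun x => uinv (U x)).
Proof.
apply: PT_mx => i j; apply: PT_ext (PT_mulz (PT_det hU) (PT_mxE i j (PT_adj hU))) => x.
by rewrite [RHS]mxE.
Qed.

Lemma PT_numM : PT (fun x => numM (A x) (B x) (U x) f0).
Proof. by apply: PT_mulmx; [exact/PT_trmx/PT_uinv|apply: PT_mulmx => //; exact: PT_Vc]. Qed.

Lemma PT_numE : PT (fun x => numE (A x) (B x) (U x) f0).
Proof.
apply: PT_mx => k j; have hl := PT_liftB 1 PT_numM.
have := PT_subz (PT_mxE k j hl) (PT_mulz (PT_expz 2 (PT_dt hA f0)) (PT_cst X (((j : nat) == 1%N)%:R : int))).
by apply: PT_ext => x; rewrite [RHS]mxE.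
Qed.

Lemma PT_xcell c : PT c -> PT (fun x => xcell (A x) (B x) (U x) f0 (c x)).
Proof.
move=> hc; apply: PT_pair; last by apply: PT_uclk; [exact: PT_numM|exact: PT_snd].
apply: PT_cons; first by apply: PT_rsc; [exact: PT_cst|exact: PT_numE].
apply: PT_cons; last exact/PT_liftc/PT_fst.
by apply: PT_rsc; [apply: PT_subz; [exact/PT_expz/PT_dt|exact: PT_cst]|exact: PT_numE].
Qed.

End PTStep.

Lemma PT_kcons (X : encType) q (R : X -> 'M[int]_(M, q.+1)) (ks : X -> seq (int * int)) : PT R -> PT ks ->
  PT (fun x => kcons (R x) (ks x)).
Proof.
move=> hR hk; apply: PT_flatten; apply: PT_mapc => k; have h := PT_fst (PT_nth ((1 : int), (1 : int)) k hk).
apply: PT_cons.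
  apply: PT_rsc => //; apply: PT_oppz; apply: PT_ext (PT_divz h (PT_cst X (2 : int))) => x.
  by [].
by apply: PT_cons; [apply: PT_rsc => //; apply: PT_subz => //; exact: PT_cst|exact: PT_cst].
Qed.

Lemma PT_branch (X : encType) n q D (A : X -> 'M[int]_(M, n.+1)) (B : X -> 'M[int]_(M, q.+1)) f0 T ks c :
  PTD D -> PT A -> PT B -> PT T -> PT ks -> PT c ->
  PT (fun x => branch D (A x) (B x) f0 (T x) (ks x) (c x)).
Proof.
move=> hD hA hB hT hk hc.
have hS : PT (fun x => wform (A x) (fun k => (nth (1, 1) (ks x) (k : 'I_M)).2)).
  apply: PT_mx => i j.
  have : PT (fun x => \sum_k (nth (1, 1) (ks x) (k : 'I_M)).2 * A x k i * A x k j).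
    apply: PT_sumz => k; last exact: PT_cst.
    by apply: PT_mulz; [apply: PT_mulz; [exact/PT_snd/PT_nth|]|]; exact: PT_mxE.
  by apply: PT_ext => x; rewrite [RHS]mxE.
have hU := PT_comp hS (@PT_Red _).
apply: PT_if; last 1 first.
- apply: PT_go => //; [exact: PT_subA|exact: PT_lastA|exact: PT_subB|exact: PT_xcell].
- apply: PT_lez => //; apply: PT_mulz; last exact: PT_cst.
  apply: PT_mulz; last exact/PT_expz/PT_Dlt.
  by apply: PT_mulz; [exact: PT_cst|apply: PT_mxtrace; exact: PT_cob].
- exact: PT_cst.
Qed.

Lemma PT_krest (X : encType) n q D (A : X -> 'M[int]_(M, n.+1)) (B : X -> 'M[int]_(M, q.+1)) s f0 c :
  PTD D -> PT A -> PT B -> PT c -> PT (fun x => krest D (A x) (B x) s f0 (c x)).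
Proof.
move=> hD hA hB hc.
have hR : PT (fun x => Rc (A x) (phi (A x) s) *m B x).
  apply: PT_mulmx => //; apply: PT_Rc => // f.
  by apply: PT_andb; [exact: PT_dtn0|exact: PT_cst].
have hk := PT_kpair (PT_uclk hR (PT_snd hc)).
apply: PT_flatten; apply: (PT_map (F := fun x ks => branch D (A x) (B x) f0
  (4 ^+ size (uclk (Rc (A x) (phi (A x) s) *m B x) (c x).2)) ks (addc (c x) (kcons (Rc (A x) (phi (A x) s) *m B x) ks)))).
  have f1 (Y : encType) (g : X -> Y) : PT g -> PT (fun p : X * seq (int * int) => g p.1).
    by move=> hg; exact: (PT_comp (PT_fst (PT_id _)) hg).
  apply: (@PT_branch (prod_enc X (seq_enc (prod_enc int_enc int_enc))) n q D (fun p => A p.1) (fun p => B p.1) f0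
    (fun p => 4 ^+ size (uclk (Rc (A p.1) (phi (A p.1) s) *m B p.1) (c p.1).2)) (fun p => p.2)
    (fun p => addc (c p.1) (kcons (Rc (A p.1) (phi (A p.1) s) *m B p.1) p.2))) => //.
  - exact: f1.
  - exact: f1.
  - exact: (f1 _ _ (PT_snd hk)).
  - exact/PT_snd/PT_id.
  - by apply: PT_addc; [exact: f1|apply: PT_kcons; [exact: (f1 _ _ hR)|exact/PT_snd/PT_id]].
exact/PT_kseqs/(PT_fst hk).
Qed.

Lemma PT_Dec n : PTD (@Dec m n).
Proof.
elim: n => [|n IH] q.
  apply: (@PT_level (prod_enc (mx_enc M 0) (prod_enc (mx_enc M q.+1) (prod_enc (seq_enc (seq_enc int_enc)) (seq_enc unit_enc)))) 0 q
    (fun _ _ _ _ => [::]) (fun p => p.1) (fun p => p.2.1) (fun p => p.2.2)).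
  - exact/PT_fst/PT_id.
  - exact/PT_fst/PT_snd/PT_id.
  - exact/PT_snd/PT_snd/PT_id.
  - by move=> s f; exact: PT_cst.
have hA : PT (fun p : 'M[int]_(M, n.+1) * ('M[int]_(M, q.+1) * acell) => p.1) by exact/PT_fst/PT_id.
have hB : PT (fun p : 'M[int]_(M, n.+1) * ('M[int]_(M, q.+1) * acell) => p.2.1) by exact/PT_fst/PT_snd/PT_id.
have hc : PT (fun p : 'M[int]_(M, n.+1) * ('M[int]_(M, q.+1) * acell) => p.2.2) by exact/PT_snd/PT_snd/PT_id.
apply: (PT_level (rest := fun p => krest (@Dec m n) p.1 p.2.1)) => // s f.
by apply: PT_krest => //; apply: PT_addc => //; apply: PT_sgnforms.
Qed.

Lemma size_flatten2 (T U : Type) (F : T -> seq U) s : (forall x, size (F x) = 2) -> size (flatten (map F s)) = (2 * size s)%N.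
Proof. by move=> h; elim: s => //= x s IH; rewrite size_cat IH h; lia. Qed.

(** Bounds the number of forms that a leaf adds to its cell, in terms of the dimensions only, so
    that all leaves fit a matrix of one width. *)
Fixpoint ZN n : nat := #|{: choice n * 'I_M}| + 2 * EN m n +
  (if n is n'.+1 then 2 * M + 2 + size (slices m n') * ZN n' else 0).

Lemma size_sgnforms n q (A : 'M[int]_(M, n)) (B : 'M[int]_(M, q.+1)) s :
  size (sgnforms A B s) = #|{: choice n * 'I_M}|.
Proof. by rewrite size_map; exact/esym/cardT. Qed.

Lemma level_size n q rest (A : 'M[int]_(M, n)) (B : 'M[int]_(M, q.+1)) c (L : acell) Z :
  (forall s f0 c1, L \in rest s f0 c1 -> (size L.1 <= size c1.1 + Z)%N) ->
  L \in level rest A B c -> (size L.1 <= size c.1 + (#|{: choice n * 'I_M}| + 2 * EN m n + Z))%N.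
Proof.
move=> h /flattenP[l /mapP[s _ ->]]; have sp := size_sgnforms A B s.
case: pickP => [f0 _ /h|_]; first by rewrite /= size_cat sp; move: #|_| => a; lia.
rewrite inE => /eqP ->; rewrite /= !size_cat size_map size_cat sp size_flatten2 // size_iota.
by move: #|_| => a; lia.
Qed.

Lemma Dec_size n q (A : 'M[int]_(M, n)) (B : 'M[int]_(M, q.+1)) c (L : acell) : L \in Dec A B c ->
  (size L.1 <= size c.1 + ZN n)%N.
Proof.
elim: n q A B c L => [|n IH] q A B c L; first exact: level_size.
apply: level_size => s f0 c1 /flattenP[l' /mapP[ks _ ->]]; rewrite /branch; case: ifP => // _.
have hgo ls q' (A' : 'M[int]_(M, n)) lc (B' : 'M[int]_(M, q'.+1)) c' :
    L \in go (EN m n) (@Dec m n) A' lc ls B' c' -> (size L.1 <= size c'.1 + size ls * ZN n)%N.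
  elim: ls q' B' c' => [|i ls IH'] q' B' c' /=; first by rewrite inE => /eqP ->; rewrite addn0.
  move=> /flattenP[l2 /mapP[L' hL' ->]] /IH' h; have h' := IH _ _ _ _ _ hL'.
  by apply: leq_trans h _; rewrite mulSn addnA leq_add2r.
move=> /hgo h; apply: leq_trans h _.
set U := Red _; set c2 := addc _ _; have -> : size (xcell A B U f0 c2).1 = (size c2.1).+2 by rewrite /= size_map.
have -> : size c2.1 = (2 * M + size c1.1)%N by rewrite size_cat size_flatten2 // size_enum_ord.
by move: (size c1.1) (size (slices m n) * ZN n)%N => a e; lia.
Qed.

End PTDec.

(** * Generating functions of projections *)

Section Lists.
Variables (p : nat) (K : fieldType) (chi : 'rV[int]_p -> K).
Hypothesis chiD : forall u v, chi (u + v) = chi u * chi v.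
Local Notation V := 'rV[int]_p.
Implicit Types (l : seq (int * V)) (phi : V -> int) (g v : V).

Definition lval l v : int := \sum_(x <- l) x.1 * (x.2 == v)%:R.
Definition leval l : K := \sum_(x <- l) x.1%:~R * chi x.2.

Lemma leval_supp l (S : seq V) : uniq S -> (forall x, x \in l -> x.2 \in S) ->
  leval l = \sum_(v <- S) (lval l v)%:~R * chi v.
Proof.
move=> uS h; transitivity (\sum_(v <- S) \sum_(x <- l) (x.1%:~R * (x.2 == v)%:R) * chi v); last first.
  apply: eq_bigr => v _; rewrite -mulr_suml /lval rmorph_sum /=; congr (_ * _); apply: eq_bigr => x _.
  by rewrite intrM; case: eqP.
rewrite exchange_big /=; apply: eq_big_seq => x /h hx.
rewrite (bigD1_seq x.2) //= eqxx mulr1 big1 ?addr0 // => v /negPf ne.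
by rewrite eq_sym ne mulr0 mul0r.
Qed.

Lemma leval_ext l l' : lval l =1 lval l' -> leval l = leval l'.
Proof.
move=> h; pose S := undup (map snd (l ++ l')).
rewrite (@leval_supp l S) ?undup_uniq ?(@leval_supp l' S) ?undup_uniq //.
- by apply: eq_bigr => v _; rewrite h.
- by move=> x hx; rewrite mem_undup; apply: map_f; rewrite mem_cat hx orbT.
- by move=> x hx; rewrite mem_undup; apply: map_f; rewrite mem_cat hx.
Qed.

(** Multiplication by [1 - x^g] on coefficient functions, which need not have finite support; [dl]
    is the same operation on finite formal sums. *)
Definition df g phi v := phi v - phi (v - g).
Definition dfs gs phi := foldr df phi gs.
Definition dl g l := l ++ [seq (- x.1, x.2 + g) | x <- l].
Definition dls gs l := foldr dl l gs.

Lemma lval_dl g l v : lval (dl g l) v = df g (lval l) v.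
Proof.
rewrite /lval /df big_cat big_map /=; congr (_ + _); rewrite -sumrN; apply: eq_bigr => x _ /=.
by rewrite mulNr eq_sym -subr_eq eq_sym.
Qed.

Lemma leval_dl g l : leval (dl g l) = (1 - chi g) * leval l.
Proof.
rewrite /leval big_cat big_map /= mulrBl mul1r; congr (_ + _); rewrite mulr_sumr -sumrN.
by apply: eq_bigr => x _; rewrite /= chiD rmorphN /=; ring.
Qed.

Lemma df_ext g phi psi : phi =1 psi -> df g phi =1 df g psi.
Proof. by move=> h v; rewrite /df !h. Qed.

Lemma dfs_ext gs phi psi : phi =1 psi -> dfs gs phi =1 dfs gs psi.
Proof. by move=> h; elim: gs => //= g gs IH; exact: df_ext. Qed.

Lemma lval_dls gs l : lval (dls gs l) =1 dfs gs (lval l).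
Proof. by elim: gs => //= g gs IH v; rewrite lval_dl; exact: df_ext. Qed.

Lemma leval_dls gs l : leval (dls gs l) = (\prod_(g <- gs) (1 - chi g)) * leval l.
Proof.
elim: gs => [|g gs IH] /=; first by rewrite big_nil mul1r.
by rewrite leval_dl IH big_cons mulrA.
Qed.

Lemma df_dfs g gs phi : df g (dfs gs phi) =1 dfs gs (df g phi).
Proof.
elim: gs => //= h gs IH v; rewrite -(df_ext h IH).
rewrite /df; have -> : v - g - h = v - h - g by rewrite addrAC.
ring.
Qed.

Lemma dfs_comm gs hs phi : dfs gs (dfs hs phi) =1 dfs hs (dfs gs phi).
Proof.
elim: gs => //= g gs IH v; rewrite (df_ext g IH); exact: df_dfs.
Qed.

Lemma dfsD gs phi psi v : dfs gs (fun v => phi v + psi v) v = dfs gs phi v + dfs gs psi v.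
Proof.
elim: gs v => //= g gs IH v; rewrite /df !IH; ring.
Qed.

Lemma dfsZ gs (c : int) phi v : dfs gs (fun v => c * phi v) v = c * dfs gs phi v.
Proof. by elim: gs v => //= g gs IH v; rewrite /df !IH; ring. Qed.

Definition cind q gs v : int := (nat_of_bool `[< conein q gs v >])%:Z.

Lemma indep_tail g gs : indep (g :: gs) -> indep gs.
Proof.
move=> h c e i lt; pose c' j := if j is j'.+1 then c j' else 0.
by apply: (h c' _ i.+1) => //; rewrite big_ord_recl /= scale0r add0r.
Qed.

Lemma indep_head_neq0 g gs : indep (g :: gs) -> g != 0.
Proof.
move=> h; apply/eqP => e; pose c j : int := if j is j'.+1 then 0 else 1.
have := h c _ 0%N isT; rewrite big_ord_recl /= e scaler0 add0r big1 => [/(_ erefl)//|i _].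
by rewrite scale0r.
Qed.

Lemma conein_sum q gs v : conein q gs v ->
  exists s : nat -> nat, v = q + \sum_(i < size gs) nth 0 gs i *+ s i.
Proof.
elim: gs v => [|g gs IH] v /=; first by move=> ->; exists (fun=> 0%N); rewrite big_ord0 addr0.
move=> [k /IH[s e]]; exists (fun j => if j is j'.+1 then s j' else k).
by rewrite big_ord_recl /= addrCA -e addrC subrK.
Qed.

(** The geometric series in the direction [g] telescopes. Independence excludes points reached with
    two different multiples of [g]. *)
Lemma df_cind q g gs : indep (g :: gs) -> df g (cind q (g :: gs)) =1 cind q gs.
Proof.
move=> hi v; rewrite /df /cind.
have sh k : v - g - g *+ k = v - g *+ k.+1 by rewrite mulrS opprD addrA.
have [hv|hv] := pselect (conein q gs v).
  rewrite (asboolT hv) (asboolT (P := conein q (g :: gs) v)); last by exists 0%N; rewrite mulr0n subr0.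
  rewrite asboolF ?subr0 // => -[k]; rewrite sh => /conein_sum[t e2].
  have [s e1] := conein_sum hv.
  pose c j : int := if j is j'.+1 then (t j')%:Z - (s j')%:Z else k.+1%:Z.
  have := hi c _ 0%N isT; rewrite big_ord_recl /= => hc; suff : k.+1%:Z = 0 by [].
  apply: hc; transitivity (g *+ k.+1 + (\sum_(i < size gs) nth 0 gs i *+ t i - \sum_(i < size gs) nth 0 gs i *+ s i)).
    rewrite -sumrB; congr (_ + _); first by rewrite -natz scaler_nat.
    by apply: eq_bigr => i _; rewrite scalerBl -!natz !scaler_nat.
  have -> : \sum_(i < size gs) nth 0 gs i *+ t i = v - g *+ k.+1 - q by rewrite e2 addrC addKr.
  have -> : \sum_(i < size gs) nth 0 gs i *+ s i = v - q by rewrite {1}e1 addrC addKr.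
  by rewrite [v - g *+ k.+1 - q]addrAC [v - q - _ - _]addrAC subrr add0r subrr.
rewrite (asboolF hv).
suff -> : `[< conein q (g :: gs) v >] = `[< conein q (g :: gs) (v - g) >] by rewrite subrr.
apply: asbool_equiv_eq; split=> [[[|k] hk]|[k hk]].
- by rewrite mulr0n subr0 in hk.
- by exists k; rewrite sh.
- by exists k.+1; rewrite -sh.
Qed.

Lemma dfs_cind q gs : indep gs -> dfs gs (cind q gs) =1 lval [:: (1, q)].
Proof.
elim: gs => [|g gs IH] hi v.
  rewrite /= /lval big_seq1 /cind mul1r /= -natz; congr ((nat_of_bool _)%:R).
  by apply/asboolP/eqP.
by rewrite /= df_dfs -(IH (indep_tail hi)); apply: dfs_ext; exact: df_cind.
Qed.

Definition gval (T : int * (V * seq V)) : K :=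
  T.1%:~R * (chi T.2.1 / \prod_(g <- T.2.2) (1 - chi g)).

(** The differences along all generators turn the sum of indicators into a finite one, whose value
    is the sum of the rational functions times the product of the denominators. *)
Lemma cones_list (Ts : seq (int * (V * seq V))) :
  (forall T, T \in Ts -> indep T.2.2 /\ forall g, g \in T.2.2 -> chi g != 1) ->
  exists G l, [/\ forall g, g \in G -> chi g != 1,
    dfs G (fun v => \sum_(T <- Ts) T.1 * cind T.2.1 T.2.2 v) =1 lval l &
    leval l = (\prod_(g <- G) (1 - chi g)) * \sum_(T <- Ts) gval T].
Proof.
elim: Ts => [|T Ts IH] h.
  exists [::], [::]; split=> // [v|]; first by rewrite /= /lval !big_nil.
  by rewrite /leval !big_nil mulr0.
have [|G [l [h1 h2 h3]]] := IH; first by move=> T' hT'; apply: h; rewrite inE hT' orbT.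
have [hi hg] := h T (mem_head _ _); set gs := T.2.2 in hi hg.
exists (gs ++ G), (dls gs l ++ dls G [:: (T.1, T.2.1)]); split.
- by move=> g; rewrite mem_cat => /orP[/hg|/h1].
- move=> v; rewrite /dfs foldr_cat -/(dfs _ _) -/(dfs gs _).
  have -> : lval (dls gs l ++ dls G [:: (T.1, T.2.1)]) v = dfs gs (lval l) v + dfs G (lval [:: (T.1, T.2.1)]) v.
    by rewrite {1}/lval big_cat -/(lval _ _) -/(lval _ _) !lval_dls.
  have e0 : (fun v => \sum_(T <- T :: Ts) T.1 * cind T.2.1 T.2.2 v) =1
      (fun v => T.1 * cind T.2.1 gs v + \sum_(T <- Ts) T.1 * cind T.2.1 T.2.2 v).
    by move=> u; rewrite big_cons.
  rewrite -(dfs_ext gs h2) (dfs_ext gs (dfs_ext G e0)).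
  have e : dfs G (fun v => T.1 * cind T.2.1 gs v + \sum_(T <- Ts) T.1 * cind T.2.1 T.2.2 v) =1
      (fun v => dfs G (fun v => T.1 * cind T.2.1 gs v) v + dfs G (fun v => \sum_(T <- Ts) T.1 * cind T.2.1 T.2.2 v) v).
    by move=> u; rewrite dfsD.
  rewrite (dfs_ext gs e) dfsD addrC; congr (_ + _); rewrite dfs_comm; apply: dfs_ext => u.
  rewrite dfsZ dfs_cind // /lval !big_seq1 /= mul1r //.
have nz (S : seq V) : (forall g, g \in S -> chi g != 1) -> \prod_(g <- S) (1 - chi g) != 0.
  by move=> hS; rewrite prodf_seq_neq0; apply/allP => g /hS; rewrite subr_eq0 eq_sym.
rewrite /leval big_cat -/(leval _) -/(leval _) !leval_dls h3 big_cat big_cons /= [leval _]/leval big_seq1 /=.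
rewrite /gval -/gs; have := nz _ hg; move: (\prod_(g <- gs) _) (\prod_(g <- G) _) (\sum_(_ <- Ts) _) => a b c a0.
by field.
Qed.

(** An identity of indicators becomes one of rational functions: apply the same difference operators
    to both sides, compare two finite sums with equal coefficients, and divide by the nonzero
    product. *)
Lemma cones_sum (Ts : seq (int * (V * seq V))) (pts : seq V) : uniq pts ->
  (forall T, T \in Ts -> indep T.2.2 /\ forall g, g \in T.2.2 -> chi g != 1) ->
  (forall v, \sum_(T <- Ts) T.1 * cind T.2.1 T.2.2 v = (v \in pts)%:R) ->
  \sum_(v <- pts) chi v = \sum_(T <- Ts) gval T.
Proof.
move=> up h hv; have [G [l [h1 h2 h3]]] := cones_list h.
have nz : \prod_(g <- G) (1 - chi g) != 0.
  by rewrite prodf_seq_neq0; apply/allP => g /h1; rewrite subr_eq0 eq_sym.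
apply: (mulfI nz); rewrite -h3.
have -> : \sum_(v <- pts) chi v = leval [seq (1, v) | v <- pts].
  by rewrite /leval big_map; apply: eq_bigr => v _; rewrite mul1r.
rewrite -leval_dls; apply: leval_ext => v; rewrite lval_dls -h2; apply: dfs_ext => u.
rewrite hv /lval big_map /=; have [hu|hu] := boolP (u \in pts).
  by rewrite (bigD1_seq u) //= eqxx mul1r big1 ?addr0 // => w /negPf ->; rewrite mulr0.
rewrite big_seq big1 // => w hw; case: eqP => [e|_]; last by rewrite mulr0.
by rewrite -e hw in hu.
Qed.

End Lists.

(** * Truncated expansions of rational functions in one variable *)

Section Expansions.
Variable K : fieldType.
Hypothesis charK : forall n : nat, n.+1%:R != 0 :> K.
Local Notation L := {fraction {poly K}}.
Implicit Types (a b c : {poly K}) (g : L).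
Local Notation iot := (@tofrac {poly K}).

Definition eqs s a b := forall i, (i < s)%N -> a`_i = b`_i.

Lemma eqsM s a a' b b' : eqs s a a' -> eqs s b b' -> eqs s (a * b) (a' * b').
Proof.
move=> h h' i lt; rewrite !coefM; apply: eq_bigr => j _; rewrite h ?h' //.
  by apply: leq_ltn_trans lt; exact: leq_subr.
by apply: leq_ltn_trans lt; rewrite -ltnS.
Qed.

Lemma eqsD s a a' b b' : eqs s a a' -> eqs s b b' -> eqs s (a + b) (a' + b').
Proof. by move=> h h' i lt; rewrite !coefD h ?h'. Qed.

Lemma eqs_refl s a : eqs s a a. Proof. by []. Qed.
Lemma eqs_sym s a b : eqs s a b -> eqs s b a. Proof. by move=> h i lt; rewrite h. Qed.
Lemma eqs_trans s b a c : eqs s a b -> eqs s b c -> eqs s a c.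
Proof. by move=> h h' i lt; rewrite h ?h'. Qed.

Lemma eqs_cancel s b c c' : b`_0 != 0 -> eqs s (b * c) (b * c') -> eqs s c c'.
Proof.
move=> b0 h i; elim/ltn_ind: i => i IH lt; have := h i lt; rewrite !coefM !big_ord_recl !subn0.
have -> : \sum_(j < i) b`_(lift ord0 j) * c`_(i - lift ord0 j) = \sum_(j < i) b`_(lift ord0 j) * c'`_(i - lift ord0 j).
  apply: eq_bigr => j _; rewrite IH //; first by rewrite /= /bump /=; have := ltn_ord j; lia.
  by apply: leq_ltn_trans lt; exact: leq_subr.
by move/addIr/(mulfI b0).
Qed.

(* [c] is, up to order [s], the expansion of [g] at the origin. *)
Definition expd s g c := exists a b, [/\ b`_0 != 0, g * iot b = iot a & eqs s a (b * c)].

Lemma expd_poly s c : expd s (iot c) c.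
Proof. by exists c, 1; rewrite coef1 eqxx oner_eq0 mul1r rmorph1 mulr1. Qed.

Lemma expd_eqs s g c c' : eqs s c c' -> expd s g c -> expd s g c'.
Proof.
move=> h [a [b [b0 e1 e2]]]; exists a, b; split=> //; apply: eqs_trans e2 _.
by apply: eqsM => //; exact: eqs_refl.
Qed.

Lemma expdD s g g' c c' : expd s g c -> expd s g' c' -> expd s (g + g') (c + c').
Proof.
move=> [a [b [b0 e1 e2]]] [a' [b' [b0' e1' e2']]]; exists (a * b' + a' * b), (b * b'); split.
- by rewrite coef0M mulf_neq0.
- by rewrite rmorphD !rmorphM /= -e1 -e1'; ring.
- have -> : b * b' * (c + c') = (b * c) * b' + (b' * c') * b by ring.
  by apply: eqsD; apply: eqsM => //; exact: eqs_refl.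
Qed.

Lemma expdM s g g' c c' : expd s g c -> expd s g' c' -> expd s (g * g') (c * c').
Proof.
move=> [a [b [b0 e1 e2]]] [a' [b' [b0' e1' e2']]]; exists (a * a'), (b * b'); split.
- by rewrite coef0M mulf_neq0.
- by rewrite !rmorphM /= -e1 -e1'; ring.
- have -> : b * b' * (c * c') = (b * c) * (b' * c') by ring.
  exact: eqsM.
Qed.

Lemma expd_inv s g c c' : expd s.+1 g c -> c`_0 != 0 -> eqs s.+1 (c * c') 1 -> expd s.+1 g^-1 c'.
Proof.
move=> [a [b [b0 e1 e2]]] c0 h.
have a0 : a`_0 != 0 by rewrite e2 // coef0M mulf_neq0.
have an : iot a != 0 by rewrite tofrac_eq0; apply: contraNneq a0 => ->; rewrite poly.coef0.
have gn : g != 0 by apply: contraNneq an => e; rewrite -e1 e mul0r.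
exists b, a; split=> //; first by rewrite -e1 mulKf.
apply: eqs_sym; apply: eqs_trans (eqsM e2 (eqs_refl c')) _; rewrite -mulrA -[X in eqs _ _ X]mulr1.
by apply: eqsM => //; exact: eqs_refl.
Qed.

Lemma expd_uniq s g c c' : expd s g c -> expd s g c' -> eqs s c c'.
Proof.
move=> [a [b [b0 e1 e2]]] [a' [b' [b0' e1' e2']]]; apply: (@eqs_cancel s (b * b')).
  by rewrite coef0M mulf_neq0.
have e : a * b' = a' * b by apply/eqP; rewrite -tofrac_eq !rmorphM /= -e1 -e1'; apply/eqP; ring.
have h1 : eqs s (b * b' * c) (a * b').
  by rewrite mulrAC; apply: eqsM (eqs_refl _); exact: eqs_sym.
apply: eqs_trans h1 _; rewrite e [b * b']mulrC mulrAC; apply: eqsM (eqs_refl _); exact: e2'.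
Qed.

Lemma expd_divX s g c : expd s.+1 g ('X * c) -> expd s (g / iot 'X) c.
Proof.
move=> [a [b [b0 e1 e2]]].
have a0 : a`_0 = 0 by rewrite e2 // !coef0M coefX mul0r mulr0.
have ea : a = drop_poly 1 a * 'X.
  rewrite -{1}(poly_take_drop 1 a) expr1 (_ : take_poly 1 a = 0) ?add0r //.
  by apply/polyP => i; rewrite coef_take_poly poly.coef0; case: i.
have x0 : iot 'X != 0 by rewrite tofrac_eq0 polyX_eq0.
exists (drop_poly 1 a), b; split=> //.
  by rewrite mulrAC e1 {1}ea rmorphM /= mulfK.
move=> i lt; rewrite coef_drop_poly addn1 e2 //.
by rewrite mulrCA mulrC coefMX.
Qed.

(** The generalised binomial coefficient; [bsp] is the truncated binomial series of [(1 + X) ^ k],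
    with [k] of either sign. *)
Definition gb (k : int) (j : nat) : K := (\prod_(i < j) (k - i%:Z))%:~R / j`!%:R.
Definition bsp s k : {poly K} := \poly_(j < s) gb k j.

Lemma gb0 k : gb k 0 = 1.
Proof. by rewrite /gb big_ord0 divr1. Qed.

Lemma gb1 k : gb k 1 = k%:~R.
Proof. by rewrite /gb big_ord1 subr0 divr1. Qed.

Lemma factn0 j : j`!%:R != 0 :> K.
Proof. by have := fact_gt0 j; case: (j`!) => // q _. Qed.

Lemma gb_pascal k j : gb (k + 1) j.+1 = gb k j.+1 + gb k j.
Proof.
have e1 : \prod_(i < j.+1) (k + 1 - i%:Z) = (k + 1) * \prod_(i < j) (k - i%:Z).
  rewrite big_ord_recl subr0; congr (_ * _); apply: eq_bigr => i _.
  by rewrite /= /bump /= add1n; lia.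
rewrite /gb e1 big_ord_recr /= factS natrM.
have h1 := charK j; have h2 := factn0 j; rewrite !intrM intrB intrD.
rewrite -natr1 in h1 *; rewrite -[j%:~R]/(j%:R); set q := (\prod_(i < j) _)%:~R.
by field; apply/andP.
Qed.

Lemma gb_0S j : gb 0 j.+1 = 0.
Proof. by rewrite /gb big_ord_recl subrr mul0r mul0r. Qed.

Lemma bsp_step s k : eqs s (bsp s k * (1 + 'X)) (bsp s (k + 1)).
Proof.
move=> i lt; rewrite mulrDr mulr1 coefD coefMX !coef_poly lt; case: i lt => [|i] lt /=.
  by rewrite !gb0 addr0.
by rewrite (ltnW lt) gb_pascal.
Qed.

Local Notation Y := (iot (1 + 'X)).

Lemma Y_neq0 : Y != 0.
Proof. by rewrite tofrac_eq0 addrC -size_poly_eq0 -polyC1 size_XaddC. Qed.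

(** Pascal's rule passes from [k] to [k + 1] and, [1 + X] being a unit at the origin, also back. *)
Lemma expd_Y s (k : int) : expd s (Y ^ k) (bsp s k).
Proof.
have h0 : expd s (Y ^ 0) (bsp s 0).
  rewrite expr0z -(rmorph1 iot); apply: expd_eqs (expd_poly _ _) => i lt.
  by rewrite coef_poly lt coef1; case: i {lt} => [|i]; rewrite ?gb0 ?gb_0S.
have up j : expd s (Y ^ j) (bsp s j) -> expd s (Y ^ (j + 1)) (bsp s (j + 1)).
  move=> h; rewrite expfzDr ?Y_neq0 // expr1z.
  exact: expd_eqs (@bsp_step s j) (expdM h (expd_poly _ _)).
have dn j : expd s (Y ^ (j + 1)) (bsp s (j + 1)) -> expd s (Y ^ j) (bsp s j).
  move=> [a [b [b0 e1 e2]]]; exists a, (b * (1 + 'X)); split.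
  - by rewrite coef0M mulf_neq0 // coefD coef1 coefX addr0 oner_eq0.
  - by rewrite rmorphM /= -e1 expfzDr ?Y_neq0 // expr1z [iot b * _]mulrC mulrA.
  - rewrite -mulrA; apply: eqs_trans e2 _; apply: eqsM (eqs_refl _) _.
    by rewrite [(1 + 'X) * _]mulrC; apply: eqs_sym; exact: bsp_step.
have pos n : expd s (Y ^ n%:Z) (bsp s n%:Z).
  by elim: n => // n IH; rewrite -addn1 PoszD; exact: up.
have neg n : expd s (Y ^ - n%:Z) (bsp s (- n%:Z)).
  by elim: n => [|n IH]; rewrite ?oppr0 //; apply: dn; rewrite (_ : - n.+1%:Z + 1 = - n%:Z) //; lia.
by case: k => n //; rewrite NegzE.
Qed.

(* Truncated geometric series by iteration: [h] has no constant term. *)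
Lemma geom_inv s (U : K) (h : {poly K}) (r : nat -> {poly K}) : h`_0 = 0 -> U != 0 ->
  (forall i, eqs s (r i.+1) (U%:P * (1 + h * r i))) -> eqs s ((U^-1%:P - h) * r s) 1.
Proof.
move=> h0 U0 hr.
have key i : (i <= s)%N -> eqs i ((1 - U%:P * h) * r i) U%:P.
  elim: i => // i IH lt j ltj.
  have e1 : ((1 - U%:P * h) * r i.+1)`_j = ((1 - U%:P * h) * (U%:P * (1 + h * r i)))`_j.
    by apply: (eqsM (s := s) (eqs_refl _) (hr i)); apply: leq_trans lt.
  have e2 : (1 - U%:P * h) * (U%:P * (1 + h * r i)) = (1 - U%:P * h) * U%:P + U%:P * (h * ((1 - U%:P * h) * r i)) by ring.
  rewrite e1 e2 coefD coefCM.
  have -> : (h * ((1 - U%:P * h) * r i))`_j = (h * U%:P)`_j.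
    rewrite !coefM; apply: eq_bigr => -[[|k] hk] _ /=; first by rewrite h0 !mul0r.
    by congr (_ * _); apply: IH; [exact: ltnW|lia].
  have e3 : (1 - U%:P * h) * U%:P + U%:P * (h * U%:P) = U%:P by ring.
  by rewrite -coefCM -coefD e3.
have k2 := key s (leqnn s); move=> j lt.
have -> : (U^-1%:P - h) * r s = U^-1%:P * ((1 - U%:P * h) * r s).
  rewrite mulrA mulrBr mulr1 mulrA -polyCM mulVf // mul1r //.
by rewrite coefCM k2 // -coefCM -polyCM mulVf.
Qed.

End Expansions.

(* A formal term [((a, b), (z, l))] stands for [(a / b) x^z / prod_(c in l) (1 - x^c)]. *)
Definition fterm d := ((int * int) * ('rV[int]_d * seq 'rV[int]_d))%type.
Definition tmul d (t u : fterm d) : fterm d :=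
  ((t.1.1 * u.1.1, t.1.2 * u.1.2), (t.2.1 + u.2.1, t.2.2 ++ u.2.2)).
Definition fmul d (f g : seq (fterm d)) := flatten [seq [seq tmul t u | u <- g] | t <- f].

Section Formal.
Variables (d s : nat).
Local Notation fk := (seq (fterm d)).
Implicit Types (f g : fk) (p q : seq fk).

Definition smul p q : seq fk :=
  [seq flatten [seq fmul (nth [::] p i) (nth [::] q (k - i)) | i <- iota 0 k.+1] | k <- iota 0 s].
Definition sadd p q : seq fk := [seq nth [::] p k ++ nth [::] q k | k <- iota 0 s].
Definition fone : fterm d := ((1, 1), (0, [::])).
Definition ffall (k : int) (j : nat) : int := \prod_(i <- iota 0 j) (k - i%:Z).
Definition fbin (z : 'rV[int]_d) k j : fk := [:: ((ffall k j, (j`!)%:Z), (z, [::]))].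
Definition bss z k : seq fk := [seq fbin z k j | j <- iota 0 s].
(** [1 - x^z (1 + X)^k], divided by [X] when [z = 0], is its constant term minus this series. The
    constant term is [- k] or [1 - x^z], and [uterm] is its inverse; [rstp] iterates
    [r = u (1 + h r)]. *)
Definition hser z k : seq fk :=
  [seq (if j == 0%N then [::] else fbin z k (if z == 0 then j.+1 else j)) | j <- iota 0 s].
Definition uterm z (k : int) : fterm d := if z == 0 then ((1, - k), (0, [::])) else ((1, 1), (0, [:: z])).
Definition rstp z k (r : seq fk) := smul [:: [:: uterm z k]] (sadd [:: [:: fone]] (smul (hser z k) r)).
Definition gser z k : seq fk :=
  let r := iter s (rstp z k) [::] in if z == 0 then r else smul [:: [::]; [:: fone]] r.

(** The series of [X ^ fuel] over the product of the denominators: when the list is exhausted, the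
    remaining factors are plain [X], so that all terms share the same shift. *)
Fixpoint pser fuel (l : seq ('rV[int]_d * int)) : seq fk :=
  if fuel is fuel'.+1 then
    smul (if l is x :: _ then gser x.1 x.2 else [:: [::]; [:: fone]]) (pser fuel' (behead l))
  else [:: [:: fone]].

Definition tser fuel (a : int) z k l : seq fk :=
  smul [:: [:: ((a, 1), (z, [::]))]] (smul (bss 0 k) (pser fuel l)).

(** A bound on the number of denominators, uniform over all terms, is what yields the fixed [s] of
    the statement. *)
Definition tok D (t : fterm d) := (size t.2.2 <= D)%N && all (fun b => b != 0) t.2.2.
Definition sok D p := all (all (tok D)) p.

Lemma sok_nth D p i : sok D p -> all (tok D) (nth [::] p i).
Proof.
move=> /allP h; have [lt|ge] := ltnP i (size p); first by apply: h; rewrite mem_nth.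
by rewrite nth_default.
Qed.

Lemma sok_mul D D' p q : sok D p -> sok D' q -> sok (D + D') (smul p q).
Proof.
move=> hp hq; apply/allP => f /mapP[k _ ->]; apply/allP => t /flattenP[l /mapP[i _ ->]].
move=> /flattenP[l' /mapP[t1 h1 ->] /mapP[t2 h2 ->]].
have /allP/(_ _ h1)/andP[a1 b1] := sok_nth i hp.
have /allP/(_ _ h2)/andP[a2 b2] := sok_nth (k - i) hq.
by rewrite /tok size_cat all_cat b1 b2 leq_add.
Qed.

Lemma sok_add D p q : sok D p -> sok D q -> sok D (sadd p q).
Proof.
move=> hp hq; apply/allP => f /mapP[k _ ->]; rewrite all_cat; by rewrite !sok_nth.
Qed.

Lemma sok_gser z k : sok s (gser z k).
Proof.
have hr i : sok i (iter i (rstp z k) [::]).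
  elim: i => // i IH; rewrite iterS -add1n; apply: sok_mul.
    by rewrite /= !andbT /tok /uterm; case: eqP => //= /eqP ->.
  apply: sok_add => //; rewrite -[i]add0n; apply: sok_mul => //.
  by apply/allP => f /mapP[j _ ->]; case: eqP => //= _.
rewrite /gser; case: eqP => _ //; rewrite -[X in sok X]add0n; exact: sok_mul.
Qed.

Lemma sok_tser fuel a z k l : sok (fuel * s) (tser fuel a z k l).
Proof.
rewrite -[(_ * _)%N]add0n; apply: sok_mul => //; rewrite -[(_ * _)%N]add0n; apply: sok_mul.
  by apply/allP => f /mapP[j _ ->].
elim: fuel l => // fuel IH l; rewrite mulSn; apply: sok_mul => //.
by case: l => // x l; exact: sok_gser.
Qed.

Section Values.
Variables (K : fieldType) (xp : 'rV[int]_d -> K).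
Hypothesis charK : forall n : nat, n.+1%:R != 0 :> K.
Hypothesis xpD : forall u v, xp (u + v) = xp u * xp v.
Hypothesis xp0 : xp 0 = 1.
Hypothesis xp1 : forall z, z != 0 -> xp z != 1.

Definition tv (t : fterm d) : K :=
  t.1.1%:~R / t.1.2%:~R * (xp t.2.1 / \prod_(b <- t.2.2) (1 - xp b)).
Definition fv f : K := \sum_(t <- f) tv t.
Definition pv p : {poly K} := \poly_(i < s) fv (nth [::] p i).

Lemma tv_mul t u : tv (tmul t u) = tv t * tv u.
Proof. by rewrite /tv /= big_cat /= !intrM !invfM xpD; ring. Qed.

Lemma fv_mul f g : fv (fmul f g) = fv f * fv g.
Proof.
rewrite /fv big_flatten big_map mulr_suml; apply: eq_bigr => t _.
by rewrite big_map mulr_sumr; apply: eq_bigr => u _; rewrite tv_mul.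
Qed.

Lemma nth_smul p q k : (k < s)%N -> nth [::] (smul p q) k =
  flatten [seq fmul (nth [::] p i) (nth [::] q (k - i)) | i <- iota 0 k.+1].
Proof. by move=> lt; rewrite (nth_map 0%N) ?size_iota // nth_iota. Qed.

Lemma pv_mul p q : eqs s (pv (smul p q)) (pv p * pv q).
Proof.
move=> k lt; rewrite coef_poly lt nth_smul // coefM /fv big_flatten big_map.
rewrite -[iota 0 k.+1]/(index_iota 0 k.+1) big_mkord; apply: eq_bigr => i _.
rewrite -/(fv _) fv_mul !coef_poly (leq_ltn_trans _ lt) ?(leq_ltn_trans (leq_subr _ _) lt) //.
by rewrite -ltnS.
Qed.

Lemma pv_add p q : eqs s (pv (sadd p q)) (pv p + pv q).
Proof.
move=> k lt; rewrite coefD !coef_poly lt (nth_map 0%N) ?size_iota // nth_iota // add0n.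
by rewrite /fv big_cat.
Qed.

Lemma pv_cst f : eqs s (pv [:: f]) (fv f)%:P.
Proof. by move=> [|[|k]] lt; rewrite coef_poly lt coefC //= /fv big_nil. Qed.

Lemma fv1 t : fv [:: t] = tv t. Proof. by rewrite /fv big_seq1. Qed.

Lemma tv_one : tv fone = 1.
Proof. by rewrite /tv /= big_nil xp0 !divr1 mulr1. Qed.

Lemma pv_X : eqs s (pv [:: [::]; [:: fone]]) 'X.
Proof.
move=> [|[|[|k]]] lt; rewrite coef_poly lt coefX //= ?fv1 ?tv_one //; by rewrite /fv big_nil.
Qed.

Lemma fv_bin z k j : fv (fbin z k j) = gb K k j * xp z.
Proof.
by rewrite fv1 /tv /= big_nil divr1 /gb -(big_mkord xpredT (fun i => k - i%:Z)) /index_iota subn0.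
Qed.

Lemma pv_bss z k : eqs s (pv (bss z k)) ((xp z)%:P * bsp K s k).
Proof.
move=> j lt; rewrite coefCM !coef_poly lt (nth_map 0%N) ?size_iota // nth_iota // add0n fv_bin.
by rewrite mulrC.
Qed.

Lemma tv_uterm z k : tv (uterm z k) = if z == 0 then (- k%:~R)^-1 else (1 - xp z)^-1.
Proof.
rewrite /uterm; case: eqP => _; rewrite /tv /= ?big_nil ?big_seq1 xp0 ?divr1 ?mulr1 ?mul1r //.
by rewrite rmorphN.
Qed.

Local Notation iot := (@tofrac {poly K}).
Local Notation Y := (iot (1 + 'X)).

Lemma rstp_iter z k : (0 < s)%N -> (z == 0 -> k%:~R != 0 :> K) ->
  eqs s ((((tv (uterm z k))^-1)%:P - pv (hser z k)) * pv (iter s (rstp z k) [::])) 1.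
Proof.
move=> s0 k0; apply: (@geom_inv K s (tv (uterm z k)) _ (fun i => pv (iter i (rstp z k) [::]))).
- by rewrite coef_poly s0 (nth_map 0%N) ?size_iota // nth_iota //= /fv big_nil.
- rewrite tv_uterm; case: ifP => [/k0 h|/negbT/xp1 h]; first by rewrite invr_eq0 oppr_eq0.
  by rewrite invr_eq0 subr_eq0 eq_sym.
move=> i /=; apply: eqs_trans (pv_mul _ _) _; apply: eqsM; first by rewrite -fv1; exact: pv_cst.
apply: eqs_trans (pv_add _ _) _; apply: eqsD; last exact: pv_mul.
by have := @pv_cst [:: fone]; rewrite fv1 tv_one.
Qed.

(** If [z] is nonzero, [1 - G] is a unit at the origin. If [z = 0], it has a simple zero, because
    [k] is nonzero in characteristic zero, and the factor [X] cancels the pole. *)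
Lemma expd_gser z k (G : {fraction {poly K}}) : (1 < s)%N -> (z == 0 -> k != 0) ->
  G = iot (xp z)%:P * Y ^ k -> G != 1 /\ expd s (iot 'X / (1 - G)) (pv (gser z k)).
Proof.
move=> s1 k0 eG; have s0 : (0 < s)%N by exact: ltnW.
have k1 : z == 0 -> k%:~R != 0 :> K.
  move=> /k0; case: (k) => n; first by case: n => // n _; exact: charK.
  by move=> _; rewrite NegzE rmorphN oppr_eq0; exact: charK.
have exG s2 : expd s2 G ((xp z)%:P * bsp K s2 k).
  by rewrite eG; apply: expdM; [exact: expd_poly|exact: expd_Y].
have ex1 s2 : expd s2 (1 - G) (1 - (xp z)%:P * bsp K s2 k).
  apply: expdD; first by rewrite -(rmorph1 iot); exact: expd_poly.
  rewrite -mulN1r -[X in expd _ _ X]mulN1r; apply: expdM => //.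
  by rewrite -(rmorph1 iot) -rmorphN; exact: expd_poly.
have exinv (H : {fraction {poly K}}) (c c' : {poly K}) : expd s H c -> c`_0 != 0 -> eqs s (c * c') 1 -> expd s H^-1 c'.
  by case: (s) s0 => // s' _; exact: expd_inv.
have G1 : G != 1.
  apply/eqP => e; have e1 : expd s G 1 by rewrite e -(rmorph1 iot); exact: expd_poly.
  have h := expd_uniq (exG s) e1; have [z0|z0] := eqVneq z 0.
    have := h 1%N s1; rewrite coefCM coef_poly s1 z0 xp0 mul1r gb1 coef1 /=.
    by move/eqP; apply/negP/k1; rewrite z0.
  have := h 0%N s0; rewrite coefCM coef_poly s0 gb0 mulr1 coef1 /= => /eqP.
  by apply/negP/xp1.
split=> //; have hr := rstp_iter s0 k1; rewrite tv_uterm in hr; rewrite /gser.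
case: ifP hr => [/eqP z0|z0] hr.
  have exd : expd s ((1 - G) / iot 'X) (- \poly_(j < s) gb K k j.+1).
    apply: expd_divX; apply: expd_eqs (ex1 s.+1) => -[|j] lt.
      by rewrite coefB coef1 coefCM coef_poly /= z0 xp0 gb0 mulr1 subrr coef0M coefX mul0r.
    rewrite coefB coef1 coefCM coef_poly /= lt z0 xp0 mul1r sub0r [in RHS]mulrC coefMX coefN coef_poly.
    by rewrite -ltnS lt.
  have -> : iot 'X / (1 - G) = ((1 - G) / iot 'X)^-1 by rewrite invf_div.
  rewrite invrK in hr.
  have c0 : (- \poly_(j < s) gb K k j.+1)`_0 != 0 by rewrite coefN coef_poly s0 gb1 oppr_eq0; apply: k1; rewrite z0.
  apply: exinv exd c0 _; apply: eqs_trans hr; apply: eqsM (eqs_refl _).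
  move=> j lt; rewrite coefN coefB coefC !coef_poly lt (nth_map 0%N) ?size_iota // nth_iota // add0n.
  by rewrite z0 eqxx; case: j lt => [|j] lt /=; rewrite ?fv_bin ?xp0 ?mulr1 ?sub0r ?gb1 // /fv big_nil subr0.
have exi : expd s (1 - G)^-1 (pv (iter s (rstp z k) [::])).
  rewrite invrK in hr; apply: exinv (ex1 _) _ _.
    by rewrite coefB coef1 coefCM coef_poly s0 gb0 mulr1 subr_eq0 eq_sym xp1 // z0.
  apply: eqs_trans hr; apply: eqsM (eqs_refl _) => j lt.
  rewrite !coefB coef1 coefC coefCM !coef_poly lt (nth_map 0%N) ?size_iota // nth_iota // add0n z0.
  by case: j lt => [|j] lt /=; rewrite ?fv_bin ?gb0 ?mulr1 ?sub0r ?[gb _ _ _ * _]mulrC // /fv big_nil subr0.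
apply: expd_eqs (expdM (expd_poly s 'X) exi); apply: eqs_sym; apply: eqs_trans (pv_mul _ _) _.
by apply: eqsM (eqs_refl _); exact: pv_X.
Qed.

End Values.
End Formal.

(** The lowest digit is a multiple of [M] smaller than [M] in absolute value, hence zero. *)
Lemma horner_digits (M : int) n (f : nat -> int) : (forall i, `|f i| < M) ->
  \sum_(i < n) f i * M ^+ i = 0 -> forall i, (i < n)%N -> f i = 0.
Proof.
elim: n f => // n IH f hf; rewrite big_ord_recl expr0 mulr1 => e.
have M0 : 0 < M by apply: le_lt_trans (hf 0%N).
have e2 : \sum_(i < n) f (lift ord0 i) * M ^+ (lift ord0 i) = M * \sum_(i < n) f i.+1 * M ^+ i.
  by rewrite mulr_sumr; apply: eq_bigr => i _; rewrite /= /bump /= add1n exprS; ring.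
rewrite e2 /= in e; set q := \sum_(i < n) _ in e.
have q0 : q = 0.
  have := hf 0%N; have [//|qn] := eqVneq q 0.
  have -> : f 0%N = - (M * q) by apply/eqP; rewrite -addr_eq0 e.
  rewrite normrN normrM gtr0_norm // => h; have : 1 <= `|q| by rewrite -gtz0_ge1 normr_gt0.
  by move=> h2; have := ler_wpM2l (ltW M0) h2; rewrite mulr1 leNgt h.
have f0 : f 0%N = 0 by move: e; rewrite q0 mulr0 addr0.
by case=> // i; rewrite ltnS; exact: (IH (fun i => f i.+1)).
Qed.

(** * Specialisation of the extra variables along a generic curve *)

Section Project.
Variables (E d : nat).
Local Notation p := (E + d)%N.
Local Notation V := 'rV[int]_p.
Implicit Types (w g : V) (M : int).

Definition zof w : 'rV[int]_d := \row_j w 0 (rshift E j).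
(** The exponent of [1 + X] after substituting [(1 + X) ^ (M ^ i)] for the extra variable [i]. For
    [M] above all entries, no nonzero generator is sent to 1. *)
Definition lam M w : int := \sum_(i < E) w 0 (lshift d i) * M ^+ i.

Lemma zofD u v : zof (u + v) = zof u + zof v.
Proof. by apply/rowP => j; rewrite !mxE. Qed.

Lemma lamD M u v : lam M (u + v) = lam M u + lam M v.
Proof. by rewrite /lam -big_split; apply: eq_bigr => i _; rewrite mxE mulrDl. Qed.

Lemma lam_neq0 M g : g != 0 -> (forall i, `|g 0 i| < M) -> zof g == 0 -> lam M g != 0.
Proof.
move=> g0 hM z0; apply: contra g0 => /eqP e; apply/eqP/rowP => j; rewrite [RHS]mxE.
case: (split_ordP j) => i ->; last by have /rowP/(_ i) := eqP z0; rewrite !mxE.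
pose f k := if insub k is Some i then g 0 (lshift d (i : 'I_E)) else 0.
have M0 : 0 < M by apply: le_lt_trans (hM (lshift d i)).
have fi (l : 'I_E) : f l = g 0 (lshift d l) by rewrite /f valK.
rewrite -fi; apply: (@horner_digits M E f) => // [k|]; last by under eq_bigr do rewrite fi.
by rewrite /f; case: insubP => // _; rewrite normr0.
Qed.

(** A term has at most [p.+1] denominators, so its pole at [X = 0] has at most that order. The
    coefficient of [X ^ p.+1] in the shifted series is the constant term of the Laurent
    expansion. *)
Definition tproj M (T : int * (V * seq V)) : seq (fterm d) :=
  nth [::] (tser p.+2 p.+1 T.1 (zof T.2.1) (lam M T.2.1) [seq (zof g, lam M g) | g <- T.2.2]) p.+1.

Lemma tproj_ok M T t : t \in tproj M T -> tok (p.+1 * p.+2) t.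
Proof. by have /allP := sok_nth p.+1 (sok_tser p.+2 p.+1 T.1 (zof T.2.1) (lam M T.2.1) [seq (zof g, lam M g) | g <- T.2.2]); apply. Qed.

Section Val.
Variables (K : fieldType) (xp : 'rV[int]_d -> K).
Hypothesis charK : forall n : nat, n.+1%:R != 0 :> K.
Hypothesis xpD : forall u v, xp (u + v) = xp u * xp v.
Hypothesis xp0 : xp 0 = 1.
Hypothesis xp1 : forall z, z != 0 -> xp z != 1.
Local Notation iot := (@tofrac {poly K}).
Local Notation Y := (iot (1 + 'X)).

Definition chi M w : {fraction {poly K}} := iot (xp (zof w))%:P * Y ^ lam M w.

Lemma chiD M u v : chi M (u + v) = chi M u * chi M v.
Proof. by rewrite /chi zofD lamD xpD polyCM rmorphM /= expfzDr ?Y_neq0 //; ring. Qed.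

Lemma expd_sum s (I : eqType) (r : seq I) (F : I -> {fraction {poly K}}) c :
  (forall i, i \in r -> expd s (F i) (c i)) -> expd s (\sum_(i <- r) F i) (\sum_(i <- r) c i).
Proof.
elim: r => [|i r IH] h; rewrite ?big_nil ?big_cons.
  by rewrite -(rmorph0 iot); exact: expd_poly.
apply: expdD; first exact/h/mem_head.
by apply: IH => j hj; apply: h; rewrite inE hj orbT.
Qed.

Lemma expd_pser M fuel (gs : seq V) : (size gs <= fuel)%N ->
  (forall g, g \in gs -> zof g == 0 -> lam M g != 0) ->
  expd p.+2 (iot 'X^fuel / \prod_(g <- gs) (1 - chi M g)) (pv p.+2 xp (pser p.+2 fuel [seq (zof g, lam M g) | g <- gs])).
Proof.
elim: fuel gs => [|fuel IH] [|g gs] //= hs hg.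
- rewrite big_nil divr1 expr0; apply: expd_eqs (expd_poly _ _); apply: eqs_sym.
  by have := @pv_cst d p.+2 K xp [:: fone d]; rewrite fv1 tv_one.
- rewrite exprS rmorphM /= -mulrA; apply: expd_eqs (expdM (expd_poly _ 'X) (IH [::] _ _)) => //.
  apply: eqs_sym; apply: eqs_trans (pv_mul xpD _ _) _; apply: eqsM (eqs_refl _).
  exact: pv_X.
rewrite big_cons exprS rmorphM /= invfM mulrACA.
apply: expd_eqs (expdM (proj2 (expd_gser charK xpD xp0 xp1 (z := zof g) (k := lam M g) _ _ erefl)) (IH gs _ _)) => //.
- by apply: eqs_sym; exact: pv_mul.
- by apply: hg; exact: mem_head.
- by move=> h hh; apply: hg; rewrite inE hh orbT.
Qed.

Lemma expd_tser M T : (size T.2.2 <= p.+1)%N -> (forall g, g \in T.2.2 -> zof g == 0 -> lam M g != 0) ->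
  expd p.+2 (iot 'X^(p.+1) * gval (chi M) T) (pv p.+2 xp (tser p.+2 p.+1 T.1 (zof T.2.1) (lam M T.2.1) [seq (zof g, lam M g) | g <- T.2.2])).
Proof.
move=> hs hg; have -> : iot 'X^(p.+1) * gval (chi M) T =
    iot (T.1%:~R * xp (zof T.2.1))%:P * (Y ^ lam M T.2.1 * (iot 'X^(p.+1) / \prod_(g <- T.2.2) (1 - chi M g))).
  by rewrite /gval {1}/chi polyCM rmorphM /= !rmorph_int; ring.
apply: expd_eqs (expdM (expd_poly _ _) (expdM (expd_Y charK _ _) (expd_pser hs hg))).
apply: eqs_sym; apply: eqs_trans (pv_mul xpD _ _) _; apply: eqsM.
  apply: eqs_trans (@pv_cst d p.+2 K xp _) _; rewrite fv1 /tv /= big_nil !divr1; exact: eqs_refl.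
apply: eqs_trans (pv_mul xpD _ _) _; apply: eqsM (eqs_refl _).
by have := @pv_bss d p.+2 K xp 0 (lam M T.2.1); rewrite xp0 mul1r.
Qed.

(** Single terms may have poles, but their sum is a Laurent polynomial regular at [X = 0]. Comparing
    the coefficients of [X ^ p.+1] on both sides gives its value there. *)
Lemma proj_sum M (Ts : seq (int * (V * seq V))) (pts : seq V) : uniq pts ->
  (forall T, T \in Ts -> indep T.2.2) -> (forall T, T \in Ts -> (size T.2.2 <= p.+1)%N) ->
  (forall T g i, T \in Ts -> g \in T.2.2 -> `|g 0 i| < M) ->
  (forall v, \sum_(T <- Ts) T.1 * cind T.2.1 T.2.2 v = (v \in pts)%:R) ->
  \sum_(w <- pts) xp (zof w) = fv xp (flatten [seq tproj M T | T <- Ts]).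
Proof.
move=> up hi hs hM hv.
have gn0 T g : T \in Ts -> g \in T.2.2 -> g != 0.
  move=> /hi; elim: (T.2.2) => // h gs IH hi'; rewrite inE => /orP[/eqP ->|]; first exact: indep_head_neq0 hi'.
  by apply: IH; exact: indep_tail hi'.
have hl T g : T \in Ts -> g \in T.2.2 -> zof g == 0 -> lam M g != 0.
  by move=> hT hg; apply: lam_neq0; [exact: gn0 hg|move=> i; exact: hM hg].
have hc : forall T, T \in Ts -> indep T.2.2 /\ forall g, g \in T.2.2 -> chi M g != 1.
  move=> T hT; split=> [|g hg]; first exact: hi.
  by have [] := expd_gser charK xpD xp0 xp1 (z := zof g) (k := lam M g) (isT : (1 < p.+2)%N) (hl T g hT hg) erefl.
have e := cones_sum (@chiD M) up hc hv.
have e1 : expd p.+2 (iot 'X^(p.+1) * \sum_(w <- pts) chi M w) ('X^(p.+1) * \sum_(w <- pts) (xp (zof w))%:P * bsp K p.+2 (lam M w)).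
  apply: expdM; first exact: expd_poly.
  by apply: expd_sum => w _; apply: expdM; [exact: expd_poly|exact: expd_Y].
have e2 : expd p.+2 (iot 'X^(p.+1) * \sum_(T <- Ts) gval (chi M) T) (\sum_(T <- Ts) pv p.+2 xp (tser p.+2 p.+1 T.1 (zof T.2.1) (lam M T.2.1) [seq (zof g, lam M g) | g <- T.2.2])).
  by rewrite mulr_sumr; apply: expd_sum => T hT; apply: expd_tser; [exact: hs|move=> g; exact: (hl T)].
rewrite -e in e2; have := expd_uniq e1 e2 (ltnSn p.+1).
rewrite coefXnM ltnn subnn !coef_sum => h; transitivity (\sum_(w <- pts) ((xp (zof w))%:P * bsp K p.+2 (lam M w))`_0).
  by apply: eq_bigr => w _; rewrite coefCM coef_poly gb0 mulr1.
rewrite h /fv big_flatten big_map; apply: eq_bigr => T _.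
by rewrite coef_poly ltnSn.
Qed.

End Val.
End Project.

(** * Polynomial time of the specialisation *)

Section PTFormal.
Variable d : nat.
Local Notation fk := (seq (fterm d)).

Lemma PT_eq0mx (X : encType) (z : X -> 'rV[int]_d) : PT z -> PT (fun x => z x == 0).
Proof.
move=> hz; have : PT (fun x => [forall j, z x 0 j == 0]).
  by apply: PT_forall => j; apply: PT_eqz; [exact: PT_mxE|exact: PT_cst].
apply: PT_ext => x; apply/forallP/eqP => [h|-> j]; last by rewrite mxE.
by apply/rowP => j; rewrite mxE; apply/eqP.
Qed.

Lemma PT_fmul (X : encType) (f g : X -> fk) : PT f -> PT g -> PT (fun x => fmul (f x) (g x)).
Proof.
move=> hf hg; apply: PT_flatten; apply: (PT_map (F := fun x (t : fterm d) => [seq tmul t u | u <- g x])) => //.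
apply: (PT_map (F := fun (p : X * fterm d) (u : fterm d) => tmul p.2 u)); last exact: (PT_comp (PT_fst (PT_id _)) hg).
have h1 : PT (fun p : (X * fterm d) * fterm d => p.1.2) by exact/PT_snd/PT_fst/PT_id.
have h2 : PT (fun p : (X * fterm d) * fterm d => p.2) by exact/PT_snd/PT_id.
apply: PT_pair; apply: PT_pair.
- by apply: PT_mulz; exact/PT_fst/PT_fst.
- by apply: PT_mulz; exact/PT_snd/PT_fst.
- by apply: PT_addmx; exact/PT_fst/PT_snd.
- by apply: PT_cat; exact/PT_snd/PT_snd.
Qed.

Variable s : nat.

Lemma PT_smul (X : encType) (f g : X -> seq fk) : PT f -> PT g -> PT (fun x => smul s (f x) (g x)).
Proof.
move=> hf hg; apply: PT_mapc => k; apply: PT_flatten; apply: PT_mapc => i.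
by apply: PT_fmul; exact: PT_nth.
Qed.

Lemma PT_sadd (X : encType) (f g : X -> seq fk) : PT f -> PT g -> PT (fun x => sadd s (f x) (g x)).
Proof. by move=> hf hg; apply: PT_mapc => k; apply: PT_cat; exact: PT_nth. Qed.

Lemma PT_fbin (X : encType) (z : X -> 'rV[int]_d) k j : PT z -> PT k -> PT (fun x => fbin (z x) (k x) j).
Proof.
move=> hz hk; apply: PT_cons; last exact: PT_cst.
apply: PT_pair; apply: PT_pair => //; try exact: PT_cst.
apply: (PT_prodz (F := fun x i => k x - i%:Z) (P := fun _ _ => true)) => i; last exact: PT_cst.
by apply: PT_subz => //; exact: PT_cst.
Qed.

Lemma PT_gser (X : encType) (z : X -> 'rV[int]_d) k : PT z -> PT k -> PT (fun x => gser s (z x) (k x)).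
Proof.
move=> hz hk; have h0 := PT_eq0mx hz.
have hh : PT (fun x => hser s (z x) (k x)).
  apply: PT_mapc => j; case: eqP => _; first exact: PT_cst.
  apply: PT_ext (PT_if h0 (PT_fbin j.+1 hz hk) (PT_fbin j hz hk)) => x.
  by case: (z x == 0).
have hu : PT (fun x => uterm (z x) (k x)).
  apply: PT_if => //; first by apply: PT_pair; [apply: PT_pair; [exact: PT_cst|exact: PT_oppz]|exact: PT_cst].
  apply: PT_pair; first exact: PT_cst.
  by apply: PT_pair; [exact: PT_cst|apply: PT_cons => //; exact: PT_cst].
have hr i : PT (fun x => iter i (rstp s (z x) (k x)) [::]).
  elim: i => [|i IH]; first exact: PT_cst.
  apply: PT_smul.
    by apply: PT_cons; [apply: PT_cons => //; exact: PT_cst|exact: PT_cst].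
  by apply: PT_sadd; [exact: PT_cst|exact: PT_smul].
by apply: PT_if => //; apply: PT_smul => //; exact: PT_cst.
Qed.

Lemma PT_pser (X : encType) fuel (l : X -> seq ('rV[int]_d * int)) : PT l -> PT (fun x => pser s fuel (l x)).
Proof.
elim: fuel l => [|fuel IH] l hl; first exact: PT_cst.
have hh := PT_head ((0 : 'rV[int]_d), (0 : int)) hl.
have := PT_smul (PT_if (PT_nilp hl) (PT_cst X [:: [::]; [:: fone d]]) (PT_gser (PT_fst hh) (PT_snd hh))) (IH _ (PT_behead hl)).
by apply: PT_ext => x; case: (l x).
Qed.

End PTFormal.

Section PTProj.
Variables (E d : nat).
Local Notation p := (E + d)%N.
Local Notation V := 'rV[int]_p.

Lemma PT_zof (X : encType) (w : X -> V) : PT w -> PT (fun x => zof (w x)).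
Proof.
by move=> hw; apply: PT_mx => i j; apply: PT_ext (PT_mxE 0 (rshift E j) hw) => x; rewrite [RHS]mxE.
Qed.

Lemma PT_lam (X : encType) M (w : X -> V) : PT M -> PT w -> PT (fun x => lam (M x) (w x)).
Proof.
move=> hM hw; apply: PT_sumz => i; last exact: PT_cst.
by apply: PT_mulz; [exact: PT_mxE|exact: PT_expz].
Qed.

(** The power of 4 exceeds every entry of [Ts]; powers of 4 are available from [PT_kpair]. *)
Definition proj (Ts : seq (int * (V * seq V))) : seq (fterm d) :=
  flatten [seq tproj (4 ^+ (sz Ts + 2)) T | T <- Ts].

Lemma PT_proj : PT proj.
Proof.
have hM : PT (fun Ts : seq (int * (V * seq V)) => (4 : int) ^+ (sz Ts + 2)).
  by apply: PT_ext (PT_snd (PT_kpair (PT_clock _))) => Ts; rewrite size_nseq.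
apply: PT_flatten; apply: (PT_map (F := fun Ts T => tproj (4 ^+ (sz Ts + 2)) T)); last exact: PT_id.
pose XX := (seq (int * (V * seq V)) * (int * (V * seq V)))%type.
have hM' : PT (fun q : XX => (4 : int) ^+ (sz q.1 + 2)) by exact: (PT_comp (PT_fst (PT_id _)) hM).
have hT : PT (fun q : XX => q.2) by exact/PT_snd/PT_id.
have hw : PT (fun q : XX => q.2.2.1) by exact/PT_fst/PT_snd.
apply: PT_nth; apply: PT_smul.
  apply: PT_cons; last exact: PT_cst; apply: PT_cons; last exact: PT_cst.
  apply: PT_pair; first by apply: PT_pair; [exact: PT_fst|exact: PT_cst].
  by apply: PT_pair; [exact: PT_zof|exact: PT_cst].
apply: PT_smul.
  by apply: PT_mapc => j; apply: PT_fbin; [exact: PT_cst|exact: PT_lam].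
apply: PT_pser; apply: (PT_map (F := fun (q : XX) g => (zof g, lam (4 ^+ (sz q.1 + 2)) g))).
  apply: PT_pair; first exact/PT_zof/PT_snd/PT_id.
  by apply: PT_lam; [exact: (PT_comp (PT_fst (PT_id _)) hM')|exact/PT_snd/PT_id].
exact/PT_snd/PT_snd.
Qed.

End PTProj.

(** * Greatest common divisors, words and monomials *)

Definition estep (p : nat * nat) : nat * nat := (if p.2 == 0 then p else (p.2, p.1 %% p.2))%N.

Lemma estep_gcd k p : gcdn (iter k estep p).1 (iter k estep p).2 = gcdn p.1 p.2.
Proof.
elim: k => //= k <-; set q := iter k _ _; rewrite /estep; case: eqP => // _ /=.
by rewrite gcdn_modr gcdnC.
Qed.

(** Two Euclidean divisions halve the smaller number, so a clock linear in the bit length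
    suffices. *)
Lemma estep_half p : ((iter 2 estep p).2 * 2 <= p.2)%N.
Proof.
case: p => a [|b]; first by [].
rewrite /= {2}/estep /=; case er: (a %% b.+1)%N => [|r]; first by [].
rewrite /estep /=; have h1 : (r.+1 < b.+1)%N by rewrite -er ltn_pmod.
have h2 : (b.+1 %% r.+1 < r.+1)%N by rewrite ltn_pmod.
have h3 := divn_eq b.+1 r.+1.
have h4 : (0 < b.+1 %/ r.+1)%N by rewrite divn_gt0 // ltnW.
by move: h2 h3 h4; move: (b.+1 %/ r.+1)%N (b.+1 %% r.+1)%N => q c h2 h3 h4; nia.
Qed.

Lemma estep_zero p k j : (p.2 < 2 ^ j)%N -> (2 * j <= k)%N -> (iter k estep p).2 = 0%N.
Proof.
elim: j p k => [|j IH] p k; rewrite ?expn0 ?expnS.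
  rewrite ltnS leqn0 => /eqP h _; elim: k => //= k e; by rewrite {1}/estep e.
move=> h le; have -> : k = (k - 2 + 2)%N by lia.
rewrite iterD; apply: IH; last by lia.
by have := estep_half p; lia.
Qed.

Lemma estep_le k p : ((iter k estep p).1 <= p.1 + p.2)%N && ((iter k estep p).2 <= p.1 + p.2)%N.
Proof.
elim: k => [|k /andP[h1 h2]] /=; first by rewrite leq_addr leq_addl.
rewrite {1 3}/estep; case: eqP => [_|/eqP n0] /=; first by rewrite h1 h2.
rewrite h2 /=; apply: leq_trans h2; rewrite ltnW // ltn_pmod // lt0n //.
Qed.

Lemma PT_modn (X : encType) (f g : X -> nat) : PT f -> PT g -> PT (fun x => (f x %% g x)%N).
Proof.
move=> hf hg; apply: PT_ext (PT_subn hf (PT_muln (PT_divn hf hg) hg)) => x.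
by rewrite {1}(divn_eq (f x) (g x)) addKn.
Qed.

Lemma PT_gcdn (X : encType) (f g : X -> nat) : PT f -> PT g -> PT (fun x => gcdn (f x) (g x)).
Proof.
move=> hf hg; have hp := PT_pair hf hg.
suff : PT (fun p : nat * nat => gcdn p.1 p.2) by exact: (PT_comp hp).
have h1 : PT (fun p : nat * nat => p.1) by exact/PT_fst/PT_id.
have h2 : PT (fun p : nat * nat => p.2) by exact/PT_snd/PT_id.
have hs : PT estep.
  by apply: PT_if; [apply: PT_eqn => //; exact: PT_cst|exact: PT_id|apply: PT_pair => //; exact: PT_modn].
have := @PT_loop (prod_enc nat_enc nat_enc) (prod_enc nat_enc nat_enc) (fun x => nseq (sz x + 2) tt) id (fun=> estep)
  (fun p => 2 * (4 * sz (p.1 + p.2)%N + 1) + 1)%N (PT_clock _) (PT_id _)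
  (PT_comp (PT_snd (PT_id _)) hs).
have hb : pbd (fun p : nat * nat => 2 * (4 * sz (p.1 + p.2)%N + 1) + 1)%N.
  have h : pbd (fun p : nat * nat => sz (p.1 + p.2)%N) by apply: pbd_sz; exact: PT_addn.
  by do ![apply: pbd_add|apply: pbd_mul|exact: pbd_cst|exact: h].
move=> /(_ hb) h.
have hloop : PT (fun p : nat * nat => iter (size (nseq (sz p + 2) tt)) estep p).
  apply: h => p k _; have /andP[/sz_nat_mono a1 /sz_nat_mono a2] := estep_le k p.
  have -> : sz (iter k estep p) = (sz (iter k estep p).1 + sz (iter k estep p).2).+1.
    by case: (iter k estep p) => ? ?; exact: sz_pair.
  by rewrite addn1 ltnS mul2n -addnn; exact: leq_add.
apply: PT_ext (PT_fst hloop) => p; rewrite size_nseq -(estep_gcd (sz p + 2) p).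
rewrite (@estep_zero p (sz p + 2) (size (bits p.2))) ?gcdn0 // -?size_bits //.
have /andP[b1 _] := sz_bits (bits p.2); have e : sz p = (sz p.1 + sz p.2).+1 by case: (p) => ? ?; exact: sz_pair.
apply: leq_trans (leq_addr _ _) (leq_trans b1 _); rewrite -[sz (bits p.2)]/(sz p.2) e addn2.
by do 3!apply: leqW; exact: leq_addl.
Qed.

(** The output encodes rationals by [numq] and [denq], so fractions must be put in lowest terms. *)
Definition numden (x : int * int) : int * int := (numq (fracq x), denq (fracq x)).

Lemma PT_numden (X : encType) (f : X -> int * int) : PT f -> PT (fun x => numden (f x)).
Proof.
move=> hf; have h1 := PT_fst hf; have h2 := PT_snd hf; have a1 := PT_absz h1; have a2 := PT_absz h2.
have hg := PT_gcdn a1 a2; have c (z : int) := PT_cst X z.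
have hn : PT (fun x => numq (fracq (f x))).
  apply: PT_ext (PT_if (PT_eqz h2 (c 0)) (c 0) (PT_mkint (PT_addb (PT_ltz0 h2) (PT_ltz0 h1)) (PT_divn a1 hg))) => x.
  rewrite num_fracq; case: eqP => //= _; case: (_ (+) _); rewrite ?expr0z ?mul1r //.
  by rewrite -[(-1) ^ true]/(-1) mulN1r.
apply: PT_pair => //; apply: PT_ext (PT_if (PT_eqz h2 (c 0)) (c 1) (PT_posz (PT_divn a2 hg))) => x.
by rewrite den_fracq; case: eqP.
Qed.

Lemma PT_letter (X Y : encType) (f : X -> letter) (gT gF gM gS : X -> Y) :
  PT f -> PT gT -> PT gF -> PT gM -> PT gS ->
  PT (fun x => match f x with Bit b => if b then gT x else gF x | Minus => gM x | Sep => gS x end).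
Proof.
move=> hf hT hF hM hS.
have hl : PT (fun x => ltree (f x) : tree) by apply: PT_recast hf.
have h1 := PT_comp hl PT_tfst; have h2 := PT_comp hl PT_tsnd.
apply: PT_ext (PT_ifN hl (PT_ifN h1 hS (PT_ifN h2 hM hT)) hF) => x /=.
by case: (f x) => [[]| |].
Qed.

(** The sign and the reversed digits of the integer being read, and the integers already read,
    latest first. *)
Definition pstate := ((bool * seq bool) * seq (bool * seq bool))%type.
Definition pstep (s : pstate) (a : letter) : pstate :=
  match a with
  | Bit b => if b then ((s.1.1, true :: s.1.2), s.2) else ((s.1.1, false :: s.1.2), s.2)
  | Minus => ((true, s.1.2), s.2)
  | Sep => ((false, [::]), s.1 :: s.2)
  end.
Definition pval (x : bool * seq bool) : int :=
  if x.1 then - (bval (rev x.2))%:Z else (bval (rev x.2))%:Z.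
Definition parse (w : word) : seq int := rev [seq pval x | x <- (foldl pstep ((false, [::]), [::]) w).2].

Lemma parse_bits b l o (s : seq bool) : foldl pstep ((b, l), o) [seq Bit x | x <- s] = ((b, catrev s l), o).
Proof. by elim: s l => //= -[] s IH l; rewrite IH. Qed.

Lemma parseK (l : seq int) : parse (encode_ints l) = l.
Proof.
have h o : foldl pstep ((false, [::]), o) (encode_ints l) =
    ((false, [::]), rev [seq ((z < 0), rev (bits `|z|%N)) | z <- l] ++ o).
  elim: l o => //= z l IH o; rewrite foldl_cat.
  have -> : foldl pstep (false, [::], o) (rcons (encode_int z) Sep) = ((false, [::]), (z < 0, rev (bits `|z|%N)) :: o).
    rewrite foldl_rcons /encode_int; case: ifP => _; rewrite ?foldl_cat /= ?parse_bits /=; by rewrite -/(rev _).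
  by rewrite IH rev_cons cat_rcons.
rewrite /parse h cats0 map_rev revK -map_comp -[RHS]map_id; apply: eq_map => z.
by rewrite /pval /= revK bitsK; case: ltP => hz; lia.
Qed.

Lemma PT_parse : PT parse.
Proof.
apply: PT_rev; apply: (PT_map (F := fun _ => pval)).
  have hb : PT (fun p : word * (bool * seq bool) => bval (rev p.2.2)).
    apply: (PT_nat (f := fun p : word * (bool * seq bool) => rev p.2.2)) => //.
    exact/PT_rev/PT_snd/PT_snd/PT_id.
  by apply: PT_mkint => //; exact/PT_fst/PT_snd/PT_id.
apply: PT_snd; pose st0 : pstate := ((false, [::]), [::]).
apply: (@PT_foldl _ _ _ (fun _ : word => pstep) (fun=> st0) id (fun w => sz st0 + 20 * sz w)%N).
- have hs : PT (fun p : word * (pstate * letter) => p.2.1) by exact/PT_fst/PT_snd/PT_id.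
  have h1 := PT_fst hs; have h2 := PT_snd hs; have c (b : bool) := PT_cst (prod_enc (seq_enc letter_enc) (prod_enc (prod_enc (prod_enc bool_enc (seq_enc bool_enc)) (seq_enc (prod_enc bool_enc (seq_enc bool_enc)))) letter_enc)) b.
  apply: (PT_letter (f := fun p : word * (pstate * letter) => p.2.2)); first exact/PT_snd/PT_snd/PT_id.
  + by apply: PT_pair => //; apply: PT_pair; [exact: PT_fst|apply: PT_cons => //; exact: PT_snd].
  + by apply: PT_pair => //; apply: PT_pair; [exact: PT_fst|apply: PT_cons => //; exact: PT_snd].
  + by apply: PT_pair => //; apply: PT_pair => //; exact: PT_snd.
  + by apply: PT_pair; [exact: PT_cst|exact: PT_cons].
- exact: PT_cst.
- exact: PT_id.
- by apply: pbd_add; [exact: pbd_cst|apply: pbd_mul; [exact: pbd_cst|exact/pbd_sz/PT_id]].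
move=> w k; have szp (s : pstate) : sz s = ((sz s.1.1 + sz s.1.2).+1 + sz s.2).+1.
  by case: s => -[x y] z; rewrite sz_pair sz_pair.
have szb (b : bool) : (1 <= sz b <= 3)%N by case: b.
have st s a : (sz (pstep s a) <= sz s + 20)%N.
  rewrite !szp; have h1 := szb s.1.1; have h2 := szb true; have h3 := szb false.
  have e1 b : sz (b :: s.1.2) = (sz b + sz s.1.2).+1 by exact: sz_cons.
  have e2 : sz (s.1 :: s.2) = (sz s.1 + sz s.2).+1 by exact: sz_cons.
  have e3 : sz s.1 = (sz s.1.1 + sz s.1.2).+1 by case: (s.1) => ? ?; exact: sz_pair.
  have e4 : sz ([::] : seq bool) = 1%N by [].
  case: a => [[]| |] /=; rewrite ?e1 ?e2 ?e3 ?e4; move: h1 h2 h3.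
  + by move: (sz _) (sz true) (sz s.1.2) (sz s.2) => a b c d; lia.
  + by move: (sz _) (sz true) (sz false) (sz s.1.2) (sz s.2) => a b c d e; lia.
  + by move: (sz s.1.1) (sz true) (sz s.1.2) (sz s.2) => a b c d; lia.
  + by move: (sz s.1.1) (sz true) (sz false) (sz s.1.2) (sz s.2) => a b c d e; lia.
have fl (l : word) s : (sz (foldl pstep s l) <= sz s + 20 * size l)%N.
  elim: l s => [|a l IH] s /=; first by rewrite muln0 addn0.
  by apply: leq_trans (IH _) _; have := st s a; move: (sz _) (sz s) => u v; lia.
apply: leq_trans (fl _ _) _; rewrite leq_add2l leq_mul2l /=.
by apply: leq_trans (_ : size w <= _)%N; [rewrite size_take_min geq_minr|exact/ltnW/sz_size].
Qed.

Lemma PT_encode_ints (X : encType) (l : X -> seq int) : PT l -> PT (fun x => encode_ints (l x)).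
Proof.
move=> hl; apply: PT_flatten; apply: (PT_map (F := fun _ z => rcons (encode_int z) Sep)) => //.
have hz : PT (fun p : X * int => p.2) by exact/PT_snd/PT_id.
have he : PT (fun p : X * int => encode_int p.2).
  apply: PT_cat; first by apply: PT_if; [exact: PT_ltz0|exact: PT_cst|exact: PT_cst].
  apply: (PT_map (F := fun _ b => Bit b)); last exact/PT_bits/PT_absz.
  apply: PT_ext (PT_if (PT_snd (PT_id _)) (PT_cst _ (Bit true)) (PT_cst _ (Bit false))) => -[p []] //.
by apply: PT_ext (PT_cat he (PT_cst _ [:: Sep])) => p; rewrite cats1.
Qed.

Lemma wordtree (w : word) : wtree w = encode w.
Proof. by elim: w => //= a w ->. Qed.

Lemma PT_entries (X : encType) m n (A : X -> 'M[int]_(m, n)) : PT A -> PT (fun x => entries (A x)).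
Proof. by move=> hA; apply: PT_recast hA. Qed.

Definition mxof d (l : seq int) : 'M[int]_d :=
  \matrix_(i, j) nth 0 l (index (i, j) [seq (i, j) | i <- enum 'I_d, j <- enum 'I_d]).

Lemma mxofK d (u : 'M[int]_d) : mxof d (entries u) = u.
Proof.
apply/matrixP => i j; rewrite mxE /entries; set s := [seq (i, j) | i <- enum 'I_d, j <- enum 'I_d].
have -> : [seq u i j | i <- enum 'I_d, j <- enum 'I_d] = [seq u x.1 x.2 | x <- s].
  by rewrite map_allpairs.
have hs : (i, j) \in s by apply/allpairsP; exists (i, j); rewrite !mem_enum.
by rewrite (nth_map (i, j)) ?index_mem // nth_index.
Qed.

Section Pad.
Variables (d N : nat) (e1 : 'rV[int]_d).

(** [1 / P = 1 / ((1 - x^e) P) - x^e / ((1 - x^e) P)] with [e = e1] raises the number of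
    denominators by one; repetition brings every term to exactly [N]. *)
Fixpoint padt k (t : fterm d) : seq (fterm d) :=
  if k is k'.+1 then
    if (size t.2.2 < N)%N then
      padt k' (t.1, (t.2.1, e1 :: t.2.2)) ++ padt k' ((- t.1.1, t.1.2), (t.2.1 + e1, e1 :: t.2.2))
    else [:: t]
  else [:: t].

Lemma padt_ok k t u : e1 != 0 -> tok N t -> (N <= size t.2.2 + k)%N -> u \in padt k t ->
  size u.2.2 = N /\ all (fun b => b != 0) u.2.2.
Proof.
move=> e0; elim: k t => [|k IH] t /andP[h1 h2] le /=.
  by rewrite inE => /eqP ->; split=> //; apply/eqP; rewrite eqn_leq h1 -[X in (N <= X)%N]addn0.
case: ifP => lt; last first.
  by rewrite inE => /eqP ->; split=> //; apply/eqP; rewrite eqn_leq h1 leqNgt lt.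
by rewrite mem_cat => /orP[] hu; apply: (IH _ _ _ hu); rewrite /tok /= ?lt ?e0 ?h2 // addSnnS.
Qed.

Lemma padt_val (K : fieldType) (xp : 'rV[int]_d -> K) k t :
  (forall u v, xp (u + v) = xp u * xp v) -> xp e1 != 1 -> fv xp (padt k t) = tv xp t.
Proof.
move=> xpD x1; elim: k t => [|k IH] t /=; first exact: fv1.
case: ifP => _; last exact: fv1.
rewrite /fv big_cat -/(fv _ _) -/(fv _ _) !IH /tv /= !big_cons xpD rmorphN /=.
have h : 1 - xp e1 != 0 by rewrite subr_eq0 eq_sym.
rewrite mulNr invfM; move: (\prod_(b <- t.2.2) (1 - xp b))^-1 (t.1.1%:~R / t.1.2%:~R : K) (xp t.2.1) => a b c.
by field.
Qed.

Lemma PT_padt k : PT (padt k).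
Proof.
elim: k => [|k IH] /=; first by apply: PT_cons; [exact: PT_id|exact: PT_cst].
pose XT := fterm d.
have h1 : PT (fun t : XT => t.1) by exact/PT_fst/PT_id.
have h2 : PT (fun t : XT => t.2) by exact/PT_snd/PT_id.
have he := PT_cst (prod_enc (prod_enc int_enc int_enc) (prod_enc (mx_enc 1 d) (seq_enc (mx_enc 1 d)))) e1.
apply: PT_if; last by apply: PT_cons; [exact: PT_id|exact: PT_cst].
  by apply: PT_ltn; [exact/PT_sizen/PT_snd|exact: PT_cst].
apply: PT_cat.
  apply: (PT_comp _ IH); apply: PT_pair => //; apply: PT_pair; first exact: PT_fst.
  by apply: PT_cons => //; exact: PT_snd.
apply: (PT_comp _ IH); apply: PT_pair; first by apply: PT_pair; [exact/PT_oppz/PT_fst|exact: PT_snd].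
by apply: PT_pair; [apply: PT_addmx => //; exact: PT_fst|apply: PT_cons => //; exact: PT_snd].
Qed.

Definition toterm (t : fterm d) : term d N :=
  (fracq t.1, t.2.1, \matrix_(j, i) (nth 0 t.2.2 j) 0 i).

Definition tints (t : fterm d) : seq int :=
  [:: (numden t.1).1; (numden t.1).2] ++ entries t.2.1 ++ entries (t_den (toterm t)).

Lemma PT_tints : PT tints.
Proof.
have h1 : PT (fun t : fterm d => t.1) by exact/PT_fst/PT_id.
have h2 : PT (fun t : fterm d => t.2) by exact/PT_snd/PT_id.
have hn := PT_numden h1.
apply: PT_cat.
  by apply: PT_cons; [exact: PT_fst|apply: PT_cons; [exact: PT_snd|exact: PT_cst]].
apply: PT_cat; first exact/PT_entries/PT_fst.
apply: PT_entries; apply: PT_mx => j i.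
have hd : PT (fun t : fterm d => nth 0 t.2.2 j 0 i) by apply: PT_mxE; exact/PT_nth/PT_snd.
by apply: PT_ext hd => t; rewrite [RHS]mxE.
Qed.

End Pad.

Section Xpow.
Variable d : nat.

Lemma tofracX_neq0 i : tofrac ('X_i : {mpoly rat[d]}) != 0.
Proof.
rewrite tofrac_eq0; apply/eqP => /(congr1 (mcoeff U_(i)%MM)); rewrite mcoeffX eqxx mcoeff0.
by move/eqP; rewrite oner_eq0.
Qed.

Lemma xpowD (u v : 'rV[int]_d) : xpow (u + v) = xpow u * xpow v.
Proof.
rewrite /xpow -big_split; apply: eq_bigr => i _; rewrite mxE expfzDr //; exact: tofracX_neq0.
Qed.

Lemma xpow0 : xpow (0 : 'rV[int]_d) = 1.
Proof. by rewrite /xpow big1 // => i _; rewrite mxE. Qed.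

(** Otherwise the monomials of the positive and of the negative part of [z] would coincide. *)
Lemma xpow_neq1 (z : 'rV[int]_d) : z != 0 -> xpow z != 1.
Proof.
apply: contra => /eqP h.
pose m1 : 'X_{1..d} := [multinom (if (0 <= z ord0 i)%R then absz (z ord0 i) else 0%N) | i < d].
pose m2 : 'X_{1..d} := [multinom (if (0 <= z ord0 i)%R then 0%N else absz (z ord0 i)) | i < d].
have e m : tofrac 'X_[m] = \prod_(i < d) (tofrac ('X_i : {mpoly rat[d]})) ^+ m i.
  by rewrite mpolyXE_id rmorph_prod /=; apply: eq_bigr => i _; rewrite rmorphXn.
have : tofrac 'X_[m1] = tofrac ('X_[m2] : {mpoly rat[d]}).
  rewrite -[RHS]mul1r -h !e /xpow -big_split; apply: eq_bigr => i _ /=; rewrite !mnmE.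
  case: (z ord0 i) => n /=; first by rewrite expr0 mulr1.
  by rewrite expr0 /exprz mulVf // expf_neq0 // tofracX_neq0.
move/eqP; rewrite tofrac_eq => /eqP e12.
have /mnmP hm : m1 = m2.
  have := congr1 (mcoeff m1) e12; rewrite !mcoeffX eqxx; case: eqP => // _ /eqP.
apply/eqP/rowP => i; rewrite [RHS]mxE -[z 0 i]/(z ord0 i); have := hm i; rewrite !mnmE.
by move: (z ord0 i) => a; case: ifP => h0 h1; lia.
Qed.

Lemma ratfun_char n : n.+1%:R != 0 :> ratfun d.
Proof.
have -> : n.+1%:R = tofrac (n.+1%:R : {mpoly rat[d]}) by rewrite rmorph_nat.
by rewrite tofrac_eq0 -(rmorph_nat (@mpolyC d rat)) mpolyC_eq0 pnatr_eq0.
Qed.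

Lemma term_ratfunE N (t : fterm d) : size t.2.2 = N -> term_ratfun (toterm N t) = tv (@xpow d) t.
Proof.
move=> hs; rewrite /term_ratfun /tv /t_coef /t_num /t_den /=; congr (_ * (_ / _)).
  case: (t.1) => a b /=; rewrite fracqE /=.
  have hi (z : int) : tofrac (z%:~R : rat)%:MP_[d] = z%:~R :> ratfun d by rewrite !rmorph_int.
  have [->|b0] := eqVneq b 0; first by rewrite !invr0 !mulr0 mpolyC0 rmorph0.
  have nb : b%:~R != 0 :> ratfun d by rewrite -hi tofrac_eq0 mpolyC_eq0 intr_eq0.
  apply: (mulIf nb); rewrite divfK // -!hi -rmorphM -mpolyCM divfK // intr_eq0 //.
rewrite -hs (big_nth 0) big_mkord; apply: eq_bigr => j _; congr (1 - xpow _).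
by apply/rowP => i; rewrite !mxE.
Qed.

End Xpow.

(** * Hilbert bases *)

Lemma col_mx_ge0 a b (X : 'cV[int]_a) (Y : 'cV[int]_b) :
  (forall k, 0 <= col_mx X Y k 0) <-> (forall i, 0 <= X i 0) /\ (forall j, 0 <= Y j 0).
Proof.
split=> [h|[h1 h2] k].
  by split=> i; [have := h (lshift b i); rewrite col_mxEu|have := h (rshift a i); rewrite col_mxEd].
by case: (split_ordP k) => i ->; rewrite ?col_mxEu ?col_mxEd.
Qed.

Lemma addmxE a b (X Y : 'M[int]_(a, b)) i j : (X + Y) i j = X i j + Y i j.
Proof. by rewrite mxE. Qed.

Lemma PT_col_mx (X : encType) a b n (F : X -> 'M[int]_(a, n)) (G : X -> 'M[int]_(b, n)) :
  PT F -> PT G -> PT (fun x => col_mx (F x) (G x)).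
Proof.
move=> hF hG; apply: PT_mx => i j; case: (split_ordP i) => k ->.
  by apply: PT_ext (PT_mxE k j hF) => x; rewrite col_mxEu.
by apply: PT_ext (PT_mxE k j hG) => x; rewrite col_mxEd.
Qed.

Lemma PT_row_mx (X : encType) m a b (F : X -> 'M[int]_(m, a)) (G : X -> 'M[int]_(m, b)) :
  PT F -> PT G -> PT (fun x => row_mx (F x) (G x)).
Proof.
move=> hF hG; apply: PT_mx => i j; case: (split_ordP j) => k ->.
  by apply: PT_ext (PT_mxE i k hF) => x; rewrite row_mxEl.
by apply: PT_ext (PT_mxE i k hG) => x; rewrite row_mxEr.
Qed.

Definition sq n (v : 'rV[int]_n) : seq int := [seq v 0 i | i <- enum 'I_n].

Lemma size_sq n (v : 'rV[int]_n) : size (sq v) = n.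
Proof. by rewrite size_map size_enum_ord. Qed.

Lemma nth_sq n (v : 'rV[int]_n) (i : 'I_n) : nth 0 (sq v) i = v 0 i.
Proof. by rewrite (nth_map i) ?size_enum_ord // nth_ord_enum. Qed.

Lemma hw_sq n (v : 'rV[int]_n) : hw n (sq v) = col_mx 1%:M v^T :> 'M_(1 + n, 1).
Proof.
apply/matrixP => i j; rewrite ord1 [LHS]mxE; case: (split_ordP i) => k ->.
  by rewrite col_mxEu ord1 mxE.
by rewrite col_mxEd mxE -nth_sq.
Qed.

Lemma barv_size n r (H : 'M[int]_(n.+1, r)) T : T \in barv H -> (size T.2.2 <= n.+1)%N.
Proof.
move=> /flattenP[s /mapP[c _ ->] /mapP[U /mapP[j _ ->] ->]] /=.
by rewrite size_map size_filter (leq_trans (count_size _ _)) // size_enum_ord.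
Qed.

Lemma proj_barv (E d r : nat) (H : 'M[int]_((E + d).+1, r)) (pts : seq 'rV[int]_(E + d)) : uniq pts ->
  (forall v, (v \in pts) = inpoly H v) ->
  \sum_(w <- pts) xpow (zof w) = fv (@xpow d) (proj (barv H)).
Proof.
move=> up hp; set Ts := barv H.
apply: (proj_sum (@ratfun_char d) (@xpowD d) (@xpow0 d) (@xpow_neq1 d)) => //.
- by move=> T hT; have [_ h] := barvP H 0; exact: h.
- by move=> T; exact: barv_size.
- move=> T g i hT hg.
  have s1 : (sz g < sz T.2.2)%N.
    by case/splitPr: hg => s1 s2; exact: (@sz_mem (mx_enc 1 (E + d))).
  have s2 : (sz T < sz Ts)%N.
    by case/splitPr: hT => t1 t2; exact: (@sz_mem (prod_enc int_enc (prod_enc (mx_enc 1 (E + d)) (seq_enc (mx_enc 1 (E + d)))))).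
  have s3 : sz T = (sz T.1 + (sz T.2.1 + sz T.2.2).+1).+1 by case: (T) => ? [? ?]; rewrite sz_pair sz_pair.
  have s4 : (sz g <= sz Ts + 2)%N.
    apply: leq_trans (ltnW s1) _; apply: leq_trans (_ : sz T.2.2 <= sz T)%N _.
      by rewrite s3; apply: leqW; apply: leq_trans (leq_addl _ _); apply: leqW; exact: leq_addl.
    by apply: leq_trans (ltnW s2) (leq_addr _ _).
  have := absz_entry g 0 i; rewrite -ltz_nat abszE => h; apply: lt_le_trans h _.
  have -> : (4 : int) ^+ (sz Ts + 2) = (4 ^ (sz Ts + 2))%N%:Z by rewrite -[RHS]natz natrX.
  rewrite lez_nat; apply: leq_trans (_ : 2 ^ (sz Ts + 2) <= _)%N; first by rewrite leq_exp2l.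
  by rewrite addn2 leq_exp2r.
move=> v; have [h _] := barvP H v; rewrite hp natz -h.
by apply: eq_bigr => T _.
Qed.

Section Main.
Variable d' : nat.
Local Notation d := d'.+1.
Local Notation m0 := (d' + (d + (1 + 1)))%N.
Implicit Types (u : 'M[int]_d) (v y : 'rV[int]_d).

Definition ctm u : 'M[int]_d := (dualmx u)^T.
Definition lrow u : 'rV[int]_d := (const_mx 1 : 'rV[int]_d) *m ctm u.
Definition coord u v i : int := (v *m dualmx u) 0 i.
Definition ell u v : int := \sum_i coord u v i.

(** Together with [Bsys] it says that [y] and [v - y] lie in the cone and satisfy [1 <= ell], which
    for integer points of the cone means nonzero. *)
Definition Asys u : 'M[int]_(d + (d + (1 + 1)), d) :=
  col_mx (ctm u) (col_mx (- ctm u) (col_mx (lrow u) (- lrow u))).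
Definition Bsys u : 'M[int]_(d + (d + (1 + 1)), 1 + d) :=
  col_mx 0 (col_mx (row_mx 0 (ctm u)) (col_mx (row_mx (-1)%:M 0) (row_mx (-1)%:M (lrow u)))).
Definition Hcell u : 'M[int]_(d + (d + 1), 1 + d) :=
  col_mx (row_mx 0 (ctm u)) (col_mx (row_mx (const_mx `|\det u|) (- ctm u)) (row_mx (-1)%:M (lrow u))).
Definition cell0 u : acell :=
  ([seq rsc 1 0 (Hcell u : 'M_(_, d.+1)) k | k <- enum 'I_(d + (d + 1))], nseq (sz u + 2) tt ++ nseq d tt).

Lemma ctmE u v i : (ctm u *m v^T) i 0 = coord u v i.
Proof. by rewrite /ctm -trmx_mul mxE. Qed.

Lemma lrowE u v i : (lrow u *m v^T) i 0 = ell u v.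
Proof.
rewrite /lrow -mulmxA mxE; apply: eq_bigr => k _; by rewrite [const_mx _ _ _]mxE mul1r ctmE.
Qed.

Lemma coordB u v y i : coord u (v - y) i = coord u v i - coord u y i.
Proof. by rewrite /coord mulmxBl addmxE oppmxE. Qed.

Lemma ellB u v y : ell u (v - y) = ell u v - ell u y.
Proof. by rewrite /ell -sumrB; apply: eq_bigr => i _; rewrite coordB. Qed.

Definition incell u v := [/\ forall i, 0 <= coord u v i, forall i, coord u v i <= `|\det u| & 1 <= ell u v].
(** The upper bounds on the summands are omitted: their coordinates are at most those of [v], which
    lies in the parallelepiped. *)
Definition decomp u v y := [/\ forall i, 0 <= coord u y i, forall i, 0 <= coord u (v - y) i,
  1 <= ell u y & 1 <= ell u (v - y)].

Lemma sat_cell0 u v : sat d (cell0 u).1 (sq v) <-> incell u v.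
Proof.
have e : sat d (cell0 u).1 (sq v) <-> forall k, 0 <= (Hcell u *m col_mx 1%:M v^T) k 0.
  rewrite /sat all_map; split=> [/allP h k|h].
    by have := h k (mem_enum _ k); rewrite /= av_rsc mul1r addr0 hw_sq.
  by apply/allP => k _ /=; rewrite av_rsc mul1r addr0 hw_sq.
rewrite e /Hcell !mul_col_mx !mul_row_col !mul0mx add0r col_mx_ge0 col_mx_ge0.
have c2 i : (const_mx `|\det u| *m (1%:M : 'M_1) + - ctm u *m v^T) i 0 = `|\det u| - coord u v i.
  by rewrite mulmx1 mulNmx addmxE oppmxE ctmE mxE.
have c3 i : ((-1)%:M *m (1%:M : 'M_1) + lrow u *m v^T) i 0 = ell u v - 1.
  by rewrite mulmx1 addmxE lrowE ord1 mxE eqxx mulr1n addrC.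
split=> [[h1 [h2 h3]]|[h1 h2 h3]].
  split=> [i|i|]; first by have := h1 i; rewrite ctmE.
    by have := h2 i; rewrite c2 subr_ge0.
  by have := h3 0; rewrite c3 subr_ge0.
split=> [i|]; first by rewrite ctmE.
by split=> i; [rewrite c2 subr_ge0|rewrite c3 subr_ge0].
Qed.

Lemma nosolE u v : nosol (m := m0) (Asys u) (Bsys u : 'M_(_, d.+1)) (sq v) <-> ~ exists y, decomp u v y.
Proof.
have e (y : 'cV[int]_d) : (forall k, 0 <= zslack (Asys u) (Bsys u *m hw d (sq v)) y k) <-> decomp u v y^T.
  have -> : (forall k, 0 <= zslack (Asys u) (Bsys u *m hw d (sq v)) y k) <->
      forall k, 0 <= (Asys u *m y + Bsys u *m col_mx 1%:M v^T) k 0.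
    by split=> h k; have := h k; rewrite /zslack hw_sq addmxE.
  rewrite /Asys /Bsys !mul_col_mx !mul_row_col !mul0mx !add0r !add_col_mx.
  rewrite col_mx_ge0 col_mx_ge0 col_mx_ge0 addr0 mulmx1.
  have c1 i : (ctm u *m y) i 0 = coord u y^T i by rewrite -ctmE trmxK.
  have c2 i : (- ctm u *m y + ctm u *m v^T) i 0 = coord u (v - y^T) i.
    by rewrite mulNmx addmxE oppmxE ctmE c1 coordB addrC.
  have c3 i : (lrow u *m y + ((-1)%:M + 0)) i 0 = ell u y^T - 1.
    by rewrite addr0 addmxE -{1}[y]trmxK lrowE ord1 mxE eqxx mulr1n.
  have c4 i : (- lrow u *m y + ((-1)%:M + lrow u *m v^T)) i 0 = ell u (v - y^T) - 1.
    rewrite mulNmx addmxE oppmxE -{1}[y]trmxK lrowE addmxE lrowE.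
    by rewrite ord1 mxE eqxx mulr1n ellB; ring.
  split=> [[h1 [h2 [h3 h4]]]|[h1 h2 h3 h4]].
    split=> [i|i||]; first by rewrite -c1.
    - by rewrite -c2.
    - by have := h3 0; rewrite c3 subr_ge0.
    - by have := h4 0; rewrite c4 subr_ge0.
  split=> [i|]; first by rewrite c1.
  split=> [i|]; first by rewrite c2.
  by split=> i; [rewrite c3 subr_ge0|rewrite c4 subr_ge0].
split=> h [y hy]; apply: h; first by exists y^T; apply/e; rewrite trmxK.
by exists y^T; apply/e.
Qed.

Lemma coord_inv u v : \det u != 0 -> (forall i, coord u v i = 0) -> v = 0.
Proof.
move=> d0 h; have e : v *m dualmx u = 0 by apply/rowP => i; rewrite [RHS]mxE; exact: h.
have := congr1 (fun r => r *m u) e; rewrite /= mul0mx -mulmxA dualmxKl mul_mx_scalar => /rowP hr.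
apply/rowP => i; have := hr i; rewrite !mxE => /eqP; by rewrite mulf_eq0 normr_eq0 (negPf d0) => /eqP.
Qed.

Lemma ell_gt0 u v : \det u != 0 -> (forall i, 0 <= coord u v i) -> (1 <= ell u v) = (v != 0).
Proof.
move=> d0 h; apply/idP/idP => [|v0].
  apply: contraTneq => ->; rewrite /ell big1 // => i _.
  by rewrite /coord mul0mx mxE.
rewrite -gtz0_ge1 lt0r sumr_ge0 // andbT; apply: contra v0 => /eqP e.
apply/eqP/(coord_inv d0) => i; apply/eqP; move: e => /eqP; rewrite psumr_eq0 //.
by move=> /allP/(_ i (mem_index_enum _)).
Qed.

(** [y] and [v - y] both in the cone bound the coordinates of [y] on both sides, so a recession
    direction has all coordinates zero. *)
Lemma norec_Asys u : \det u != 0 -> norec (qm (Asys u)).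
Proof.
move=> d0 g h.
have e1 i : 0 <= (qm (ctm u) *m g) i 0.
  have := h (lshift _ i); rewrite !mxE => hh; apply: le_trans hh _; rewrite le_eqVlt; apply/orP; left; apply/eqP.
  by apply: eq_bigr => j _; rewrite !qmE /Asys col_mxEu.
have e2 i : (qm (ctm u) *m g) i 0 <= 0.
  have := h (rshift d (lshift _ i)); rewrite -oppr_ge0 !mxE => hh; apply: le_trans hh _; rewrite le_eqVlt; apply/orP; left; apply/eqP.
  rewrite -sumrN; apply: eq_bigr => j _; rewrite !qmE /Asys col_mxEd col_mxEu.
  by rewrite oppmxE rmorphN /= mulNr.
have e3 : qm (ctm u) *m g = 0 by apply/matrixP => i j; rewrite ord1 [RHS]mxE; apply/le_anti; rewrite e1 e2.
have := congr1 (fun r => qm u^T *m r) e3; rewrite /= mulmx0 mulmxA -qm_mul /ctm -trmx_mul dualmxKl tr_scalar_mx.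
rewrite /qm map_scalar_mx mul_scalar_mx => /eqP; rewrite scaler_eq0 intr_eq0 normr_eq0 (negPf d0) => /eqP.
exact.
Qed.

Lemma incell_bound u v j : \det u != 0 -> incell u v -> (absz (v ord0 j) <= \sum_i absz (u i j))%N.
Proof.
move=> d0 [h1 h2 _]; have D0 : 0 < `|\det u| by rewrite normr_gt0.
have e : `|\det u| * v 0 j = \sum_i coord u v i * u i j.
  have := congr1 (fun A => (v *m A) 0 j) (dualmxKl u); rewrite /= mulmxA [LHS]mxE => ->.
  by rewrite mul_mx_scalar mxE.
rewrite -lez_nat abszE -(ler_pM2l D0) -[X in X * `|_|]gtr0_norm // -normrM e.
apply: le_trans (ler_norm_sum _ _ _) _; rewrite -natz natr_sum mulr_sumr; apply: ler_sum => i _.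
by rewrite normrM natz abszE ger0_norm // ler_wpM2r.
Qed.

Lemma cell0_bdd u v : \det u != 0 -> incell u v -> bdd (cell0 u).2 (sq v).
Proof.
move=> d0 hv; apply/allP => z /mapP[j _ ->]; rewrite size_cat !size_nseq.
apply: leq_ltn_trans (incell_bound j d0 hv) _.
apply: (@leq_ltn_trans (\sum_(i < d) 2 ^ sz u)%N).
  by apply: leq_sum => i _; apply: ltnW; exact: absz_entry.
rewrite sum_nat_const card_ord !expnD; have h : (d < 2 ^ d)%N by rewrite ltn_expl.
have x0 : (0 < 2 ^ sz u)%N by rewrite expn_gt0.
apply: leq_trans (_ : 2 ^ d * 2 ^ sz u <= _)%N; first by rewrite ltn_mul2r x0.
by rewrite [(2 ^ d * _)%N]mulnC leq_mul2r leq_pmulr ?orbT.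
Qed.

Lemma cell_points u : \det u != 0 -> exists Vs : seq 'rV[int]_d, uniq Vs /\ forall v, v \in Vs <-> incell u v.
Proof.
move=> d0; pose Bd := (\sum_i \sum_j absz (u i j))%N.
pose f (g : {ffun 'I_d -> 'I_Bd.*2.+1}) : 'rV[int]_d := \row_j ((g j : nat)%:Z - Bd%:Z).
exists [seq v <- undup (map f (enum {: {ffun 'I_d -> 'I_Bd.*2.+1}})) | `[< incell u v >]]; split.
  by rewrite filter_uniq // undup_uniq.
move=> v; rewrite mem_filter mem_undup; split=> [/andP[/asboolP]//|hv]; apply/andP; split; first exact/asboolP.
have b j : (absz (v ord0 j) <= Bd)%N.
  apply: leq_trans (incell_bound j d0 hv) _; by apply: leq_sum => i _; rewrite (bigD1 j) //= leq_addr.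
apply/mapP; exists [ffun j => inord (absz (v ord0 j + Bd%:Z))]; first by rewrite mem_enum.
by apply/rowP => j; rewrite !mxE ffunE inordK; have := b j; move: (v ord0 j) => z; lia.
Qed.

Section Hilbert.
Variable R : realType.

Lemma row_free_det u : row_free (real_mx R u) -> \det u != 0.
Proof. by rewrite row_free_unit unitmxE unitfE /real_mx det_map_mx intr_eq0. Qed.

Lemma in_parallelepiped u v : \det u != 0 ->
  integer_points (parallelepiped (R := R) u) v <-> forall i, 0 <= coord u v i <= `|\det u|.
Proof.
move=> d0; have D0 : 0 < `|\det u| by rewrite normr_gt0.
have D0' : 0 < (`|\det u|)%:~R :> R by rewrite ltr0z.
have sumE (a : 'I_d -> R) : \sum_(i < d) a i *: row i (real_mx R u) = (\row_i a i) *m real_mx R u.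
  by rewrite mulmx_sum_row; apply: eq_bigr => i _; rewrite mxE.
have mm (A B : 'M[int]_d) : real_mx R (A *m B) = real_mx R A *m real_mx R B by rewrite /real_mx map_mxM.
have mv (x : 'rV[int]_d) (B : 'M[int]_d) : real_mx R (x *m B) = real_mx R x *m real_mx R B by rewrite /real_mx map_mxM.
split=> [[a ha] e i|h].
  have e1 : real_mx R (v *m dualmx u) = (`|\det u|)%:~R *: \row_i a i.
    rewrite mv e sumE -mulmxA -mm dualmxK /real_mx map_scalar_mx mul_mx_scalar //.
  have e2 : (coord u v i)%:~R = (`|\det u|)%:~R * a i.
    by have /rowP/(_ i) := e1; rewrite !mxE => <-; rewrite /coord mxE.
  have /andP[a0 a1] := ha i; apply/andP; split.
    by rewrite -(ler0z R) e2 mulr_ge0 // ltW.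
  by rewrite -(ler_int R) e2 -[X in _ <= X]mulr1 ler_pM2l.
exists (fun i => (coord u v i)%:~R / (`|\det u|)%:~R).
  move=> i; have /andP[h1 h2] := h i; apply/andP; split; first by rewrite divr_ge0 ?ler0z.
  by rewrite ler_pdivrMr // mul1r ler_int.
rewrite sumE; have -> : \row_i ((coord u v i)%:~R / (`|\det u|)%:~R) = ((`|\det u|)%:~R)^-1 *: real_mx R (v *m dualmx u) :> 'rV[R]_d.
  by apply/rowP => i; rewrite !mxE /coord mxE mulrC.
rewrite -scalemxAl -mv -mulmxA dualmxKl mul_mx_scalar; apply/rowP => i; rewrite !mxE.
by rewrite intrM mulKf // gt_eqF.
Qed.

Lemma hilbertE u v : \det u != 0 ->
  hilbert_basis R u v <-> incell u v /\ ~ exists y, decomp u v y.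
Proof.
move=> d0; split=> [[h1 h2 h3]|[[h1 h2 h3] h4]].
  have hc := (in_parallelepiped v d0).1 h1.
  have c0 i : 0 <= coord u v i by case/andP: (hc i).
  have c1 i : coord u v i <= `|\det u| by case/andP: (hc i).
  split; first by split=> //; rewrite ell_gt0.
  move=> [y [y1 y2 y3 y4]]; apply: h3; exists y, (v - y); split.
  - apply/in_parallelepiped => // i; rewrite y1 /=; apply: le_trans (c1 i).
    by have := y2 i; rewrite coordB subr_ge0.
  - by rewrite -(ell_gt0 d0).
  - apply/in_parallelepiped => // i; rewrite y2 /=; apply: le_trans (c1 i).
    by rewrite coordB lerBlDr lerDl.
  - by rewrite -(ell_gt0 d0).
  - by rewrite addrC subrK.
split.
- by apply/in_parallelepiped => // i; rewrite h1 h2.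
- by rewrite -(ell_gt0 d0).
move=> [v1 [v2 [p1 n1 p2 n2 e]]]; apply: h4; exists v1.
have q1 i : 0 <= coord u v1 i by have /andP[] := (in_parallelepiped v1 d0).1 p1 i.
have q2 i : 0 <= coord u v2 i by have /andP[] := (in_parallelepiped v2 d0).1 p2 i.
rewrite /decomp (_ : v - v1 = v2); last by rewrite e addrC addKr.
by split; rewrite ?ell_gt0.
Qed.

End Hilbert.

Local Notation E := (EN m0 d).
Local Notation p := (E + d)%N.
Local Notation rr := (d + (d + 1) + ZN m0 d)%N.
(** At most [p.+1] factors, each expanded to order [p.+2] with at most one denominator per
    iteration; this is the [s] of the theorem. *)
Definition nden := (p.+1 * p.+2)%N.

Definition leafmx (L : acell) : 'M[int]_(p.+1, rr) := \matrix_(i, k) nth 0 (nth [::] L.1 k) i.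

Lemma inpoly_leaf (L : acell) (x : 'rV[int]_p) : (size L.1 <= rr)%N ->
  inpoly (leafmx L) x = sat p L.1 (sq x).
Proof.
move=> hs; have e (k : 'I_rr) : (hom x *m leafmx L) 0 k = av p (nth [::] L.1 k) (sq x).
  rewrite mxE; apply: eq_bigr => i _; rewrite [leafmx _ _ _]mxE mulrC; congr (_ * _).
  by case: (unliftP ord0 i) => [j ->|->]; rewrite ?homS ?hom0 //= -nth_sq.
apply/forallP/allP => [h f hf|h k].
  have lt : (index f L.1 < rr)%N by apply: leq_trans hs; rewrite index_mem.
  by have := h (Ordinal lt); rewrite e /= nth_index.
rewrite e; have [lt|ge] := ltnP k (size L.1); first exact/h/mem_nth.
by rewrite nth_default // /av big1 // => i _; rewrite nth_nil mul0r.
Qed.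

Definition e1 : 'rV[int]_d := delta_mx 0 0.

Lemma e1_neq0 : e1 != 0.
Proof. by apply/eqP => /rowP/(_ 0); rewrite !mxE. Qed.

Definition leaves u : seq acell := Dec (m := m0) (Asys u) (Bsys u : 'M_(_, d.+1)) (cell0 u).

Definition alg u : seq (fterm d) :=
  flatten [seq flatten [seq padt nden e1 nden t | t <- proj (barv (leafmx L))] | L <- leaves u].

Lemma alg_ok u t : t \in alg u -> size t.2.2 = nden /\ all (fun b => b != 0) t.2.2.
Proof.
move=> /flattenP[s /mapP[L _ ->] /flattenP[s' /mapP[t0 /flattenP[s2 /mapP[T _ ->] ht0] ->]]].
by apply: padt_ok; [exact: e1_neq0|exact: tproj_ok ht0|exact: leq_addl].
Qed.

Lemma leaf_size u L : L \in leaves u -> (size L.1 <= rr)%N.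
Proof. by move=> /Dec_size; rewrite size_map size_enum_ord. Qed.

(** Extensions are unique, so forgetting the extra parameters is a bijection from the integer points
    of the leaf to the points [v] that it covers, and no monomial is counted twice. *)
Lemma leaf_sum u L Vs : \det u != 0 -> uniq Vs -> (forall v, v \in Vs <-> incell u v) -> L \in leaves u ->
  \sum_(v <- Vs) (`[< has_ext d E L (sq v) >] : nat)%:R * xpow v = fv (@xpow d) (proj (barv (leafmx L))).
Proof.
move=> d0 uV hV hL; have [r1 r2] := Dec_ok (Bsys u : 'M_(_, d.+1)) (cell0 u) (norec_Asys d0).
pose ev v := if pselect (has_ext d E L (sq v)) is left h then projT1 (cid h) else [::].
have evP v : has_ext d E L (sq v) -> size (ev v) = E /\ sat p L.1 (ev v ++ sq v).
  by move=> h; rewrite /ev; case: pselect => // h'; case: (cid h') => e /= [].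
pose wv v : 'rV[int]_p := \row_i nth 0 (ev v ++ sq v) i.
have zw v : has_ext d E L (sq v) -> zof (wv v) = v.
  move=> /evP[se _]; apply/rowP => j; rewrite !mxE nth_cat se /= ltnNge leq_addr /=.
  by rewrite addKn nth_sq.
have sw v : has_ext d E L (sq v) -> sq (wv v) = ev v ++ sq v.
  move=> /evP[se _]; apply: (@eq_from_nth _ 0); first by rewrite size_sq size_cat se size_sq.
  by move=> i; rewrite size_sq => lt; rewrite -[i]/(nat_of_ord (Ordinal lt)) nth_sq mxE.
pose pts := [seq wv v | v <- Vs & `[< has_ext d E L (sq v) >]].
have up : uniq pts.
  rewrite map_inj_in_uniq ?filter_uniq // => v v'; rewrite !mem_filter => /andP[/asboolP h _] /andP[/asboolP h' _] e.
  by rewrite -(zw v h) e zw.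
have hp x : (x \in pts) = inpoly (leafmx L) x.
  rewrite inpoly_leaf ?(leaf_size hL) //; apply/mapP/idP => [[v]|hs].
    by rewrite mem_filter => /andP[/asboolP h _] ->; rewrite sw //; case: (evP v h).
  pose v := zof x; pose e := take E (sq x).
  have se : size e = E by rewrite size_takel // size_sq leq_addr.
  have ex : sq x = e ++ sq v.
    rewrite -[LHS](cat_take_drop E); congr (_ ++ _); apply: (@eq_from_nth _ 0).
      by rewrite size_drop !size_sq addKn.
    move=> i; rewrite size_drop size_sq addKn => lt; rewrite nth_drop.
    by rewrite -[i]/(nat_of_ord (Ordinal lt)) nth_sq mxE -nth_sq.
  rewrite ex in hs; have sv : size (sq v) = d by exact: size_sq.
  have hc := r1 L (sq v) e hL sv se hs.
  have hb := cell0_bdd d0 ((sat_cell0 u v).1 hc).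
  have [_ h3] := r2 (sq v) sv hc hb; have [_ h4] := h3 L e hL se hs.
  have hx : has_ext d E L (sq v) by exists e.
  exists v; first by rewrite mem_filter; apply/andP; split; [exact/asboolP|apply/hV/sat_cell0].
  have [se' hs'] := evP v hx; have e' := h4 _ se' hs'.
  by apply/rowP => i; rewrite mxE e' -ex nth_sq.
rewrite -(proj_barv up hp) /pts big_map big_filter [RHS]big_mkcond /=; apply: eq_bigr => v _.
by case: asboolP => h; rewrite ?mul1r ?mul0r // zw.
Qed.

Lemma alg_sum (R : realType) u : \det u != 0 ->
  hilbert_genfun R u = \sum_(t <- alg u) term_ratfun (toterm nden t).
Proof.
move=> d0; have [Vs [uV hV]] := cell_points d0.
have [r1 r2] := Dec_ok (Bsys u : 'M_(_, d.+1)) (cell0 u) (norec_Asys d0).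
transitivity (\sum_(v <- Vs) (`[< nosol (m := m0) (Asys u) (Bsys u : 'M_(_, d.+1)) (sq v) >] : nat)%:R * xpow v).
  rewrite /hilbert_genfun (@fsbig_fwiden _ _ _ _ [seq v <- Vs | `[< nosol (m := m0) (Asys u) (Bsys u : 'M_(_, d.+1)) (sq v) >]]).
  - rewrite big_filter [LHS]big_mkcond /=; apply: eq_bigr => v _.
    by case: asboolP => _; rewrite ?mul1r ?mul0r.
  - move=> v /(hilbertE _ _ d0)[h1 h2] /=; rewrite mem_filter; apply/andP; split; first exact/asboolP/nosolE.
    exact/hV.
  - by rewrite filter_uniq.
  - move=> v [/= ]; rewrite mem_filter => /andP[/asboolP/nosolE h1 /hV h2] h3; exfalso; apply: h3.
    by apply/hilbertE.
transitivity (\sum_(L <- leaves u) fv (@xpow d) (proj (barv (leafmx L)))).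
  transitivity (\sum_(L <- leaves u) \sum_(v <- Vs) (`[< has_ext d E L (sq v) >] : nat)%:R * xpow v).
    rewrite exchange_big /=; apply: eq_big_seq => v /hV hv.
    have [h3 _] := r2 (sq v) (size_sq v) ((sat_cell0 u v).2 hv) (cell0_bdd d0 hv).
    by rewrite -h3 -mulr_suml natr_sum.
  by apply: eq_big_seq => L hL; apply: leaf_sum d0 uV hV hL.
rewrite [RHS]big_flatten [RHS]big_map; apply: eq_big_seq => L hL.
have ok t : t \in flatten [seq padt nden e1 nden t | t <- proj (barv (leafmx L))] -> t \in alg u.
  by move=> h; apply/flattenP; eexists; [apply/mapP; exists L; [exact: hL|reflexivity]|].
rewrite (eq_big_seq (tv (@xpow d))); last first.
  by move=> t /ok/alg_ok[h _]; exact: term_ratfunE.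
rewrite big_flatten big_map /fv; apply: eq_bigr => t _.
by rewrite -/(fv _ _) padt_val //; [exact: xpowD|exact/xpow_neq1/e1_neq0].
Qed.

Lemma PT_alg : PT alg.
Proof.
have hu := PT_id (mx_enc d d).
have hC : PT ctm by apply/PT_trmx/PT_dualmx.
have hl : PT lrow by apply: PT_mulmx => //; exact: PT_cst.
have hA : PT Asys.
  by do ![apply: PT_col_mx => //|apply: PT_oppmx => //].
have hB : PT Bsys.
  apply: PT_col_mx; first exact: PT_cst.
  apply: PT_col_mx; first by apply: PT_row_mx => //; exact: PT_cst.
  by apply: PT_col_mx; [exact: PT_cst|apply: PT_row_mx => //; exact: PT_cst].
have hH : PT Hcell.
  apply: PT_col_mx; first by apply: PT_row_mx => //; exact: PT_cst.
  apply: PT_col_mx; last by apply: PT_row_mx => //; exact: PT_cst.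
  apply: PT_row_mx; last exact: PT_oppmx.
  by apply: PT_mx => i j; apply: PT_ext (PT_normz (PT_det hu)) => x; rewrite [RHS]mxE.
have hc : PT cell0.
  apply: PT_pair; first by apply: PT_mapc => k; apply: PT_rsc => //; exact: PT_cst.
  by apply: PT_cat; [exact: PT_clock|exact: PT_cst].
have hL : PT leaves := PT_app3 (@PT_Dec m0 d d) hA hB hc.
apply: PT_flatten.
apply: (PT_map (F := fun _ L => flatten [seq padt nden e1 nden t | t <- proj (barv (leafmx L))])) => //.
apply: PT_flatten; apply: (PT_map (F := fun _ t => padt nden e1 nden t)).
  exact: (PT_comp (PT_snd (PT_id _)) (PT_padt nden e1 nden)).
have hm : PT (fun q : 'M[int]_d * acell => leafmx q.2).
  apply: PT_mx => i k.
  have : PT (fun q : 'M[int]_d * acell => nth 0 (nth [::] q.2.1 k) i).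
    exact/PT_nth/PT_nth/PT_fst/PT_snd/PT_id.
  by apply: PT_ext => q; rewrite [RHS]mxE.
exact: (PT_comp (PT_comp hm (PT_barv p rr)) (PT_proj E d)).
Qed.

(** The two reversals compensate those made in reading the input and writing the output. *)
Definition walg (w : word) : word :=
  rev (encode_ints (flatten [seq tints nden t | t <- alg (mxof d (parse (rev w)))])).

Lemma PT_walg : PT walg.
Proof.
apply: PT_rev; apply: PT_encode_ints; apply: PT_flatten.
apply: (PT_map (F := fun _ t => tints nden t)).
  exact: (PT_comp (PT_snd (PT_id _)) (@PT_tints d nden)).
have hp := PT_comp (PT_rev (PT_id (seq_enc letter_enc))) PT_parse.
have hm : PT (fun w : word => mxof d (parse (rev w))).
  apply: PT_mx => i j; pose n := index (i, j) [seq (i, j) | i <- enum 'I_d, j <- enum 'I_d].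
  by apply: PT_ext (PT_nth (0 : int) n hp) => w; rewrite [RHS]mxE.
exact: (PT_comp hm PT_alg).
Qed.

End Main.

Theorem theorem7p1 (R : realType) (d : nat) (d_gt0 : (0 < d)%N) :
  exists s : nat,
    poly_time_computable
      (@encode_mx d d)
      (@encode_terms d s)
      (fun u : 'M[int]_d => row_free (real_mx R u))
      (fun (u : 'M[int]_d) (F : seq (term d s)) =>
         (forall t : term d s, t \in F ->
            forall j : 'I_s, row j (t_den t) != 0)
         /\ hilbert_genfun R u = \sum_(t <- F) term_ratfun t).
Proof.
case: d d_gt0 => // d' _; exists (nden d').
have [M [P h]] := PT_machine (PT_walg d'); exists M, P => u hu.
have d0 := row_free_det hu.
exists [seq toterm (nden d') t | t <- alg u].
  split; last by rewrite big_map; exact: alg_sum.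
  move=> t /mapP[t0 /alg_ok[hs /allP hb] ->] j.
  have hj : (j < size t0.2.2)%N by rewrite hs.
  have := hb _ (mem_nth 0 hj); apply: contra => /eqP/rowP e; apply/eqP/rowP => i.
  by have := e i; rewrite !mxE.
apply: (h (rev (encode_mx u))); first by rewrite wordtree.
rewrite wordtree /walg revK /encode_mx parseK mxofK; congr (encode (rev _)).
rewrite /encode_terms -map_comp; congr (encode_ints (flatten _)).
Qed.
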